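(* Let $\Omega=(-1,1)^2$, $f\in L^2(\Omega)$, $g\in H^{3/2}(\partial\Omega)$, with odd symmetric parts $f_o,g_o$, and let $u_o\in H^2(\Omega)$ be the solution of $$-\Delta u_o=f_o \ \text{ in }\Omega,\qquad u_o=g_o\ \text{ on }\partial\Omega. \qquad (O)$$ Let $(u^0,\psi^0)$ satisfy $u^0\in H^2(\Omega)$, $\psi^0\in H^2(\Omega)\cap H^1_0(\Omega)$ and $u^0=g$ on $\partial\Omega\cap\Gamma$, and let $u^0_o,\psi^0_o$ be the odd symmetric parts of $u^0,\psi^0$. Then for any $\theta\in(0,\tfrac12)$, the mixed Neumann-Neumann method with relaxation parameter $\theta$ applied to problem $(O)$ with initial couple $(u^0_o,\psi^0_o)$ produces a sequence $\{u_o^k\}_{k}$ that converges geometrically to $u_o$ with respect to the $L^2$-norm and the broken $H^1$-norm. Moreover, the convergence factor is $|1-4\theta|$; in particular, for $\theta=\tfrac14$ the method is a direct solver.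
   Context: Geometry: $\Omega=(-1,1)\times(-1,1)$ is divided into $\Omega_1=(-1,0)\times(-1,0)$, $\Omega_2=(0,1)\times(-1,0)$, $\Omega_3=(0,1)\times(0,1)$, $\Omega_4=(-1,0)\times(0,1)$; $\mathcal I=\{1,2,3,4\}$. For $i\ne j$, $\Gamma_{ij}=\Gamma_{ji}$ is the relative interior of $\partial\Omega_i\cap\partial\Omega_j$ (an open segment for adjacent subdomains, empty for the diagonal pairs $\{1,3\}$ and $\{2,4\}$). $\Gamma=\bigcup_{i,j}\overline{\Gamma}_{ij}$ and $\partial\Omega_i^0=\partial\Omega_i\cap\partial\Omega$; $n_i$ is the outward unit normal of $\Omega_i$. The set $\partial\Omega\cap\Gamma$ consists of the four points $(\pm1,0),(0,\pm1)$. Set $$\Gamma_D^1=\{\Gamma_{23},\Gamma_{41}\},\quad \Gamma_N^1=\{\Gamma_{12},\Gamma_{34}\},\quad \Gamma_D^2=\{\Gamma_{12},\Gamma_{34}\},\quad \Gamma_N^2=\{\Gamma_{23},\Gamma_{41}\}.$$ Regularity: $g\in H^{3/2}(\partial\Omega)$ means that $g$ is the trace of an $H^2(\Omega)$ function, so that the solution of $-\Delta u=f$ in $\Omega$, $u=g$ on $\partial\Omega$, belongs to $H^2(\Omega)$. Symmetry: a measurable function $h$ on $\Omega$ (or on $\partial\Omega$) is even symmetric if $h(-x,-y)=h(x,y)$ a.e., and odd symmetric if $h(-x,-y)=-h(x,y)$ a.e. Each $h$ decomposes uniquely as $h=h_e+h_o$ with $h_e$ even symmetric (its even symmetric part) and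 $h_o$ odd symmetric (its odd symmetric part). Mixed Neumann-Neumann method with relaxation parameter $\theta\in\mathbb R$, for a problem $-\Delta u=F$ in $\Omega$, $u=G$ on $\partial\Omega$, and initial couple $(u^0,\psi^0)$ (with $u_i^0=u^0|_{\Omega_i}$, $\psi_i^0=\psi^0|_{\Omega_i}$): each iteration $k\ge1$ consists of two steps. (First step) For all $i\in\mathcal I$ solve $-\Delta u_i^k=F$ in $\Omega_i$, $u_i^k=G$ on $\partial\Omega_i^0$, $u_i^k=u_i^{k-1}-\theta(\psi_i^{k-1}+\psi_j^{k-1})$ on $\Gamma_{ij}$ for all $j$ with $\Gamma_{ij}\in\Gamma_D^1$, $\partial_{n_i}u_i^k=\partial_{n_i}u_i^{k-1}-\theta(\partial_{n_i}\psi_i^{k-1}-\partial_{n_j}\psi_j^{k-1})$ on $\Gamma_{ij}$ for all $j$ with $\Gamma_{ij}\in\Gamma_N^1$. (Second step) For all $i\in\mathcal I$ solve $-\Delta\psi_i^k=0$ in $\Omega_i$, $\psi_i^k=0$ on $\partial\Omega_i^0$, $\psi_i^k=u_i^k-u_j^k$ on $\Gamma_{ij}$ for all $j$ with $\Gamma_{ij}\in\Gamma_D^2$, $\partial_{n_i}\psi_i^k=\partial_{n_i}u_i^k+\partial_{n_j}u_j^k$ on $\Gamma_{ij}$ for all $j$ with $\Gamma_{ij}\in\Gamma_N^2$. The local problems are understood in the usual weak sense, with solutions in $H^1(\Omega_i)$. The iterate $u^k$ (here $u_o^k$) is the function on $\Omega\setminus\Gamma$ equal to $u_i^k$ (here $u_{o,i}^k$)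 on $\Omega_i$. Convergence notions: the broken $H^1$-norm of $v$ is $\sum_{i\in\mathcal I}\|v|_{\Omega_i}\|_{H^1(\Omega_i)}$. Geometric convergence in a norm $\|\cdot\|$ with convergence factor $\rho\in[0,1)$ means $\|u_o-u_o^{k+1}\|=\rho\,\|u_o-u_o^{k}\|$ for all $k\ge1$ (hence $\|u_o-u_o^k\|\le C\rho^{k-1}$ for all $k\ge 1$, with $C$ independent of $k$). Direct solver means that the exact solution is reached after finitely many iterations. *)

(* Defs.v *)
From HB Require Import structures.
From mathcomp Require Export all_boot all_order all_algebra.
From mathcomp Require Export all_classical all_reals all_analysis.
From mathcomp Require Export measurable_realfun.
Export numFieldNormedType.Exports.
Export Order.TTheory GRing.Theory Num.Theory.

Set Implicit Arguments.
Unset Strict Implicit.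
Unset Printing Implicit Defensive.

Local Open Scope classical_set_scope.
Local Open Scope ring_scope.

Section Sobolev.
Context {R : realType}.
Implicit Types (D : set (R * R)) (u v w phi : R * R -> R) (d : R * R).

Definition mu2 := ((@lebesgue_measure R) \x (@lebesgue_measure R))%E.

(* The sigma-algebra must be the one carried by the domain of mu2: the default
   one on R * R has the same measurable sets but another display. *)
Definition measurable_on D u : Prop :=
  measurable_fun (D : set (measurableTypeR R * measurableTypeR R)) u.

Definition e1 : R * R := (1, 0).
Definition e2 : R * R := (0, 1).

Definition ae_on D (P : R * R -> Prop) : Prop :=
  {ae mu2, forall p, D p -> P p}.

Definition L2 D u : Prop :=
  measurable_on D u /\ mu2.-integrable D (fun p => (u p ^+ 2)%:E).

Definition L2norm D u : R := Num.sqrt (\int[mu2]_(p in D) (u p ^+ 2)).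

Fixpoint Ck (n : nat) phi : Prop :=
  continuous phi /\
  if n is m.+1 then
    (forall p, derivable phi p e1 /\ derivable phi p e2) /\
    Ck m ('D_e1 phi) /\ Ck m ('D_e2 phi)
  else True.

Definition smooth phi : Prop := forall n, Ck n phi.

(* phi is in C_c^oo(D), extended by 0 to the plane. *)
Definition test_fun D phi : Prop :=
  smooth phi /\
  exists K, [/\ compact K, K `<=` D & forall p, ~ K p -> phi p = 0].

Definition is_wderiv D d u w : Prop :=
  L2 D w /\ forall phi, test_fun D phi ->
    \int[mu2]_(p in D) (u p * 'D_d phi p) = - \int[mu2]_(p in D) (w p * phi p).

(* Only meaningful (and then unique a.e. on D) when u has a weak derivative
   in L^2(D). *)
Definition wderiv D d u : R * R -> R := get [set w | is_wderiv D d u w].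

(* Functions are total on the plane, but L2, H1, wderiv, etc. relative to an
   open set D only depend on their values on D: membership in H1 D is a
   property of the restriction to D. *)
Definition H1 D u : Prop :=
  [/\ L2 D u, exists w, is_wderiv D e1 u w & exists w, is_wderiv D e2 u w].

Definition H2 D u : Prop :=
  [/\ H1 D u, H1 D (wderiv D e1 u) & H1 D (wderiv D e2 u)].

Definition H1norm D u : R :=
  Num.sqrt (\int[mu2]_(p in D) (u p ^+ 2)
            + \int[mu2]_(p in D) (wderiv D e1 u p ^+ 2)
            + \int[mu2]_(p in D) (wderiv D e2 u p ^+ 2)).

Definition H10 D u : Prop :=
  H1 D u /\
  exists phi : nat -> R * R -> R,
    (forall n, test_fun D (phi n)) /\
    H1norm D (phi n \- u) @[n --> \oo] --> (0 : R).

Definition dirichlet_form D u v : R :=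
  \int[mu2]_(p in D) (wderiv D e1 u p * wderiv D e1 v p
                      + wderiv D e2 u p * wderiv D e2 v p).

(* - Laplacian u = F in D, in the sense of distributions. *)
Definition poisson D u F : Prop :=
  forall phi, test_fun D phi ->
    dirichlet_form D u phi = \int[mu2]_(p in D) (F p * phi p).

Definition wlaplacian D u : R * R -> R :=
  get [set l | L2 D l /\ poisson D u (fun p => - l p)].

(* The duality pairing <d_n u, v> on the boundary of D, where n is the outward
   unit normal of D: the weak normal derivative of a function u of H1 D whose
   Laplacian is in L2 D is defined by Green's formula
     <d_n u, v> = int_D grad u . grad v + int_D (Laplacian u) v.
   If v vanishes on the boundary outside S, this is the pairing on S. *)
Definition normal_deriv D u v : R :=
  dirichlet_form D u v + \int[mu2]_(p in D) (wlaplacian D u p * v p).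

End Sobolev.

(* All boundaries and interfaces below are contained in the six lines
   x = c or y = c with c in {-1, 0, 1}; the arc length of a subset of their
   union is obtained by summing the one-dimensional Lebesgue measure over the
   six lines (which only meet at finitely many points). *)
Section ArcLength.
Context {R : realType}.
Implicit Types (S : set (R * R)) (g : R * R -> R).

Definition gridline (l : bool * 'I_3) (t : R) : R * R :=
  let c : R := l.2%:R - 1 in if l.1 then (t, c) else (c, t).

Definition arc_ae S (P : R * R -> Prop) : Prop :=
  forall l, {ae @lebesgue_measure R,
    forall t, S (gridline l t) -> P (gridline l t)}.

Definition arc_measurable S g : Prop :=
  forall l, measurable_fun (gridline l @^-1` S : set (measurableTypeR R))
    (g \o gridline l).

Definition arc_L2 S g : Prop :=
  arc_measurable S g /\
  forall l, (@lebesgue_measure R).-integrable (gridline l @^-1` S)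
              (fun t => (g (gridline l t) ^+ 2)%:E).

Definition arc_L2norm S g : R :=
  Num.sqrt (\sum_(l : bool * 'I_3)
    \int[@lebesgue_measure R]_(t in gridline l @^-1` S)
       (g (gridline l t) ^+ 2)).

(* g is the trace on S, a part of the boundary of D, of u in H1 D: the trace
   is the continuous extension to H1 D, with values in L2 of S, of the
   restriction map on functions that are smooth up to the boundary. *)
Definition trace_of (D : set (R * R)) S (u g : R * R -> R) : Prop :=
  [/\ H1 D u, arc_L2 S g &
  exists phi : nat -> R * R -> R,
    [/\ forall n, smooth (phi n),
        H1norm D (phi n \- u) @[n --> \oo] --> (0 : R)
      & arc_L2norm S (phi n \- g) @[n --> \oo] --> (0 : R)]].

Definition boundary (A : set (R * R)) : set (R * R) := closure A `\` A°.

End ArcLength.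

Section Geometry.
Context {R : realType}.

Definition Omega : set (R * R) := `]-1, 1[ `*` `]-1, 1[.

Inductive quad := Q1 | Q2 | Q3 | Q4.

Definition Om (i : quad) : set (R * R) :=
  match i with
  | Q1 => `]-1, 0[ `*` `]-1, 0[
  | Q2 => `]0, 1[ `*` `]-1, 0[
  | Q3 => `]0, 1[ `*` `]0, 1[
  | Q4 => `]-1, 0[ `*` `]0, 1[
  end.

Definition Gam (i j : quad) : set (R * R) :=
  match i, j with
  | Q1, Q2 | Q2, Q1 => [set 0] `*` `]-1, 0[
  | Q2, Q3 | Q3, Q2 => `]0, 1[ `*` [set 0]
  | Q3, Q4 | Q4, Q3 => [set 0] `*` `]0, 1[
  | Q4, Q1 | Q1, Q4 => `]-1, 0[ `*` [set 0]
  | _, _ => set0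
  end.

Definition Gamma : set (R * R) := [set p | exists i j, closure (Gam i j) p].

Definition outer (i : quad) : set (R * R) := boundary (Om i) `&` boundary Omega.

Definition GamD1 : set (set (R * R)) := [set Gam Q2 Q3; Gam Q4 Q1].
Definition GamN1 : set (set (R * R)) := [set Gam Q1 Q2; Gam Q3 Q4].
Definition GamD2 : set (set (R * R)) := [set Gam Q1 Q2; Gam Q3 Q4].
Definition GamN2 : set (set (R * R)) := [set Gam Q2 Q3; Gam Q4 Q1].

Definition broken_H1norm (v : R * R -> R) : R :=
  \sum_(i <- [:: Q1; Q2; Q3; Q4]) H1norm (Om i) v.

End Geometry.

Section Data.
Context {R : realType}.
Implicit Types (g h : R * R -> R).

(* ho is the odd symmetric part of h, in the decomposition h = he + ho into an
   even and an odd measurable function; ae and meas are "almost everywhere" and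
   "measurable" on the underlying set, either Omega or its boundary. *)
Definition is_odd_part (ae : (R * R -> Prop) -> Prop)
    (meas : (R * R -> R) -> Prop) h ho : Prop :=
  meas ho /\
  exists he, [/\ meas he,
    ae (fun p => he (- p) = he p),
    ae (fun p => ho (- p) = - ho p)
  & ae (fun p => h p = he p + ho p)].

Definition odd_part_in : (R * R -> R) -> (R * R -> R) -> Prop :=
  is_odd_part (ae_on Omega) (measurable_on Omega).

Definition odd_part_bd : (R * R -> R) -> (R * R -> R) -> Prop :=
  is_odd_part (arc_ae (boundary Omega)) (arc_measurable (boundary Omega)).

Definition H32_bd g : Prop :=
  exists2 G, H2 Omega G & trace_of Omega (boundary Omega) G g.

(* Equality of u and g at the points of A, as pointwise values of their
   continuous representatives (which exist if u is in H2 Omega and g in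
   H32_bd). *)
Definition agree_at (A : set (R * R)) (u g : R * R -> R) : Prop :=
  exists uc gc : R * R -> R,
    [/\ {within closure Omega, continuous uc}
        /\ ae_on Omega (fun p => uc p = u p),
        {within boundary Omega, continuous gc}
        /\ arc_ae (boundary Omega) (fun p => gc p = g p)
      & forall p, A p -> uc p = gc p].

End Data.

Section Method.
Context {R : realType}.
Implicit Types (F G u psi : R * R -> R).

(* v in H1 (Om i) and w in H1 (Om j) vanish on the boundary of their subdomain
   outside Gam i j, and have the same trace on Gam i j: they represent the same
   test function on the interface. *)
Definition interface_test (i j : quad) (v w : R * R -> R) : Prop :=
  [/\ trace_of (Om i) (boundary (Om i) `\` Gam i j) v (cst 0),
      trace_of (Om j) (boundary (Om j) `\` Gam i j) w (cst 0)
    & exists2 t, trace_of (Om i) (Gam i j) v t & trace_of (Om j) (Gam i j) w t].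

(* A broken function is represented by a single function on the plane; its
   component with index i is its restriction to Om i (and its values on Gamma
   are irrelevant). Below u, psi are the previous iterates, u' and psi' the
   new ones. *)
Definition first_step (theta : R) F G u psi u' : Prop :=
  forall i : quad,
  [/\ H1 (Om i) u',
      poisson (Om i) u' F,
      trace_of (Om i) (outer i) u' G,
      (forall j, @GamD1 R (Gam i j) ->
        exists ti' ti si sj : R * R -> R,
          [/\ trace_of (Om i) (Gam i j) u' ti',
              trace_of (Om i) (Gam i j) u ti,
              trace_of (Om i) (Gam i j) psi si,
              trace_of (Om j) (Gam i j) psi sj
            & arc_ae (Gam i j)
                (fun p => ti' p = ti p - theta * (si p + sj p))])
    & (forall j, @GamN1 R (Gam i j) ->
        forall v w, interface_test i j v w ->
          normal_deriv (Om i) u' v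
          = normal_deriv (Om i) u v
            - theta * (normal_deriv (Om i) psi v - normal_deriv (Om j) psi w))].

Definition second_step u' psi' : Prop :=
  forall i : quad,
  [/\ H1 (Om i) psi',
      poisson (Om i) psi' (cst 0),
      trace_of (Om i) (outer i) psi' (cst 0),
      (forall j, @GamD2 R (Gam i j) ->
        exists si ti tj : R * R -> R,
          [/\ trace_of (Om i) (Gam i j) psi' si,
              trace_of (Om i) (Gam i j) u' ti,
              trace_of (Om j) (Gam i j) u' tj
            & arc_ae (Gam i j) (fun p => si p = ti p - tj p)])
    & (forall j, @GamN2 R (Gam i j) ->
        forall v w, interface_test i j v w ->
          normal_deriv (Om i) psi' v
          = normal_deriv (Om i) u' v + normal_deriv (Om j) u' w)].

Definition mixed_NN (theta : R) F G u0 psi0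
    (u psi : nat -> R * R -> R) : Prop :=
  [/\ u 0%N = u0, psi 0%N = psi0 &
      forall k, first_step theta F G (u k) (psi k) (u k.+1)
                /\ second_step (u k.+1) (psi k.+1)].

Definition converges_geometrically (nrm : (R * R -> R) -> R) (rho : R)
    (u : nat -> R * R -> R) (ulim : R * R -> R) : Prop :=
  0 <= rho < 1 /\
  forall k, (1 <= k)%N -> nrm (ulim \- u k.+1) = rho * nrm (ulim \- u k).

Definition reached_exactly (u : nat -> R * R -> R) (ulim : R * R -> R) : Prop :=
  exists K, forall k, (K <= k)%N ->
    ae_on (Omega `\` Gamma) (fun p => u k p = ulim p).

End Method.

(* Main.v *)
(* The error u_o - u^k is followed explicitly. All the data being odd, the error
   e = u^1 - u_o of the first iteration is harmonic in each subdomain, vanishes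
   on the outer boundary, and is odd in x and even in y. Hence the jump of
   u_o + c e across x = 0 is 2 c e, and the sum of its outward normal derivatives
   on y = 0 is the normal derivative of 2 c e: the second step gives
   psi = 2 c e. The corrections of the first step are then the data of
   4 theta c e, which turns c into (1 - 4 theta) c.

   By reflection, e is determined by its restriction to the first subdomain,
   which solves a mixed problem with the Dirichlet and Neumann data of
   w = u^0_o - u_o - 2 theta psi^0_o. The values of u^0 and g at the points where
   the interfaces meet the boundary agree, so that w, which is odd, vanishes
   there; this makes it possible to lift the Dirichlet datum to H^1 by
   w(x, 0) (1 + y), and Riesz' theorem does the rest.

   Each step determines its result: the difference of two solutions has zero
   Dirichlet data, so that it can be tested against itself, paired with its
   mirror image in the adjacent subdomain, and its Dirichlet energy vanishes. *)

Require Import Defs.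
From HB Require Import structures.
From mathcomp Require Import ring lra.

Set Implicit Arguments.
Unset Strict Implicit.
Unset Printing Implicit Defensive.

Local Open Scope classical_set_scope.
Local Open Scope ring_scope.

(** * Pre-Hilbert forms and square-integrable functions *)

(* The steps pair normal derivatives with functions that are merely in H1, while [poisson] tests
   only against smooth functions of compact support and traces are limits of smooth functions. Three
   facts on rectangles bridge this gap. Sums of tensor products are dense and stay sums of tensor
   products when integrated along an axis, which yields smooth approximations that also converge in
   a prescribed derivative. For [w] in H2 the mixed derivative controls [w] uniformly, whence a
   continuous representative, and puts the derivative of [w(x, 0)] in L2, whence the H1 lift. A
   component with a weak derivative along its own axis has the same flux seen from both sides of a
   line, so an H2 function has no jump of normal derivative; with the continuity of psi^0 this gives
   the factor 2 in [2 * theta].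

   Only the symmetry p -> -p is given, not the two reflections. It suffices because the Dirichlet
   datum lives on y = 0, where this symmetry acts as x -> -x, and the Neumann datum, the
   x-derivative of an odd function, is even on x = 0. Finally |1 - 4 theta| < 1 means exactly 0 <
   theta < 1/2. *)
Create HintDb space.

(* Lets [//] discharge closure conditions, which are not boolean. *)
Ltac done ::=
  solve [ auto 8 with space nocore
        | trivial; hnf; intros; solve
            [ do ![solve [trivial | apply: sym_equal; trivial]
                  | discriminate | contradiction | split]
            | match goal with H : ~ _ |- _ => solve [case H; trivial] end ] ].

Lemma cvg_dist_le {R : realType} (a b : nat -> R) (l : R) :
  (forall n, `|a n - l| <= b n) -> b n @[n --> \oo] --> (0 : R) ->
  a n @[n --> \oo] --> l.
Proof.
move=> ab /cvgrPdist_lt b0; apply/cvgrPdist_lt => e e0.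
apply: filterS (b0 e e0) => n /=; rewrite sub0r normrN distrC.
by apply: le_lt_trans; rewrite (le_trans (ab n))// ler_norm.
Qed.

(** The seminorm of a form. It is locked so that the same lemmas serve the L2, H1, Dirichlet,
    segment and arc forms without their integrals being unfolded. *)
HB.lock Definition bn {R : realType} {E : lmodType R} (B : E -> E -> R) (u : E) : R :=
  Num.sqrt (B u u).

Lemma bn_ge0 {R : realType} {E : lmodType R} (B : E -> E -> R) u : 0 <= bn B u.
Proof. by rewrite bn.unlock sqrtr_ge0. Qed.

Section PreHilbert.
Context {R : realType} {E : lmodType R} (V : E -> Prop) (B : E -> E -> R).

(** Functions are not identified when equal almost everywhere, so positivity is only semi-definite;
    and integrals are linear only on integrable functions, so the laws are relative to a predicate
    [V] stable under linear combinations. *)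
Record preip : Prop := Preip {
  preip0 : V 0;
  preipL : forall a u v, V u -> V v -> V (a *: u + v);
  preipC : forall u v, V u -> V v -> B u v = B v u;
  preipE : forall a u v w, V u -> V v -> V w ->
    B (a *: u + v) w = a * B u w + B v w;
  preip_ge0 : forall u, V u -> 0 <= B u u }.

Hypothesis H : preip.

Lemma preipD u v : V u -> V v -> V (u + v).
Proof. by move=> Vu Vv; rewrite -[u]scale1r; exact: preipL. Qed.

Lemma preipZ a u : V u -> V (a *: u).
Proof. by move=> Vu; rewrite -[_ *: _]addr0; apply: (preipL H) => //; exact: (preip0 H). Qed.

#[local] Hint Resolve preipD preipZ : space.

Lemma preipN u : V u -> V (- u).
Proof. by move=> Vu; rewrite -scaleN1r; exact: preipZ. Qed.

Lemma preipB u v : V u -> V v -> V (u - v).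
Proof. by move=> Vu Vv; apply: preipD => //; exact: preipN. Qed.

#[local] Hint Resolve preipN preipB : space.

Lemma preip_formDl u v w : V u -> V v -> V w -> B (u + v) w = B u w + B v w.
Proof. by move=> Vu Vv Vw; rewrite -{1}[u]scale1r (preipE H)// mul1r. Qed.

Lemma preip_form0l w : V w -> B 0 w = 0.
Proof.
move=> Vw; have V0 := preip0 H; have := preip_formDl V0 V0 Vw.
by rewrite addr0 => /eqP; rewrite -subr_eq subrr eq_sym => /eqP.
Qed.

Lemma preip_formZl a u w : V u -> V w -> B (a *: u) w = a * B u w.
Proof.
move=> Vu Vw; have V0 := preip0 H.
by rewrite -[a *: u]addr0 (preipE H)// preip_form0l// addr0.
Qed.

Lemma preip_formBl u v w : V u -> V v -> V w -> B (u - v) w = B u w - B v w.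
Proof.
by move=> Vu Vv Vw; rewrite preip_formDl// -scaleN1r preip_formZl// mulN1r.
Qed.

Lemma preip_formDr u v w : V u -> V v -> V w -> B w (u + v) = B w u + B w v.
Proof.
move=> Vu Vv Vw; have Vuv := preipD Vu Vv.
by rewrite (preipC H)// preip_formDl// !(preipC H _ Vw).
Qed.

Lemma preip_formZr a u w : V u -> V w -> B w (a *: u) = a * B w u.
Proof.
move=> Vu Vw; have Vau := preipZ a Vu.
by rewrite (preipC H)// preip_formZl// (preipC H Vu).
Qed.

Lemma preip_formBr u v w : V u -> V v -> V w -> B w (u - v) = B w u - B w v.
Proof.
move=> Vu Vv Vw; rewrite preip_formDr// -scaleN1r preip_formZr//.
by rewrite mulN1r.
Qed.

Notation bn := (bn B).

Lemma sqr_bn u : V u -> bn u ^+ 2 = B u u.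
Proof. by move=> Vu; rewrite bn.unlock sqr_sqrtr// (preip_ge0 H). Qed.

Lemma preip_sqr_expand t u v : V u -> V v ->
  B (u + t *: v) (u + t *: v) = B u u + 2 * t * B u v + t ^+ 2 * B v v.
Proof.
move=> Vu Vv; have Vtv := preipZ t Vv; have Vs := preipD Vu Vtv.
rewrite preip_formDl// !preip_formDr// !preip_formZl// !preip_formZr//.
by rewrite (preipC H Vv Vu); ring.
Qed.

Lemma quadratic_discr (a b c : R) : 0 <= c ->
  (forall t, 0 <= a + 2 * t * b + t ^+ 2 * c) -> b ^+ 2 <= a * c.
Proof.
move=> c0 h; have a0 : 0 <= a by move: (h 0); lra.
move: c0; rewrite le_eqVlt => /orP[/eqP c0|c0].
  have [->|bn0] := eqVneq b 0; first by rewrite expr0n mulr_ge0// -c0.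
  (* The polynomial is affine here, and this [t] gives it the value [a - (a + 1) = -1]. *)
  have := h (- (a + 1) / (2 * b)); rewrite -c0 mulr0 addr0.
  rewrite (_ : 2 * _ * b = - (a + 1)); last by field.
  lra.
have := h (- b / c).
rewrite (_ : a + _ + _ = (a * c - b ^+ 2) / c); last by field; rewrite gt_eqF.
by rewrite pmulr_lge0 ?invr_gt0// subr_ge0.
Qed.

Lemma bn_CS u v : V u -> V v -> `|B u v| <= bn u * bn v.
Proof.
move=> Vu Vv; rewrite -(ler_pXn2r (n:=2))// ?nnegrE ?mulr_ge0 ?bn_ge0//.
rewrite exprMn !sqr_bn// real_normK ?num_real//.
apply: quadratic_discr => [|t]; first exact: (preip_ge0 H).
by rewrite -preip_sqr_expand//; apply: (preip_ge0 H).
Qed.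

Lemma bnD u v : V u -> V v -> bn (u + v) <= bn u + bn v.
Proof.
move=> Vu Vv; rewrite -(ler_pXn2r (n:=2))// ?nnegrE ?addr_ge0 ?bn_ge0//.
rewrite sqr_bn// sqrrD !sqr_bn// preip_formDl//.
rewrite !preip_formDr// (preipC H Vv Vu).
have := le_trans (ler_norm _) (bn_CS Vu Vv); lra.
Qed.

Lemma bnZ a u : V u -> bn (a *: u) = `|a| * bn u.
Proof.
move=> Vu; rewrite bn.unlock preip_formZl// preip_formZr// mulrA -expr2.
by rewrite sqrtrM ?sqr_ge0// sqrtr_sqr.
Qed.

Lemma bnN u : V u -> bn (- u) = bn u.
Proof. by move=> Vu; rewrite -scaleN1r bnZ// normrN1 mul1r. Qed.

Lemma bnBC u v : V u -> V v -> bn (u - v) = bn (v - u).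
Proof. by move=> Vu Vv; rewrite -bnN// opprB. Qed.

Lemma bnB_le u v w : V u -> V v -> V w -> bn (u - w) <= bn (u - v) + bn (v - w).
Proof.
move=> Vu Vv Vw; rewrite (_ : u - w = (u - v) + (v - w)); last by rewrite addrA subrK.
by apply: bnD; exact: preipB.
Qed.

Lemma ler_bn_dist u v : V u -> V v -> `|bn u - bn v| <= bn (u - v).
Proof.
move=> Vu Vv; rewrite ler_norml; apply/andP; split.
  by have := bnD Vu (preipB Vv Vu); rewrite addrC subrK bnBC//; lra.
by have := bnD Vv (preipB Vu Vv); rewrite addrC subrK; lra.
Qed.

Definition bn_cauchy (u : nat -> E) := forall e : R, 0 < e -> exists N, forall m n,
  (N <= m)%N -> (N <= n)%N -> bn (u m - u n) < e.

Definition bn_complete := forall u : nat -> E, (forall n, V (u n)) -> bn_cauchy u ->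
  exists2 v, V v & bn (u n - v) @[n --> \oo] --> (0 : R).

Lemma bn_cvg_cauchy (u : nat -> E) v : (forall n, V (u n)) -> V v ->
  bn (u n - v) @[n --> \oo] --> (0 : R) -> bn_cauchy u.
Proof.
move=> Vu Vv /cvgrPdist_lt uv e e0.
have /uv [N _ hN] : 0 < e / 2 by rewrite divr_gt0.
exists N => m n mN nN; apply: le_lt_trans (bnB_le (Vu m) Vv (Vu n)) _.
rewrite (bnBC Vv (Vu n)).
have := hN m mN; have := hN n nN; rewrite /= !sub0r !normrN !ger0_norm ?bn_ge0//.
lra.
Qed.

Lemma cvg_form (u : nat -> E) v w : (forall n, V (u n)) -> V v -> V w ->
  bn (u n - v) @[n --> \oo] --> (0 : R) -> B (u n) w @[n --> \oo] --> B v w.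
Proof.
move=> Vu Vv Vw uv; apply: (@cvg_dist_le _ _ (fun n => bn (u n - v) * bn w)).
  by move=> n; rewrite -preip_formBl//; exact: bn_CS.
by rewrite -[0 in X in _ --> X](mul0r (bn w)); apply: cvgM => //; exact: cvg_cst.
Qed.

Lemma cvg_bn (u : nat -> E) v : (forall n, V (u n)) -> V v ->
  bn (u n - v) @[n --> \oo] --> (0 : R) -> bn (u n) @[n --> \oo] --> bn v.
Proof.
move=> Vu Vv uv; apply: (@cvg_dist_le _ _ (fun n => bn (u n - v))) => // n.
exact: ler_bn_dist.
Qed.

(* The minimiser of [B v v - 2 * l v]: a minimising sequence is Cauchy by the
   parallelogram identity. *)
Lemma riesz (l : E -> R) (C : R) : bn_complete ->
  (forall a u v, V u -> V v -> l (a *: u + v) = a * l u + l v) ->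
  (forall u, V u -> `|l u| <= C * bn u) ->
  exists2 v, V v & forall w, V w -> B v w = l w.
Proof.
move=> cpl lin bd.
have lD u v : V u -> V v -> l (u + v) = l u + l v.
  by move=> Vu Vv; rewrite -{1}[u]scale1r lin// mul1r.
have l0 : l 0 = 0.
  have V0 := preip0 H; have := lD _ _ V0 V0.
  by rewrite addr0 => /eqP; rewrite -subr_eq subrr eq_sym => /eqP.
have lZ a u : V u -> l (a *: u) = a * l u.
  by move=> Vu; rewrite -[a *: u]addr0 lin ?l0 ?addr0//; exact: preip0 H.
pose J u := B u u - 2 * l u.
have JE t u v : V u -> V v ->
    J (u + t *: v) = J u + 2 * t * (B u v - l v) + t ^+ 2 * B v v.
  move=> Vu Vv; rewrite /J preip_sqr_expand// lD// lZ//; ring.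
pose S := [set J u | u in V].
have Slb : lbound S (- C ^+ 2).
  (* Completing the square: [J u] is at least [bn u ^+ 2 - 2 * C * bn u], hence at least
     [- C ^+ 2]. *)
  move=> _ [u Vu <-]; rewrite /J -sqr_bn//.
  have := le_trans (ler_norm _) (bd _ Vu) => h.
  have := sqr_ge0 (bn u - C); rewrite sqrrB.
  lra.
have S0 : S !=set0 by exists (J 0), 0 => //; exact: preip0 H.
have hS : has_inf S by split => //; exists (- C ^+ 2).
pose m := inf S.
have mJ u : V u -> m <= J u by move=> Vu; apply: ge_inf; [exists (- C ^+ 2)|exists u].
have /choice[u hu] : forall n, exists u, V u /\ J u < m + n.+1%:R^-1.
  move=> n.
  have n0 : 0 < n.+1%:R^-1 :> R by rewrite invr_gt0.
  by have [_ [u Vu <-] h] := inf_adherent n0 hS; exists u.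
have Vu n : V (u n) := (hu n).1.
have hJ n : J (u n) < m + n.+1%:R^-1 := (hu n).2.
have cau : bn_cauchy u.
  move=> e e0.
  have /cvgrPdist_lt/(_ (e ^+ 2 / 4)) : @harmonic R @ \oo --> (0 : R) by exact: cvg_harmonic.
  rewrite divr_gt0 ?exprn_gt0// => /(_ isT)[N _ hN].
  exists N => p q Np Nq.
  have Vpq := preipB (Vu p) (Vu q).
  rewrite -(ltr_pXn2r (n:=2))// ?nnegrE ?bn_ge0 ?(ltW e0)// sqr_bn//.
  have e1 := hN p Np; have e2 := hN q Nq.
  rewrite /= sub0r normrN ger0_norm ?invr_ge0// /harmonic in e1.
  rewrite /= sub0r normrN ger0_norm ?invr_ge0// /harmonic in e2.
  have j1 := JE 1 (u q) (u p - u q) (Vu q) Vpq.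
  rewrite scale1r addrC subrK in j1.
  (* At the midpoint, [J] is the mean of [J (u p)] and [J (u q)] minus a quarter of the squared
     distance. Being at least [m], it bounds that distance; this explains [e ^+ 2 / 4]. *)
  have j2 := JE (1/2) (u q) (u p - u q) (Vu q) Vpq.
  have := mJ _ (preipD (Vu q) (preipZ (1/2) Vpq)); rewrite j2.
  have := hJ p; rewrite j1; have := hJ q; move: e1 e2; clear.
  set a := p.+1%:R^-1; set b := q.+1%:R^-1; set x := B _ _; set y := l _.
  set z := B _ _; set j := J _; clearbody a b x y z j => h1 h2 h3 h4 h5.
  lra.
have [v Vv uv] := cpl u Vu cau.
exists v => // w Vw.
(* [J (u n + t *: w)] is at least [m] while [J (u n)] tends to [m]: in the limit a quadratic
   polynomial in [t] without constant term is non-negative, so its linear coefficient vanishes. *)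
have key t : 0 <= 0 + 2 * t * (B v w - l w) + t ^+ 2 * B w w.
  have c1 : (fun n => n.+1%:R^-1 + 2 * t * (B (u n) w - l w) + t ^+ 2 * B w w) @ \oo -->
      0 + 2 * t * (B v w - l w) + t ^+ 2 * B w w.
    apply: cvgD; last exact: cvg_cst.
    apply: cvgD; first exact: cvg_harmonic.
    apply: cvgM; first exact: cvg_cst.
    by apply: cvgB; [exact: cvg_form|exact: cvg_cst].
  rewrite -(cvg_lim _ c1)//; apply: limr_ge; first by apply/cvg_ex; eexists; exact: c1.
  near=> n; have := mJ _ (preipD (Vu n) (preipZ t Vw)); rewrite JE//.
  by have := hJ n; set a := n.+1%:R^-1; clearbody a; lra.
have := quadratic_discr (preip_ge0 H Vw) key.
rewrite mul0r => h; apply/eqP; rewrite -subr_eq0 -sqrf_eq0.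
by rewrite eq_le sqr_ge0 h.
Unshelve. all: by end_near. Qed.

End PreHilbert.

(** * Square-integrable functions on a measurable set *)

Section SquareIntegrable.
Context d {T : measurableType d} {R : realType} (mu : {measure set T -> \bar R}).
Variable D : set T.
Implicit Types f g h : T -> R.

Definition sqint f : Prop :=
  measurable_fun D f /\ mu.-integrable D (fun x => (f x ^+ 2)%:E).

Definition ip f g : R := \int[mu]_(x in D) (f x * g x).

Definition nrm f : R := bn ip f.

Hypothesis mD : measurable D.

Lemma nrmE f : nrm f = Num.sqrt (\int[mu]_(x in D) (f x ^+ 2)).
Proof. by rewrite /nrm bn.unlock. Qed.

Lemma sqint_integrableM f g : sqint f -> sqint g ->
  mu.-integrable D (EFin \o (fun x => f x * g x)).
Proof.
move=> [mf if2] [mg ig2].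
apply: (@le_integrable _ _ _ _ _ mD _ (fun x => (f x ^+ 2)%:E + (g x ^+ 2)%:E)%E).
- by apply/measurable_EFinP; exact: measurable_funM.
- move=> x Dx /=; rewrite lee_fin.
  rewrite [leRHS]ger0_norm ?addr_ge0 ?sqr_ge0//.
  rewrite ler_norml; have := sqr_ge0 (f x + g x); have := sqr_ge0 (f x - g x).
  have := sqr_ge0 (f x); have := sqr_ge0 (g x).
  move=> h1 h2; rewrite sqrrB sqrrD => h3 h4; apply/andP; split; lra.
- exact: integrableD.
Qed.

Lemma sqintL a f g : sqint f -> sqint g -> sqint (a *: f + g).
Proof.
move=> hf hg; have [mf if2] := hf; have [mg ig2] := hg; split.
  by apply: measurable_funD => //; exact: measurable_funM.
have := integrableD mD (integrableD mD (integrableZl mD (a ^+ 2) if2)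
  (integrableZl mD (2 * a) (sqint_integrableM hf hg))) ig2.
apply: eq_integrable => // x _ /=.
change ((a *: f + g) x) with (a * f x + g x).
by rewrite -!EFinM -!EFinD; congr EFin; ring.
Qed.

Lemma sqint0 : sqint 0.
Proof.
split; first exact: measurable_cst.
by apply: eq_integrable (integrable0 mu D) => // x _ /=; rewrite expr0n.
Qed.

Lemma ip_preip : preip sqint ip.
Proof.
split; [exact: sqint0|exact: sqintL| | |].
- by move=> f g _ _; apply: eq_Rintegral => x _; rewrite mulrC.
- move=> a f g h hf hg hh; rewrite /ip -RintegralZl//; last exact: sqint_integrableM.
  rewrite -RintegralD//; last exact: sqint_integrableM.
    by apply: eq_Rintegral => x _; rewrite [in LHS]mulrDl -mulrA.
  have := integrableZl mD a (sqint_integrableM hf hh).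
  by apply: eq_integrable => // x _ /=; rewrite EFinM.
- by move=> f _; apply: Rintegral_ge0 => x _; exact: sqr_ge0.
Qed.

Lemma sqint_ae f g : measurable_fun D g -> ae_eq mu D f g -> sqint f -> sqint g.
Proof.
move=> mg fg [mf if2]; split=> //.
apply/integrableP; split.
  by apply/measurable_EFinP; exact: measurable_funX.
move/integrableP : if2 => [_]; congr (_ < _)%E.
apply: ge0_ae_eq_integral => //.
- by do 2 apply: measurableT_comp => //; exact: measurable_funX.
- by do 2 apply: measurableT_comp => //; exact: measurable_funX.
- by apply: filterS fg => x /= fg Dx; rewrite fg.
Qed.

Lemma ip_ae f g h : measurable_fun D f -> measurable_fun D g -> measurable_fun D h ->
  ae_eq mu D f g -> ip f h = ip g h.
Proof.
move=> mf mg mh fg; congr fine; apply: ae_eq_integral => //.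
- by apply/measurable_EFinP; exact: measurable_funM.
- by apply/measurable_EFinP; exact: measurable_funM.
- by apply: filterS fg => x /= fg Dx; rewrite fg.
Qed.

Lemma nrm_eq0 f : sqint f -> nrm f = 0 -> ae_eq mu D f (cst 0).
Proof.
move=> [mf if2] /eqP; rewrite nrmE sqrtr_eq0 => le0.
have int0 : (\int[mu]_(x in D) `|(f x ^+ 2)%:E| = 0)%E.
  under eq_integral do rewrite gee0_abs ?lee_fin ?sqr_ge0//.
  rewrite -[LHS]fineK; last exact: integrable_fin_num.
  congr EFin; apply/eqP; rewrite eq_le le0/=.
  by apply: Rintegral_ge0 => x _; exact: sqr_ge0.
have /ae_eq_integral_abs : measurable_fun D (fun x => (f x ^+ 2)%:E).
  by apply/measurable_EFinP; exact: measurable_funX.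
move=> /(_ mu mD)[/(_ int0) h _]; apply: filterS h => x /= h /h [] /eqP.
by rewrite sqrf_eq0 => /eqP.
Qed.

Hypothesis finD : (mu D < +oo)%E.

Lemma sqint_cst a : sqint (cst a).
Proof.
split; first exact: measurable_cst.
apply/integrableP; split.
  by apply/measurable_EFinP; apply: measurable_funX; exact: measurable_cst.
rewrite (eq_integral (cst `|(a ^+ 2)%:E|%E))//.
by rewrite integral_cst// lte_mul_pinfty.
Qed.

Lemma sqint_integrable f : sqint f -> mu.-integrable D (EFin \o f).
Proof.
move=> hf; have := sqint_integrableM hf (sqint_cst 1).
by apply: eq_integrable => // x _ /=; rewrite mulr1.
Qed.

(** Cauchy-Schwarz against the constant 1, which is square-integrable because [D] has finite
    measure. *)
Lemma Rintegral_abs_le_nrm f : sqint f ->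
  (\int[mu]_(x in D) `|f x|%:E <= (nrm (cst 1) * nrm f)%:E)%E.
Proof.
move=> hf.
have haf : sqint (fun x => `|f x|).
  split; first by apply: measurableT_comp => //; exact: hf.1.
  by apply: eq_integrable hf.2 => // x _ /=; rewrite real_normK ?num_real.
have h1 := sqint_cst 1.
have ia := sqint_integrable haf.
rewrite -[leLHS]fineK; last exact: integrable_fin_num.
rewrite lee_fin.
have -> : nrm f = nrm (fun x => `|f x|).
  by rewrite !nrmE; congr Num.sqrt; apply: eq_Rintegral => x _; rewrite real_normK ?num_real.
apply: le_trans (bn_CS ip_preip h1 haf); apply: le_trans (ler_norm _).
by rewrite le_eqVlt; apply/orP; left; apply/eqP/eq_Rintegral => x _; rewrite mul1r.
Qed.

(** Fatou's lemma for the squares. It serves twice: to bound the remainders in the completeness of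
    L2, and to identify a uniform limit with an L2 limit. *)
Lemma fatou_sqint (g : nat -> T -> R) f C : (forall n, sqint (g n)) -> 0 <= C ->
  (forall x, D x -> g n x @[n --> \oo] --> f x) ->
  (\forall n \near \oo, nrm (g n) <= C) -> sqint f /\ nrm f <= C.
Proof.
move=> hg C0 gf bd.
have mf : measurable_fun D f.
  by apply: measurable_fun_cvg gf => n; exact: (hg n).1.
have nE n : (\int[mu]_(x in D) (g n x ^+ 2)%:E = (nrm (g n) ^+ 2)%:E)%E.
  rewrite (sqr_bn ip_preip (hg n)) fineK; last exact: integrable_fin_num (hg n).2.
  by [].
have key : (\int[mu]_(x in D) (f x ^+ 2)%:E <= (C ^+ 2)%:E)%E.
  have := @fatou _ _ _ mu D mD (fun n x => (g n x ^+ 2)%:E).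
  have m2 n : measurable_fun D (fun x => (g n x ^+ 2)%:E).
    by apply/measurable_EFinP; apply: measurable_funX; exact: (hg n).1.
  move=> /(_ m2) => /(_ (fun n x _ => _)) h.
  apply: (le_trans (le_trans _ (h _))).
  - rewrite le_eqVlt; apply/orP; left; apply/eqP/eq_integral => x /set_mem Dx.
    apply/esym/(cvg_limn_einf_sup _).1.
    by apply/cvg_EFin; [exact: nearW|]; apply: cvgM; exact: gf.
  - by move=> n x; rewrite lee_fin sqr_ge0.
  - rewrite limn_einf_lim; apply: lime_le.
      apply: ereal_nondecreasing_is_cvgn => m n mn.
      by apply: ereal_inf_le_tmp => _ [p /= np <-]; exists p => //=; exact: leq_trans np.
    near=> n; apply: ereal_inf_le; exists (nrm (g n) ^+ 2)%:E.
      by exists n => //=; rewrite nE.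
    rewrite lee_fin lerXn2r ?nnegrE ?bn_ge0//; near: n; exact: bd.
have hf : sqint f.
  split=> //; apply/integrableP; split.
    by apply/measurable_EFinP; exact: measurable_funX.
  under eq_integral do rewrite gee0_abs ?lee_fin ?sqr_ge0//.
  by apply: le_lt_trans key _; rewrite ltry.
split => //; rewrite -(ler_pXn2r (n:=2))// ?nnegrE ?bn_ge0// (sqr_bn ip_preip hf).
rewrite -lee_fin; apply: le_trans key.
by rewrite /ip /Rintegral fineK; last exact: integrable_fin_num hf.2.
Unshelve. all: by end_near. Qed.

Lemma nrm_ae f g : measurable_fun D f -> measurable_fun D g ->
  ae_eq mu D f g -> nrm f = nrm g.
Proof.
move=> mf mg fg; rewrite !nrmE; congr Num.sqrt; congr fine; apply: ae_eq_integral => //.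
- by apply/measurable_EFinP; exact: measurable_funX.
- by apply/measurable_EFinP; exact: measurable_funX.
- by apply: filterS fg => x /= fg Dx; rewrite fg.
Qed.

Lemma cauchy_rapid (f : nat -> T -> R) : bn_cauchy ip f ->
  exists s : nat -> nat, forall k n, (s k <= n)%N -> nrm (f n - f (s k)) <= (2 ^- k).
Proof.
move=> cf.
have /choice[s hs] : forall k, exists N, forall n, (N <= n)%N -> nrm (f n - f N) <= (2 ^- k).
  move=> k; have /cf[N hN] : 0 < 2 ^- k :> R by rewrite invr_gt0 exprn_gt0.
  by exists N => n Nn; apply: ltW; exact: hN.
by exists s.
Qed.

(* Riesz-Fischer: a rapidly converging subsequence has an integrable sum of
   increments, hence converges almost everywhere. *)
Lemma sqint_complete : bn_complete sqint ip.
Proof.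
move=> f hf cf.
have [s0 hs0] := cauchy_rapid cf.
(* [cauchy_rapid] chooses each index separately; running maxima make the subsequence nondecreasing,
   at the price of the factor 2 in [hs]. *)
pose s := fix s k := if k is k'.+1 then maxn (s k') (s0 k) else s0 0%N.
have ss k : (s k <= s k.+1)%N by rewrite leq_maxl.
have s0s k : (s0 k <= s k)%N by case: k => //= k; rewrite leq_maxr.
have smon : {homo s : m n / (m <= n)%N}.
  by apply: homo_leq => //; [move=> ? ? ?; exact: leq_trans].
have PI := ip_preip.
have hd m n : sqint (f m - f n) by apply: (preipB PI).
have hs k n : (s k <= n)%N -> nrm (f n - f (s k)) <= 2 * 2 ^- k.
  move=> kn; have h1 := hs0 k n (leq_trans (s0s k) kn).
  have h2 := hs0 k (s k) (s0s k).
  have := bnB_le PI (hf n) (hf (s0 k)) (hf (s k)).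
  by rewrite -/(nrm _) (bnBC PI (hf (s0 k)))// -/(nrm _) => h3; move: h1 h2 h3; rewrite /nrm; lra.
pose g k := f (s k).
pose h k x := (`|g k.+1 x - g k x|)%:E.
have mh k : measurable_fun D (h k).
  by apply/measurable_EFinP; apply: measurableT_comp => //; exact: (hd _ _).1.
have h0 k x : (0 <= h k x)%E by rewrite lee_fin.
pose S x := (\sum_(k <oo) h k x)%E.
have S0 x : (0 <= S x)%E by apply: nneseries_ge0.
have mS : measurable_fun D S by apply: ge0_emeasurable_sum => // k _; exact: mh.
have intS : mu.-integrable D S.
  apply/integrableP; split => //.
  under eq_integral do rewrite gee0_abs//.
  rewrite integral_nneseries//.
  apply: (@le_lt_trans _ _ (\sum_(k <oo) (nrm (cst 1) * (2 * 2 ^- k))%:E)%E).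
    apply: lee_nneseries => [k _ _|k _]; first exact: integral_ge0.
    apply: le_trans (Rintegral_abs_le_nrm (hd _ _)) _.
    rewrite lee_fin ler_wpM2l ?bn_ge0//; exact: hs.
  have -> : (fun n => \sum_(0 <= k < n) (nrm (cst 1) * (2 * 2 ^- k))%:E)%E =
      (fun n => (series (geometric (nrm (cst 1) * 2) (2^-1)) n)%:E).
    apply/funext => n; rewrite /series/= -sumEFin; apply: eq_bigr => k _.
    by rewrite /geometric/= exprVn mulrA.
  have cg : cvgn (series (geometric (nrm (cst 1) * 2) (2^-1 : R))).
    by apply: is_cvg_geometric_series; rewrite ger0_norm ?invf_lt1 ?ltr1n.
  by rewrite EFin_lim// ltry.
pose C := D `&` [set x | S x < +oo]%E.
have mC : measurable C by apply: emeasurable_fun_infty_o.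
(* Replacing the subsequence by 0 where the increments are not summable makes it converge everywhere
   on [D] and changes it only on a null set. *)
pose g' k x := g k x * \1_C x.
have cg' x : D x -> cvgn (g'^~ x).
  move=> Dx; rewrite /g'; have [/set_mem Cx|nCx] := boolP (x \in C); last first.
    by rewrite indicE (negbTE nCx); under eq_fun do rewrite mulr0; exact: is_cvg_cst.
  rewrite indicE mem_set//; under eq_fun do rewrite mulr1.
  have : cvgn (series (fun k => g k.+1 x - g k x)).
    apply: normed_cvg.
    have fS : S x \is a fin_num by rewrite ge0_fin_numE//; exact: Cx.2.
    apply: nondecreasing_is_cvgn.
      by apply: nondecreasing_series => k _ /=.
    exists (fine (S x)) => _ [n _ <-]; rewrite -lee_fin fineK//.
    rewrite /series/= -sumEFin; exact: nneseries_lim_ge.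
  have -> : g^~ x = (fun n => g 0%N x + series (fun k => g k.+1 x - g k x) n).
    by apply/funext => n /=; rewrite /series/= telescope_sumr// addrC subrK.
  by move=> h1; apply: is_cvgD => //; exact: is_cvg_cst.
pose F x := limn (g'^~ x).
have gF x : D x -> g' n x @[n --> \oo] --> F x by move=> Dx; exact: cg'.
have mI : measurable_fun D (\1_C : T -> R) by exact: measurable_indic.
have mg' k : measurable_fun D (g' k) by apply: measurable_funM => //; exact: (hf _).1.
have gg' k : ae_eq mu D (g k) (g' k).
  have := integrable_ae mD intS; apply: filterS => x /= + Dx => /(_ Dx) fx.
  by rewrite /g' indicE mem_set ?mulr1//; split=> //=; rewrite -ge0_fin_numE.
have sg' k : sqint (g' k) := sqint_ae (mg' k) (gg' k) (hf _).
have key k : sqint (F - g' k) /\ nrm (F - g' k) <= 2 * 2 ^- k.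
  apply: (@fatou_sqint (fun n => g' n - g' k)).
  - by move=> n; exact: (preipB PI).
  - by rewrite mulr_ge0// invr_ge0 exprn_ge0.
  - by move=> x Dx; apply: cvgB; [exact: gF|exact: cvg_cst].
  - exists k => // n /= kn; rewrite (@nrm_ae _ (g n - g k)).
    + exact: hs (smon _ _ kn).
    + exact: (preipB PI (sg' n) (sg' k)).1.
    + exact: (hd _ _).1.
    + apply: filterS2 (gg' n) (gg' k) => x /= e1 e2 Dx.
      by change (g' n x - g' k x = g n x - g k x); rewrite e1// e2.
have sF : sqint F by rewrite -[F](subrK (g' 0%N)); apply: (preipD PI) => //; exact: (key _).1.
exists F => //; apply/cvgrPdist_lt => e e0.
have [k hk] : exists k, 4 * 2 ^- k < e :> R.
  have : (fun k => 4 * 2^-1 ^+ k : R) @ \oo --> 4 * (0 : R).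
    apply: cvgM; first exact: cvg_cst.
    by apply: cvg_expr; rewrite ger0_norm ?invf_lt1 ?ltr1n.
  rewrite mulr0 => /cvgrPdist_lt/(_ e e0)[k _ /(_ k)/= hk]; exists k.
  have := hk (leqnn k); rewrite sub0r normrN exprVn; apply: le_lt_trans; exact: ler_norm.
exists (s k) => // n /= kn; rewrite sub0r normrN ger0_norm ?bn_ge0//.
apply: le_lt_trans hk.
have := bnB_le PI (hf n) (hf (s k)) sF => /le_trans; apply.
have -> : bn ip (f (s k) - F) = nrm (F - g' k).
  rewrite (bnBC PI (hf _) sF); apply: nrm_ae.
  - exact: (preipB PI sF (hf _)).1.
  - exact: (key k).1.1.
  - by apply: filterS (gg' k) => x /= e1 Dx; change (F x - g k x = F x - g' k x); rewrite e1.
by have := hs k n kn; have := (key k).2; rewrite /nrm; lra.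
Qed.

End SquareIntegrable.

(** * Smooth functions of one variable *)

Section Smooth1.
Context {R : realType}.
Implicit Types (a b : R -> R) (x : R) (n k : nat).
Notation leb := (@lebesgue_measure R).

Fixpoint Ck1 n a : Prop :=
  if n is m.+1 then exists2 b, (forall x, is_derive x 1 a (b x)) & Ck1 m b
  else continuous a.

Definition smooth1 a : Prop := forall n, Ck1 n a.

Lemma is_derive_continuous a b : (forall x, is_derive x 1 a (b x)) -> continuous a.
Proof.
by move=> ab x; apply/differentiable_continuous/derivable1_diffP; have [] := ab x.
Qed.

Lemma Ck1_continuous n a : Ck1 n a -> continuous a.
Proof. by case: n => // n [b ab _]; exact: is_derive_continuous ab. Qed.

Lemma Ck1S n a : Ck1 n.+1 a -> Ck1 n a.
Proof.
elim: n a => [|n IH] a; first by move=> h; exact: Ck1_continuous h.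
by move=> [b ab /IH h]; exists b.
Qed.

Lemma Ck1D n a b : Ck1 n a -> Ck1 n b -> Ck1 n (fun x => a x + b x).
Proof.
elim: n a b => [|n IH] a b /=; first by move=> ca cb x; apply: cvgD; [exact: ca|exact: cb].
move=> [a' aa' ha] [b' bb' hb]; exists (fun x => a' x + b' x); last exact: IH.
by move=> x; apply: is_deriveD.
Qed.

Lemma Ck1Z n c a : Ck1 n a -> Ck1 n (fun x => c * a x).
Proof.
elim: n a => [|n IH] a /=; first by move=> ca x; apply: cvgM; [exact: cvg_cst|exact: ca].
move=> [a' aa' ha]; exists (fun x => c * a' x); last exact: IH.
by move=> x; apply: (@is_deriveZ _ _ _ a c x 1 (a' x)).
Qed.

Lemma Ck1M n a b : Ck1 n a -> Ck1 n b -> Ck1 n (fun x => a x * b x).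
Proof.
elim: n a b => [|n IH] a b; first by move=> ca cb x; apply: cvgM; [exact: ca|exact: cb].
move=> ha hb; have [a' aa' ha'] := ha; have [b' bb' hb'] := hb.
exists (fun x => a x * b' x + b x * a' x).
  by move=> x; apply: (is_deriveM (f := a) (g := b)).
by apply: Ck1D; apply: IH => //; exact: Ck1S.
Qed.

Lemma Ck1_affine n a (k m : R) : Ck1 n a -> Ck1 n (fun x => a (k * x + m)).
Proof.
elim: n a => [|n IH] a /=.
  move=> ca x; apply: (@continuous_comp _ _ _ (fun x => k * x + m)); last exact: ca.
  by apply: cvgD; [apply: cvgM; [exact: cvg_cst|exact: cvg_id]|exact: cvg_cst].
move=> [a' aa' ha]; exists (fun x => k * a' (k * x + m)); last exact/Ck1Z/IH.
move=> x; have dm : is_derive x 1 (fun x => k * x + m) k.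
  by apply: is_derive_eq; rewrite addr0 /GRing.scale/= mulr1.
have := @is_derive1_comp _ a (fun x => k * x + m) x _ _ (aa' (k * x + m)) dm.
by rewrite /comp mulrC.
Qed.

Lemma Ck1_cst n c : Ck1 n (fun=> c).
Proof.
elim: n c => [|n IH] c /=; first exact: cst_continuous.
by exists (fun=> 0) => // x; exact: is_derive_cst.
Qed.

Lemma Ck1_id n : Ck1 n (fun x => x).
Proof.
case: n => [|n] /=; first by move=> x; exact: cvg_id.
by exists (fun=> 1); [move=> x; exact: is_derive_id|exact: Ck1_cst].
Qed.

Lemma smooth1D a b : smooth1 a -> smooth1 b -> smooth1 (fun x => a x + b x).
Proof. by move=> ha hb n; exact: Ck1D. Qed.

Lemma smooth1Z c a : smooth1 a -> smooth1 (fun x => c * a x).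
Proof. by move=> ha n; exact: Ck1Z. Qed.

Lemma smooth1M a b : smooth1 a -> smooth1 b -> smooth1 (fun x => a x * b x).
Proof. by move=> ha hb n; exact: Ck1M. Qed.

Lemma smooth1_affine a (k m : R) : smooth1 a -> smooth1 (fun x => a (k * x + m)).
Proof. by move=> ha n; exact: Ck1_affine. Qed.

Lemma smooth1_cst c : smooth1 (fun=> c).
Proof. by move=> n; exact: Ck1_cst. Qed.

Lemma smooth1_id : smooth1 (fun x => x).
Proof. by move=> n; exact: Ck1_id. Qed.

Lemma smooth1_continuous a : smooth1 a -> continuous a.
Proof. by move/(_ 0%N). Qed.

Lemma smooth1_is_derive a x : smooth1 a -> is_derive x 1 a (a^`()%classic x).
Proof.
move=> /(_ 1%N)[b ab _]; rewrite derive1E; have h := ab x.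
by apply: DeriveDef => //; exact: ex_derive.
Qed.

Lemma is_derive_derive1 a b : (forall x, is_derive x 1 a (b x)) -> a^`()%classic = b.
Proof. by move=> ab; apply/funext => x; rewrite derive1E; have h := ab x; rewrite derive_val. Qed.

Lemma smooth1_derive a : smooth1 a -> smooth1 a^`()%classic.
Proof.
by move=> ha n; have [b ab hb] := ha n.+1; rewrite (is_derive_derive1 ab).
Qed.

Lemma smooth1_primitive a b : (forall x, is_derive x 1 a (b x)) -> smooth1 b -> smooth1 a.
Proof.
move=> ab hb [|n] /=; first exact: is_derive_continuous ab.
by exists b.
Qed.

(** Only [flat 0] serves in [bump]; the powers of [x^-1] make the family stable, up to linear
    combinations, under differentiation, so that smoothness is one induction over all [k] at
    once. *)
Definition flat k x : R := if 0 < x then x^-1 ^+ k * expR (- x^-1) else 0.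

Lemma flat_ge0 k x : 0 <= flat k x.
Proof. by rewrite /flat; case: ifPn => // x0; rewrite mulr_ge0 ?expR_ge0// exprn_ge0// invr_ge0 ltW. Qed.

Lemma flat0_le1 x : flat 0 x <= 1.
Proof.
rewrite /flat; case: ifPn => // x0; rewrite expr0 mul1r -expR0 ler_expR.
by rewrite oppr_le0 invr_ge0 ltW.
Qed.

(** With [y = x^-1], this is [y / k.+1 <= expR (y / k.+1)] raised to the power [k.+1]. It makes the
    difference quotient at 0, which is [flat k.+1], tend to 0. *)
Lemma flat_bound k x : 0 < x -> flat k x <= (k.+1%:R ^+ k.+1) * x.
Proof.
move=> x0; rewrite /flat x0.
have e1 : x^-1 ^+ k.+1 <= k.+1%:R ^+ k.+1 * expR x^-1.
  have : x^-1 / k.+1%:R <= expR (x^-1 / k.+1%:R).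
    by apply: le_trans (expR_ge1Dx _); rewrite lerDr.
  rewrite -(ler_pXn2r (n:=k.+1))// ?nnegrE ?expR_ge0 ?divr_ge0 ?invr_ge0 ?(ltW x0)//.
  rewrite -expRM_natl mulrCA divff ?pnatr_eq0// mulr1 expr_div_n.
  by rewrite ler_pdivrMr ?exprn_gt0// mulrC.
have -> : x^-1 ^+ k = x * x^-1 ^+ k.+1 by rewrite exprS mulrA divff ?gt_eqF// mul1r.
rewrite -mulrA [leRHS]mulrC ler_wpM2l ?(ltW x0)// expRN ler_pdivrMr ?expR_gt0//.
Qed.

Lemma is_derive_flat k x : is_derive x 1 (flat k) (flat k.+2 x - k%:R * flat k.+1 x).
Proof.
have [x0|x0|->] := ltgtP x 0.
- have fl0 j : flat j x = 0 by rewrite /flat ltNge (ltW x0).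
  rewrite !fl0 mulr0 subr0.
  apply: (near_eq_is_derive (f := fun=> 0)).
  near=> y; rewrite /flat ifF//; apply/negbTE; rewrite -leNgt ltW//; near: y; exact: lt_nbhsl.
- have dV : is_derive x 1 (fun y : R => y^-1) (- x^-1 ^+ 2).
    have xn0 : x != 0 by rewrite gt_eqF.
    have := @is_deriveV R (fun y => y) x 1 1 xn0 (is_derive_id _ _).
    by rewrite exprVn /GRing.scale/= mulr1.
  have dN : is_derive x 1 (fun y : R => - y^-1) (x^-1 ^+ 2).
    by apply: is_derive_eq; rewrite opprK.
  have dE : is_derive x 1 (fun y : R => expR (- y^-1)) (expR (- x^-1) * x^-1 ^+ 2).
    exact: (is_derive1_comp (is_derive_expR _) dN).
  have dF : is_derive x 1 (fun y : R => y^-1 ^+ k * expR (- y^-1))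
      (flat k.+2 x - k%:R * flat k.+1 x).
    have := is_deriveM (is_deriveX k dV) dE.
    rewrite (_ : _ * _ = fun y : R => y^-1 ^+ k * expR (- y^-1)).
      move=> h; apply: (is_derive_eq h); rewrite fctE /flat x0 /GRing.scale/=.
      by case: (k) => [|j]; rewrite ?expr0 ?mulr0n ?exprS -?[j.+1.-1]/j; ring.
    by apply/funext => y; rewrite !fctE.
  apply: near_eq_is_derive dF.
  near=> y; rewrite /flat ifT//; near: y; exact: lt_nbhsr.
- rewrite {2 3}/flat ltxx mulr0 subr0.
  have lim0 : h^-1 *: ((flat k \o shift 0) (h *: 1) - flat k 0) @[h --> 0^'] --> (0 : R).
    apply/cvgrPdist_le => e e0; near=> h.
    rewrite /= sub0r normrN addr0 /GRing.scale/= mulr1 {2}/flat ltxx subr0.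
    have [h0|h0] := ltP 0 h; last by rewrite /flat ltNge h0/= mulr0 normr0 ltW.
    have -> : h^-1 * flat k h = flat k.+1 h by rewrite /flat h0 exprS mulrA.
    rewrite ger0_norm ?flat_ge0//; apply: le_trans (flat_bound _ h0) _.
    rewrite mulrC -ler_pdivlMr ?exprn_gt0//.
    apply: (le_trans (ler_norm _)); near: h; apply: dnbhs0_le.
    by rewrite divr_gt0// exprn_gt0.
  apply: DeriveDef; first by apply/cvg_ex; exists 0.
  exact: cvg_lim.
Unshelve. all: by end_near. Qed.

Lemma smooth1_flat k : smooth1 (flat k).
Proof.
move=> n; elim: n k => [|n IH] k.
  exact: is_derive_continuous (is_derive_flat k).
exists (fun x => flat k.+2 x + (- k%:R) * flat k.+1 x).
  by move=> x; apply: is_derive_eq (is_derive_flat k x) _; rewrite mulNr.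
by apply: Ck1D => //; exact: Ck1Z.
Qed.

Definition test1 c d a : Prop := smooth1 a /\
  exists c' d', [/\ c < c', c' <= d', d' < d & forall x, ~ (c' <= x <= d') -> a x = 0].

(** The shift by 1 keeps the support at distance [n.+1^-1] from [c] and [d]; the factor [n.+1] makes
    the bumps tend pointwise to the indicator of the open interval. They are bounded by 1, not
    normalised by their integral. *)
Definition bump c d n x : R :=
  flat 0 (n.+1%:R * (x - c) - 1) * flat 0 (n.+1%:R * (d - x) - 1).

Lemma bump_ge0 c d n x : 0 <= bump c d n x.
Proof. by rewrite mulr_ge0 ?flat_ge0. Qed.

Lemma bump_le1 c d n x : bump c d n x <= 1.
Proof. by rewrite mulr_ile1 ?flat_ge0 ?flat0_le1. Qed.

Lemma smooth1_bump c d n : smooth1 (bump c d n).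
Proof.
have E : bump c d n = (fun x => flat 0 (n.+1%:R * x + (- (n.+1%:R * c) - 1)) *
     flat 0 (- n.+1%:R * x + (n.+1%:R * d - 1))).
  by apply/funext => x; rewrite /bump; congr (flat 0 _ * flat 0 _); ring.
by rewrite E; apply: smooth1M; apply: smooth1_affine; exact: smooth1_flat.
Qed.

Lemma test1_bump c d n : c < d -> test1 c d (bump c d n).
Proof.
move=> cd; split; first exact: smooth1_bump.
have n0 : 0 < n.+1%:R^-1 :> R by rewrite invr_gt0.
have key x : bump c d n x != 0 -> c + n.+1%:R^-1 < x < d - n.+1%:R^-1.
  rewrite mulf_eq0 negb_or => /andP[]; rewrite /flat.
  case: ifPn; last by rewrite eqxx.
  rewrite subr_gt0 -ltr_pdivrMl// mulr1 => h1 _.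
  case: ifPn; last by rewrite eqxx.
  rewrite subr_gt0 -ltr_pdivrMl// mulr1 => h2 _.
  by move: h1 h2; set e := n.+1%:R^-1 => h1 h2; apply/andP; split; lra.
have [h|h] := leP (c + n.+1%:R^-1) (d - n.+1%:R^-1).
  exists (c + n.+1%:R^-1), (d - n.+1%:R^-1); split=> //; rewrite ?ltrDl ?ltrBlDr ?ltrDl//.
  move=> x hx; apply/eqP/negP => /negP /key /andP[h1 h2]; apply: hx.
  by rewrite !ltW.
(* For small [n] the two half-lines where the factors are positive do not meet, so the bump is 0 and
   any point can carry its support. *)
exists ((c + d) / 2), ((c + d) / 2); split=> //; [lra|lra|].
move=> x _; apply/eqP/negP => /negP /key /andP[h1 h2].
by have := lt_trans h1 h2; rewrite ltNge (ltW h).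
Qed.

Lemma bump_cvg c d x : bump c d n x @[n --> \oo] --> (\1_(`]c, d[) x : R).
Proof.
have fl (y : R) : flat 0 (n.+1%:R * y - 1) @[n --> \oo] --> ((0 < y)%R%:R : R).
  have [y0|y0] := ltP 0 y; last first.
    apply: cvg_near_cst; apply: nearW => n; rewrite /flat ifF//.
    apply/negbTE; rewrite -leNgt subr_le0 (le_trans _ ler01)//.
    by rewrite mulr_ge0_le0.
  apply/cvgrPdist_le => e e0.
  pose t := e^-1; have t0 : 0 < t by rewrite invr_gt0.
  near=> n.
  have n1 : t < n.+1%:R * y - 1.
    rewrite ltrBrDr -ltr_pdivrMr//; apply: lt_trans (_ : n%:R < _); last by rewrite ltr_nat.
    by near: n; exact: nbhs_infty_gtr.
  have n0 : 0 < n.+1%:R * y - 1 by exact: lt_trans n1.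
  rewrite ger0_norm; last by rewrite subr_ge0 flat0_le1.
  rewrite /flat n0 expr0 mul1r lerBlDr -lerBlDl.
  apply: le_trans (expR_ge1Dx _); rewrite lerD2l lerN2.
  by rewrite -[leRHS]invrK lef_pV2 ?posrE// ltW.
have -> : \1_(`]c, d[) x = (0 < x - c)%R%:R * (0 < d - x)%R%:R :> R.
  rewrite indicE mem_setE in_itv/= !subr_gt0; case: (c < x); case: (x < d) => /=; rewrite ?mulr0 ?mul0r ?mulr1//.
by apply: cvgM; exact: fl.
Unshelve. all: by end_near. Qed.

Lemma ivl_finite (a b : R) : (leb `]a, b[%classic < +oo)%E.
Proof. by rewrite lebesgue_measure_itv/=; case: ifP; rewrite ?ltry// -EFinB ltry. Qed.

Lemma continuous_integrable_ivl (f : R -> R) (a b : R) : continuous f ->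
  leb.-integrable `]a, b[ (EFin \o f).
Proof.
move=> cf; have h : leb.-integrable `[a, b] (EFin \o f).
  apply: continuous_compact_integrable; first exact: segment_compact.
  exact: continuous_subspaceT.
by apply: integrableS h => //; exact: subset_itv_oo_cc.
Qed.

Lemma Rintegral_ivl_closed (f : R -> R) (a b : R) : continuous f ->
  \int[leb]_(x in `]a, b[) f x = \int[leb]_(x in `[a, b]) f x.
Proof.
move=> cf; congr fine; symmetry; apply: integral_itv_bndoo; apply/measurable_EFinP.
by apply: measurable_funTS; exact: continuous_measurable_fun.
Qed.

Lemma FTC_ivl (F f : R -> R) (a b : R) : a <= b -> (forall x, is_derive x 1 F (f x)) ->
  continuous f -> \int[leb]_(x in `]a, b[) f x = F b - F a.
Proof.
rewrite le_eqVlt => /predU1P[->|ab] Ff cf.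
  by rewrite set_itvoo0// Rintegral_set0 subrr.
have cF := is_derive_continuous Ff.
rewrite Rintegral_ivl_closed//.
rewrite /Rintegral (@continuous_FTC2 _ f F)//.
- exact: continuous_subspaceT.
- split; first by move=> x _; have h := Ff x; exact: ex_derive.
  + exact/cvg_at_right_filter/cF.
  + exact/cvg_at_left_filter/cF.
- by move=> x _; rewrite (is_derive_derive1 Ff).
Qed.

Lemma test1_primitive c d a : test1 c d a -> exists A : R -> R,
  [/\ forall x, is_derive x 1 A (a x),
   (exists2 c', c < c' & forall x, x <= c' -> A x = 0)
   & exists2 d', d' < d & forall x, d' <= x -> A x = \int[leb]_(x in `]c, d[) a x].
Proof.
move=> [sa [c' [d' [cc' cd' dd' a0]]]].
have ca := smooth1_continuous sa.
pose A x := \int[leb]_(t in `]c, x[) a t.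
have A0 x : x <= c' -> A x = 0.
  move=> xc'; rewrite /A (@eq_Rintegral _ _ _ _ _ (cst 0)) ?Rintegral_cst ?mul0r//.
  move=> t; rewrite inE/= in_itv/= => /andP[_ tx].
  by rewrite a0// => /andP[h _]; have := lt_le_trans tx xc'; rewrite ltNge h.
have dA x : is_derive x 1 A (a x).
  (* The fundamental theorem differentiates only to the right of [c]; near the points below [c'],
     the primitive is identically 0. *)
  have [xc'|c'x] := ltP x c'.
    rewrite a0; last by rewrite leNgt xc'.
    apply: (near_eq_is_derive (f := fun=> 0)).
    near=> y; rewrite A0//; apply: ltW; near: y; exact: lt_nbhsl.
  have cx : c < x by exact: lt_le_trans c'x.
  have -> : A = fun x => \int[leb]_(t in `[c, x]) a t.
    by apply/funext => y; exact: Rintegral_ivl_closed.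
  have [] := @continuous_FTC1_closed R a c x (x + 1).
  - by rewrite ltrDl.
  - apply: continuous_compact_integrable; first exact: segment_compact.
    exact: continuous_subspaceT.
  - exact: cx.
  - exact: ca.
  by rewrite derive1E => dx Dx; apply: DeriveDef.
exists A; split=> //; first by exists c'.
exists d' => // x d'x.
have cd : c <= d by rewrite ltW// (lt_trans cc')// (le_lt_trans cd').
rewrite (FTC_ivl cd dA ca) (A0 c (ltW cc')) subr0.
have [xd|dx] := leP x d.
  suff : A d - A x = 0 by move/eqP; rewrite subr_eq0 => /eqP.
  rewrite -(FTC_ivl xd dA ca).
  rewrite (@eq_Rintegral _ _ _ _ _ (cst 0)) ?Rintegral_cst ?mul0r//.
  move=> t; rewrite inE/= in_itv/= => /andP[xt _].
  by rewrite a0// => /andP[_]; rewrite leNgt (le_lt_trans d'x xt).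
apply/eqP; rewrite -subr_eq0 -(FTC_ivl (ltW dx) dA ca).
rewrite (@eq_Rintegral _ _ _ _ _ (cst 0)) ?Rintegral_cst ?mul0r//.
move=> t; rewrite inE/= in_itv/= => /andP[xt _].
by rewrite a0// => /andP[_]; rewrite leNgt (lt_trans dd' xt).
Unshelve. all: by end_near. Qed.

Lemma test1_primitive_test c d a A : test1 c d a -> (forall x, is_derive x 1 A (a x)) ->
  (exists2 c', c < c' & forall x, x <= c' -> A x = 0) ->
  (exists2 d', d' < d & forall x, d' <= x -> A x = 0) -> test1 c d A.
Proof.
move=> [sa [c1 [d1 [c1c c1d d1d _]]]] dA [c' cc' A0] [d' dd' A1].
split; first exact: smooth1_primitive dA sa.
exists (Num.min c' c1), (Num.max d' d1); split.
- by rewrite lt_min cc' c1c.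
- by rewrite ge_min !le_max c1d !orbT.
- by rewrite gt_max dd' d1d.
- move=> x hx; have [h|h] := leP x c'; first exact: A0.
  have [h'|h'] := leP d' x; first exact: A1.
  exfalso; apply: hx; rewrite ge_min (ltW h) /= le_max (ltW h')//.
Qed.

Lemma test1D c d a b : test1 c d a -> test1 c d b -> test1 c d (fun x => a x + b x).
Proof.
move=> [sa [c1 [d1 [? ? ? ha]]]] [sb [c2 [d2 [? ? ? hb]]]]; split; first exact: smooth1D.
exists (Num.min c1 c2), (Num.max d1 d2); split.
- by rewrite lt_min; apply/andP.
- by rewrite ge_min !le_max; apply/orP; left; apply/orP; left.
- by rewrite gt_max; apply/andP.
- move=> x hx; rewrite ha ?hb ?addr0// => /andP[h1 h2]; apply: hx.
  + by rewrite ge_min le_max h1 h2 !orbT.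
  + by rewrite ge_min le_max h1 h2.
Qed.

Lemma test1Z c d (k : R) a : test1 c d a -> test1 c d (fun x => k * a x).
Proof.
move=> [sa [c1 [d1 [? ? ? ha]]]]; split; first exact: smooth1Z.
by exists c1, d1; split => // x hx; rewrite ha ?mulr0.
Qed.

Lemma test1_derive c d a : test1 c d a -> test1 c d a^`()%classic.
Proof.
move=> [sa [c1 [d1 [? ? ? ha]]]]; split; first exact: smooth1_derive.
exists c1, d1; split => // x hx; rewrite derive1E.
rewrite -(derive_cst 0 x (1 : R)); apply: near_eq_derive.
have : (~` `[c1, d1]%classic) x by rewrite /= in_itv/=.
move=> xo; have : nbhs x (~` `[c1, d1]%classic).
  by apply: open_nbhs_nbhs; split => //; apply: closed_openC; exact: itv_closed.
by apply: filterS => y; rewrite /= in_itv/= => hy; rewrite ha.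
Qed.

End Smooth1.

(** * Smooth functions of two variables *)

Section PlaneMeasure.
Context {R : realType}.
Notation leb := (@lebesgue_measure R).
Notation RR := (measurableTypeR R * measurableTypeR R)%type.

Definition rect (a b c d : R) : set (R * R) := `]a, b[ `*` `]c, d[.

Lemma measurable_rect a b c d : @measurable _ RR (rect a b c d).
Proof. by apply: measurableX; exact: measurable_itv. Qed.

Lemma rect_finite a b c d : (mu2 (rect a b c d) < +oo)%E.
Proof.
rewrite /mu2 /rect product_measure1E; [|exact: measurable_itv|exact: measurable_itv].
by rewrite lte_mul_pinfty//; [rewrite ge0_fin_numE//|]; exact: ivl_finite.
Qed.

(** [mu2] lives on the product sigma-algebra; an open set belongs to it as the countable union of
    the open squares with rational centre and half-side that it contains. *)
Lemma open_measurable2 (U : set (R * R)) : open U -> @measurable _ RR U.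
Proof.
move=> oU.
pose B (q : rat * rat * rat) : set (R * R) :=
  rect (ratr q.1.1 - ratr q.2) (ratr q.1.1 + ratr q.2)
       (ratr q.1.2 - ratr q.2) (ratr q.1.2 + ratr q.2).
have -> : U = \bigcup_q (if `[< B q `<=` U >] then B q else set0).
  apply/seteqP; split => [[x y] Uxy|p [q _]]; last by case: asboolP => // h /h.
  have /nbhs_ballP[e /= e0 he] : nbhs (x, y) U by exact: open_nbhs_nbhs.
  have [q1] : exists q1 : rat, ratr q1 \in `](x - e / 4), (x + e / 4)[.
    by apply: rat_in_itvoo; lra.
  rewrite in_itv/= => /andP[q1a q1b].
  have [q2] : exists q2 : rat, ratr q2 \in `](y - e / 4), (y + e / 4)[.
    by apply: rat_in_itvoo; lra.
  rewrite in_itv/= => /andP[q2a q2b].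
  have [q3] : exists q3 : rat, ratr q3 \in `](e / 4), (e / 2)[.
    by apply: rat_in_itvoo; lra.
  rewrite in_itv/= => /andP[q3a q3b].
  exists (q1, q2, q3) => //; case: asboolP => [_|[]].
    by split; rewrite /= in_itv/=; apply/andP; split; lra.
  move=> [s t] []; rewrite /= !in_itv/= => /andP[s1 s2] /andP[t1 t2].
  by apply: he; split; rewrite /ball/= ltr_norml; apply/andP; split; lra.
apply: countable_bigcupT_measurable; first exact: countableP.
move=> q; case: asboolP => // _.
exact: measurable_rect.
Qed.

Lemma continuous_measurable2 (f : R * R -> R) : continuous f ->
  measurable_fun (setT : set RR) f.
Proof.
move=> /continuousP cf; apply: (measurability _ (RGenOpens.measurableE R)).
move=> _ [_ [a [b ->] <-]]; rewrite setTI; apply: open_measurable2.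
exact/cf/interval_open.
Qed.

Lemma continuous_integrable_rect (f : R * R -> R) a b c d : continuous f ->
  mu2.-integrable (rect a b c d : set RR) (EFin \o f).
Proof.
move=> cf.
have cK : compact (`[a, b] `*` `[c, d] : set (R * R)).
  by apply: compact_setX; exact: segment_compact.
have /compact_bounded[M [_ hM]] : compact (f @` (`[a, b] `*` `[c, d])).
  by apply: continuous_compact => //; exact: continuous_subspaceT.
apply: (@measurable_bounded_integrable _ _ _ mu2 f (rect a b c d)).
- exact: measurable_rect.
- exact: rect_finite.
- by apply: measurable_funTS; exact: continuous_measurable2.
- exists M; split; first exact: num_real.
  move=> x Mx p [p1 p2]; apply: (hM _ Mx); exists p => //.
  by split; apply: subset_itv_oo_cc.
Qed.

Lemma sqint_continuous_rect (f : R * R -> R) a b c d : continuous f ->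
  sqint mu2 (rect a b c d) f.
Proof.
move=> cf; split.
  by apply: measurable_funTS; exact: continuous_measurable2.
apply: (@continuous_integrable_rect (fun p => f p ^+ 2)) => p.
by apply: cvgM; exact: cf.
Qed.

Lemma continuous_slice1 (f : R * R -> R) y : continuous f -> continuous (fun x => f (x, y)).
Proof.
move=> cf x; apply: (@continuous_comp _ _ _ (fun x => (x, y)) f); last exact: cf.
by apply: (@cvg_pair _ _ _ _ (nbhs x) (nbhs y)); [exact: cvg_id|exact: cvg_cst].
Qed.

Lemma continuous_slice2 (f : R * R -> R) x : continuous f -> continuous (fun y => f (x, y)).
Proof.
move=> cf y; apply: (@continuous_comp _ _ _ (fun y => (x, y)) f); last exact: cf.
by apply: (@cvg_pair _ _ _ _ (nbhs x) (nbhs y)); [exact: cvg_cst|exact: cvg_id].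
Qed.

Lemma Rintegral_EFin_ivl (f : R -> R) a b : continuous f ->
  (\int[leb]_(x in `]a, b[) (f x)%:E = (\int[leb]_(x in `]a, b[) f x)%:E)%E.
Proof.
move=> cf; rewrite /Rintegral fineK//; apply: integrable_fin_num => //.
exact: continuous_integrable_ivl.
Qed.

Lemma fubini_rect12 (f : R * R -> R) a b c d : continuous f ->
  \int[mu2]_(p in rect a b c d) f p =
  \int[leb]_(x in `]a, b[) (\int[leb]_(y in `]c, d[) f (x, y)) /\
  leb.-integrable `]a, b[ (fun x => (\int[leb]_(y in `]c, d[) f (x, y))%:E).
Proof.
move=> cf; have If := continuous_integrable_rect a b c d cf.
have mr := measurable_rect a b c d.
(* Fubini's theorem is applied on the whole plane, to the extension by 0. *)
pose g : RR -> \bar R := ((EFin \o f) \_ (rect a b c d)).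
have Ig : mu2.-integrable setT g by apply/(integrable_mkcond _ mr).
have gE x : fubini_F leb g x =
    ((fun x => (\int[leb]_(y in `]c, d[) f (x, y))%:E) \_ `]a, b[) x.
  rewrite /fubini_F /patch; case: ifPn => xI.
    rewrite -Rintegral_EFin_ivl; last exact: continuous_slice2.
    rewrite [RHS]integral_mkcond; apply: eq_integral => y _.
    rewrite /g /patch; congr (if _ then _ else _).
    by rewrite in_setX xI.
  rewrite (eq_integral (cst 0%E)) ?integral0// => y _.
  by rewrite /g /patch in_setX (negbTE xI).
have mI : measurable (`]a, b[%classic : set (measurableTypeR R)) by exact: measurable_itv.
split; last first.
  by apply/(integrable_mkcond _ mI); apply: eq_integrable (integrable_fubini_F Ig).
rewrite /Rintegral integral_mkcond -(integral12_prod_meas1 Ig) [in RHS]integral_mkcond.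
by congr fine; apply: eq_integral => x _; rewrite gE.
Qed.

Lemma fubini_rect21 (f : R * R -> R) a b c d : continuous f ->
  \int[mu2]_(p in rect a b c d) f p =
  \int[leb]_(y in `]c, d[) (\int[leb]_(x in `]a, b[) f (x, y)) /\
  leb.-integrable `]c, d[ (fun y => (\int[leb]_(x in `]a, b[) f (x, y))%:E).
Proof.
move=> cf; have If := continuous_integrable_rect a b c d cf.
have mr := measurable_rect a b c d.
pose g : RR -> \bar R := ((EFin \o f) \_ (rect a b c d)).
have Ig : mu2.-integrable setT g by apply/(integrable_mkcond _ mr).
have gE y : fubini_G leb g y =
    ((fun y => (\int[leb]_(x in `]a, b[) f (x, y))%:E) \_ `]c, d[) y.
  rewrite /fubini_G /patch; case: ifPn => yI.
    rewrite -Rintegral_EFin_ivl; last exact: continuous_slice1.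
    rewrite [RHS]integral_mkcond; apply: eq_integral => x _.
    rewrite /g /patch; congr (if _ then _ else _).
    by rewrite in_setX yI andbT.
  rewrite (eq_integral (cst 0%E)) ?integral0// => x _.
  by rewrite /g /patch in_setX (negbTE yI) andbF.
have mI : measurable (`]c, d[%classic : set (measurableTypeR R)) by exact: measurable_itv.
split; last first.
  (* The integrability of the outer integrand is that of the other order of integration, after
     exchanging the coordinates. *)
  have cs : continuous (fun p : R * R => f (p.2, p.1)).
    move=> p; apply: (@continuous_comp _ _ _ (fun p : R * R => (p.2, p.1)) f); last exact: cf.
    by apply: (@cvg_pair _ _ _ _ (nbhs p.2) (nbhs p.1)); [exact: cvg_snd|exact: cvg_fst].
  exact: (fubini_rect12 c d a b cs).2.
rewrite /Rintegral integral_mkcond -(integral21_prod_meas1 Ig) [in RHS]integral_mkcond.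
by congr fine; apply: eq_integral => x _; rewrite gE.
Qed.

End PlaneMeasure.

(** * Partial derivatives and Green's formula on rectangles *)

Section Partial.
Context {R : realType}.
Implicit Types (f g : R * R -> R) (x y : R).
Notation leb := (@lebesgue_measure R).

Lemma partial1E f x y :
  (fun h => h^-1 *: ((f \o shift (x, y)) (h *: e1) - f (x, y))) =
  (fun h => h^-1 *: (((fun t => f (t, y)) \o shift x) (h *: 1) - f (x, y))).
Proof.
apply/funext => h /=; congr (_ *: (f _ - _)).
by congr (_, _); rewrite /= ?scaler0 ?add0r.
Qed.

Lemma partial2E f x y :
  (fun h => h^-1 *: ((f \o shift (x, y)) (h *: e2) - f (x, y))) =
  (fun h => h^-1 *: (((fun t => f (x, t)) \o shift y) (h *: 1) - f (x, y))).
Proof.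
apply/funext => h /=; congr (_ *: (f _ - _)).
by congr (_, _); rewrite /= ?scaler0 ?add0r.
Qed.

Lemma derivable_e1 f x y : derivable f (x, y) e1 <-> derivable (fun t => f (t, y)) x 1.
Proof. by rewrite /derivable partial1E. Qed.

Lemma derivable_e2 f x y : derivable f (x, y) e2 <-> derivable (fun t => f (x, t)) y 1.
Proof. by rewrite /derivable partial2E. Qed.

Lemma derive_e1 f x y : 'D_e1 f (x, y) = (fun t => f (t, y))^`()%classic x.
Proof. by rewrite derive1E /derive partial1E. Qed.

Lemma derive_e2 f x y : 'D_e2 f (x, y) = (fun t => f (x, t))^`()%classic y.
Proof. by rewrite derive1E /derive partial2E. Qed.

Lemma is_derive_e1 f df x y : is_derive (x, y) e1 f df <-> is_derive x 1 (fun t => f (t, y)) df.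
Proof.
split=> -[h1 h2]; apply: DeriveDef.
- exact/derivable_e1.
- by rewrite -derive1E -derive_e1.
- exact/derivable_e1.
- by rewrite derive_e1 derive1E.
Qed.

Lemma is_derive_e2 f df x y : is_derive (x, y) e2 f df <-> is_derive y 1 (fun t => f (x, t)) df.
Proof.
split=> -[h1 h2]; apply: DeriveDef.
- exact/derivable_e2.
- by rewrite -derive1E -derive_e2.
- exact/derivable_e2.
- by rewrite derive_e2 derive1E.
Qed.

Definition partial1 f g := forall p, is_derive p e1 f (g p).
Definition partial2 f g := forall p, is_derive p e2 f (g p).

Lemma Ck_continuous n f : Ck n f -> continuous f.
Proof. by case: n => [|n] []. Qed.

Lemma CkS_derive n f : Ck n.+1 f -> Ck n ('D_e1 f) /\ Ck n ('D_e2 f).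
Proof. by case=> _ []. Qed.

Lemma CkS_partial n f : Ck n.+1 f -> partial1 f ('D_e1 f) /\ partial2 f ('D_e2 f).
Proof. by case=> _ [h _]; split=> p; apply: derivableP; have [] := h p. Qed.

Lemma Ck_intro n f f1 f2 : continuous f -> partial1 f f1 -> partial2 f f2 ->
  Ck n f1 -> Ck n f2 -> Ck n.+1 f.
Proof.
move=> cf d1 d2 h1 h2.
have E1 : 'D_e1 f = f1 by apply/funext => p; have h := d1 p; exact: derive_val.
have E2 : 'D_e2 f = f2 by apply/funext => p; have h := d2 p; exact: derive_val.
split; first exact: cf.
split; last by rewrite E1 E2; exact: (conj h1 h2).
by move=> p; have [? _] := d1 p; have [? _] := d2 p.
Qed.

Lemma partial1L (a : R) f g f1 g1 : partial1 f f1 -> partial1 g g1 ->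
  partial1 (a *: f + g) (a *: f1 + g1).
Proof. by move=> h1 h2 p; have := h1 p; have := h2 p => ? ?; exact: (is_deriveD (is_deriveZ _ _) _). Qed.

Lemma partial2L (a : R) f g f1 g1 : partial2 f f1 -> partial2 g g1 ->
  partial2 (a *: f + g) (a *: f1 + g1).
Proof. by move=> h1 h2 p; have := h1 p; have := h2 p => ? ?; exact: (is_deriveD (is_deriveZ _ _) _). Qed.

Lemma partial1M f g f1 g1 : partial1 f f1 -> partial1 g g1 ->
  partial1 (fun p => f p * g p) (fun p => f p * g1 p + g p * f1 p).
Proof. by move=> h1 h2 p; have := h1 p; have := h2 p => ? ?; exact: (is_deriveM (f := f) (g := g)). Qed.

Lemma partial2M f g f1 g1 : partial2 f f1 -> partial2 g g1 ->
  partial2 (fun p => f p * g p) (fun p => f p * g1 p + g p * f1 p).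
Proof. by move=> h1 h2 p; have := h1 p; have := h2 p => ? ?; exact: (is_deriveM (f := f) (g := g)). Qed.

Lemma continuousL (a : R) f g : continuous f -> continuous g -> continuous (a *: f + g).
Proof.
move=> cf cg p; apply: cvgD; last exact: cg.
by apply: cvgM; [exact: cvg_cst|exact: cf].
Qed.

Lemma CkL n (a : R) f g : Ck n f -> Ck n g -> Ck n (a *: f + g).
Proof.
elim: n f g => [|n IH] f g hf hg.
  by split=> //; exact: continuousL (Ck_continuous hf) (Ck_continuous hg).
have [hf1 hf2] := CkS_derive hf; have [hg1 hg2] := CkS_derive hg.
have [pf1 pf2] := CkS_partial hf; have [pg1 pg2] := CkS_partial hg.
exact: (Ck_intro (continuousL (a := a) (Ck_continuous hf) (Ck_continuous hg))
  (partial1L a pf1 pg1) (partial2L a pf2 pg2) (IH _ _ hf1 hg1) (IH _ _ hf2 hg2)).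
Qed.

Definition tens (a b : R -> R) : R * R -> R := fun p => a p.1 * b p.2.

Lemma is_derive_tens1 a b p (da : R -> R) : (forall x, is_derive x 1 a (da x)) ->
  is_derive p e1 (tens a b) (tens da b p).
Proof.
case: p => x y h; apply/is_derive_e1; rewrite /tens/=.
have -> : (fun t => a t * b y) = (fun t => b y * a t) by apply/funext => t; rewrite mulrC.
by rewrite mulrC; exact: (@is_deriveZ _ _ _ a (b y) x 1 (da x)).
Qed.

Lemma is_derive_tens2 a b p (db : R -> R) : (forall x, is_derive x 1 b (db x)) ->
  is_derive p e2 (tens a b) (tens a db p).
Proof.
case: p => x y h; apply/is_derive_e2; rewrite /tens/=.
exact: (@is_deriveZ _ _ _ b (a x) y 1 (db y)).
Qed.

Lemma continuous_tens a b : continuous a -> continuous b -> continuous (tens a b).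
Proof.
move=> ca cb p; apply: cvgM.
  by apply: (continuous_comp (f := fst)); [exact: cvg_fst|exact: ca].
by apply: (continuous_comp (f := snd)); [exact: cvg_snd|exact: cb].
Qed.

Lemma Ck_tens n a b : Ck1 n a -> Ck1 n b -> Ck n (tens a b).
Proof.
elim: n a b => [|n IH] a b ha hb; first by split=> //; exact: continuous_tens.
have [da hda hda'] := ha; have [db hdb hdb'] := hb.
have d1 : partial1 (tens a b) (tens da b) by move=> p; exact: is_derive_tens1.
have d2 : partial2 (tens a b) (tens a db) by move=> p; exact: is_derive_tens2.
have ct : continuous (tens a b).
  exact: continuous_tens (Ck1_continuous ha) (Ck1_continuous hb).
exact: (Ck_intro ct d1 d2 (IH _ _ hda' (Ck1S hb)) (IH _ _ (Ck1S ha) hdb')).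
Qed.

Lemma smooth_tens a b : smooth1 a -> smooth1 b -> smooth (tens a b).
Proof. by move=> ha hb n; exact: Ck_tens. Qed.

Lemma smoothL (a : R) f g : smooth f -> smooth g -> smooth (a *: f + g).
Proof. by move=> hf hg n; exact: CkL. Qed.

Lemma smooth0 : smooth (0 : R * R -> R).
Proof.
have -> : 0 = tens (fun=> 0) (fun=> 0) by apply/funext => p; rewrite /tens mulr0.
by apply: smooth_tens; exact: smooth1_cst.
Qed.

Lemma smooth_continuous f : smooth f -> continuous f.
Proof. by move/(_ 0%N)/Ck_continuous. Qed.

Lemma smooth_derive1 f : smooth f -> smooth ('D_e1 f).
Proof. by move=> sf n; exact: (CkS_derive (sf n.+1)).1. Qed.

Lemma smooth_derive2 f : smooth f -> smooth ('D_e2 f).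
Proof. by move=> sf n; exact: (CkS_derive (sf n.+1)).2. Qed.

Lemma smooth_partial1 f : smooth f -> partial1 f ('D_e1 f).
Proof. by move=> /(_ 1%N)/CkS_partial[]. Qed.

Lemma smooth_partial2 f : smooth f -> partial2 f ('D_e2 f).
Proof. by move=> /(_ 1%N)/CkS_partial[]. Qed.

Lemma smooth_is_derive1 f x y : smooth f -> is_derive x 1 (fun t => f (t, y)) ('D_e1 f (x, y)).
Proof. by move=> sf; apply/is_derive_e1; exact: smooth_partial1. Qed.

Lemma smooth_is_derive2 f x y : smooth f -> is_derive y 1 (fun t => f (x, t)) ('D_e2 f (x, y)).
Proof. by move=> sf; apply/is_derive_e2; exact: smooth_partial2. Qed.

Lemma continuousM2 f g : continuous f -> continuous g -> continuous (fun p => f p * g p).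
Proof. by move=> cf cg p; apply: cvgM; [exact: cf|exact: cg]. Qed.

Lemma smoothM f g : smooth f -> smooth g -> smooth (fun p => f p * g p).
Proof.
move=> sf sg n; elim: n f g sf sg => [|n IH] f g sf sg.
  by split=> //; exact: continuousM2 (smooth_continuous sf) (smooth_continuous sg).
have cM := continuousM2 (smooth_continuous sf) (smooth_continuous sg).
apply: (Ck_intro cM (partial1M (smooth_partial1 sf) (smooth_partial1 sg))
                    (partial2M (smooth_partial2 sf) (smooth_partial2 sg))).
- have -> : (fun p => f p * 'D_e1 g p + g p * 'D_e1 f p) =
    1 *: (fun p => f p * 'D_e1 g p) + (fun p => g p * 'D_e1 f p) by rewrite scale1r.
  exact: CkL (IH _ _ sf (smooth_derive1 sg)) (IH _ _ sg (smooth_derive1 sf)).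
- have -> : (fun p => f p * 'D_e2 g p + g p * 'D_e2 f p) =
    1 *: (fun p => f p * 'D_e2 g p) + (fun p => g p * 'D_e2 f p) by rewrite scale1r.
  exact: CkL (IH _ _ sf (smooth_derive2 sg)) (IH _ _ sg (smooth_derive2 sf)).
Qed.

Lemma partial1E_derive f g : partial1 f g -> 'D_e1 f = g.
Proof. by move=> h; apply/funext => p; have hp := h p; exact: derive_val. Qed.

Lemma partial2E_derive f g : partial2 f g -> 'D_e2 f = g.
Proof. by move=> h; apply/funext => p; have hp := h p; exact: derive_val. Qed.

Lemma green1 f a b c d : a <= b -> smooth f ->
  \int[mu2]_(p in rect a b c d) 'D_e1 f p =
  \int[leb]_(y in `]c, d[) (f (b, y) - f (a, y)).
Proof.
move=> ab sf; rewrite (fubini_rect21 _ _ _ _ (smooth_continuous (smooth_derive1 sf))).1.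
apply: eq_Rintegral => y _; apply: (@FTC_ivl _ (fun x => f (x, y))) => //.
  by move=> x; exact: smooth_is_derive1.
exact: (@continuous_slice1 R _ y (smooth_continuous (smooth_derive1 sf))).
Qed.

Lemma green2 f a b c d : c <= d -> smooth f ->
  \int[mu2]_(p in rect a b c d) 'D_e2 f p =
  \int[leb]_(x in `]a, b[) (f (x, d) - f (x, c)).
Proof.
move=> ab sf; rewrite (fubini_rect12 _ _ _ _ (smooth_continuous (smooth_derive2 sf))).1.
apply: eq_Rintegral => x _; apply: (@FTC_ivl _ (fun y => f (x, y))) => //.
  by move=> y; exact: smooth_is_derive2.
exact: (@continuous_slice2 R _ x (smooth_continuous (smooth_derive2 sf))).
Qed.

End Partial.

(** * Tensor products are dense *)

Section Density.
Context {R : realType} {E : lmodType R} (V S : E -> Prop) (B : E -> E -> R).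

(** The closure [W] of [S] is complete, so Riesz' theorem represents [B x] on it by some [v] in [W].
    Then [v - x] is orthogonal to [S], hence null, and [x] is as close to [S] as [v] is. *)
Lemma preip_dense : preip V B -> bn_complete V B ->
  S 0 -> (forall a u v, S u -> S v -> S (a *: u + v)) -> (forall u, S u -> V u) ->
  (forall v, V v -> (forall s, S s -> B v s = 0) -> bn B v = 0) ->
  forall x, V x -> exists2 s : nat -> E, forall n, S (s n) &
    bn B (s n - x) @[n --> \oo] --> (0 : R).
Proof.
move=> H cpl S0 SL SV orth x Vx.
pose W v := V v /\ forall e, 0 < e -> exists2 s, S s & bn B (s - v) < e.
have SW s : S s -> W s.
  move=> Ss; split; first exact: SV.
  by move=> e e0; exists s => //; rewrite subrr bn.unlock (preip_form0l H (preip0 H)) sqrtr0.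
have HW : preip W B.
  split.
  - exact: SW.
  - move=> a u v [Vu hu] [Vv hv]; split; first exact: (preipL H).
    move=> e e0; have a0 : 0 < `|a| + 1 by rewrite ltr_wpDl.
    have [|s Ss hs] := hu (e / 2 / (`|a| + 1)); first by rewrite !divr_gt0.
    have [|t St ht] := hv (e / 2); first by rewrite divr_gt0.
    exists (a *: s + t); first exact: SL.
    rewrite (_ : _ - _ = a *: (s - u) + (t - v)); last first.
      by rewrite scalerBr opprD addrACA.
    have Vsu := preipB H (SV _ Ss) Vu; have Vtv := preipB H (SV _ St) Vv.
    apply: le_lt_trans (bnD H (preipZ H a Vsu) Vtv) _.
    rewrite (bnZ H)// [ltRHS](splitr e); apply: ler_ltD => //.
    apply: (@le_trans _ _ ((`|a| + 1) * bn B (s - u))).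
      by rewrite ler_wpM2r ?bn_ge0// lerDl.
    by rewrite mulrC -ler_pdivlMr// ltW.
  - by move=> u v [Vu _] [Vv _]; exact: (preipC H).
  - by move=> a u v w [Vu _] [Vv _] [Vw _]; exact: (preipE H).
  - by move=> u [Vu _]; exact: (preip_ge0 H).
have cW : bn_complete W B.
  move=> u Wu cu; have [v Vv uv] := cpl u (fun n => (Wu n).1) cu.
  exists v => //; split=> // e e0.
  move/cvgrPdist_lt : uv => /(_ (e / 2)); rewrite divr_gt0// => /(_ isT)[N _ /(_ N (leqnn N))/=].
  rewrite sub0r normrN ger0_norm ?bn_ge0// => hN.
  have [|s Ss hs] := (Wu N).2 (e / 2); first by rewrite divr_gt0.
  exists s => //; apply: le_lt_trans (bnB_le H (SV _ Ss) (Wu N).1 Vv) _.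
  by rewrite [ltRHS](splitr e) ltrD.
have [v [Vv hv] vE] := @riesz _ _ W B HW (B x) (bn B x) cW
  (fun a u v hu hv => etrans (preip_formDr H (preipZ H a hu.1) hv.1 Vx)
     (congr1 (+%R^~ _) (preip_formZr H a hu.1 Vx)))
  (fun u hu => bn_CS H Vx hu.1).
have vx0 : bn B (v - x) = 0.
  apply: orth; first exact: (preipB H).
  move=> s Ss; rewrite (preip_formBl H Vv Vx (SV _ Ss)) vE ?subrr//; exact: SW.
have /choice[s hs] : forall n, exists s, S s /\ bn B (s - v) < n.+1%:R^-1.
  move=> n; have [|s Ss hs] := hv n.+1%:R^-1; first by rewrite invr_gt0.
  by exists s.
exists s; first by move=> n; exact: (hs n).1.
apply: (@cvg_dist_le _ _ (fun n => n.+1%:R^-1)); last exact: cvg_harmonic.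
move=> n; rewrite subr0 ger0_norm ?bn_ge0//; have [Ss /ltW] := hs n; apply: le_trans.
by have := bnB_le H (SV _ Ss) Vv Vx; rewrite vx0 addr0.
Qed.

End Density.

(** * The fundamental lemma of the calculus of variations, for tensor products *)

Section Fundamental.
Context {R : realType}.
Notation RR := (measurableTypeR R * measurableTypeR R)%type.
Notation MR := (measurableTypeR R).

Lemma test1W (a b c d : R) f : a <= c -> d <= b -> test1 c d f -> test1 a b f.
Proof.
move=> ac db [sf [c' [d' [h1 h2 h3 h4]]]]; split=> //; exists c', d'; split=> //.
  exact: le_lt_trans h1.
exact: lt_le_trans db.
Qed.

Lemma tens_bump_le1 (a b c d : R) n (p : R * R) :
  `|tens (bump a b n) (bump c d n) p| <= 1.
Proof.
rewrite /tens ger0_norm; last by apply: mulr_ge0; exact: bump_ge0.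
by apply: mulr_ile1; [exact: bump_ge0|exact: bump_ge0|exact: bump_le1|exact: bump_le1].
Qed.

Lemma itvI_oo (a b c d : R) :
  `]a, b[%classic `&` `]c, d[%classic = `]Num.max a c, Num.min b d[%classic :> set R.
Proof.
apply/seteqP; split => x /=; rewrite !in_itv/= gt_max lt_min.
  by move=> [/andP[-> ->] /andP[-> ->]].
by move=> /andP[/andP[-> ->] /andP[-> ->]].
Qed.

(** Dynkin's theorem with open intervals as pi-system. It suits the sets on which an integral
    vanishes: they are stable under complement and disjoint union, but not a priori under
    intersection. *)
Lemma borel_induction (P : set R -> Prop) : P setT -> (forall a b : R, P `]a, b[%classic) ->
  (forall A : set MR, measurable A -> P A -> P (~` A)) ->
  (forall F : (set MR)^nat, (forall n, measurable (F n)) -> trivIset setT F ->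
     (forall k, P (F k)) -> P (\bigcup_k F k)) ->
  forall A : set MR, measurable A -> P A.
Proof.
move=> PT Pi PC PU A mA.
rewrite RGenOpens.measurableE in mA.
apply: (@dynkin_induction _ MR (@RGenOpens.G R) P) => //.
- exact: RGenOpens.measurableE.
- move=> _ _ [a [b ->]] [c [d ->]]; exists (Num.max a c), (Num.min b d).
  exact: itvI_oo.
- by move=> _ [a [b ->]].
Qed.

Variables (a b c d : R) (w : R * R -> R).
Hypothesis iw : mu2.-integrable (rect a b c d : set RR) (EFin \o w).
Hypothesis hw : forall f g, test1 a b f -> test1 c d g ->
  \int[mu2]_(p in rect a b c d) (w p * tens f g p) = 0.

Let D : set RR := rect a b c d.
Let mD : measurable D. Proof. exact: measurable_rect. Qed.

Let null (A : set (R * R)) := (\int[mu2]_(p in (A : set RR) `&` D) (w p)%:E = 0)%E.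

(** Products of bumps tend to the indicator of the part of the rectangle in [D], and [w] dominates
    because bumps are at most 1. *)
Lemma null_rect (x1 x2 y1 y2 : R) : null (rect x1 x2 y1 y2).
Proof.
have mw : measurable_fun D w by apply/measurable_EFinP; exact: measurable_int iw.
pose a' := Num.max x1 a; pose b' := Num.min x2 b.
pose c' := Num.max y1 c; pose d' := Num.min y2 d.
have E : rect x1 x2 y1 y2 `&` D = rect a' b' c' d'.
  by rewrite /D /rect -!itvI_oo; apply/seteqP; split=> p; [move=> [[? ?] [? ?]]|move=> [[? ?] [? ?]]].
have sD : rect a' b' c' d' `<=` D by rewrite -E; exact: subIsetr.
rewrite /null E.
have [ab|ba] := ltP a' b'; last first.
  by rewrite /rect set_itv_ge ?bnd_simp -?leNgt// set0X integral_set0.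
have [cd|dc] := ltP c' d'; last first.
  by rewrite /rect [`]c', d'[%classic]set_itv_ge ?bnd_simp -?leNgt// setX0 integral_set0.
pose f n := bump a' b' n; pose g n := bump c' d' n.
have tf n : test1 a b (f n).
  by apply: test1W (test1_bump n ab); rewrite /a' /b' ?le_max ?ge_min lexx ?orbT.
have tg n : test1 c d (g n).
  by apply: test1W (test1_bump n cd); rewrite /c' /d' ?le_max ?ge_min lexx ?orbT.
have mfg n : measurable_fun D (tens (f n) (g n)).
  apply: measurable_funTS; apply: continuous_measurable2.
  by apply: continuous_tens; apply: smooth1_continuous; exact: smooth1_bump.
have := @dominated_cvg _ RR R mu2 D mD (fun n p => (w p * tens (f n) (g n) p)%:E)
  (fun p => (w p * \1_(rect a' b' c' d') p)%:E) (fun p => `|w p|%:E).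
have m n : measurable_fun D (fun p => (w p * tens (f n) (g n) p)%:E).
  by apply/measurable_EFinP; exact: measurable_funM.
move=> /(_ m) h.
have : (fun n => \int[mu2]_(p in D) (w p * tens (f n) (g n) p)%:E)%E @ \oo -->
    (\int[mu2]_(p in D) (w p * \1_(rect a' b' c' d') p)%:E)%E.
  apply: h.
  - move=> [x y] _; apply/cvg_EFin; first exact: nearW.
    apply: cvgM; first exact: cvg_cst.
    rewrite /tens/=.
    have -> : \1_(rect a' b' c' d') (x, y) = \1_(`]a', b'[) x * \1_(`]c', d'[) y :> R.
      by rewrite !indicE in_setX; case: (x \in _); rewrite /= ?mul1r ?mul0r.
    by apply: cvgM; exact: bump_cvg.
  - by move=> p _; rewrite fin_numE.
  - by have := integrable_abse iw.
  - move=> n p _; rewrite lee_fin normrM ler_piMr//.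
    exact: tens_bump_le1.
have E0 n : (\int[mu2]_(p in D) (w p * tens (f n) (g n) p)%:E = 0)%E.
  rewrite -[LHS]fineK; first by congr EFin; exact: hw.
  apply: integrable_fin_num => //; apply: (le_integrable mD _ _ iw) => //.
  move=> p _; rewrite lee_fin normrM ler_piMr//.
  exact: tens_bump_le1.
under eq_fun do rewrite E0.
move=> cv; have h0 : (0 = \int[mu2]_(p in D) (w p * \1_(rect a' b' c' d') p)%:E)%E.
  by apply: (cvg_unique (@ereal_hausdorff R) _ cv); exact: cvg_cst.
rewrite -[rect _ _ _ _](setIidr sD) integral_mkcondr [RHS]h0.
apply: eq_integral => p _; rewrite patchE indicE.
by case: ifPn => _; rewrite ?mulr1 ?mulr0.
Qed.

Lemma nullD (A B : set RR) : measurable A -> measurable B -> A `<=` B ->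
  null B -> null A -> null (B `\` A).
Proof.
move=> mA mB AB; rewrite /null => nB nA.
have mw : measurable_fun D w by apply/measurable_EFinP; exact: measurable_int iw.
have mAD : measurable (A `&` D) by exact: measurableI.
have mCD : measurable ((B `\` A) `&` D) by apply: measurableI => //; exact: measurableD.
have := @integral_setU_EFin _ RR R mu2 (A `&` D) ((B `\` A) `&` D) w mAD mCD.
rewrite -setIUl setDUK// nB nA add0e => <-//.
- by apply: measurable_funS mw => //; exact: subIsetr.
- by apply/disj_setPS => p [[Ap _] [[_ nAp] _]].
Qed.

Lemma nullU (F : (set RR)^nat) : (forall n, measurable (F n)) -> trivIset setT F ->
  (forall k, null (F k)) -> null (\bigcup_k F k).
Proof.
move=> mF tF nF; rewrite /null setI_bigcupl integral_bigcup//.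
- by rewrite eseries0// => k _ _; exact: nF.
- exact: trivIset_setIr.
- by move=> k; exact: measurableI.
- apply: integrableS iw => //; last by apply: bigcup_sub => k _; exact: subIsetr.
  by apply: bigcup_measurable => k _; exact: measurableI.
Qed.

(** Vanishing integrals pass from rectangles to all measurable sets by three Dynkin arguments: in
    the first factor, in the second factor, then from measurable boxes to the product
    sigma-algebra. *)
Lemma fundamental_lemma : ae_eq mu2 D w (cst 0).
Proof.
have RT : rect a b c d `&` D = setT `&` D by rewrite /D setIid setTI.
have nT : null setT by have := null_rect a b c d; rewrite /null RT.
have mX (A B : set MR) : measurable A -> measurable B -> @measurable _ RR (A `*` B).
  by move=> mA mB; exact: measurableX.
have n1 (y1 y2 : R) : forall A : set MR, measurable A -> null (A `*` `]y1, y2[).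
  have mI : @measurable _ MR `]y1, y2[ by exact: measurable_itv.
  apply: (@borel_induction (fun A => null (A `*` `]y1, y2[))).
  - have := null_rect a b y1 y2; rewrite /null; congr (integral _ _ _ = _).
    by apply/seteqP; split=> p; [move=> [[? ?] ?]|move=> [[_ ?] [? ?]]].
  - by move=> x1 x2; exact: null_rect.
  - move=> A mA nA.
    have -> : ~` A `*` `]y1, y2[ = (setT `*` `]y1, y2[) `\` (A `*` `]y1, y2[).
      by apply/seteqP; split=> p; [move=> [? ?]; split=> // -[]|move=> [[_ ?] h]; split=> // ?; exact: h].
    apply: nullD => //; try by apply: mX.
      by move=> p [_ ?].
    have := null_rect a b y1 y2; rewrite /null; congr (integral _ _ _ = _).
    by apply/seteqP; split=> p; [move=> [[? ?] ?]|move=> [[_ ?] [? ?]]].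
  - move=> F mF tF nF; rewrite (_ : _ `*` _ = \bigcup_k (F k `*` `]y1, y2[)); last first.
      by apply/seteqP; split=> p; [move=> [[k _ ?] ?]; exists k|move=> [k _ [? ?]]; split=> //; exists k].
    apply: (nullU (fun n => mX _ _ (mF n) mI) _ nF).
    apply/trivIsetP => i j _ _ ij; have /trivIsetP/(_ i j I I ij) := tF.
    move=> FF; apply/seteqP; split=> // p [[p1 _] [p2 _]].
    by have : (F i `&` F j) p.1 by []; rewrite FF.
have n2 (A : set MR) : measurable A -> forall B : set MR, measurable B -> null (A `*` B).
  move=> mA; apply: (@borel_induction (fun B => null (A `*` B))).
  - have := n1 c d A mA; rewrite /null; congr (integral _ _ _ = _).
    by apply/seteqP; split=> p; [move=> [[? ?] ?]|move=> [[? _] [? ?]]].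
  - by move=> x1 x2; exact: n1.
  - move=> B mB nB.
    have -> : A `*` ~` B = (A `*` setT) `\` (A `*` B).
      by apply/seteqP; split=> p; [move=> [? ?]; split=> // -[]|move=> [[? _] h]; split=> // ?; exact: h].
    apply: nullD => //; try by apply: mX.
      by move=> p [? _].
    have := n1 c d A mA; rewrite /null; congr (integral _ _ _ = _).
    by apply/seteqP; split=> p; [move=> [[? ?] ?]|move=> [[? _] [? ?]]].
  - move=> F mF tF nF; rewrite (_ : _ `*` _ = \bigcup_k (A `*` F k)); last first.
      by apply/seteqP; split=> p; [move=> [? [k _ ?]]; exists k|move=> [k _ [? ?]]; split=> //; exists k].
    apply: (nullU (fun n => mX _ _ mA (mF n)) _ nF).
    apply/trivIsetP => i j _ _ ij; have /trivIsetP/(_ i j I I ij) := tF.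
    move=> FF; apply/seteqP; split=> // p [[_ p1] [_ p2]].
    by have : (F i `&` F j) p.2 by []; rewrite FF.
have nA (A : set RR) : measurable A -> null A.
  move=> mA; rewrite measurable_prod_measurableType in mA.
  apply: (@dynkin_induction _ RR _ null _ _ _ _ _ _ A mA) => //.
  - exact: measurable_prod_measurableType.
  - move=> _ _ [A1 mA1 [B1 mB1 <-]] [A2 mA2 [B2 mB2 <-]].
    exists (A1 `&` A2); first exact: measurableI.
    exists (B1 `&` B2); first exact: measurableI.
    by apply/seteqP; split=> p; [move=> [[? ?] [? ?]]|move=> [[? ?] [? ?]]].
  - by move=> _ [A1 mA1 [B1 mB1 <-]]; exact: n2.
  - by move=> S mS nS; rewrite -setTD; apply: nullD.
  - by move=> F mF tF nF; exact: nullU.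
have h0 : ae_eq mu2 D (EFin \o w) (cst 0%E).
  apply: integral_ae_eq => //.
  move=> E ED mE; rewrite integral0; have := nA E mE; rewrite /null.
  by rewrite (setIidl ED).
by apply: filterS h0 => p /= h Dp; have [] := h Dp.
Qed.

End Fundamental.

(** Finite sums of tensor products with factors in given classes. The inductive form lets
    one-dimensional operations on the factors, such as primitives and averages, extend by
    induction. *)
Inductive tsum {R : realType} (P Q : (R -> R) -> Prop) : (R * R -> R) -> Prop :=
| tsum0 : tsum P Q 0
| tsumD a b f : P a -> Q b -> tsum P Q f -> tsum P Q (tens a b + f).

Section TensorSums.
Context {R : realType}.
Notation RR := (measurableTypeR R * measurableTypeR R)%type.
Implicit Types P Q : (R -> R) -> Prop.

Lemma tsumW P Q P' Q' f : (forall a, P a -> P' a) -> (forall a, Q a -> Q' a) ->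
  tsum P Q f -> tsum P' Q' f.
Proof.
move=> PP QQ; elim=> [|a b g Pa Qb _ h]; first exact: tsum0.
by apply: tsumD h; [exact: PP|exact: QQ].
Qed.

Lemma tsumL P Q (k : R) f g : (forall k a, P a -> P (fun x => k * a x)) ->
  tsum P Q f -> tsum P Q g -> tsum P Q (k *: f + g).
Proof.
move=> PZ; elim=> [|a b h Pa Qb _ IH] hg; first by rewrite scaler0 add0r.
have -> : k *: (tens a b + h) + g = tens (fun x => k * a x) b + (k *: h + g).
  rewrite scalerDr -addrA; congr (_ + _); apply/funext => p.
  by change (k * (a p.1 * b p.2) = (k * a p.1) * b p.2); rewrite mulrA.
by apply: tsumD (IH hg) => //; exact: PZ.
Qed.

Lemma smooth_tsum (f : R * R -> R) : tsum smooth1 smooth1 f -> smooth f.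
Proof.
elim=> [|a b g sa sb _ sg]; first exact: smooth0.
rewrite -[tens a b]scale1r; apply: smoothL => //; exact: smooth_tens.
Qed.

Variables a b c d : R.
Notation D := (rect a b c d).

Lemma test_tsum_smooth f : tsum (test1 a b) (test1 c d) f -> smooth f.
Proof. by move=> h; apply: smooth_tsum; apply: tsumW h => g [sg _]. Qed.

Lemma rect_preip : preip (sqint mu2 (D : set RR)) (ip mu2 (D : set RR)).
Proof. by apply: ip_preip; exact: measurable_rect. Qed.

Lemma rect_complete : bn_complete (sqint mu2 (D : set RR)) (ip mu2 (D : set RR)).
Proof. by apply: sqint_complete; [exact: measurable_rect|exact: rect_finite]. Qed.

Lemma sqint_smooth f : smooth f -> sqint mu2 (D : set RR) f.
Proof. by move/smooth_continuous; exact: sqint_continuous_rect. Qed.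

Lemma sqint_orthogonal v : sqint mu2 (D : set RR) v ->
  (forall f g, test1 a b f -> test1 c d g -> ip mu2 (D : set RR) v (tens f g) = 0) ->
  ae_eq mu2 (D : set RR) v (cst 0).
Proof.
move=> hv h0; apply: fundamental_lemma => //.
by apply: sqint_integrable => //; [exact: measurable_rect|exact: rect_finite].
Qed.

Lemma tsum_dense v : sqint mu2 (D : set RR) v ->
  exists2 s : nat -> R * R -> R, forall n, tsum (test1 a b) (test1 c d) (s n) &
    nrm mu2 (D : set RR) (s n - v) @[n --> \oo] --> (0 : R).
Proof.
have PI := rect_preip.
apply: (preip_dense PI rect_complete).
- exact: tsum0.
- by move=> k f g; apply: tsumL => k' f'; exact: test1Z.
- by move=> f /test_tsum_smooth; exact: sqint_smooth.
- move=> w hw orth.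
  have w0 : ae_eq mu2 (D : set RR) w (cst 0).
    apply: sqint_orthogonal => // f g tf tg; apply: orth.
    by rewrite -[tens f g]addr0; apply: tsumD => //; exact: tsum0.
  have := nrm_ae (measurable_rect a b c d) hw.1 (preip0 PI).1 w0; rewrite /nrm => ->.
  by rewrite bn.unlock (preip_form0l PI (preip0 PI)) sqrtr0.
Qed.

End TensorSums.

(** * Weak derivatives *)

Notation RR R := (measurableTypeR R * measurableTypeR R)%type.

Lemma Rintegral_subset {R : realType} d (T : measurableType d) (mu : {measure set T -> \bar R})
    (A B : set T) (f : T -> R) : A `<=` B -> (forall x, B x -> ~ A x -> f x = 0) ->
  \int[mu]_(x in B) f x = \int[mu]_(x in A) f x.
Proof.
move=> AB f0; rewrite Rintegral_mkcond [RHS]Rintegral_mkcond; congr (Rintegral _ _ _).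
apply/funext => x; rewrite /patch; case: ifPn => [/set_mem Bx|nBx].
  by case: ifPn => // /negP nA; apply: f0 => // Ax; apply: nA; exact/mem_set.
by rewrite ifN//; apply: contra nBx => /set_mem/AB/mem_set.
Qed.

Lemma Rintegral_eq0 {R : realType} d (T : measurableType d) (mu : {measure set T -> \bar R})
    (A : set T) (f : T -> R) : (forall x, A x -> f x = 0) -> \int[mu]_(x in A) f x = 0.
Proof. by move=> f0; rewrite /Rintegral integral0_eq// => x Ax; rewrite f0. Qed.

Lemma ae_mono {R : realType} d (T : measurableType d) (mu : {measure set T -> \bar R})
    (D : set T) (P Q : T -> Prop) : (forall p, D p -> P p -> Q p) ->
  {ae mu, forall p, D p -> P p} -> {ae mu, forall p, D p -> Q p}.
Proof. by move=> PQ; apply: filterS => p h Dp; apply: PQ => //; exact: h. Qed.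

Lemma ae_mono2 {R : realType} d (T : measurableType d) (mu : {measure set T -> \bar R})
    (D : set T) (P Q S : T -> Prop) : (forall p, D p -> P p -> Q p -> S p) ->
  {ae mu, forall p, D p -> P p} -> {ae mu, forall p, D p -> Q p} ->
  {ae mu, forall p, D p -> S p}.
Proof. by move=> PQ; apply: filterS2 => p h h' Dp; exact: PQ (h Dp) (h' Dp). Qed.

Lemma preip_add {R : realType} (E : lmodType R) (V V' : E -> Prop)
    (B B' : E -> E -> R) : (forall v, V v -> V' v) ->
  preip V B -> preip V' B' -> preip V (fun u v => B u v + B' u v).
Proof.
move=> VV h h'; split; [exact: (preip0 h)|exact: (preipL h)| | |].
- by move=> u v hu hv; congr (_ + _); [exact: (preipC h)|apply: (preipC h'); exact: VV].
- move=> k u v w hu hv hw; rewrite (preipE h)// (preipE h'); [|exact: VV|exact: VV|exact: VV].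
  by rewrite mulrDr addrACA.
- by move=> u hu; rewrite addr_ge0 ?(preip_ge0 h)// (preip_ge0 h'); last exact: VV.
Qed.

HB.lock Definition iq {R : realType} (D : set (R * R)) (u v : R * R -> R) : R :=
  \int[mu2]_(p in D) (u p * v p).

(** Axes are indexed by booleans so that one proof covers both directions; negation is the passage
    to the other axis. *)
HB.lock Definition ax {R : realType} (b : bool) : R * R := if b then e1 else e2.

HB.lock Definition wd {R : realType} (b : bool) (D : set (R * R)) (u : R * R -> R) :
  R * R -> R := wderiv D (ax b) u.

HB.lock Definition cd {R : realType} (b : bool) (u : R * R -> R) : R * R -> R :=
  'D_(ax b) u.

Section WeakDerivative.
Context {R : realType}.
Implicit Types (D : set (R * R)) (u v w phi psi : R * R -> R) (d : bool).

Definition nm D u : R := bn (iq D) u.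

Definition aeq D u v : Prop := ae_on D (fun p => u p = v p).

Definition isrect D : Prop :=
  exists a b c d : R, [/\ a <= b, c <= d & D = rect a b c d].

Lemma ax1 : ax true = e1 :> R * R. Proof. by rewrite ax.unlock. Qed.
Lemma ax2 : ax false = e2 :> R * R. Proof. by rewrite ax.unlock. Qed.
Lemma wd1 D u : wd true D u = wderiv D e1 u. Proof. by rewrite wd.unlock ax1. Qed.
Lemma wd2 D u : wd false D u = wderiv D e2 u. Proof. by rewrite wd.unlock ax2. Qed.
Lemma cd1 u : cd true u = 'D_e1 u. Proof. by rewrite cd.unlock ax1. Qed.
Lemma cd2 u : cd false u = 'D_e2 u. Proof. by rewrite cd.unlock ax2. Qed.

Definition is_wd d D u w : Prop := L2 D w /\
  forall phi, test_fun D phi -> iq D u (cd d phi) = - iq D w phi.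

Lemma is_wdE d D u w : is_wderiv D (ax d) u w <-> is_wd d D u w.
Proof. by rewrite /is_wd iq.unlock cd.unlock. Qed.

Lemma smooth_cd d u : smooth u -> smooth (cd d u).
Proof. by case: d => su; rewrite ?cd1 ?cd2; [exact: smooth_derive1|exact: smooth_derive2]. Qed.

Lemma isrect_measurable D : isrect D -> @measurable _ (RR R) D.
Proof. by move=> [a [b [c [d [_ _ ->]]]]]; exact: measurable_rect. Qed.

Lemma isrect_finite D : isrect D -> (mu2 D < +oo)%E.
Proof. by move=> [a [b [c [d [_ _ ->]]]]]; exact: rect_finite. Qed.

Lemma L2_preip D : isrect D -> preip (L2 D) (iq D).
Proof.
move=> /isrect_measurable mD; have H := ip_preip mu2 mD; rewrite iq.unlock.
split; [exact: (preip0 H)|exact: (preipL H)|exact: (preipC H)|exact: (preipE H)|].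
exact: (preip_ge0 H).
Qed.

Lemma L2_complete D : isrect D -> bn_complete (L2 D) (iq D).
Proof.
move=> rD; rewrite iq.unlock; exact: (@sqint_complete _ (RR R) R mu2 D (isrect_measurable rD) (isrect_finite rD)).
Qed.

Lemma L2_integrableM D u v : isrect D -> L2 D u -> L2 D v ->
  mu2.-integrable (D : set (RR R)) (EFin \o (fun p => u p * v p)).
Proof. by move=> /isrect_measurable mD hu hv; exact: (@sqint_integrableM _ (RR R) R mu2 D mD u v hu hv). Qed.

Lemma L2_ae D u v : isrect D -> measurable_on D v -> aeq D u v -> L2 D u -> L2 D v.
Proof. by move=> /isrect_measurable mD mv uv; exact: (sqint_ae mD mv uv). Qed.

Lemma iq_ae D u v w : isrect D -> measurable_on D u -> measurable_on D v ->
  measurable_on D w -> aeq D u v -> iq D u w = iq D v w.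
Proof. by move=> /isrect_measurable mD mu mv mw uv; rewrite iq.unlock; exact: (@ip_ae _ (RR R) R mu2 D mD u v w mu mv mw uv). Qed.

Lemma nm_ae D u v : isrect D -> measurable_on D u -> measurable_on D v ->
  aeq D u v -> nm D u = nm D v.
Proof. by move=> /isrect_measurable mD mu mv uv; rewrite /nm iq.unlock; exact: (nrm_ae mD mu mv uv). Qed.

Lemma nm_eq0 D u : isrect D -> L2 D u -> nm D u = 0 -> aeq D u (cst 0).
Proof. by move=> /isrect_measurable mD Lu; rewrite /nm iq.unlock => u0; exact: (nrm_eq0 mD Lu u0). Qed.

Lemma aeq_refl D u : aeq D u u. Proof. exact: nearW. Qed.

Lemma ae_onS D (P Q : R * R -> Prop) : (forall p, D p -> P p -> Q p) ->
  ae_on D P -> ae_on D Q.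
Proof. exact: (@ae_mono _ _ (RR R) mu2). Qed.

Lemma ae_onS2 D (P Q S : R * R -> Prop) : (forall p, D p -> P p -> Q p -> S p) ->
  ae_on D P -> ae_on D Q -> ae_on D S.
Proof. exact: (@ae_mono2 _ _ (RR R) mu2). Qed.

Lemma aeq_sym D u v : aeq D u v -> aeq D v u.
Proof. exact: ae_onS. Qed.

Lemma aeqB D u u' v v' : aeq D u u' -> aeq D v v' -> aeq D (u - v) (u' - v').
Proof.
apply: ae_onS2 => p _ h h'.
by change (u p - v p = u' p - v' p); rewrite h h'.
Qed.

Definition h1form D u v : R :=
  iq D u v + iq D (wd true D u) (wd true D v) + iq D (wd false D u) (wd false D v).

Lemma H1normE D u : H1norm D u = bn (h1form D) u.
Proof. by rewrite /H1norm bn.unlock /h1form iq.unlock wd1 wd2. Qed.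

Lemma sum_iq D u u' v v' : isrect D -> L2 D u -> L2 D u' -> L2 D v -> L2 D v' ->
  \int[mu2]_(p in D) (u p * u' p + v p * v' p) = iq D u u' + iq D v v'.
Proof.
move=> rD hu hu' hv hv'; rewrite iq.unlock RintegralD//; first exact: isrect_measurable.
  exact: L2_integrableM.
exact: L2_integrableM.
Qed.

Lemma iq_subset D D' u v : D' `<=` D -> (forall p, D p -> ~ D' p -> u p * v p = 0) ->
  iq D u v = iq D' u v.
Proof. by move=> DD h; rewrite iq.unlock; apply: (@Rintegral_subset _ _ (RR R) mu2 D' D _ DD). Qed.

Lemma cdM d phi psi : smooth phi -> smooth psi ->
  cd d (fun p => phi p * psi p) = (fun p => phi p * cd d psi p + cd d phi p * psi p).
Proof.
move=> sp ss; case: d; rewrite ?cd1 ?cd2.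
  rewrite (partial1E_derive (partial1M (smooth_partial1 sp) (smooth_partial1 ss))).
  by apply/funext => p; congr (_ + _); rewrite mulrC.
rewrite (partial2E_derive (partial2M (smooth_partial2 sp) (smooth_partial2 ss))).
by apply/funext => p; congr (_ + _); rewrite mulrC.
Qed.

Lemma cdL d (k : R) phi psi : smooth phi -> smooth psi ->
  cd d (k *: phi + psi) = k *: cd d phi + cd d psi.
Proof.
move=> sp ss; case: d; rewrite ?cd1 ?cd2.
  exact: (partial1E_derive (partial1L k (smooth_partial1 sp) (smooth_partial1 ss))).
exact: (partial2E_derive (partial2L k (smooth_partial2 sp) (smooth_partial2 ss))).
Qed.

Lemma iq_cdM a b c e d phi psi : a <= b -> c <= e -> smooth phi -> smooth psi ->
  iq (rect a b c e) phi (cd d psi) + iq (rect a b c e) (cd d phi) psi =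
  \int[mu2]_(p in rect a b c e) cd d (fun p => phi p * psi p) p.
Proof.
move=> ab ce sp spsi.
have rD : isrect (rect a b c e) by exists a, b, c, e.
have L2s f : smooth f -> L2 (rect a b c e) f.
  by move=> sf; apply: sqint_continuous_rect; exact: smooth_continuous.
rewrite cdM// (sum_iq rD)//; apply: L2s => //; exact: smooth_cd.
Qed.

Lemma test_fun_smooth D phi : test_fun D phi -> smooth phi.
Proof. by case. Qed.

(** The complement of a compact set is open, so [phi] vanishes in a neighbourhood of [p]. *)
Lemma compact_out (K : set (R * R)) phi : compact K -> (forall p, ~ K p -> phi p = 0) ->
  forall d p, ~ K p -> cd d phi p = 0.
Proof.
move=> cK phi0 d p nKp; rewrite cd.unlock -(derive_cst 0 p (ax d)); apply: near_eq_derive.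
have : nbhs p (~` K).
  apply: open_nbhs_nbhs; split => //; apply: closed_openC.
  by apply: compact_closed cK; apply: norm_hausdorff.
by apply: filterS => q nKq; rewrite phi0.
Qed.

Lemma test_fun_out D phi : test_fun D phi -> forall p, ~ D p -> phi p = 0.
Proof. by move=> [_ [K [_ KD phi0]]] p nDp; apply: phi0 => /KD. Qed.

Lemma test_fun_derive_out D phi d : test_fun D phi -> forall p, ~ D p -> cd d phi p = 0.
Proof. by move=> [_ [K [cK KD phi0]]] p nDp; apply: (compact_out cK) => // /KD. Qed.

Lemma test_funS D D' phi : D' `<=` D -> test_fun D' phi -> test_fun D phi.
Proof.
by move=> DD [sp [K [cK KD phi0]]]; split=> //; exists K; split=> //; exact: subset_trans DD.
Qed.

Lemma test_fun_tens (a b c d : R) f g : test1 a b f -> test1 c d g ->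
  test_fun (rect a b c d) (tens f g).
Proof.
move=> [sf [a1 [b1 [h1 _ h3 f0]]]] [sg [c1 [d1 [h5 _ h7 g0]]]].
split; first exact: smooth_tens.
exists (`[a1, b1] `*` `[c1, d1]); split.
- by apply: compact_setX; exact: segment_compact.
- move=> p [] /=; rewrite !in_itv/= => /andP[x1 x2] /andP[y1 y2]; split=> /=; rewrite in_itv/=.
    by rewrite (lt_le_trans h1)//= (le_lt_trans x2).
  by rewrite (lt_le_trans h5)//= (le_lt_trans y2).
- move=> p np; rewrite /tens; have [x|/f0 ->] := pselect (a1 <= p.1 <= b1); last by rewrite mul0r.
  have [y|/g0 ->] := pselect (c1 <= p.2 <= d1); last by rewrite mulr0.
  by exfalso; apply: np; split; rewrite /= in_itv.
Qed.

Lemma L2_continuous D u : isrect D -> continuous u -> L2 D u.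
Proof. by move=> [a [b [c [d [_ _ ->]]]]]; exact: sqint_continuous_rect. Qed.

Lemma L2_smooth D u : isrect D -> smooth u -> L2 D u.
Proof. by move=> rD /smooth_continuous; exact: L2_continuous. Qed.

Lemma L2_test D u : isrect D -> test_fun D u -> L2 D u.
Proof. by move=> rD /test_fun_smooth; exact: L2_smooth. Qed.

Lemma L2_test_derive D u d : isrect D -> test_fun D u -> L2 D (cd d u).
Proof. by move=> rD /test_fun_smooth /(@smooth_cd d); exact: L2_smooth. Qed.

Lemma L2S D D' u : isrect D -> isrect D' -> D' `<=` D -> L2 D u -> L2 D' u.
Proof.
move=> /isrect_measurable mD /isrect_measurable mD' DD [mu iu]; split.
  exact: measurable_funS mu.
exact: integrableS iu.
Qed.

Lemma L2_orthogonal D v : isrect D -> L2 D v ->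
  (forall phi, test_fun D phi -> iq D v phi = 0) -> aeq D v (cst 0).
Proof.
move=> [a [b [c [d [_ _ ->]]]]] Lv h.
apply: sqint_orthogonal => // f g tf tg; have := h _ (test_fun_tens tf tg).
by rewrite iq.unlock.
Qed.

Lemma is_wd_unique D d u w w' : isrect D ->
  is_wd d D u w -> is_wd d D u w' -> aeq D w w'.
Proof.
move=> rD [Lw hw] [Lw' hw']; have PI := L2_preip rD.
have : aeq D (w - w') (cst 0).
  apply: L2_orthogonal => //; first exact: (preipB PI).
  move=> phi tp; have Lp := L2_test rD tp.
  rewrite (preip_formBl PI)//; apply/eqP; rewrite subr_eq0; apply/eqP.
  by apply: oppr_inj; rewrite -(hw phi tp) -(hw' phi tp).
by apply: ae_onS => p _ h; apply/eqP; rewrite -subr_eq0; apply/eqP.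
Qed.

Lemma is_wdL D d (k : R) u v w w' : isrect D -> L2 D u -> L2 D v ->
  is_wd d D u w -> is_wd d D v w' -> is_wd d D (k *: u + v) (k *: w + w').
Proof.
move=> rD Lu Lv [Lw hw] [Lw' hw']; have PI := L2_preip rD.
split; first exact: (preipL PI).
move=> phi tp; have Lp := L2_test rD tp; have Ldp := L2_test_derive d rD tp.
by rewrite !(preipE PI)// (hw phi tp) (hw' phi tp) opprD mulrN.
Qed.

Lemma is_wd_ae D d u v w w' : isrect D ->
  measurable_on D u -> measurable_on D v -> measurable_on D w' ->
  aeq D u v -> aeq D w w' -> is_wd d D u w -> is_wd d D v w'.
Proof.
move=> rD mu mv mw' uv ww [Lw hw].
split; first exact: L2_ae ww Lw.
move=> phi tp; have Lp := L2_test rD tp; have Ldp := L2_test_derive d rD tp.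
by rewrite -(iq_ae rD mu mv Ldp.1 uv) -(iq_ae rD Lw.1 mw' Lp.1 ww) hw.
Qed.

Lemma wdP D d u : (exists w, is_wd d D u w) -> is_wd d D u (wd d D u).
Proof.
move=> [w /is_wdE hw]; apply/is_wdE; rewrite wd.unlock.
exact: (@getPex _ [set w | is_wderiv D (ax d) u w]) (ex_intro _ w hw).
Qed.

Lemma aeq_wd D d u w : isrect D -> is_wd d D u w -> aeq D (wd d D u) w.
Proof. by move=> rD hw; apply: (is_wd_unique rD _ hw); apply: wdP; exists w. Qed.

(** Functions equal almost everywhere have the same set of weak derivatives, so the choice made by
    [get] is literally the same: hence an equality, and not only one almost everywhere. *)
Lemma wd_ae D d u v : isrect D -> measurable_on D u -> measurable_on D v ->
  aeq D u v -> wd d D u = wd d D v.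
Proof.
move=> rD mu mv uv; rewrite wd.unlock /wderiv; congr (get _); apply/funext => w; apply/propext.
have rfl := @aeq_refl D w; split=> /is_wdE h; apply/is_wdE; have := h.1.1 => mw.
  exact: (is_wd_ae rD mu mv mw uv rfl h).
exact: (is_wd_ae rD mv mu mw (aeq_sym uv) rfl h).
Qed.

(** Green's formula for the product [phi * psi]: a test function vanishes outside the open
    rectangle, in particular on its sides. *)
Lemma is_wd_smooth D d phi : isrect D -> smooth phi -> is_wd d D phi (cd d phi).
Proof.
move=> rD sp; split; first by apply: L2_smooth => //; exact: smooth_cd.
move=> psi tpsi; have spsi := test_fun_smooth tpsi.
apply/eqP; rewrite -addr_eq0; apply/eqP.
have spp := smoothM sp spsi.
have out := test_fun_out tpsi.
case: rD => a [b [c [e [ab ce DE]]]]; rewrite DE in out *.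
rewrite iq_cdM//; case: d.
  rewrite cd1 (green1 _ _ ab spp); apply: Rintegral_eq0 => y _.
  by rewrite !out ?mulr0 ?subr0//; move=> [] /=; rewrite in_itv/= ltxx ?andbF.
rewrite cd2 (green2 _ _ ce spp); apply: Rintegral_eq0 => y _.
by rewrite !out ?mulr0 ?subr0//; move=> [] /= _; rewrite in_itv/= ltxx ?andbF.
Qed.

Lemma is_wd_cvg D d (u w : nat -> R * R -> R) ul wl : isrect D ->
  (forall n, L2 D (u n)) -> L2 D ul -> L2 D wl ->
  (forall n, is_wd d D (u n) (w n)) ->
  nm D (u n - ul) @[n --> \oo] --> (0 : R) -> nm D (w n - wl) @[n --> \oo] --> (0 : R) ->
  is_wd d D ul wl.
Proof.
move=> rD Lu Lul Lwl uw uul wwl; split=> // phi tp.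
have PI := L2_preip rD; have Lp := L2_test rD tp; have Ldp := L2_test_derive d rD tp.
have c1 := cvg_form PI Lu Lul Ldp uul.
have c2 := cvgN (cvg_form PI (fun n => (uw n).1) Lwl Lp wwl).
apply: (cvg_unique _ c1) => //.
have E : (fun n => iq D (u n) (cd d phi)) = - (fun n => iq D (w n) phi).
  by apply/funext => n; have [_ ->] := uw n.
by rewrite E; exact: c2.
Qed.

Lemma is_wdS D D' d u w : isrect D -> isrect D' -> D' `<=` D ->
  is_wd d D u w -> is_wd d D' u w.
Proof.
move=> rD rD' DD [Lw hw]; split.
  exact: L2S rD rD' DD Lw.
move=> phi tp; have := hw phi (test_funS DD tp).
rewrite (iq_subset DD); last by move=> p _ /(test_fun_derive_out d tp) ->; rewrite mulr0.
by rewrite (iq_subset DD); last by move=> p _ /(test_fun_out tp) ->; rewrite mulr0.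
Qed.

Lemma H1P D u : H1 D u <-> L2 D u /\ forall d, exists w, is_wd d D u w.
Proof.
split=> [[Lu [w1 h1] [w2 h2]]|[Lu h]].
  split=> // -[]; [exists w1|exists w2]; apply/is_wdE; by rewrite ?ax1 ?ax2.
have [w1 /is_wdE h1] := h true; have [w2 /is_wdE h2] := h false.
by rewrite ax1 in h1; rewrite ax2 in h2; split=> //; [exists w1|exists w2].
Qed.

Lemma H1_wd d D u : H1 D u -> is_wd d D u (wd d D u).
Proof. by move=> /H1P[_ h]; apply: wdP. Qed.

Lemma H1_L2 D u : H1 D u -> L2 D u. Proof. by case. Qed.

Lemma H1_L2_wd d D u : H1 D u -> L2 D (wd d D u).
Proof. by move=> /(H1_wd d)[]. Qed.

Lemma H1_intro D u (w : bool -> R * R -> R) : L2 D u -> (forall d, is_wd d D u (w d)) -> H1 D u.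
Proof. by move=> Lu h; apply/H1P; split=> // d; exists (w d). Qed.

Lemma H1L D (k : R) u v : isrect D -> H1 D u -> H1 D v -> H1 D (k *: u + v).
Proof.
move=> rD hu hv; have Lu := H1_L2 hu; have Lv := H1_L2 hv.
apply: (@H1_intro _ _ (fun d => k *: wd d D u + wd d D v)).
  exact: (preipL (L2_preip rD)).
by move=> d; apply: is_wdL => //; exact: H1_wd.
Qed.

Lemma wdL D d (k : R) u v : isrect D -> H1 D u -> H1 D v ->
  aeq D (wd d D (k *: u + v)) (k *: wd d D u + wd d D v).
Proof.
move=> rD hu hv; apply: aeq_wd => //.
by apply: is_wdL => //; [exact: H1_L2|exact: H1_L2|exact: H1_wd|exact: H1_wd].
Qed.

Lemma H1_smooth D phi : isrect D -> smooth phi -> H1 D phi.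
Proof.
move=> rD sp; apply: (@H1_intro _ _ (fun d => cd d phi)); first exact: L2_smooth.
by move=> d; exact: is_wd_smooth.
Qed.

Lemma wd_smooth D d phi : isrect D -> smooth phi -> aeq D (wd d D phi) (cd d phi).
Proof. by move=> rD sp; apply: aeq_wd => //; exact: is_wd_smooth. Qed.

Lemma H1_ae D u v : isrect D -> measurable_on D v -> aeq D u v -> H1 D u -> H1 D v.
Proof.
move=> rD mv uv hu; have Lu := H1_L2 hu; have Lv := L2_ae rD mv uv Lu.
apply: (@H1_intro _ _ (fun d => wd d D u)) => // d.
have h := H1_wd d hu.
exact: (is_wd_ae rD Lu.1 Lv.1 h.1.1 uv (@aeq_refl _ _) h).
Qed.

Lemma H1_measurable D u : H1 D u -> measurable_on D u.
Proof. by move=> /H1_L2[]. Qed.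

Lemma H1_measurable_wd d D u : H1 D u -> measurable_on D (wd d D u).
Proof. by move=> /(H1_L2_wd d)[]. Qed.

Lemma iq_wd_preip D d : isrect D ->
  preip (H1 D) (fun u v => iq D (wd d D u) (wd d D v)).
Proof.
move=> rD; have PI := L2_preip rD.
split.
- by apply: H1_smooth => //; exact: smooth0.
- by move=> k u v hu hv; exact: H1L.
- move=> u v /(H1_L2_wd d) hu /(H1_L2_wd d) hv; exact: (preipC PI hu hv).
- move=> k u v w hu hv hw.
  have Lu := H1_L2_wd d hu; have Lv := H1_L2_wd d hv; have Lw := H1_L2_wd d hw.
  rewrite (iq_ae rD (H1_measurable_wd d (H1L k rD hu hv)) (preipL PI k Lu Lv).1 Lw.1 (wdL d k rD hu hv)).
  by rewrite (preipE PI).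
- by move=> u /(H1_L2_wd d) hu; exact: (preip_ge0 PI hu).
Qed.

Lemma H1_iq_preip D : isrect D -> preip (H1 D) (iq D).
Proof.
move=> rD; have PI := L2_preip rD.
split; [by apply: H1_smooth => //; exact: smooth0|by move=> k u v; exact: H1L| | |].
- by move=> u v /H1_L2 hu /H1_L2 hv; exact: (preipC PI hu hv).
- by move=> k u v w /H1_L2 hu /H1_L2 hv /H1_L2 hw; exact: (preipE PI k hu hv hw).
- by move=> u /H1_L2 hu; exact: (preip_ge0 PI hu).
Qed.

Lemma h1form_preip D : isrect D -> preip (H1 D) (h1form D).
Proof.
move=> rD; have idf u : H1 D u -> H1 D u by [].
exact: (preip_add idf (preip_add idf (H1_iq_preip rD) (iq_wd_preip true rD)) (iq_wd_preip false rD)).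
Qed.

Lemma dirichlet_formE D u v : isrect D -> H1 D u -> H1 D v ->
  dirichlet_form D u v = iq D (wd true D u) (wd true D v) + iq D (wd false D u) (wd false D v).
Proof.
move=> rD hu hv; rewrite -sum_iq//; try exact: H1_L2_wd.
by rewrite !wd1 !wd2.
Qed.

Lemma dirichlet_preip D : isrect D -> preip (H1 D) (dirichlet_form D).
Proof.
move=> rD; have idf u : H1 D u -> H1 D u by [].
have h := preip_add idf (iq_wd_preip true rD) (iq_wd_preip false rD).
split; [exact: (preip0 h)|exact: (preipL h)| | |].
- move=> u v hu hv; rewrite (dirichlet_formE rD hu hv) (dirichlet_formE rD hv hu).
  exact: (preipC h hu hv).
- move=> k u v w hu hv hw; rewrite (dirichlet_formE rD hu hw) (dirichlet_formE rD hv hw).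
  rewrite (dirichlet_formE rD (H1L k rD hu hv) hw).
  exact: (preipE h k hu hv hw).
- by move=> u hu; rewrite (dirichlet_formE rD hu hu); exact: (preip_ge0 h hu).
Qed.

Lemma wdB D d u v : isrect D -> H1 D u -> H1 D v ->
  aeq D (wd d D (u - v)) (wd d D u - wd d D v).
Proof.
move=> rD hu hv.
have -> : u - v = (-1) *: v + u by rewrite scaleN1r addrC.
have -> : wd d D u - wd d D v = (-1) *: wd d D v + wd d D u by rewrite scaleN1r addrC.
exact: wdL.
Qed.

Lemma H1B D u v : isrect D -> H1 D u -> H1 D v -> H1 D (u - v).
Proof. by move=> rD hu hv; exact: (preipB (h1form_preip rD) hu hv). Qed.

Lemma nm_wdB D d u v : isrect D -> H1 D u -> H1 D v ->
  nm D (wd d D (u - v)) = nm D (wd d D u - wd d D v).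
Proof.
move=> rD hu hv; have PI := L2_preip rD; apply: nm_ae => //; last exact: wdB.
  by apply: H1_measurable_wd; exact: H1B.
exact: (preipB PI (H1_L2_wd d hu) (H1_L2_wd d hv)).1.
Qed.

Lemma bn_le {E E' : lmodType R} (B : E -> E -> R) (B' : E' -> E' -> R) (u : E) (u' : E') :
  B u u <= B' u' u' -> bn B u <= bn B' u'.
Proof. by move=> h; rewrite !bn.unlock; exact: ler_wsqrtr. Qed.

Lemma nm_le_H1norm D u : isrect D -> H1 D u ->
  nm D u <= H1norm D u /\ forall d, nm D (wd d D u) <= H1norm D u.
Proof.
move=> rD hu; have PI := L2_preip rD.
have h0 := preip_ge0 PI (H1_L2 hu); have h d := preip_ge0 PI (H1_L2_wd d hu).
have h1 := h true; have h2 := h false.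
rewrite H1normE; split.
  by apply: bn_le; rewrite /h1form -addrA lerDl addr_ge0.
have E d : nm D (wd d D u) = bn (fun u v => iq D (wd d D u) (wd d D v)) u.
  by rewrite /nm bn.unlock.
case; rewrite E; apply: bn_le; rewrite /h1form.
  by rewrite [X in _ <= X + _]addrC -addrA lerDl addr_ge0.
by rewrite lerDr addr_ge0.
Qed.

Lemma H1norm_le_nm D u : isrect D -> H1 D u ->
  H1norm D u <= nm D u + nm D (wd true D u) + nm D (wd false D u).
Proof.
move=> rD hu; have PI := L2_preip rD.
have p0 : 0 <= nm D u by exact: bn_ge0.
have p1 : 0 <= nm D (wd true D u) by exact: bn_ge0.
have p2 : 0 <= nm D (wd false D u) by exact: bn_ge0.
have e0 : nm D u ^+ 2 = iq D u u := sqr_bn PI (H1_L2 hu).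
have e1 : nm D (wd true D u) ^+ 2 = iq D (wd true D u) (wd true D u) := sqr_bn PI (H1_L2_wd true hu).
have e2 : nm D (wd false D u) ^+ 2 = iq D (wd false D u) (wd false D u) := sqr_bn PI (H1_L2_wd false hu).
rewrite H1normE -(ler_pXn2r (n:=2))// ?nnegrE ?addr_ge0 ?bn_ge0//.
rewrite (sqr_bn (h1form_preip rD) hu) /h1form -e0 -e1 -e2.
move: p0 p1 p2; clear; move: (nm D u) (nm D (wd true D u)) (nm D (wd false D u)) => x y z x0 y0 z0.
have := mulr_ge0 x0 y0; have := mulr_ge0 x0 z0; have := mulr_ge0 y0 z0.
rewrite !expr2 => h1 h2 h3.
by rewrite !mulrDl !mulrDr; lra.
Qed.

Lemma cvg_nm0 D (u : nat -> R * R -> R) : isrect D -> (forall n, H1 D (u n)) ->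
  H1norm D (u n) @[n --> \oo] --> (0 : R) ->
  nm D (u n) @[n --> \oo] --> (0 : R) /\
  forall d, nm D (wd d D (u n)) @[n --> \oo] --> (0 : R).
Proof.
move=> rD hu u0; have h n := nm_le_H1norm rD (hu n).
split=> [|d]; apply: cvg_dist_le u0 => n; rewrite subr0 ger0_norm ?bn_ge0//.
  exact: (h n).1.
exact: (h n).2.
Qed.

Lemma cvgD0 (f g : nat -> R) : f n @[n --> \oo] --> (0 : R) -> g n @[n --> \oo] --> (0 : R) ->
  f n + g n @[n --> \oo] --> (0 : R).
Proof. by move=> hf hg; rewrite -(addr0 0); exact: cvgD. Qed.

Lemma cvg_H1norm D (u : nat -> R * R -> R) : isrect D -> (forall n, H1 D (u n)) ->
  nm D (u n) @[n --> \oo] --> (0 : R) ->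
  (forall d, nm D (wd d D (u n)) @[n --> \oo] --> (0 : R)) ->
  H1norm D (u n) @[n --> \oo] --> (0 : R).
Proof.
move=> rD hu h0 h.
have b n := H1norm_le_nm rD (hu n).
have g n : 0 <= H1norm D (u n) by rewrite H1normE bn_ge0.
apply: cvg_dist_le (cvgD0 (cvgD0 h0 (h true)) (h false)) => n.
by rewrite subr0 ger0_norm.
Qed.

Lemma H1_of_cvg D (u : nat -> R * R -> R) ul (w : bool -> R * R -> R) : isrect D ->
  (forall n, H1 D (u n)) -> L2 D ul -> (forall d, L2 D (w d)) ->
  nm D (u n - ul) @[n --> \oo] --> (0 : R) ->
  (forall d, nm D (wd d D (u n) - w d) @[n --> \oo] --> (0 : R)) ->
  [/\ H1 D ul, forall d, is_wd d D ul (w d)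
    & H1norm D (u n - ul) @[n --> \oo] --> (0 : R)].
Proof.
move=> rD hu Lul Lw c0 c.
have PI := L2_preip rD; have Lu n := H1_L2 (hu n).
have dw d := is_wd_cvg rD Lu Lul (Lw d) (fun n => H1_wd d (hu n)) c0 (c d).
have hul := H1_intro Lul dw.
split=> //; apply: cvg_H1norm => //; first by move=> n; exact: H1B.
move=> d; suff E : (fun n => nm D (wd d D (u n - ul))) = (fun n => nm D (wd d D (u n) - w d)).
  by rewrite E; exact: c.
apply/funext => n; rewrite (nm_wdB d rD (hu n) hul); have Lun := H1_L2_wd d (hu n).
apply: nm_ae => //.
- exact: (preipB PI Lun (H1_L2_wd d hul)).1.
- exact: (preipB PI Lun (Lw d)).1.
- by apply: aeqB; [exact: aeq_refl|exact: aeq_wd].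
Qed.

Lemma bn_cauchy_le {E E' : lmodType R} (B : E -> E -> R) (B' : E' -> E' -> R)
    (u : nat -> E) (v : nat -> E') :
  (forall m n, bn B' (v m - v n) <= bn B (u m - u n)) -> bn_cauchy B u -> bn_cauchy B' v.
Proof.
move=> h cu e /cu[N hN]; exists N => m n mN nN.
exact: le_lt_trans (h m n) (hN m n mN nN).
Qed.

Lemma H1_complete D : isrect D -> bn_complete (H1 D) (h1form D).
Proof.
move=> rD u hu cu; have cL := L2_complete rD.
have hB m n := H1B rD (hu m) (hu n).
have hle m n := nm_le_H1norm rD (hB m n).
have c0 : bn_cauchy (iq D) u.
  by apply: bn_cauchy_le cu => m n; rewrite -H1normE; exact: (hle m n).1.
have c d : bn_cauchy (iq D) (fun n => wd d D (u n)).
  apply: bn_cauchy_le cu => m n; rewrite -H1normE -/(nm D _) -(nm_wdB d rD (hu m) (hu n)).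
  exact: (hle m n).2.
have [ul Lul l0] := cL _ (fun n => H1_L2 (hu n)) c0.
have /choice[w hw] d : exists w, L2 D w /\ bn (iq D) (wd d D (u n) - w) @[n --> \oo] --> (0 : R).
  by have [w Lw l] := cL _ (fun n => H1_L2_wd d (hu n)) (c d); exists w.
have [hul _ cul] := H1_of_cvg rD hu Lul (fun d => (hw d).1) l0 (fun d => (hw d).2).
by exists ul => //; rewrite -[bn _]/(bn (h1form D)); under eq_fun do rewrite -H1normE.
Qed.

Lemma H1S D D' u : isrect D -> isrect D' -> D' `<=` D -> H1 D u -> H1 D' u.
Proof.
move=> rD rD' DD hu; apply: (@H1_intro _ _ (fun d => wd d D u)).
  exact: L2S rD rD' DD (H1_L2 hu).
by move=> d; exact: is_wdS rD rD' DD (H1_wd d hu).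
Qed.

Lemma wdS D D' d u : isrect D -> isrect D' -> D' `<=` D -> H1 D u ->
  aeq D' (wd d D' u) (wd d D u).
Proof.
by move=> rD rD' DD hu; apply: aeq_wd => //; exact: is_wdS rD rD' DD (H1_wd d hu).
Qed.

End WeakDerivative.

(** * Slices of rectangles *)

HB.lock Definition jq {R : realType} (A : set R) (f g : R -> R) : R :=
  \int[@lebesgue_measure R]_(t in A) (f t * g t).

(** [s] is the coordinate along the axis [d]: for fixed [s] the point runs along a line normal to
    [d], for fixed [t] along a line parallel to it. *)
HB.lock Definition line {R : realType} (d : bool) (s t : R) : R * R :=
  if d then (s, t) else (t, s).

Section LineInequalities.
Context {R : realType}.
Notation leb := (@lebesgue_measure R).
Implicit Types (f g : R -> R) (a b c e s t : R).

Definition L2l (A : set R) f : Prop := sqint leb A f.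

Lemma jqE A f g : jq A f g = \int[leb]_(t in A) (f t * g t).
Proof. by rewrite jq.unlock. Qed.

Lemma jq_preip (A : set R) : measurable (A : set (measurableTypeR R)) -> preip (L2l A) (jq A).
Proof. by move=> mA; have := ip_preip leb mA; rewrite jq.unlock. Qed.

Lemma L2l_complete (A : set R) : measurable (A : set (measurableTypeR R)) -> (leb A < +oo)%E ->
  bn_complete (L2l A) (jq A).
Proof. by move=> mA fA; rewrite jq.unlock; exact: (@sqint_complete _ (measurableTypeR R) R leb A mA fA). Qed.

Lemma L2l_continuous a b f : continuous f -> L2l `]a, b[ f.
Proof.
move=> cf; split; first by apply: measurable_funTS; exact: continuous_measurable_fun.
apply: (@continuous_integrable_ivl _ (fun x => f x ^+ 2)) => x.
by apply: cvgM; exact: cf.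
Qed.

Lemma form_CS2 {E : lmodType R} (V : E -> Prop) (B : E -> E -> R) u v :
  preip V B -> V u -> V v -> B u v ^+ 2 <= B u u * B v v.
Proof.
move=> PI Vu Vv; have := bn_CS PI Vu Vv.
rewrite -(ler_pXn2r (n:=2)) ?nnegrE ?mulr_ge0 ?bn_ge0//.
by rewrite exprMn !(sqr_bn PI)// real_normK ?num_real.
Qed.

Lemma jq_ge0 A f : 0 <= jq A f f.
Proof. by rewrite jq.unlock; apply: Rintegral_ge0 => t _; rewrite -expr2 sqr_ge0. Qed.

Lemma Rintegral_ivl_cst a b k : a <= b -> \int[leb]_(t in `]a, b[) k = k * (b - a).
Proof.
move=> ab; have dk (x : R) : is_derive x 1 (fun x => k * x) k.
  have := @is_deriveZ _ _ _ (fun x : R => x) k x 1 1 (is_derive_id _ _).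
  by rewrite /GRing.scale/= mulr1.
by rewrite (FTC_ivl ab dk (@cst_continuous _ _ k)) mulrBr.
Qed.

Lemma Rintegral_lin2 dd (T : measurableType dd) (mu : {measure set T -> \bar R}) (A : set T)
    (F G : T -> R) (k k' : R) : measurable A -> mu.-integrable A (EFin \o F) ->
  mu.-integrable A (EFin \o G) ->
  k * (\int[mu]_(x in A) F x) + k' * (\int[mu]_(x in A) G x) = \int[mu]_(x in A) (k * F x + k' * G x)
  /\ mu.-integrable A (EFin \o (fun x => k * F x + k' * G x)).
Proof.
move=> mA iF iG; have iF' := integrableZl mA k iF; have iG' := integrableZl mA k' iG.
split; last by have := integrableD mA iF' iG'.
by rewrite RintegralD// !RintegralZl.
Qed.

Lemma jq_cst a b k : a <= b -> jq `]a, b[ (cst k) (cst k) = k ^+ 2 * (b - a).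
Proof.
by move=> ab; rewrite jq.unlock (@Rintegral_ivl_cst a b (k * k))// -expr2.
Qed.

Lemma le_jq a b f g : continuous f -> continuous g -> (forall t, a < t < b -> f t ^+ 2 <= g t ^+ 2) ->
  jq `]a, b[ f f <= jq `]a, b[ g g.
Proof.
move=> cf cg fg; rewrite jq.unlock; apply: le_Rintegral => //.
- by apply: continuous_integrable_ivl => t; apply: cvgM; exact: cf.
- by apply: continuous_integrable_ivl => t; apply: cvgM; exact: cg.
Qed.

Lemma jq_sub a b s t f : a <= s -> t <= b -> continuous f ->
  jq `]s, t[ f f <= jq `]a, b[ f f.
Proof.
move=> as_ tb cf; rewrite jq.unlock /Rintegral.
have cff : continuous (fun x => f x * f x) by move=> x; apply: cvgM; exact: cf.
have sub : (`]s, t[ : set R) `<=` `]a, b[.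
  by move=> x /=; rewrite !in_itv/= => /andP[? ?]; rewrite (le_lt_trans as_)// (lt_le_trans _ tb).
have fin c e : (\int[leb]_(x in `]c, e[) (f x * f x)%:E)%E \is a fin_num.
  by apply: integrable_fin_num => //; exact: (continuous_integrable_ivl c e cff).
apply: fine_le => //.
apply: ge0_subset_integral => //.
- apply/measurable_EFinP; apply: measurable_funTS; exact: continuous_measurable_fun.
- by move=> x _; rewrite lee_fin -expr2 sqr_ge0.
Qed.

(** Cauchy-Schwarz for the integral of the derivative: on an interval of length at most 2, the
    squared increment is at most twice the integral of [g ^+ 2]. *)
Lemma oscillation a b f g s t : b - a <= 2 -> (forall x : R, is_derive x 1 f (g x)) ->
  continuous g -> a <= s <= b -> a <= t <= b ->
  f s ^+ 2 <= 2 * f t ^+ 2 + 4 * jq `]a, b[ g g.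
Proof.
move=> ab2 fg cg sab tab.
suff H s' t' : a <= s' -> s' <= t' -> t' <= b -> (f t' - f s') ^+ 2 <= 2 * jq `]a, b[ g g.
  have h : (f s - f t) ^+ 2 <= 2 * jq `]a, b[ g g.
    move: sab tab => /andP[? ?] /andP[? ?]; have [st|/ltW ts] := leP s t; last exact: H.
    by rewrite -sqrrN opprB; exact: H.
  (* This square is [2 * f t ^+ 2 + 2 * (f s - f t) ^+ 2 - f s ^+ 2]. *)
  have := sqr_ge0 (f s - 2 * f t); move: h; rewrite !expr2; clear.
  by move: (f s) (f t) (jq _ _ _) => x y j; nra.
move=> h1 h2 h3; rewrite -(FTC_ivl h2 fg cg).
have PI := jq_preip (measurable_itv `]s', t'[).
have := form_CS2 PI (L2l_continuous s' t' (@cst_continuous _ _ (1 : R))) (L2l_continuous s' t' cg).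
rewrite jq_cst// expr1n mul1r.
have -> : jq `]s', t'[ (cst 1) g = \int[leb]_(x in `]s', t'[) g x.
  by rewrite jq.unlock; apply: eq_Rintegral => x _; rewrite mul1r.
move=> h; apply: (le_trans h); have := jq_sub h1 h3 cg; have := jq_ge0 `]s', t'[ g.
have : t' - s' <= 2 by clear -h1 h3 ab2; lra.
move: h2; clear; move: (jq _ _ _) (jq _ _ _) => x y; nra.
Qed.

Lemma Rintegral_le_cst a b f (k : R) : a <= b -> continuous f -> (forall t, a < t < b -> f t <= k) ->
  \int[leb]_(t in `]a, b[) f t <= k * (b - a).
Proof.
move=> ab cf fk; have <- : \int[leb]_(t in `]a, b[) (cst k t) = k * (b - a).
  exact: Rintegral_ivl_cst.
apply: le_Rintegral => //; first exact: continuous_integrable_ivl.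
  by apply: continuous_integrable_ivl; exact: cst_continuous.
Qed.

Lemma Rintegral_ge_cst a b f (k : R) : a <= b -> continuous f -> (forall t, a < t < b -> k <= f t) ->
  k * (b - a) <= \int[leb]_(t in `]a, b[) f t.
Proof.
move=> ab cf fk; have <- : \int[leb]_(t in `]a, b[) (cst k t) = k * (b - a).
  exact: Rintegral_ivl_cst.
apply: le_Rintegral => //.
  by apply: continuous_integrable_ivl; exact: cst_continuous.
  exact: continuous_integrable_ivl.
Qed.

(** [oscillation] integrated over [t]; the length, at least 1, can then be divided out. *)
Lemma trace_line a b f g s : 1 <= b - a <= 2 -> (forall x : R, is_derive x 1 f (g x)) ->
  continuous g -> a <= s <= b -> f s ^+ 2 <= 2 * jq `]a, b[ f f + 4 * jq `]a, b[ g g.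
Proof.
move=> /andP[ab1 ab2] fg cg sab.
have ab : a <= b by clear -ab1; lra.
have cf := is_derive_continuous fg.
have : (f s ^+ 2 - 4 * jq `]a, b[ g g) / 2 * (b - a) <= jq `]a, b[ f f.
  rewrite (jqE _ f f); apply: Rintegral_ge_cst => //.
    by move=> x; apply: cvgM; exact: cf.
  move=> t /andP[at_ tb]; rewrite -expr2.
  have tab : a <= t <= b by rewrite !ltW.
  by have := oscillation ab2 fg cg sab tab; clear; move: (jq _ _ _) (f s ^+ 2) (f t ^+ 2) => x y z; lra.
have := jq_ge0 `]a, b[ g; have := jq_ge0 `]a, b[ f; move: ab1; clear.
by move: (jq _ f f) (jq _ g g) (f s ^+ 2) => x y z; nra.
Qed.

Lemma poincare_line a b f g s : a <= b -> b - a <= 2 -> (forall x : R, is_derive x 1 f (g x)) ->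
  continuous g -> a <= s <= b -> jq `]a, b[ f f <= 4 * f s ^+ 2 + 8 * jq `]a, b[ g g.
Proof.
move=> ab ab2 fg cg sab; have cf := is_derive_continuous fg.
have : jq `]a, b[ f f <= (2 * f s ^+ 2 + 4 * jq `]a, b[ g g) * (b - a).
  rewrite (jqE _ f f); apply: Rintegral_le_cst => //.
    by move=> x; apply: cvgM; exact: cf.
  move=> t /andP[at_ tb]; rewrite -expr2.
  have tab : a <= t <= b by rewrite !ltW.
  exact: (oscillation ab2 fg cg tab sab).
have := jq_ge0 `]a, b[ g; have := sqr_ge0 (f s); move: ab ab2; clear.
by move: (jq _ f f) (jq _ g g) (f s ^+ 2) => x y z; nra.
Qed.

End LineInequalities.

(** * Trace and Poincare inequalities on rectangles *)

Section AxisRect.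
Context {R : realType}.
Notation leb := (@lebesgue_measure R).
Implicit Types (d : bool) (a b c e s t : R) (f g : R * R -> R).

(** The interval from [a] to [b] is the extent along the axis [d], the other one the extent across
    it. *)
Definition rectd d a b c e : set (R * R) := if d then rect a b c e else rect c e a b.

Lemma rectd_isrect d a b c e : a <= b -> c <= e -> isrect (rectd d a b c e).
Proof. by case: d => ab ce; [exists a, b, c, e|exists c, e, a, b]. Qed.

Lemma fubini_d d a b c e f : continuous f ->
  \int[mu2]_(p in rectd d a b c e) f p =
  \int[leb]_(t in `]c, e[) (\int[leb]_(s in `]a, b[) f (line d s t)) /\
  leb.-integrable `]c, e[ (fun t => (\int[leb]_(s in `]a, b[) f (line d s t))%:E).
Proof.
by case: d => cf; rewrite line.unlock/=; [exact: fubini_rect21|exact: fubini_rect12].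
Qed.

Lemma continuous_line d t f : continuous f -> continuous (fun s => f (line d s t)).
Proof.
by case: d => cf; rewrite line.unlock; [exact: continuous_slice1|exact: continuous_slice2].
Qed.

Lemma continuous_line2 d s f : continuous f -> continuous (fun t => f (line d s t)).
Proof.
by case: d => cf; rewrite line.unlock; [exact: continuous_slice2|exact: continuous_slice1].
Qed.

Lemma is_derive_line d s t f : smooth f ->
  is_derive s 1 (fun s => f (line d s t)) (cd d f (line d s t)).
Proof.
by case: d => sf; rewrite line.unlock/= ?cd1 ?cd2;
  [exact: smooth_is_derive1|exact: smooth_is_derive2].
Qed.

Lemma green_d d a b c e f : a <= b -> smooth f ->
  \int[mu2]_(p in rectd d a b c e) cd d f p =
  \int[leb]_(t in `]c, e[) (f (line d b t) - f (line d a t)).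
Proof.
by case: d => ab sf; rewrite line.unlock ?cd1 ?cd2 /=; [exact: green1|exact: green2].
Qed.

Lemma iq_fubini d a b c e f : continuous f ->
  iq (rectd d a b c e) f f =
  \int[leb]_(t in `]c, e[) jq `]a, b[ (fun s => f (line d s t)) (fun s => f (line d s t)) /\
  leb.-integrable `]c, e[ (fun t => (jq `]a, b[ (fun s => f (line d s t)) (fun s => f (line d s t)))%:E).
Proof.
move=> cf; rewrite iq.unlock jq.unlock; apply: (@fubini_d d a b c e (fun p => f p * f p)).
by move=> p; apply: cvgM; exact: cf.
Qed.

Lemma trace_rect d a b c e f s : 1 <= b - a <= 2 -> smooth f -> a <= s <= b ->
  jq `]c, e[ (fun t => f (line d s t)) (fun t => f (line d s t)) <=
  2 * iq (rectd d a b c e) f f + 4 * iq (rectd d a b c e) (cd d f) (cd d f).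
Proof.
move=> ab sf sab.
have cf := smooth_continuous sf; have cdf := smooth_continuous (smooth_cd d sf).
have [-> I1] := iq_fubini d a b c e cf; have [-> I2] := iq_fubini d a b c e cdf.
have mI : measurable (`]c, e[%classic : set (measurableTypeR R)) := measurable_itv _.
have [-> I3] := Rintegral_lin2 2 4 mI I1 I2.
rewrite (jqE _ (fun t => f (line d s t))); apply: le_Rintegral => //.
- apply: continuous_integrable_ivl => t.
  by apply: cvgM; exact: (@continuous_line2 d s _ cf).
move=> t _; rewrite -expr2.
have := @trace_line _ a b (fun s => f (line d s t)) (fun s => cd d f (line d s t)) s ab
  (fun x => @is_derive_line d x t _ sf) (@continuous_line d t _ cdf) sab.
done.
Qed.

Lemma poincare_rect d a b c e f s : a <= b -> b - a <= 2 -> smooth f -> a <= s <= b ->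
  iq (rectd d a b c e) f f <=
  4 * jq `]c, e[ (fun t => f (line d s t)) (fun t => f (line d s t))
  + 8 * iq (rectd d a b c e) (cd d f) (cd d f).
Proof.
move=> ab ab2 sf sab.
have cf := smooth_continuous sf; have cdf := smooth_continuous (smooth_cd d sf).
have [-> I1] := iq_fubini d a b c e cf; have [-> I2] := iq_fubini d a b c e cdf.
have cl := @continuous_line2 d s _ cf.
have I3 : leb.-integrable `]c, e[ (EFin \o (fun t => f (line d s t) * f (line d s t))).
  by apply: continuous_integrable_ivl => t; apply: cvgM; exact: cl.
have mI : measurable (`]c, e[%classic : set (measurableTypeR R)) := measurable_itv _.
rewrite (jqE _ (fun t => f (line d s t))).
have [-> I4] := Rintegral_lin2 4 8 mI I3 I2.
apply: le_Rintegral => //.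
move=> t _; rewrite -expr2.
exact: (@poincare_line _ a b (fun s => f (line d s t)) (fun s => cd d f (line d s t)) s ab ab2
  (fun x => @is_derive_line d x t _ sf) (@continuous_line d t _ cdf) sab).
Qed.

End AxisRect.

(** * Sums of tensor products and their primitives along an axis *)

Section AxisTensors.
Context {R : realType}.
Implicit Types (d : bool) (a b c e s t : R) (f g : R -> R) (u v : R * R -> R).

Definition tensd d f g : R * R -> R := if d then tens f g else tens g f.

Definition tsumd d (P Q : (R -> R) -> Prop) : (R * R -> R) -> Prop :=
  if d then tsum P Q else tsum Q P.

Lemma tsumd_ind d P Q (X : (R * R -> R) -> Prop) : X 0 ->
  (forall f g u, P f -> Q g -> tsumd d P Q u -> X u -> X (tensd d f g + u)) ->
  forall u, tsumd d P Q u -> X u.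
Proof.
move=> X0 XD u; case: d XD => /= XD; elim=> // f g v Pf Qg tv Xv; exact: XD.
Qed.

Lemma tsumd0 d P Q : tsumd d P Q 0.
Proof. by case: d; exact: tsum0. Qed.

Lemma tsumdD d P Q f g u : P f -> Q g -> tsumd d P Q u -> tsumd d P Q (tensd d f g + u).
Proof. by case: d => /= Pf Qg tu; exact: tsumD. Qed.

Lemma tensd_line d f g s t : tensd d f g (line d s t) = f s * g t.
Proof. by case: d; rewrite line.unlock /tensd /tens//= mulrC. Qed.

Lemma smooth_tensd d f g : smooth1 f -> smooth1 g -> smooth (tensd d f g).
Proof. by case: d => sf sg; exact: smooth_tens. Qed.

Lemma cd_tensd d f f' g : (forall x : R, is_derive x 1 f (f' x)) ->
  cd d (tensd d f g) = tensd d f' g.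
Proof.
move=> ff; case: d; rewrite ?cd1 ?cd2 /=.
  by apply: partial1E_derive => p; exact: is_derive_tens1.
by apply: partial2E_derive => p; exact: is_derive_tens2.
Qed.

Lemma cd_tensdC d f g g' : (forall x : R, is_derive x 1 g (g' x)) ->
  cd (~~ d) (tensd d f g) = tensd d f g'.
Proof. by case: d => /= gg; [exact: (@cd_tensd false g g' f gg)|exact: (@cd_tensd true g g' f gg)]. Qed.

Lemma smoothD u v : smooth u -> smooth v -> smooth (u + v).
Proof. by move=> su sv; rewrite -[u]scale1r; exact: smoothL. Qed.

Lemma smoothB u v : smooth u -> smooth v -> smooth (u - v).
Proof. by move=> su sv; rewrite addrC -scaleN1r; exact: smoothL. Qed.

Lemma cdD d u v : smooth u -> smooth v -> cd d (u + v) = cd d u + cd d v.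
Proof. by move=> su sv; rewrite -[u in LHS]scale1r cdL// scale1r. Qed.

Lemma cdB d u v : smooth u -> smooth v -> cd d (u - v) = cd d u - cd d v.
Proof. by move=> su sv; rewrite addrC -scaleN1r cdL// scaleN1r addrC. Qed.

Lemma cd0 d : cd d (0 : R * R -> R) = 0.
Proof.
have := cdB d (@smooth0 R) (@smooth0 R).
by rewrite subrr => ->; rewrite subrr.
Qed.

Lemma smooth_tsumd d P Q u : (forall f, P f -> smooth1 f) -> (forall f, Q f -> smooth1 f) ->
  tsumd d P Q u -> smooth u.
Proof.
move=> hP hQ; elim/tsumd_ind => [|f g v Pf Qg _ sv]; first exact: smooth0.
by apply: smoothD => //; apply: smooth_tensd; [exact: hP|exact: hQ].
Qed.

Lemma iq_tensd d a b c e f g f' g' : continuous f -> continuous g ->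
  continuous f' -> continuous g' ->
  iq (rectd d a b c e) (tensd d f g) (tensd d f' g') = jq `]a, b[ f f' * jq `]c, e[ g g'.
Proof.
move=> cf cg cf' cg'; rewrite iq.unlock.
have ct h k : continuous h -> continuous k -> continuous (tensd d h k).
  by case: d => ch ck; exact: continuous_tens.
rewrite (fubini_d _ _ _ _ _ _).1; last by move=> p; apply: cvgM; exact: ct.
rewrite !jqE -RintegralZl//; last first.
  by apply: continuous_integrable_ivl => x; apply: cvgM; [exact: cg|exact: cg'].
apply: eq_Rintegral => t _.
rewrite mulrC -RintegralZl//; last first.
  by apply: continuous_integrable_ivl => x; apply: cvgM; [exact: cf|exact: cf'].
by apply: eq_Rintegral => s _; rewrite !tensd_line; ring.
Qed.

Lemma test_fun_tensd d a b c e f g : test1 a b f -> test1 c e g ->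
  test_fun (rectd d a b c e) (tensd d f g).
Proof. by case: d => tf tg; exact: test_fun_tens. Qed.

Lemma test1_cont a b f : test1 a b f -> continuous f.
Proof. by move=> [sf _]; exact: smooth1_continuous. Qed.

Lemma test1_0 a b : a < b -> test1 a b (fun=> 0).
Proof.
move=> ab; split; first exact: smooth1_cst.
by exists ((a + b) / 2), ((a + b) / 2); split => //; lra.
Qed.

Definition cvn (D : set (R * R)) (un : nat -> R * R -> R) u : Prop :=
  nm D (un n - u) @[n --> \oo] --> (0 : R).

Lemma cvnD D un u vn v : isrect D -> (forall n, L2 D (un n)) -> L2 D u ->
  (forall n, L2 D (vn n)) -> L2 D v -> cvn D un u -> cvn D vn v ->
  cvn D (fun n => un n + vn n) (u + v).
Proof.
move=> rD hun hu hvn hv cu cv; have PI := L2_preip rD.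
apply: cvg_dist_le (cvgD0 cu cv) => n; rewrite subr0 ger0_norm ?bn_ge0//.
rewrite (_ : _ - _ = (un n - u) + (vn n - v)); last by rewrite opprD addrACA.
by apply: (bnD PI); exact: (preipB PI).
Qed.

Lemma cvn_cauchy D un u : isrect D -> (forall n, L2 D (un n)) -> L2 D u -> cvn D un u ->
  bn_cauchy (iq D) un.
Proof. by move=> rD hun hu; exact: (bn_cvg_cauchy (L2_preip rD) hun hu). Qed.

Lemma cvn_cst D u : cvn D (fun=> u) u.
Proof.
have nm0 : nm D 0 = 0.
  by rewrite /nm bn.unlock iq.unlock Rintegral_eq0 ?sqrtr0// => x _; exact: mul0r.
by rewrite /cvn; under eq_fun do rewrite subrr nm0; exact: cvg_cst.
Qed.

Lemma bn_cauchy_leK {E E' : lmodType R} (B : E -> E -> R) (B' : E' -> E' -> R)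
    (u : nat -> E) (v : nat -> E') (K : R) : 0 < K ->
  (forall m n, bn B' (v m - v n) <= K * bn B (u m - u n)) -> bn_cauchy B u -> bn_cauchy B' v.
Proof.
move=> K0 h cu e e0; have [|N hN] := cu (e / K); first by rewrite divr_gt0.
exists N => m n mN nN; apply: le_lt_trans (h m n) _.
by rewrite mulrC -ltr_pdivlMr//; exact: hN.
Qed.

Lemma L2_cauchy_lim D (un : nat -> R * R -> R) : isrect D -> (forall n, L2 D (un n)) ->
  bn_cauchy (iq D) un -> exists2 u, L2 D u & cvn D un u.
Proof. by move=> rD hu cu; exact: (L2_complete rD hu cu). Qed.

Lemma tsumd_dense d a b c e u : L2 (rectd d a b c e) u ->
  exists2 un : nat -> R * R -> R, forall n, tsumd d (test1 a b) (test1 c e) (un n)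
    & cvn (rectd d a b c e) un u.
Proof.
by case: d => hu; have [un h1 h2] := tsum_dense hu; exists un => //; rewrite /cvn /nm iq.unlock.
Qed.

Lemma nm_poincare d a b c e u s : a <= b -> b - a <= 2 -> c <= e -> smooth u -> a <= s <= b ->
  (forall t, u (line d s t) = 0) ->
  nm (rectd d a b c e) u <= 3 * nm (rectd d a b c e) (cd d u).
Proof.
move=> ab ab2 ce su sab u0.
have rD := rectd_isrect d ab ce; have PI := L2_preip rD.
have := poincare_rect d c e ab ab2 su sab.
rewrite jqE (@Rintegral_eq0 _ _ (measurableTypeR R)); last by move=> t _; rewrite u0 mul0r.
rewrite -(sqr_bn PI (L2_smooth rD su)) -(sqr_bn PI (L2_smooth rD (smooth_cd d su))).
rewrite -!/(nm _ _) mulr0 add0r => h.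
have p1 : 0 <= nm (rectd d a b c e) u := bn_ge0 _ _.
have p2 : 0 <= nm (rectd d a b c e) (cd d u) := bn_ge0 _ _.
move: h p1 p2; move: (nm _ _) (nm _ _) => x y; clear; rewrite !expr2 => h x0 y0.
by rewrite leNgt; apply/negP => h2; nra.
Qed.

(** For functions vanishing on one side, Poincare's inequality bounds a function by its derivative
    along [d]: convergence of the derivatives alone gives convergence of the functions. *)
Lemma line_primitive_cauchy d a b c e (un : nat -> R * R -> R) : a <= b -> b - a <= 2 -> c <= e ->
  (forall n, smooth (un n)) -> (forall n t, un n (line d a t) = 0) ->
  bn_cauchy (iq (rectd d a b c e)) (fun n => cd d (un n)) ->
  exists2 u, L2 (rectd d a b c e) u & cvn (rectd d a b c e) un u.
Proof.
move=> ab ab2 ce su u0 cu; have rD := rectd_isrect d ab ce.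
apply: (L2_cauchy_lim rD); first by move=> n; exact: L2_smooth.
have K0 : 0 < 3 :> R by [].
apply: (bn_cauchy_leK K0) cu => m n; rewrite -cdB//.
have aab : a <= a <= b by rewrite lexx.
apply: (@nm_poincare d a b c e _ a ab ab2 ce (smoothB (su m) (su n)) aab).
by move=> t; change (un m (line d a t) - un n (line d a t) = 0); rewrite !u0 subrr.
Qed.

Definition sm0 a f := smooth1 f /\ f a = 0.

Lemma test1_primitive0 a b f : test1 a b f ->
  exists F, sm0 a F /\ forall x : R, is_derive x 1 F (f x).
Proof.
move=> tf; have [F [dF [c' cc' F0] _]] := test1_primitive tf; exists F; split=> //.
split; last by apply: F0; exact: ltW.
by apply: smooth1_primitive dF _; case: tf.
Qed.

(** Integration acts on the factors along [d] only, starting from [a]: the result is still a tensor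
    sum, and it vanishes on the side where [line_primitive_cauchy] needs it to. *)
Lemma tsumd_primitive d a b Q u : (forall g, Q g -> smooth1 g) -> tsumd d (test1 a b) Q u ->
  exists U, [/\ tsumd d (sm0 a) Q U, cd d U = u & forall t, U (line d a t) = 0].
Proof.
move=> sQ; elim/tsumd_ind => [|f g v tf Qg tv [V [tV dV V0]]].
  exists 0; split=> //; first exact: tsumd0.
  exact: cd0.
have [F [[sF Fa] dF]] := test1_primitive0 tf.
exists (tensd d F g + V); split.
- exact: tsumdD.
- rewrite cdD ?dV ?(cd_tensd _ _ dF)//; first by apply: smooth_tensd => //; exact: sQ.
  by apply: smooth_tsumd tV => // h [].
- move=> t; change (tensd d F g (line d a t) + V (line d a t) = 0).
  by rewrite tensd_line V0 Fa mul0r addr0.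
Qed.

End AxisTensors.

(** * Approximation by smooth functions *)

Section Approximation.
Context {R : realType}.
Implicit Types (f g : R -> R) (u v : R * R -> R).

Lemma flat0_ge (x : R) : 1 <= x -> expR (-1) <= flat 0 x.
Proof.
move=> x1; have x0 : 0 < x by rewrite (lt_le_trans _ x1).
by rewrite /flat x0 expr0 mul1r ler_expR lerN2 invf_le1.
Qed.

Lemma test1_mass (a b : R) : a < b -> exists2 f, test1 a b f & jq `]a, b[ f (cst 1) = 1.
Proof.
(* With this [n], both factors of the bump are evaluated at arguments at least 1 on the middle half
   of the interval, where the bump is thus at least [expR (-1) * expR (-1)]: its integral is
   positive. *)
move=> ab; pose n := Num.truncn (8 / (b - a)).
have nab : 2 <= n.+1%:R * ((b - a) / 4).
  have ba0 : 0 < b - a by rewrite subr_gt0.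
  have : 8 / (b - a) < n.+1%:R by exact: truncnS_gt.
  rewrite ltr_pdivrMr// => h; clear -h; move: h; set k := _%:R; set l := b - a => h.
  by rewrite mulrA ler_pdivlMr//; lra.
have tb := test1_bump n ab; have cb := test1_cont tb.
pose s := a + (b - a) / 4; pose t := b - (b - a) / 4.
have st : s < t by rewrite /s /t; lra.
have I0 : 0 < jq `]a, b[ (bump a b n) (cst 1).
  apply: (@lt_le_trans _ _ (jq `]s, t[ (cst (expR (-1) * expR (-1))) (cst (expR (-1) * expR (-1))))).
    by rewrite jq_cst ?ltW// mulr_gt0 ?subr_gt0// exprn_gt0// mulr_gt0// expR_gt0.
  apply: (@le_trans _ _ (jq `]s, t[ (bump a b n) (bump a b n))).
    apply: le_jq => //; first exact: cst_continuous.
    move=> x /andP[sx xt]; rewrite ler_pXn2r ?nnegrE ?bump_ge0 ?mulr_ge0 ?expR_ge0//.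
    apply: ler_pM; rewrite ?expR_ge0//; apply: flat0_ge.
      have : n.+1%:R * ((b - a) / 4) <= n.+1%:R * (x - a).
        by rewrite ler_wpM2l//; move: sx; rewrite /s; clear; lra.
      by move: nab; clear; move: (_%:R * _) (_%:R * (x - a)) => y z; lra.
    have : n.+1%:R * ((b - a) / 4) <= n.+1%:R * (b - x).
      by rewrite ler_wpM2l//; move: xt; rewrite /t; clear; lra.
    by move: nab; clear; move: (_%:R * _) (_%:R * (b - x)) => y z; lra.
  apply: (@le_trans _ _ (jq `]a, b[ (bump a b n) (bump a b n))).
    by apply: jq_sub => //; rewrite /s /t; lra.
  rewrite !jqE; apply: le_Rintegral => //.
  - by apply: continuous_integrable_ivl => x; apply: cvgM; exact: cb.
  - by apply: continuous_integrable_ivl => x; apply: cvgM; [exact: cb|exact: cvg_cst].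
  - by move=> x _; rewrite ler_wpM2l ?bump_ge0 ?bump_le1.
exists (fun x => (jq `]a, b[ (bump a b n) (cst 1))^-1 * bump a b n x); first exact: test1Z.
rewrite jqE; under eq_Rintegral do rewrite -mulrA.
rewrite RintegralZl//.
  by rewrite -jqE mulVf// gt_eqF.
by apply: continuous_integrable_ivl => x; apply: cvgM; [exact: cb|exact: cvg_cst].
Qed.

(** The argument of du Bois-Reymond: subtracting a multiple of a fixed unit mass makes the integral
    zero, so the primitive is compactly supported. *)
Lemma test1_mean0 (a b : R) f f0 : test1 a b f -> test1 a b f0 -> jq `]a, b[ f0 (cst 1) = 1 ->
  exists2 h, test1 a b h & forall x : R, is_derive x 1 h (f x - jq `]a, b[ f (cst 1) * f0 x).
Proof.
move=> tf tf0 m0.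
pose k := jq `]a, b[ f (cst 1).
have tg : test1 a b (fun x => f x + (- k) * f0 x) by apply: test1D => //; exact: test1Z.
have [h [dh h0 [b' b'b h1]]] := test1_primitive tg.
exists h; last by move=> x; rewrite -mulNr; exact: dh.
apply: (test1_primitive_test tg dh h0); exists b' => // x hx; rewrite h1//.
have PI := jq_preip (measurable_itv `]a, b[).
have Lf := L2l_continuous a b (test1_cont tf); have Lf0 := L2l_continuous a b (test1_cont tf0).
have L1 := L2l_continuous a b (@cst_continuous _ _ (1 : R)).
transitivity (jq `]a, b[ ((- k) *: f0 + f) (cst 1)).
  by rewrite jqE; apply: eq_Rintegral => y _; rewrite mulr1 addrC.
by rewrite (preipE PI)// m0 /k; ring.
Qed.

Section Strip.
Variables (d : bool) (a b c e : R).
Hypotheses (ab : a < b) (ce : c < e).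
Let Q := rectd d a b c e.
Let rQ : isrect Q := rectd_isrect d (ltW ab) (ltW ce).
Let PI := L2_preip rQ.
Let PJ := jq_preip (measurable_itv `]a, b[).
Variable f0 : R -> R.
Hypotheses (tf0 : test1 a b f0) (mf0 : jq `]a, b[ f0 (cst 1) = 1).

(** The weighted mean along the axis [d]: it turns a function of two variables into one of the other
    variable, and leaves functions of that variable unchanged since [f0] has mass 1. *)
Let avg u : R -> R := fun t => jq `]a, b[ (fun s => u (line d s t)) f0.

Let L2c f : continuous f -> L2l `]a, b[ f. Proof. exact: L2l_continuous. Qed.
Let cf0 : continuous f0 := test1_cont tf0.
Let c1 : continuous (cst 1 : R -> R) := @cst_continuous _ _ (1 : R).

Let tsum_smooth u : tsumd d (test1 a b) (test1 c e) u -> smooth u.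
Proof. by apply: smooth_tsumd => f []. Qed.

Lemma avg_tsum u : tsumd d (test1 a b) (test1 c e) u -> test1 c e (avg u) /\
  forall g, continuous g -> jq `]c, e[ (avg u) g = iq Q u (tensd d f0 g).
Proof.
move: u; apply: tsumd_ind => [|f g v tf tg tv [tav av]].
  have a0 : avg 0 = fun=> 0.
    by apply/funext => t; rewrite /avg jqE; apply: Rintegral_eq0 => s _; exact: mul0r.
  rewrite a0; split; first exact: test1_0.
  move=> g _; rewrite iq.unlock jqE !Rintegral_eq0// => x _; exact: mul0r.
have cf := test1_cont tf; have cg := test1_cont tg.
have cv := smooth_continuous (tsum_smooth tv).
have aE : avg (tensd d f g + v) = fun t => jq `]a, b[ f f0 * g t + avg v t.
  apply/funext => t; rewrite /avg mulrC.
  rewrite -(preipE PJ); [|exact: L2c|by apply: L2c; exact: continuous_line|exact: L2c].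
  rewrite !jqE; apply: eq_Rintegral => s _; congr (_ * _).
  by change (tensd d f g (line d s t) + v (line d s t) = g t * f s + v (line d s t));
    rewrite tensd_line mulrC.
rewrite aE; split; first by apply: test1D => //; exact: test1Z.
move=> g' cg'; have PK := jq_preip (measurable_itv `]c, e[).
have Lg' := L2l_continuous c e cg'; have Lg := L2l_continuous c e cg.
have Lv := L2l_continuous c e (test1_cont tav).
transitivity (jq `]c, e[ (jq `]a, b[ f f0 *: g + avg v) g'); first by rewrite !jqE.
rewrite (preipE PK)// av// (preip_formDl PI); [|apply: L2_smooth => //|apply: L2_smooth => //|].
- by rewrite /Q iq_tensd// mulrC.
- by apply: smooth_tensd; [case: tf|case: tg].
- by apply: L2_continuous => //; case: (d); exact: continuous_tens.
Qed.

Lemma avgB u v : smooth u -> smooth v -> avg (u - v) = avg u - avg v.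
Proof.
move=> su sv; apply/funext => t; rewrite /avg.
have h w : smooth w -> L2l `]a, b[ (fun s => w (line d s t)).
  by move=> sw; apply: L2c; apply: continuous_line; exact: smooth_continuous.
rewrite [RHS](_ : _ = jq `]a, b[ (fun s => u (line d s t)) f0 - jq `]a, b[ (fun s => v (line d s t)) f0)//.
by rewrite -(preip_formBl PJ).
Qed.

Let K := Num.sqrt ((b - a) * jq `]a, b[ f0 f0).

(** Cauchy-Schwarz on each line bounds the mean by the norm of [f0] times that of [u]; extending the
    mean constantly along [d] contributes the length [b - a] to [K]. *)
Lemma nm_avg u : smooth u -> continuous (avg u) -> nm Q (tensd d (cst 1) (avg u)) <= K * nm Q u.
Proof.
move=> su ca; have cu := smooth_continuous su.
have p := jq_ge0 `]a, b[ f0; have ba : 0 <= b - a by rewrite subr_ge0 ltW.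
rewrite /nm bn.unlock /K -sqrtrM ?mulr_ge0//; apply: ler_wsqrtr.
have -> : iq Q (tensd d (cst 1) (avg u)) (tensd d (cst 1) (avg u)) = (b - a) * jq `]c, e[ (avg u) (avg u).
  by rewrite /Q iq_tensd// jq_cst ?(ltW ab)// expr1n mul1r.
rewrite -mulrA; apply: ler_wpM2l => //.
have [-> I1] := iq_fubini d a b c e cu.
have mI : measurable (`]c, e[%classic : set (measurableTypeR R)) := measurable_itv _.
rewrite -RintegralZl// jqE; apply: le_Rintegral => //.
- by apply: continuous_integrable_ivl => x; apply: cvgM; exact: ca.
- by have := integrableZl mI (jq `]a, b[ f0 f0) I1.
move=> t _; rewrite -expr2 mulrC.
by apply: (form_CS2 PJ); [apply: L2c; exact: continuous_line|exact: L2c].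
Qed.

(** A function whose derivative along [d] is zero depends on the other variable alone. Tensor sums
    approximating [z] are averaged along [d]: averaging is bounded in L2, so the means converge, and
    their limit has the same pairings as [z] with all tensor products. *)
Lemma flat_dir z : L2 Q z ->
  (forall f g, test1 a b f -> test1 c e g -> iq Q z (tensd d f^`()%classic g) = 0) ->
  (forall f g, test1 a b f -> test1 c e g ->
     iq Q z (tensd d f g) = jq `]a, b[ f (cst 1) * iq Q z (tensd d f0 g)) /\
  exists2 cn : nat -> R -> R, forall n, test1 c e (cn n) &
    cvn Q (fun n => tensd d (cst 1) (cn n)) z.
Proof.
move=> Lz hz.
have L2t f g : continuous f -> continuous g -> L2 Q (tensd d f g).
  by move=> cf cg; apply: L2_continuous => //; case: (d); exact: continuous_tens.
have hz' f g : test1 a b f -> test1 c e g ->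
    iq Q z (tensd d f g) = jq `]a, b[ f (cst 1) * iq Q z (tensd d f0 g).
  move=> tf tg; have [h th dh] := test1_mean0 tf tf0 mf0.
  have := hz h g th tg; rewrite (is_derive_derive1 dh) => h0.
  apply/eqP; rewrite -subr_eq0; apply/eqP; rewrite -h0.
  have Lf := L2t _ _ (test1_cont tf) (test1_cont tg).
  have Lf0 := L2t _ _ cf0 (test1_cont tg).
  rewrite -(preip_formZr PI)// -(preip_formBr PI)//; last exact: (preipZ PI).
  congr (iq Q z _); apply/funext => p.
  rewrite /tensd; case: (d); rewrite /tens.
    change (f p.1 * g p.2 - jq `]a, b[ f (cst 1) * (f0 p.1 * g p.2) =
      (f p.1 - jq `]a, b[ f (cst 1) * f0 p.1) * g p.2); ring.
  change (g p.1 * f p.2 - jq `]a, b[ f (cst 1) * (g p.1 * f0 p.2) =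
      g p.1 * (f p.2 - jq `]a, b[ f (cst 1) * f0 p.2)); ring.
split=> //.
have [s ts sz] := tsumd_dense Lz.
have Ls n : L2 Q (s n) by apply: L2_smooth => //; exact: tsum_smooth.
have ta n := (avg_tsum (ts n)).1.
have La n : L2 Q (tensd d (cst 1) (avg (s n))) by apply: L2t => //; exact: test1_cont (ta n).
have K0 : 0 < K + 1 by rewrite ltr_wpDl// sqrtr_ge0.
have : bn_cauchy (iq Q) (fun n => tensd d (cst 1) (avg (s n))).
  apply: bn_cauchy_leK K0 _ (cvn_cauchy rQ Ls Lz sz) => m n.
  have -> : tensd d (cst 1) (avg (s m)) - tensd d (cst 1) (avg (s n)) =
      tensd d (cst 1) (avg (s m - s n)).
    rewrite avgB; [|exact: tsum_smooth|exact: tsum_smooth].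
    apply/funext => p; rewrite /tensd; case: (d); rewrite /tens.
      by change (1 * avg (s m) p.2 - 1 * avg (s n) p.2 = 1 * (avg (s m) p.2 - avg (s n) p.2)); ring.
    by change (avg (s m) p.1 * 1 - avg (s n) p.1 * 1 = (avg (s m) p.1 - avg (s n) p.1) * 1); ring.
  apply: (@le_trans _ _ (K * nm Q (s m - s n))).
    apply: nm_avg; first by apply: smoothB; exact: tsum_smooth.
    rewrite avgB; [|exact: tsum_smooth|exact: tsum_smooth].
    by move=> t; apply: cvgB; [exact: (test1_cont (ta m))|exact: (test1_cont (ta n))].
  by rewrite ler_wpM2r ?bn_ge0// lerDl.
move=> /(L2_cauchy_lim rQ La)[y Ly ay].
exists (fun n => avg (s n)) => //.
(* The means converge to some [y]; it is identified with [z] by testing against tensor products,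
   which determine a function of L2. *)
suff yz : aeq Q y z.
  rewrite /cvn; suff -> : (fun n => nm Q (tensd d (cst 1) (avg (s n)) - z)) =
    (fun n => nm Q (tensd d (cst 1) (avg (s n)) - y)) by exact: ay.
  apply/funext => n; apply: nm_ae => //; [exact: (preipB PI (La n) Lz).1|exact: (preipB PI (La n) Ly).1|].
  by apply: aeqB; [exact: aeq_refl|exact: aeq_sym].
suff : aeq Q (y - z) (cst 0).
  by apply: ae_onS => p _ h; apply/eqP; rewrite -subr_eq0; apply/eqP.
have Lyz := preipB PI Ly Lz.
suff H : forall f g, test1 a b f -> test1 c e g -> iq Q (y - z) (tensd d f g) = 0.
  move: H Lyz; rewrite /Q iq.unlock /tensd /rectd; case: (d) => H Lyz; apply: sqint_orthogonal => // f g tf tg.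
  exact: H.
move=> f g tf tg; have cf := test1_cont tf; have cg := test1_cont tg.
have Lfg := L2t _ _ cf cg; have Lfg0 := L2t _ _ cf0 cg.
rewrite (preip_formBl PI)// (hz' f g tf tg).
have l1 := cvg_form PI La Ly Lfg ay.
have l2 := cvg_form PI Ls Lz Lfg0 sz.
have l3 : jq `]a, b[ f (cst 1) * iq Q (s n) (tensd d f0 g) @[n --> \oo] -->
   jq `]a, b[ f (cst 1) * iq Q z (tensd d f0 g) by apply: cvgM => //; exact: cvg_cst.
apply/eqP; rewrite subr_eq0; apply/eqP; apply: (cvg_unique _ l1) => //.
suff <- : (fun n => jq `]a, b[ f (cst 1) * iq Q (s n) (tensd d f0 g)) =
  (fun n => iq Q (tensd d (cst 1) (avg (s n))) (tensd d f g)) by [].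
apply/funext => n; rewrite /Q iq_tensd//; last exact: test1_cont (ta n).
rewrite -(avg_tsum (ts n)).2//; congr (_ * _).
exact: (preipC PJ (L2c cf) (L2c c1)).
Qed.

End Strip.

End Approximation.

(** * Smooth approximation controlling one derivative, or the mixed derivative *)

Section Structure.
Context {R : realType}.
Implicit Types (f g : R -> R) (u v w : R * R -> R) (d : bool).

Lemma is_wdB D d u v w w' : isrect D -> L2 D u -> L2 D v ->
  is_wd d D u w -> is_wd d D v w' -> is_wd d D (u - v) (w - w').
Proof.
move=> rD Lu Lv hu hv.
have -> : u - v = (-1) *: v + u by rewrite scaleN1r addrC.
have -> : w - w' = (-1) *: w' + w by rewrite scaleN1r addrC.
exact: is_wdL.
Qed.

Lemma is_wdD D d u v w w' : isrect D -> L2 D u -> L2 D v ->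
  is_wd d D u w -> is_wd d D v w' -> is_wd d D (u + v) (w + w').
Proof. by move=> rD Lu Lv hu hv; rewrite -[u]scale1r -[w]scale1r; exact: is_wdL. Qed.

Lemma H1norm_ae D u v : isrect D -> measurable_on D u -> measurable_on D v -> aeq D u v ->
  H1norm D u = H1norm D v.
Proof.
move=> rD mu mv uv; rewrite !H1normE bn.unlock /h1form !(wd_ae _ rD mu mv uv).
congr (Num.sqrt (_ + _ + _)).
have := congr1 (fun x => x ^+ 2) (nm_ae rD mu mv uv); rewrite /nm bn.unlock !sqr_sqrtr//.
  by rewrite iq.unlock; apply: Rintegral_ge0 => p _; rewrite -expr2 sqr_ge0.
by rewrite iq.unlock; apply: Rintegral_ge0 => p _; rewrite -expr2 sqr_ge0.
Qed.

Lemma H1_cvg_smooth D (un : nat -> R * R -> R) u (w : bool -> R * R -> R) : isrect D ->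
  (forall n, smooth (un n)) -> L2 D u -> (forall d, L2 D (w d)) -> cvn D un u ->
  (forall d, cvn D (fun n => cd d (un n)) (w d)) ->
  [/\ H1 D u, forall d, is_wd d D u (w d) & H1norm D (un n - u) @[n --> \oo] --> (0 : R)].
Proof.
move=> rD su Lu Lw cu cw; apply: H1_of_cvg => //; first by move=> n; exact: H1_smooth.
move=> d; suff -> : (fun n => nm D (wd d D (un n) - w d)) = (fun n => nm D (cd d (un n) - w d)).
  exact: cw.
have PI := L2_preip rD; apply/funext => n.
have L := L2_smooth rD (smooth_cd d (su n)).
have L' := H1_L2_wd d (H1_smooth rD (su n)).
apply: nm_ae => //; [exact: (preipB PI L' (Lw d)).1|exact: (preipB PI L (Lw d)).1|].
by apply: aeqB; [exact: wd_smooth|exact: aeq_refl].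
Qed.

Lemma cvn_cd_wd D d (un : nat -> R * R -> R) u : isrect D -> (forall n, smooth (un n)) -> H1 D u ->
  H1norm D (un n - u) @[n --> \oo] --> (0 : R) ->
  cvn D un u /\ cvn D (fun n => cd d (un n)) (wd d D u).
Proof.
move=> rD su hu cu; have hun n := H1_smooth rD (su n); have PI := L2_preip rD.
have [c0 c1] := cvg_nm0 rD (fun n => H1B rD (hun n) hu) cu.
split=> //; rewrite /cvn; suff -> : (fun n => nm D (cd d (un n) - wd d D u)) =
  (fun n => nm D (wd d D (un n - u))) by exact: c1.
apply/funext => n; rewrite nm_wdB//.
have L := L2_smooth rD (smooth_cd d (su n)).
have L' := H1_L2_wd d (H1_smooth rD (su n)); have Lu := H1_L2_wd d hu.
apply: nm_ae => //; [exact: (preipB PI L Lu).1|exact: (preipB PI L' Lu).1|].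
by apply: aeqB; [apply: aeq_sym; exact: wd_smooth|exact: aeq_refl].
Qed.

Lemma flat_of_wd d a b c e z f g : a <= b -> c <= e -> is_wd d (rectd d a b c e) z 0 ->
  test1 a b f -> test1 c e g -> iq (rectd d a b c e) z (tensd d f^`()%classic g) = 0.
Proof.
move=> ab ce [_ h] tf tg; have rQ := rectd_isrect d ab ce; have PI := L2_preip rQ.
have t := test_fun_tensd d tf tg.
have sf : smooth1 f by case: tf.
rewrite -(@cd_tensd _ d f _ g (fun x => smooth1_is_derive x sf)) h//.
by rewrite (preip_form0l PI) ?oppr0//; exact: L2_test.
Qed.

Lemma cvn_congr D (un vn : nat -> R * R -> R) u : (forall n, un n = vn n) -> cvn D un u -> cvn D vn u.
Proof. by move=> /funext ->. Qed.

(* No mollification: the derivative is approximated by sums of tensor products,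
   which are integrated along the axis; what remains of [p] is a function of the
   other variable. *)
Lemma is_wd_approx d a b c e p r : a < b -> b - a <= 2 -> c < e ->
  L2 (rectd d a b c e) p -> is_wd d (rectd d a b c e) p r ->
  exists pn : nat -> R * R -> R, [/\ forall n, smooth (pn n), cvn (rectd d a b c e) pn p
    & cvn (rectd d a b c e) (fun n => cd d (pn n)) r].
Proof.
move=> ab ab2 ce; have rQ := rectd_isrect d (ltW ab) (ltW ce).
set Q := rectd d a b c e in rQ * => Lp hp; have PI := L2_preip rQ; have Lr := hp.1.
have [rn trn crn] := tsumd_dense Lr.
have sP n : smooth (rn n) by apply: smooth_tsumd (trn n) => f [].
have s2 f : test1 c e f -> smooth1 f by case.
have /choice[U hU] n := tsumd_primitive s2 (trn n).
have sU n : smooth (U n) by have [t _ _] := hU n; apply: smooth_tsumd t => f [].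
have dU n : cd d (U n) = rn n by have [] := hU n.
have Lrn n : L2 Q (rn n) by exact: L2_smooth.
have LU n : L2 Q (U n) by exact: L2_smooth.
have [|rho Lrho crho] := @line_primitive_cauchy _ d a b c e U (ltW ab) ab2 (ltW ce) sU
  (fun n t => let: And3 _ _ h := hU n in h t).
  by under eq_fun do rewrite dU; exact: (cvn_cauchy rQ Lrn Lr crn).
have wrho : is_wd d Q rho r.
  apply: (is_wd_cvg rQ LU Lrho Lr _ crho crn) => n.
  by rewrite -dU; exact: is_wd_smooth.
have Lz := preipB PI Lp Lrho.
have wz : is_wd d Q (p - rho) 0 by rewrite -(subrr r); exact: is_wdB.
have [f0 tf0 mf0] := test1_mass ab.
have [_ [cn tcn ccn]] := flat_dir ab ce tf0 mf0 Lz (fun f g tf tg => flat_of_wd (ltW ab) (ltW ce) wz tf tg).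
have s1 n : smooth (tensd d (cst 1) (cn n)).
  by apply: smooth_tensd; [exact: smooth1_cst|case: (tcn n)].
exists (fun n => U n + tensd d (cst 1) (cn n)); split.
- by move=> n; exact: smoothD.
- have -> : p = rho + (p - rho) by rewrite addrCA subrr addr0.
  by apply: cvnD => // n; exact: L2_smooth.
- apply: cvn_congr crn => n; rewrite cdD// dU.
  rewrite (@cd_tensd _ d (cst 1) (fun=> 0) _ (fun x => is_derive_cst _ _ _)).
  suff -> : tensd d (fun=> 0) (cn n) = 0 by rewrite addr0.
  by apply/funext => q; rewrite /tensd /tens; case: (d); rewrite ?mul0r ?mulr0.
Qed.

Lemma tsum_cdC u : tsumd true smooth1 smooth1 u -> cd true (cd false u) = cd false (cd true u).
Proof.
move: u; apply: tsumd_ind => [|f g v sf sg tv IH]; first by rewrite !cd0.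
have df x := smooth1_is_derive x sf; have dg x := smooth1_is_derive x sg.
have sv : smooth v by apply: smooth_tsumd tv.
have s1 : smooth (tensd true f g) by exact: smooth_tensd.
rewrite !cdD//; try exact: smooth_cd.
rewrite IH; congr (_ + _).
rewrite (@cd_tensdC _ true f g _ dg) (@cd_tensd _ true f _ _ df) (@cd_tensd _ true f _ _ df).
by rewrite (@cd_tensdC _ true _ g _ dg).
Qed.

Lemma L2_orth_tens a b c e v : L2 (rect a b c e) v ->
  (forall f g, test1 a b f -> test1 c e g -> iq (rect a b c e) v (tens f g) = 0) ->
  aeq (rect a b c e) v (cst 0).
Proof. by rewrite iq.unlock => Lv h; exact: sqint_orthogonal. Qed.

(** [flat_dir] along both axes reduces the pairing with [tens f g] to the product of the two
    integrals and the pairing with the fixed unit masses, which is therefore the constant. *)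
Lemma is_wd_const (a b c e : R) (z : R * R -> R) : a < b -> c < e -> L2 (rect a b c e) z ->
  (forall d, is_wd d (rect a b c e) z 0) -> exists k, aeq (rect a b c e) z (cst k).
Proof.
move=> ab ce Lz hz; have rQ := rectd_isrect true (ltW ab) (ltW ce); have PI := L2_preip rQ.
have [f0 tf0 mf0] := test1_mass ab; have [g0 tg0 mg0] := test1_mass ce.
have [h1 _] := @flat_dir _ true a b c e ab ce f0 tf0 mf0 z Lz
   (fun f g tf tg => flat_of_wd (ltW ab) (ltW ce) (hz true) tf tg).
have [h2 _] := @flat_dir _ false c e a b ce ab g0 tg0 mg0 z Lz
   (fun f g tf tg => flat_of_wd (ltW ce) (ltW ab) (hz false) tf tg).
exists (iq (rect a b c e) z (tens f0 g0)); set k := iq _ _ _.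
suff : aeq (rect a b c e) (z - cst k) (cst 0).
  by apply: ae_onS => p _ h; apply/eqP; rewrite -subr_eq0; apply/eqP.
have kE : cst k = tensd true (cst k) (cst 1) :> (R * R -> R).
  by apply/funext => p; rewrite /tensd /tens/= mulr1.
have Lk : L2 (rect a b c e) (cst k) by apply: L2_continuous => //; exact: cst_continuous.
apply: L2_orth_tens; first exact: (preipB PI).
move=> f g tf tg; have cf := test1_cont tf; have cg := test1_cont tg.
have Lfg : L2 (rect a b c e) (tens f g) by apply: L2_continuous => //; exact: continuous_tens.
rewrite (preip_formBl PI)//.
have -> := h1 f g tf tg; have := h2 g f0 tg tf0; rewrite /rectd /tensd => ->.
rewrite kE -[rect _ _ _ _]/(rectd true a b c e) -[tens f g]/(tensd true f g) iq_tensd//;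
  try exact: cst_continuous.
have PJ := jq_preip (measurable_itv `]a, b[); have PK := jq_preip (measurable_itv `]c, e[).
have L1 := L2l_continuous a b (@cst_continuous _ _ (1 : R)).
have L2' := L2l_continuous c e (@cst_continuous _ _ (1 : R)).
have Lf := L2l_continuous a b cf; have Lg := L2l_continuous c e cg.
rewrite (preipC PK L2' Lg).
have -> : jq `]a, b[ (cst k) f = k * jq `]a, b[ f (cst 1).
  have -> : cst k = k *: cst 1 :> (R -> R) by apply/funext => x; exact: (esym (mulr1 k)).
  by rewrite (preip_formZl PJ)// (preipC PJ).
by rewrite -/k; ring.
Qed.

(** Tensor sums tending to [s] are integrated along both axes. The remainder of [u] has no mixed
    derivative, so its partial derivatives are functions of one variable each; these are
    approximated and integrated in turn, and what is left is a constant. *)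
Lemma mixed_approx (a b c e : R) u s : a < b -> b - a <= 2 -> c < e -> e - c <= 2 ->
  H1 (rect a b c e) u -> is_wd false (rect a b c e) (wd true (rect a b c e) u) s ->
  exists un : nat -> R * R -> R, [/\ forall n, smooth (un n),
    H1norm (rect a b c e) (un n - u) @[n --> \oo] --> (0 : R)
    & cvn (rect a b c e) (fun n => cd false (cd true (un n))) s].
Proof.
move=> ab ab2 ce ce2 hu hs.
set Q := rect a b c e in hu hs *.
have rQ : isrect Q := rectd_isrect true (ltW ab) (ltW ce).
have PI := L2_preip rQ; have Ls := hs.1.
have [sn tsn csn] := @tsumd_dense _ false c e a b s Ls.
have s2 f : test1 a b f -> smooth1 f by case.
have /choice[W hW] n := tsumd_primitive s2 (tsn n).
have dW n : cd false (W n) = sn n by have [] := hW n.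
have s3 f : sm0 c f -> smooth1 f by case.
have /choice[U hU] n : exists U, [/\ tsumd true (sm0 a) (sm0 c) U, cd true U = W n & forall t, U (line true a t) = 0].
  by have [t _ _] := hW n; exact: (@tsumd_primitive _ true a b (sm0 c) (W n) s3 t).
have dU n : cd true (U n) = W n by have [] := hU n.
have sU n : smooth (U n) by have [t _ _] := hU n; apply: smooth_tsumd t => f [].
have sW n : smooth (W n) by rewrite -dU; exact: smooth_cd.
have ssn n : smooth (sn n) by rewrite -dW; exact: smooth_cd.
pose V n := cd false (U n).
have sV n : smooth (V n) by exact: smooth_cd.
have dV n : cd true (V n) = sn n.
  rewrite /V tsum_cdC ?dU ?dW//; have [t _ _] := hU n.
  by move: t; apply: tsumW => f [].
(* [U n] vanishes on the whole line x = a, hence so does its derivative along that line. *)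
have V0 n t : V n (line true a t) = 0.
  have h := @is_derive_line _ false t a _ (sU n).
  have E : (fun x => U n (line false x a)) = cst 0.
    by apply/funext => x; have [_ _ h0] := hU n; have := h0 x; rewrite line.unlock.
  rewrite E in h; rewrite -[line true a t]/(_) (_ : line true a t = line false t a); last by rewrite line.unlock.
  by rewrite /V -(@derive_val _ _ _ _ _ _ _ h) derive_cst.
have Lsm (f : R * R -> R) : smooth f -> L2 Q f by exact: L2_smooth.
have csnC : bn_cauchy (iq Q) sn := cvn_cauchy rQ (fun n => Lsm _ (ssn n)) Ls csn.
have [|P1 LP1 cP1] := @line_primitive_cauchy _ false c e a b W (ltW ce) ce2 (ltW ab) sW
  (fun n t => let: And3 _ _ h := hW n in h t).
  by under eq_fun do rewrite dW; exact: csnC.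
have [|U0 LU0 cU0] := @line_primitive_cauchy _ true a b c e U (ltW ab) ab2 (ltW ce) sU
  (fun n t => let: And3 _ _ h := hU n in h t).
  by under eq_fun do rewrite dU; exact: (cvn_cauchy rQ (fun n => Lsm _ (sW n)) LP1 cP1).
have [|P2 LP2 cP2] := @line_primitive_cauchy _ true a b c e V (ltW ab) ab2 (ltW ce) sV V0.
  by under eq_fun do rewrite dV; exact: csnC.
have wP1 : is_wd false Q P1 s.
  apply: (is_wd_cvg rQ (fun n => Lsm _ (sW n)) LP1 Ls _ cP1 csn) => n.
  by rewrite -dW; exact: is_wd_smooth.
have wU1 : is_wd true Q U0 P1.
  apply: (is_wd_cvg rQ (fun n => Lsm _ (sU n)) LU0 LP1 _ cU0 cP1) => n.
  by rewrite -dU; exact: is_wd_smooth.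
have wU2 : is_wd false Q U0 P2.
  apply: (is_wd_cvg rQ (fun n => Lsm _ (sU n)) LU0 LP2 _ cU0 cP2) => n.
  exact: is_wd_smooth.
have Lu := H1_L2 hu; have Ly := preipB PI Lu LU0.
have Lp := preipB PI (H1_L2_wd true hu) LP1; have Lq := preipB PI (H1_L2_wd false hu) LP2.
have wy1 := is_wdB rQ Lu LU0 (H1_wd true hu) wU1.
have wy2 := is_wdB rQ Lu LU0 (H1_wd false hu) wU2.
have wp : is_wd false Q (wd true Q u - P1) 0.
  by rewrite -(subrr s); apply: is_wdB => //; exact: H1_L2_wd.
set y := u - U0 in Ly wy1 wy2; set p := wd true Q u - P1 in Lp wy1 wp; set q := wd false Q u - P2 in Lq wy2.
have [f0 tf0 mf0] := test1_mass ab; have [g0 tg0 mg0] := test1_mass ce.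
have [_ [cn tcn ccn]] := @flat_dir _ false c e a b ce ab g0 tg0 mg0 p Lp
   (fun f g tf tg => flat_of_wd (ltW ce) (ltW ab) wp tf tg).
(* The first derivative of [q] cannot be taken directly; two integrations by parts through [y] turn
   it into the second-axis derivative of [p], which is 0. *)
have hq f g : test1 a b f -> test1 c e g -> iq Q q (tensd true f^`()%classic g) = 0.
  move=> tf tg; have tf' := test1_derive tf; have tg' := test1_derive tg.
  have sf : smooth1 f by case: tf. have sg : smooth1 g by case: tg.
  have df x := smooth1_is_derive x sf; have dg x := smooth1_is_derive x sg.
  apply: oppr_inj; rewrite oppr0 -wy2.2; last exact: (test_fun_tensd true tf' tg).
  rewrite (@cd_tensdC _ true _ g _ dg) -(@cd_tensd _ true f _ _ df) wy1.2; last exact: (test_fun_tensd true tf tg').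
  rewrite -(@cd_tensdC _ true f g _ dg) wp.2; last exact: (test_fun_tensd true tf tg).
  by rewrite (preip_form0l PI) ?oppr0//; apply: L2_test => //; exact: (test_fun_tensd true tf tg).
have [_ [dn tdn cdn]] := @flat_dir _ true a b c e ab ce f0 tf0 mf0 q Lq hq.
have /choice[C hC] n := test1_primitive0 (tcn n).
have /choice[G hG] n := test1_primitive0 (tdn n).
pose X n := tensd true (C n) (cst 1); pose Y n := tensd false (G n) (cst 1).
have d1 x : is_derive x (1 : R) (cst (1 : R)) 0 by exact: is_derive_cst.
have dX n : cd true (X n) = tensd false (cst 1) (cn n).
  by rewrite /X (@cd_tensd _ true _ _ _ (hC n).2).
have dY n : cd false (Y n) = tensd true (cst 1) (dn n).
  by rewrite /Y (@cd_tensd _ false _ _ _ (hG n).2).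
have t0 d f : tensd d f (fun=> 0) = 0.
  by apply/funext => z; rewrite /tensd /tens; case: (d); rewrite ?mul0r ?mulr0.
have dX' n : cd false (X n) = 0 by rewrite /X (@cd_tensdC _ true _ _ _ d1) t0.
have dY' n : cd true (Y n) = 0 by rewrite /Y (@cd_tensdC _ false _ _ _ d1) t0.
have sX n : smooth (X n) by apply: smooth_tensd; [case: (hC n) => -[]|exact: smooth1_cst].
have sY n : smooth (Y n) by apply: smooth_tensd; [case: (hG n) => -[]|exact: smooth1_cst].
have scn n : smooth (tensd false (cst 1) (cn n)) by rewrite -dX; exact: smooth_cd.
have sdn n : smooth (tensd true (cst 1) (dn n)) by rewrite -dY; exact: smooth_cd.
have [||X0 LX0 cX0] := @line_primitive_cauchy _ true a b c e X (ltW ab) ab2 (ltW ce) sX.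
- by move=> n t; rewrite /X tensd_line; have [[_ ->] _] := hC n; rewrite mul0r.
- by under eq_fun do rewrite dX; exact: (cvn_cauchy rQ (fun n => Lsm _ (scn n)) Lp ccn).
have [||Y0 LY0 cY0] := @line_primitive_cauchy _ false c e a b Y (ltW ce) ce2 (ltW ab) sY.
- by move=> n t; rewrite /Y tensd_line; have [[_ ->] _] := hG n; rewrite mul0r.
- by under eq_fun do rewrite dY; exact: (cvn_cauchy rQ (fun n => Lsm _ (sdn n)) Lq cdn).
have L0 : L2 Q 0 := preip0 PI.
have wX1 : is_wd true Q X0 p.
  apply: (is_wd_cvg rQ (fun n => Lsm _ (sX n)) LX0 Lp _ cX0 ccn) => n.
  by rewrite -dX; exact: is_wd_smooth.
have wX2 : is_wd false Q X0 0.
  apply: (is_wd_cvg rQ (fun n => Lsm _ (sX n)) LX0 L0 _ cX0 (cvn_cst _ _)) => n.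
  by rewrite -(dX' n); exact: is_wd_smooth.
have wY1 : is_wd true Q Y0 0.
  apply: (is_wd_cvg rQ (fun n => Lsm _ (sY n)) LY0 L0 _ cY0 (cvn_cst _ _)) => n.
  by rewrite -(dY' n); exact: is_wd_smooth.
have wY2 : is_wd false Q Y0 q.
  apply: (is_wd_cvg rQ (fun n => Lsm _ (sY n)) LY0 Lq _ cY0 cdn) => n.
  by rewrite -dY; exact: is_wd_smooth.
have LXY := preipD PI LX0 LY0.
have wk1 := is_wdB rQ Ly LXY wy1 (is_wdD rQ LX0 LY0 wX1 wY1).
have wk2 := is_wdB rQ Ly LXY wy2 (is_wdD rQ LX0 LY0 wX2 wY2).
rewrite addr0 subrr in wk1; rewrite add0r subrr in wk2.
(* Without the double primitive [U0] and the one-variable primitives [X0] and [Y0], both weak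
   derivatives of the remainder are 0. *)
have [|k hk] := is_wd_const ab ce (preipB PI Ly LXY); first by case.
have sk : smooth (cst k : R * R -> R).
  have -> : cst k = tens (cst k) (cst 1) by apply/funext => z; rewrite /tens/= mulr1.
  by apply: smooth_tens; exact: smooth1_cst.
have dk d : cd d (cst k : R * R -> R) = 0 by rewrite cd.unlock; apply/funext => z; rewrite derive_cst.
pose un n := U n + (X n + Y n) + cst k.
have sun n : smooth (un n) by apply: smoothD => //; apply: smoothD => //; exact: smoothD.
have dun1 n : cd true (un n) = W n + tensd false (cst 1) (cn n).
  by rewrite /un cdD ?cdD ?dk ?dX ?dY' ?dU ?addr0//; try exact: smoothD; apply: smoothD => //; exact: smoothD.
have dun2 n : cd false (un n) = V n + tensd true (cst 1) (dn n).
  by rewrite /un cdD ?cdD ?dk ?dX' ?dY ?addr0 ?add0r//; try exact: smoothD; apply: smoothD => //; exact: smoothD.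
have LUXY := preipD PI LU0 LXY.
have Lul : L2 Q (U0 + (X0 + Y0) + cst k) by apply: (preipD PI) => //; exact: Lsm.
have LUn n := Lsm _ (sU n); have LXn n := Lsm _ (sX n); have LYn n := Lsm _ (sY n).
have [|||_ _ cun] := @H1_cvg_smooth Q un (U0 + (X0 + Y0) + cst k)
  (fun d => if d then wd true Q u else wd false Q u) rQ sun Lul.
- by case; exact: H1_L2_wd.
- have LXYn n := preipD PI (LXn n) (LYn n); have LUXYn n := preipD PI (LUn n) (LXYn n).
  have cXY := cvnD rQ LXn LX0 LYn LY0 cX0 cY0.
  have cUXY := cvnD rQ LUn LU0 LXYn LXY cU0 cXY.
  exact: (cvnD rQ LUXYn LUXY (fun=> Lsm _ sk) (Lsm _ sk) cUXY (cvn_cst _ _)).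
- case.
    under eq_fun do rewrite dun1.
    have -> : wd true Q u = P1 + p by rewrite /p addrCA subrr addr0.
    exact: (cvnD rQ (fun n => Lsm _ (sW n)) LP1 (fun n => Lsm _ (scn n)) Lp cP1 ccn).
  under eq_fun do rewrite dun2.
  have -> : wd false Q u = P2 + q by rewrite /q addrCA subrr addr0.
  exact: (cvnD rQ (fun n => Lsm _ (sV n)) LP2 (fun n => Lsm _ (sdn n)) Lq cP2 cdn).
exists un; split; [exact: sun| |]; last first.
  apply: cvn_congr csn => n; rewrite dun1 cdD// dW.
  rewrite (@cd_tensd _ false (cst 1) (fun=> 0) _ d1).
  suff -> : tensd false (fun=> 0) (cn n) = 0 by rewrite addr0.
  by apply/funext => z; rewrite /tensd /tens mulr0.
suff -> : (fun n => H1norm Q (un n - u)) = (fun n => H1norm Q (un n - (U0 + (X0 + Y0) + cst k))).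
  exact: cun.
apply/funext => n; apply: H1norm_ae => //.
- exact: (preipB PI (Lsm _ (sun n)) Lu).1.
- exact: (preipB PI (Lsm _ (sun n)) Lul).1.
apply: aeqB; first exact: aeq_refl.
move: hk; apply: ae_onS => z _ h.
have : u z - U0 z - (X0 z + Y0 z) = k by exact: h.
by move=> h'; change (u z = U0 z + (X0 z + Y0 z) + k); rewrite -h'; ring.
Qed.

End Structure.

(** * Traces *)

(** The form whose seminorm is [arc_L2norm]; it makes the pre-Hilbert lemmas available on arcs. *)
HB.lock Definition aq {R : realType} (S : set (R * R)) (f g : R * R -> R) : R :=
  \sum_(l : bool * 'I_3) jq (gridline l @^-1` S) (f \o gridline l) (g \o gridline l).

Lemma ae_imp {R : realType} d (T : measurableType d) (mu : {measure set T -> \bar R})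
    (P Q : T -> Prop) : (forall p, P p -> Q p) -> {ae mu, forall p, P p} -> {ae mu, forall p, Q p}.
Proof. by move=> PQ; apply: filterS. Qed.

Lemma cvg0_le {R : realType} (x y : nat -> R) : (forall n, 0 <= x n <= y n) ->
  y n @[n --> \oo] --> (0 : R) -> x n @[n --> \oo] --> (0 : R).
Proof.
by move=> h cy; apply: cvg_dist_le cy => n; have /andP[x0 xy] := h n; rewrite subr0 ger0_norm.
Qed.

Lemma H1norm_ge0 {R : realType} D (u : R * R -> R) : 0 <= H1norm D u.
Proof. by rewrite H1normE bn_ge0. Qed.

(** * Square-integrable functions on parts of the grid lines *)

Section ArcForms.
Context {R : realType}.
Notation leb := (@lebesgue_measure R).
Notation MR := (measurableTypeR R).
Implicit Types (S : set (R * R)) (u v : R * R -> R).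

Definition arcset S := forall l : bool * 'I_3, measurable (gridline l @^-1` S : set MR).

Lemma aqE S u v : aq S u v =
  \sum_(l : bool * 'I_3) jq (gridline l @^-1` S) (u \o gridline l) (v \o gridline l).
Proof. by rewrite aq.unlock. Qed.

Lemma arc_L2P S u : arc_L2 S u <-> forall l, L2l (gridline l @^-1` S) (u \o gridline l).
Proof.
split=> [[h1 h2] l|h]; first by split; [exact: h1|exact: h2].
by split=> l; have [? ?] := h l.
Qed.

Lemma arc_L2normE S u : arc_L2norm S u = bn (aq S) u.
Proof. by rewrite /arc_L2norm bn.unlock aqE; congr Num.sqrt; apply: eq_bigr => l _; rewrite jqE. Qed.

Lemma aq_preip S : arcset S -> preip (arc_L2 S) (aq S).
Proof.
move=> mS; have P l := jq_preip (mS l).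
split.
- by apply/arc_L2P => l; exact: (preip0 (P l)).
- by move=> k u v /arc_L2P hu /arc_L2P hv; apply/arc_L2P => l; exact: (preipL (P l)).
- by move=> u v /arc_L2P hu /arc_L2P hv; rewrite !aqE; apply: eq_bigr => l _; exact: (preipC (P l)).
- move=> k u v w /arc_L2P hu /arc_L2P hv /arc_L2P hw; rewrite !aqE mulr_sumr -big_split/=.
  by apply: eq_bigr => l _; exact: (preipE (P l)).
- by move=> u /arc_L2P hu; rewrite aqE; apply: sumr_ge0 => l _; exact: (preip_ge0 (P l)).
Qed.

Lemma arc_L2_eq0 S u : arcset S -> arc_L2 S u -> bn (aq S) u = 0 -> arc_ae S (fun p => u p = 0).
Proof.
move=> mS hu u0 l; have PA := aq_preip mS.
have : aq S u u = 0 by rewrite -(sqr_bn PA)// u0 expr0n.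
rewrite aqE => /eqP; rewrite psumr_eq0; last by move=> i _; exact: jq_ge0.
move=> /allP /(_ l); rewrite mem_index_enum => /(_ isT)/= /eqP h.
move/arc_L2P : hu => /(_ l) hul.
have := @nrm_eq0 _ MR R leb (gridline l @^-1` S) (mS l) _ hul.
by apply; rewrite /nrm; move: h; rewrite jqE bn.unlock /ip => ->; rewrite sqrtr0.
Qed.

Lemma arc_aeS S (P Q : R * R -> Prop) : (forall p, S p -> P p -> Q p) -> arc_ae S P -> arc_ae S Q.
Proof. by move=> PQ h l; apply: ae_mono (h l) => t; exact: PQ. Qed.

Lemma arc_aeS2 S (P Q T : R * R -> Prop) : (forall p, S p -> P p -> Q p -> T p) ->
  arc_ae S P -> arc_ae S Q -> arc_ae S T.
Proof. by move=> PQ h h' l; apply: ae_mono2 (h l) (h' l) => t; exact: PQ. Qed.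

Lemma aq_ae S u v w : arcset S -> arc_L2 S u -> arc_measurable S v -> arc_L2 S w ->
  arc_ae S (fun p => u p = v p) -> aq S u w = aq S v w.
Proof.
move=> mS /arc_L2P hu mv /arc_L2P hw uv; rewrite !aqE; apply: eq_bigr => l _.
rewrite !jqE; apply: (@ip_ae _ MR R leb (gridline l @^-1` S) (mS l) _ _ _ (hu l).1 (mv l) (hw l).1).
exact: uv.
Qed.

Lemma arc_L2_ae S u v : arcset S -> arc_L2 S u -> arc_measurable S v ->
  arc_ae S (fun p => u p = v p) -> arc_L2 S v.
Proof.
move=> mS /arc_L2P hu mv uv; apply/arc_L2P => l.
exact: (sqint_ae (mS l) (mv l) (uv l) (hu l)).
Qed.

Lemma gridlineE (l : bool * 'I_3) t : gridline l t = line (~~ l.1) (l.2%:R - 1) t :> R * R.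
Proof. by rewrite /gridline line.unlock; case: l => -[] k. Qed.

(** Stated with a covering up to a null set, so that it serves both to glue zero traces and, with
    [B2] empty, to compare a set with a larger one. *)
Lemma jq_cover (A B1 B2 : set R) f : measurable (A : set MR) -> measurable (B1 : set MR) ->
  measurable (B2 : set MR) -> L2l A f -> L2l B1 f -> L2l B2 f ->
  {ae leb, forall t, A t -> B1 t \/ B2 t} -> jq A f f <= jq B1 f f + jq B2 f f.
Proof.
move=> mA mB1 mB2 hA hB1 hB2 cov.
pose F (B : set R) : MR -> \bar R := (fun t => (f t * f t)%:E) \_ B.
have mF (B : set R) : measurable (B : set MR) -> L2l B f -> measurable_fun setT (F B).
  move=> mB [mf _]; apply/(measurable_restrictT _ mB).
  by apply/measurable_EFinP; exact: measurable_funM.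
have F0 B t : (0 <= F B t)%E.
  by rewrite /F /patch; case: ifP => // _; rewrite lee_fin -expr2 sqr_ge0.
have FE (B : set R) : measurable (B : set MR) -> L2l B f -> (\int[leb]_t F B t = (jq B f f)%:E)%E.
  move=> mB [mf i2]; rewrite -integral_mkcond jqE /Rintegral fineK//.
  by apply: integrable_fin_num => //.
rewrite -lee_fin EFinD -!FE// -ge0_integralD//; try exact: mF.
apply: ae_ge0_le_integral => //; try exact: mF.
- by move=> t _; rewrite adde_ge0.
- by apply: emeasurable_funD; exact: mF.
apply: ae_imp cov => t h _; rewrite {1}/F /patch; case: ifPn => [/set_mem At|_]; last by rewrite adde_ge0.
have [Bt|Bt] := h At.
  by rewrite {1}/F /patch mem_set// leeDl.
by rewrite [X in (_ <= _ + X)%E]/F /patch mem_set// leeDr.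
Qed.

Lemma L2l_continuousS (A : set R) (c e : R) f : measurable (A : set MR) ->
  A `<=` `[c, e] -> continuous f -> L2l A f.
Proof.
move=> mA sA cf; split; first by apply: measurable_funTS; exact: continuous_measurable_fun.
have h : leb.-integrable `[c, e] (EFin \o (fun x => f x ^+ 2)).
  apply: continuous_compact_integrable; first exact: segment_compact.
  by apply: continuous_subspaceT => x; apply: cvgM; exact: cf.
exact: integrableS h.
Qed.

Lemma jq_continuousS (A : set R) (c e : R) f : measurable (A : set MR) ->
  A `<=` `[c, e] -> continuous f -> jq A f f <= jq `]c, e[ f f.
Proof.
move=> mA sA cf.
have cff : continuous (fun x => f x * f x) by move=> x; apply: cvgM; exact: cf.
have mI : measurable (`[c, e]%classic : set MR) := measurable_itv _.
rewrite [leRHS]jqE (@Rintegral_ivl_closed _ (fun x => f x * f x))// -jqE.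
have L0 : L2l set0 f by split; [exact: measurable_fun_set0|exact: integrable_set0].
have LI : L2l `[c, e] f by exact: (@L2l_continuousS _ c e).
have := jq_cover mA mI measurable0 (L2l_continuousS mA sA cf) LI L0.
rewrite [jq set0 _ _]jqE Rintegral_set0 addr0; apply.
by apply: nearW => t /sA; left.
Qed.

End ArcForms.

(** * Traces on parts of the boundary of a rectangle *)

Section Traces.
Context {R : realType}.
Notation leb := (@lebesgue_measure R).
Notation MR := (measurableTypeR R).
Lemma closure_rect_sub (a b c e : R) : closure (rect a b c e) `<=` [set p | a <= p.1 <= b /\ c <= p.2 <= e].
Proof.
have E : [set p : R * R | a <= p.1 <= b /\ c <= p.2 <= e] = (fst @^-1` `[a, b]) `&` (snd @^-1` `[c, e]).
  by apply/seteqP; split=> p /=; rewrite !in_itv.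
have cl : closed [set p : R * R | a <= p.1 <= b /\ c <= p.2 <= e].
  rewrite E; apply: closedI.
    by apply: preimage_closed; [move=> p _; exact: cvg_fst|exact: itv_closed].
  by apply: preimage_closed; [move=> p _; exact: cvg_snd|exact: itv_closed].
rewrite [X in _ `<=` X](closure_id _).1//; apply: closure_subset => p [] /=.
by rewrite !in_itv/= => /andP[h1 h2] /andP[h3 h4]; rewrite !ltW.
Qed.

(** Sides between 1 and 2 cover the subdomains and the whole square, and give the trace and Poincare
    inequalities numerical constants. *)
Definition isbox (D : set (R * R)) : Prop :=
  exists a b c e : R, [/\ 1 <= b - a <= 2, 1 <= e - c <= 2 & D = rect a b c e].

Variable D : set (R * R).
Hypothesis box : isbox D.

Lemma isbox_rect : isrect D.
Proof.
case: box => a [b [c [e [/andP[h _] /andP[h' _] ->]]]].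
by exists a, b, c, e; split=> //; rewrite -subr_ge0 (le_trans ler01).
Qed.

Let rD := isbox_rect.
Let PH := h1form_preip rD.
Implicit Types (S : set (R * R)) (u v g h : R * R -> R) (d : bool).

Lemma box_frame d : exists A B C E : R, [/\ 1 <= B - A <= 2, 1 <= E - C <= 2, D = rectd d A B C E
  & forall s t, closure D (line d s t) -> (A <= s <= B) /\ (C <= t <= E)].
Proof.
case: box => a [b [c [e [b1 b2 ->]]]]; case: d; rewrite line.unlock.
  by exists a, b, c, e; split => // s t /closure_rect_sub.
by exists c, e, a, b; split => // s t /closure_rect_sub[].
Qed.

Definition barc S := S `<=` closure D /\ arcset S.

Lemma barc_line S (l : bool * 'I_3) : barc S -> exists A B C E : R,
  [/\ 1 <= B - A <= 2, 1 <= E - C <= 2, D = rectd (~~ l.1) A B C E, gridline l @^-1` S `<=` `[C, E]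
    & (A <= l.2%:R - 1 <= B) \/ gridline l @^-1` S = set0].
Proof.
move=> [SK mS]; have [A [B [C [E [h1 h2 h3 h4]]]]] := box_frame (~~ l.1).
exists A, B, C, E; split => //.
  by move=> t /SK; rewrite gridlineE => /h4[_]; rewrite /= in_itv.
have [h|h] := pselect (A <= l.2%:R - 1 <= B); [by left|right].
by apply/seteqP; split=> // t /SK; rewrite gridlineE => /h4[].
Qed.

Lemma arc_L2_continuous S u : barc S -> continuous u -> arc_L2 S u.
Proof.
move=> bS cu; apply/arc_L2P => l; have [A [B [C [E [_ _ _ sub _]]]]] := barc_line l bS.
have cl : continuous (u \o gridline l).
  rewrite (_ : _ \o _ = (fun t => u (line (~~ l.1) (l.2%:R - 1) t))); first exact: continuous_line2.
  by apply/funext => t; rewrite /= gridlineE.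
exact: L2l_continuousS (bS.2 l) sub cl.
Qed.

Lemma arc_L2_smooth S u : barc S -> smooth u -> arc_L2 S u.
Proof. by move=> bS /smooth_continuous; exact: arc_L2_continuous. Qed.

(** By [trace_rect] each of the six grid lines contributes at most 4 times the squared H1 norm, and
    24 is at most the square of 5. *)
Lemma aq_le_H1 S u : barc S -> smooth u -> bn (aq S) u <= 5 * H1norm D u.
Proof.
move=> bS su; have hu := H1_smooth rD su; have PI := L2_preip rD.
have PA := aq_preip bS.2; have Lu := arc_L2_smooth bS su.
rewrite -(ler_pXn2r (n:=2)) ?nnegrE ?mulr_ge0 ?bn_ge0// ?H1normE ?bn_ge0//.
rewrite (sqr_bn PA)// exprMn (sqr_bn PH)//.
have key l : jq (gridline l @^-1` S) (u \o gridline l) (u \o gridline l) <= 4 * h1form D u u.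
  have [A [B [C [E [h1 h2 h3 sub h]]]]] := barc_line l bS.
  have pos v : L2 D v -> 0 <= iq D v v by move=> hv; exact: (preip_ge0 PI).
  have q0 := pos _ (H1_L2 hu); have q1 := pos _ (H1_L2_wd true hu); have q2 := pos _ (H1_L2_wd false hu).
  case: h => [hs|->]; last first.
    by rewrite jqE Rintegral_set0 /h1form; apply: mulr_ge0 => //; rewrite !addr_ge0.
  have cl := @continuous_line2 R (~~ l.1) (l.2%:R - 1) _ (smooth_continuous su).
  have E1 : u \o gridline l = (fun t => u (line (~~ l.1) (l.2%:R - 1) t)).
    by apply/funext => t; rewrite /= gridlineE.
  rewrite E1; apply: le_trans (jq_continuousS (bS.2 l) sub cl) _.
  apply: le_trans (@trace_rect R (~~ l.1) A B C E u _ h1 su hs) _; rewrite -h3.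
  have wE d : iq D (cd d u) (cd d u) = iq D (wd d D u) (wd d D u).
    have w := wd_smooth d rD su.
    have m1 := (H1_L2_wd d hu).1; have m2 := (L2_smooth rD (smooth_cd d su)).1.
    by rewrite -(iq_ae rD m1 m2 m2 w) (preipC PI (H1_L2_wd d hu) (L2_smooth rD (smooth_cd d su)))
      -(iq_ae rD m1 m2 m1 w).
  rewrite wE /h1form; move: q0 q1 q2; case: (~~ l.1); clear;
    move: (iq _ u u) (iq _ (wd true _ _) _) (iq _ (wd false _ _) _) => x y z; lra.
rewrite aqE; apply: (@le_trans _ _ (\sum_(l : bool * 'I_3) 4 * h1form D u u)).
  by apply: ler_sum => l _; exact: key.
have := preip_ge0 PH hu; rewrite sumr_const card_prod card_bool card_ord -[(_ *+ _)]mulr_natl.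
move: (h1form D u u) => x x0; rewrite mulrA; apply: ler_wpM2r => //.
by rewrite -!natrM -natrX ler_nat.
Qed.

Lemma trace_ofP S u g : trace_of D S u g <-> [/\ H1 D u, arc_L2 S g & exists phi : nat -> R * R -> R,
  [/\ forall n, smooth (phi n), H1norm D (phi n - u) @[n --> \oo] --> (0 : R)
    & bn (aq S) (phi n - g) @[n --> \oo] --> (0 : R)]].
Proof.
split=> -[hu hg [phi [h1 h2 h3]]]; split=> //; exists phi; split=> //.
  by have -> : (fun n => bn (aq S) (phi n - g)) = (fun n => arc_L2norm S (phi n \- g))
    by apply/funext => n; rewrite arc_L2normE.
by have -> : (fun n => arc_L2norm S (phi n \- g)) = (fun n => bn (aq S) (phi n - g))
    by apply/funext => n; rewrite arc_L2normE.
Qed.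

Lemma cvgK0 (k : R) (x : nat -> R) : x n @[n --> \oo] --> (0 : R) -> k * x n @[n --> \oo] --> (0 : R).
Proof. by move=> h; rewrite -(mulr0 k); apply: cvgM => //; exact: cvg_cst. Qed.

Lemma H1norm_cvg_sub u (phi psi : nat -> R * R -> R) : (forall n, smooth (phi n)) ->
  (forall n, smooth (psi n)) -> H1 D u ->
  H1norm D (phi n - u) @[n --> \oo] --> (0 : R) -> H1norm D (psi n - u) @[n --> \oo] --> (0 : R) ->
  H1norm D (phi n - psi n) @[n --> \oo] --> (0 : R).
Proof.
move=> s1 s2 hu c1 c2; apply: cvg0_le (cvgD0 c1 c2) => n.
have h1 := H1_smooth rD (s1 n); have h2 := H1_smooth rD (s2 n).
rewrite H1norm_ge0 /=.
by have := bnB_le PH h1 hu h2; rewrite (bnBC PH hu h2) -!H1normE.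
Qed.

(** The continuity bound [aq_le_H1] makes the limit on the arc independent of the smooth sequence.
    Hence traces are unique, and one sequence can serve several arcs. *)
Lemma trace_cvg S u g (phi : nat -> R * R -> R) : barc S -> trace_of D S u g ->
  (forall n, smooth (phi n)) -> H1norm D (phi n - u) @[n --> \oo] --> (0 : R) ->
  bn (aq S) (phi n - g) @[n --> \oo] --> (0 : R).
Proof.
move=> bS /trace_ofP[hu hg [psi [s2 c2 cg]]] s1 c1.
have cc := H1norm_cvg_sub s1 s2 hu c1 c2; have PA := aq_preip bS.2.
apply: cvg_dist_le (cvgD0 (cvgK0 5 cc) cg) => n; rewrite subr0 ger0_norm ?bn_ge0//.
have L1 := arc_L2_smooth bS (s1 n); have L2' := arc_L2_smooth bS (s2 n).
apply: le_trans (bnB_le PA L1 L2' hg) _; rewrite lerD2r.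
by apply: aq_le_H1 => //; exact: smoothB.
Qed.

Lemma trace_unique S u g h : barc S -> trace_of D S u g -> trace_of D S u h ->
  arc_ae S (fun p => g p = h p).
Proof.
move=> bS tg th; have /trace_ofP[hu hg [phi [s1 c1 cg]]] := tg; have /trace_ofP[_ hh _] := th.
have ch := trace_cvg bS th s1 c1; have PA := aq_preip bS.2.
have : arc_ae S (fun p => (g - h) p = 0).
  apply: arc_L2_eq0; [exact: bS.2|exact: (preipB PA)|].
  have l1 : (fun=> bn (aq S) (g - h) : R) @ \oo --> (0 : R).
    apply: cvg_dist_le (cvgD0 cg ch) => n; rewrite subr0 ger0_norm ?bn_ge0//.
    have L1 := arc_L2_smooth bS (s1 n).
    by rewrite (bnBC PA L1 hg); exact: (bnB_le PA).
  by apply: (cvg_unique _ _ l1) => //; exact: cvg_cst.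
by apply: arc_aeS => p _ h0; apply/eqP; rewrite -subr_eq0; apply/eqP.
Qed.

Lemma trace_ae S u g h : barc S -> trace_of D S u g -> arc_measurable S h ->
  arc_ae S (fun p => g p = h p) -> trace_of D S u h.
Proof.
move=> bS /trace_ofP[hu hg [phi [s1 c1 cg]]] mh gh; have PA := aq_preip bS.2.
have hh := arc_L2_ae bS.2 hg mh gh.
apply/trace_ofP; split=> //; exists phi; split=> //.
suff -> : (fun n => bn (aq S) (phi n - h)) = (fun n => bn (aq S) (phi n - g)) by [].
apply/funext => n; have Lp := arc_L2_smooth bS (s1 n).
have L1 := preipB PA Lp hg; have L2' := preipB PA Lp hh.
have E : arc_ae S (fun p => (phi n - g) p = (phi n - h) p).
  by apply: arc_aeS gh => p _ gh; change (phi n p - g p = phi n p - h p); rewrite gh.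
rewrite bn.unlock (aq_ae bS.2 L1 L2'.1 L1 E) (preipC PA L2' L1).
by rewrite (aq_ae bS.2 L1 L2'.1 L2' E).
Qed.

Lemma H1norm_lin (k : R) u v u' v' : H1 D u -> H1 D v -> H1 D u' -> H1 D v' ->
  H1norm D ((k *: u + v) - (k *: u' + v')) <= `|k| * H1norm D (u - u') + H1norm D (v - v').
Proof.
move=> hu hv hu' hv'; rewrite !H1normE.
have -> : (k *: u + v) - (k *: u' + v') = k *: (u - u') + (v - v').
  by rewrite scalerBr opprD addrACA.
by rewrite -(bnZ PH); [apply: (bnD PH); [apply: (preipZ PH)|]|]; exact: (preipB PH).
Qed.

Lemma trace_lin S (k : R) u v g h : barc S -> trace_of D S u g -> trace_of D S v h ->
  trace_of D S (k *: u + v) (k *: g + h).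
Proof.
move=> bS /trace_ofP[hu hg [phi [s1 c1 cg]]] /trace_ofP[hv hh [psi [s2 c2 ch]]].
have PA := aq_preip bS.2.
apply/trace_ofP; split; [exact: H1L|exact: (preipL PA)|].
exists (fun n => k *: phi n + psi n); split.
- by move=> n; exact: smoothL.
- apply: cvg_dist_le (cvgD0 (cvgK0 `|k| c1) c2) => n.
  rewrite subr0 ger0_norm; last by rewrite H1normE bn_ge0.
  by apply: H1norm_lin => //; apply: H1_smooth.
- apply: cvg_dist_le (cvgD0 (cvgK0 `|k| cg) ch) => n.
  rewrite subr0 ger0_norm ?bn_ge0//.
  have L1 := arc_L2_smooth bS (s1 n); have L2' := arc_L2_smooth bS (s2 n).
  have -> : (k *: phi n + psi n) - (k *: g + h) = k *: (phi n - g) + (psi n - h).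
    by rewrite scalerBr opprD addrACA.
  by rewrite -(bnZ PA); [apply: (bnD PA); [apply: (preipZ PA)|]|]; exact: (preipB PA).
Qed.

Lemma trace_sub S u v g h : barc S -> trace_of D S u g -> trace_of D S v h ->
  trace_of D S (u - v) (g - h).
Proof.
move=> bS tu tv; have := trace_lin (-1) bS tv tu.
by rewrite !scaleN1r addrC [- h + g]addrC.
Qed.

Lemma trace_restrict S S' u g : S' `<=` S -> barc S -> barc S' -> trace_of D S u g ->
  trace_of D S' u g.
Proof.
move=> SS bS bS' /trace_ofP[hu hg [phi [s1 c1 cg]]].
have PA := aq_preip bS.2; have PA' := aq_preip bS'.2.
have sub l : gridline l @^-1` S' `<=` gridline l @^-1` S by move=> t /SS.
have hg' : arc_L2 S' g.
  move/arc_L2P : hg => hg; apply/arc_L2P => l; have [m i] := hg l; split.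
    apply: measurable_funS m; [exact: (bS.2 l)|exact: sub].
  apply: integrableS i => //; [exact: (bS.2 l)|exact: (bS'.2 l)].
apply/trace_ofP; split=> //; exists phi; split=> //.
apply: cvg_dist_le cg => n; rewrite subr0 ger0_norm ?bn_ge0//; apply: bn_le.
have Lp := arc_L2_smooth bS (s1 n); have Lp' := arc_L2_smooth bS' (s1 n).
have /arc_L2P L1 := preipB PA Lp hg; have /arc_L2P L2' := preipB PA' Lp' hg'.
rewrite !aqE; apply: ler_sum => l _.
have L0 f : L2l (set0 : set R) f by split; [exact: measurable_fun_set0|exact: integrable_set0].
have := jq_cover (bS'.2 l) (bS.2 l) measurable0 (L2' l) (L1 l) (L0 _).
rewrite [jq set0 _ _]jqE Rintegral_set0 addr0; apply.
by apply: nearW => t /sub; left.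
Qed.

(** By [trace_cvg], a sequence that witnesses the zero trace on [S1] also tends to 0 on [S2], and
    [jq_cover] adds the two pieces on each grid line. *)
Lemma trace0_union S S1 S2 u : barc S -> barc S1 -> barc S2 ->
  arc_ae S (fun p => S1 p \/ S2 p) ->
  trace_of D S1 u (cst 0) -> trace_of D S2 u (cst 0) -> trace_of D S u (cst 0).
Proof.
move=> bS bS1 bS2 cov t1 t2; have /trace_ofP[hu _ [phi [s1 c1 cg1]]] := t1.
have cg2 := trace_cvg bS2 t2 s1 c1.
have PA := aq_preip bS.2.
apply/trace_ofP; split=> //; first exact: (preip0 PA).
exists phi; split=> //.
apply: cvg_dist_le (cvgD0 cg1 cg2) => n; rewrite subr0 ger0_norm ?bn_ge0//.
rewrite -[cst 0]/(0 : R * R -> R) !subr0.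
have PA1 := aq_preip bS1.2; have PA2 := aq_preip bS2.2.
have L := arc_L2_smooth bS (s1 n); have L1 := arc_L2_smooth bS1 (s1 n); have L2' := arc_L2_smooth bS2 (s1 n).
rewrite -(ler_pXn2r (n:=2)) ?nnegrE ?addr_ge0 ?bn_ge0//.
apply: (@le_trans _ _ (bn (aq S1) (phi n) ^+ 2 + bn (aq S2) (phi n) ^+ 2)).
  rewrite (sqr_bn PA)// (sqr_bn PA1)// (sqr_bn PA2)// !aqE -big_split/=.
  move/arc_L2P : L => L; move/arc_L2P : L1 => L1; move/arc_L2P : L2' => L2'.
  apply: ler_sum => l _; apply: jq_cover; [exact: (bS.2 l)|exact: (bS1.2 l)|exact: (bS2.2 l)|
    exact: L|exact: L1|exact: L2'|exact: cov].
have := bn_ge0 (aq S1) (phi n); have := bn_ge0 (aq S2) (phi n).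
by move: (bn _ _) (bn _ _) => x y x0 y0; rewrite sqrrD; nra.
Qed.

(** A diagonal argument: each [un n] is replaced by a smooth function within [n.+1^-1] of it, in the
    H1 norm and on the arc. *)
Lemma trace0_closed S (un : nat -> R * R -> R) u : barc S -> (forall n, trace_of D S (un n) (cst 0)) ->
  H1 D u -> H1norm D (un n - u) @[n --> \oo] --> (0 : R) -> trace_of D S u (cst 0).
Proof.
move=> bS tn hu cu; have PA := aq_preip bS.2.
have /choice[phi hphi] n : exists f, [/\ smooth f, H1norm D (f - un n) <= n.+1%:R^-1 & bn (aq S) f <= n.+1%:R^-1].
  have /trace_ofP[hun _ [phi [s1 /cvgrPdist_lt c1 /cvgrPdist_lt c2]]] := tn n.
  have n0 : 0 < n.+1%:R^-1 :> R by rewrite invr_gt0.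
  have [N1 _ h1] := c1 _ n0; have [N2 _ h2] := c2 _ n0.
  have := h1 (maxn N1 N2); have := h2 (maxn N1 N2) => /=.
  rewrite leq_maxl leq_maxr => /(_ isT) h3 /(_ isT) h4.
  exists (phi (maxn N1 N2)); split=> //.
    by rewrite sub0r normrN in h4; apply: le_trans (ler_norm _) (ltW h4).
  rewrite sub0r normrN -[cst 0]/(0 : R * R -> R) subr0 in h3.
  exact: le_trans (ler_norm _) (ltW h3).
have cn : (n.+1%:R^-1 : R) @[n --> \oo] --> (0 : R) by exact: cvg_harmonic.
apply/trace_ofP; split=> //; first exact: (preip0 PA).
exists phi; split.
- by move=> n; have [] := hphi n.
- apply: cvg_dist_le (cvgD0 cn cu) => n; rewrite subr0 ger0_norm; last by rewrite H1normE bn_ge0.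
  have [s h _] := hphi n; have /trace_ofP[hun _ _] := tn n.
  have := bnB_le PH (H1_smooth rD s) hun hu; rewrite -!H1normE => h'.
  by apply: le_trans h' _; rewrite lerD2r.
- apply: cvg_dist_le cn => n; rewrite subr0 ger0_norm ?bn_ge0// -[cst 0]/(0 : R * R -> R) subr0.
  by have [] := hphi n.
Qed.

(* Traces exist on any set meeting a single grid line; this spares the case
   of functions prescribed on several lines, which cross. *)
Lemma trace_exists S S' u g (l0 : bool * 'I_3) : barc S -> trace_of D S' u g ->
  (forall l, l != l0 -> gridline l @^-1` S = set0) -> exists h, trace_of D S u h.
Proof.
move=> bS /trace_ofP[hu _ [phi [s1 c1 _]]] hl; have PA := aq_preip bS.2.
have LS n := arc_L2_smooth bS (s1 n).
have cphi : bn_cauchy (h1form D) phi.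
  apply: (bn_cvg_cauchy PH (fun n => H1_smooth rD (s1 n)) hu).
  by under eq_fun do rewrite -H1normE.
pose f n := phi n \o gridline l0.
have aqS v w : aq S v w = jq (gridline l0 @^-1` S) (v \o gridline l0) (w \o gridline l0).
  rewrite aqE (bigD1 l0)//= big1 ?addr0// => l ll.
  by rewrite hl// jqE Rintegral_set0.
have Lf n : L2l (gridline l0 @^-1` S) (f n) by move/arc_L2P : (LS n); exact.
have K5 : 0 < 5 :> R by [].
have cf : bn_cauchy (jq (gridline l0 @^-1` S)) f.
  apply: (bn_cauchy_leK K5) cphi => m n.
  have -> : bn (jq (gridline l0 @^-1` S)) (f m - f n) = bn (aq S) (phi m - phi n).
    by rewrite bn.unlock aqS.
  by rewrite -H1normE; apply: aq_le_H1 => //; exact: smoothB.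
have [A [B [C [E [_ _ _ sub _]]]]] := barc_line l0 bS.
have fin : (leb (gridline l0 @^-1` S) < +oo)%E.
  apply: (@le_lt_trans _ _ (leb `[C, E])); last first.
    by rewrite lebesgue_measure_itv/=; case: ifP; rewrite ?ltry// -EFinB ltry.
  by apply: le_measure => //; rewrite inE; [exact: (bS.2 l0)|exact: measurable_itv].
have [h Lh ch] := L2l_complete (bS.2 l0) fin Lf cf.
pose g' (p : R * R) := h (if l0.1 then p.1 else p.2).
have gE : g' \o gridline l0 = h.
  by apply/funext => t; rewrite /g' /= /gridline; case: l0.1.
have Lg : arc_L2 S g'.
  apply/arc_L2P => l; have [->|/hl ->] := eqVneq l l0; first by rewrite gE.
  by split; [exact: measurable_fun_set0|exact: integrable_set0].
exists g'; apply/trace_ofP; split=> //; exists phi; split=> //.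
suff -> : (fun n => bn (aq S) (phi n - g')) = (fun n => bn (jq (gridline l0 @^-1` S)) (f n - h)) by [].
by apply/funext => n; rewrite bn.unlock aqS -gE.
Qed.

(** [poincare_rect] for the smooth approximations of [u], whose term on the grid line tends to 0.
    One full segment normal to [d] in [S] is enough. *)
Lemma trace0_poincare S u d (A B C E : R) (l : bool * 'I_3) : barc S -> trace_of D S u (cst 0) ->
  A <= B -> B - A <= 2 -> D = rectd d A B C E -> ~~ l.1 = d -> A <= l.2%:R - 1 <= B ->
  `]C, E[ `<=` gridline l @^-1` S -> nm D u <= 3 * nm D (wd d D u).
Proof.
move=> bS tu AB h1' h3 ld sl hl; have /trace_ofP[hu _ [phi [s1 c1 cg]]] := tu.
have PI := L2_preip rD; have PA := aq_preip bS.2.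
have [k0 k1] := cvn_cd_wd d rD s1 hu c1.
have Lp n := L2_smooth rD (s1 n); have Ldp n := L2_smooth rD (smooth_cd d (s1 n)).
have n0 := cvg_bn PI Lp (H1_L2 hu) k0; have n1 := cvg_bn PI Ldp (H1_L2_wd d hu) k1.
rewrite -!/(nm _ _) in n0 n1.
have bound n : nm D (phi n) <= 2 * bn (aq S) (phi n - cst 0) + 3 * nm D (cd d (phi n)).
  have := @poincare_rect R d A B C E _ _ AB h1' (s1 n) sl; rewrite -h3.
  rewrite -(sqr_bn PI (Lp n)) -(sqr_bn PI (Ldp n)) -!/(nm _ _).
  rewrite -[cst 0]/(0 : R * R -> R) subr0.
  have LS := arc_L2_smooth bS (s1 n).
  have le1 : jq `]C, E[ (fun t => phi n (line d (l.2%:R - 1) t)) (fun t => phi n (line d (l.2%:R - 1) t))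
      <= bn (aq S) (phi n) ^+ 2.
    rewrite (sqr_bn PA)// aqE (bigD1 l)//=.
    apply: (@le_trans _ _ (jq (gridline l @^-1` S) (phi n \o gridline l) (phi n \o gridline l))); last first.
      by rewrite lerDl; apply: sumr_ge0 => i _; exact: jq_ge0.
    have E1 : phi n \o gridline l = (fun t => phi n (line d (l.2%:R - 1) t)).
      by apply/funext => t; rewrite /= gridlineE ld.
    have mI : measurable (`]C, E[%classic : set MR) := measurable_itv _.
    have cl := @continuous_line2 R d (l.2%:R - 1) _ (smooth_continuous (s1 n)).
    have LC := L2l_continuous C E cl.
    have L0 : L2l (set0 : set R) (phi n \o gridline l) by split; [exact: measurable_fun_set0|exact: integrable_set0].
    rewrite -E1 in LC *.
    have := jq_cover mI (bS.2 l) measurable0 LC (_ : L2l _ (phi n \o gridline l)) L0.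
    rewrite [jq set0 _ _]jqE Rintegral_set0 addr0; apply; first by move/arc_L2P : LS; exact.
    by apply: nearW => t /hl; left.
  have p1 : 0 <= nm D (phi n) := bn_ge0 _ _; have p2 : 0 <= nm D (cd d (phi n)) := bn_ge0 _ _.
  have p3 := bn_ge0 (aq S) (phi n).
  move: le1 p1 p2 p3; clear; move: (nm _ _) (nm _ _) (bn _ _) (jq _ _ _) => x y z j jz x0 y0 z0 h.
  rewrite leNgt; apply/negP => h4.
  have : (2 * z + 3 * x) ^+ 2 < y ^+ 2 by rewrite ltr_pXn2r// ?nnegrE ?addr_ge0 ?mulr_ge0//.
  have := mulr_ge0 y0 z0; move: jz h; rewrite !expr2; nra.
have lim : (2 * bn (aq S) (phi n - cst 0) + 3 * nm D (cd d (phi n))) @[n --> \oo] -->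
    3 * nm D (wd d D u).
  rewrite -[X in _ --> X]add0r; apply: cvgD; first exact: cvgK0.
  by apply: cvgM; [exact: cvg_cst|exact: n1].
by apply: (ler_cvg_to n0 lim); apply: nearW => n; exact: bound.
Qed.

End Traces.

(** * Smooth approximation in H2 *)

Section SmoothLimits.
Context {R : realType}.
Notation leb := (@lebesgue_measure R).
Notation MR := (measurableTypeR R).
Implicit Types (u v r : R * R -> R) (d : bool) (D S : set (R * R)).

(* Agmon's inequality: the mixed second derivative is the only one needed. *)
Lemma sup_bound D u x : isbox D -> smooth u -> closure D x ->
  `|u x| <= 4 * (nm D u + nm D (cd true u) + nm D (cd false u) + nm D (cd false (cd true u))).
Proof.
move=> [a [b [c [e [b1 b2 DE]]]]] su; rewrite {1}DE => /closure_rect_sub[xa yc].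
have rD : isrect D by apply: isbox_rect; exists a, b, c, e.
have PI := L2_preip rD.
have s1 := smooth_cd true su; have s2 := smooth_cd false su; have s12 := smooth_cd false s1.
have c0 := smooth_continuous su; have c1 := smooth_continuous s1.
have H : u x ^+ 2 <= 2 * (2 * iq D u u + 4 * iq D (cd false u) (cd false u))
   + 4 * (2 * iq D (cd true u) (cd true u) + 4 * iq D (cd false (cd true u)) (cd false (cd true u))).
  have xE : x = line true x.1 x.2 by rewrite line.unlock; case: (x).
  rewrite [in leLHS]xE.
  apply: le_trans (@trace_line _ a b (fun s => u (line true s x.2)) (fun s => cd true u (line true s x.2)) x.1
     b1 (fun s => @is_derive_line _ true s x.2 _ su) (@continuous_line _ true x.2 _ c1) xa) _.
  have lE (f : R * R -> R) : (fun s => f (line true s x.2)) = (fun s => f (line false x.2 s)).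
    by apply/funext => s; rewrite line.unlock.
  rewrite lE [X in 4 * jq _ X _]lE [X in 4 * jq _ _ X]lE DE.
  have h1 := @trace_rect R false c e a b _ _ b2 su yc.
  have h2 := @trace_rect R false c e a b _ _ b2 s1 yc.
  apply: lerD.
    by rewrite ler_pM2l//; exact: h1.
  by rewrite ler_pM2l//; exact: h2.
have p0 := bn_ge0 (iq D) u; have p1 := bn_ge0 (iq D) (cd true u).
have p2 := bn_ge0 (iq D) (cd false u); have p3 := bn_ge0 (iq D) (cd false (cd true u)).
move: H; rewrite -!(sqr_bn PI) /nm; [|exact: L2_smooth|exact: L2_smooth|exact: L2_smooth|exact: L2_smooth].
move=> H; rewrite -(ler_pXn2r (n:=2)) ?nnegrE ?mulr_ge0 ?addr_ge0// (real_normK (num_real (u x))).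
move: H p0 p1 p2 p3; move: (bn _ _) (bn _ _) (bn _ _) (bn _ _) => x1 x2 x3 x4; clear.
move: (u x ^+ 2) => y h y1 y2 y3 y4; apply: le_trans h _.
have := mulr_ge0 y1 y2; have := mulr_ge0 y1 y3; have := mulr_ge0 y1 y4.
have := mulr_ge0 y2 y3; have := mulr_ge0 y2 y4; have := mulr_ge0 y3 y4.
by rewrite !expr2; nra.
Qed.

Lemma L2l_bounded (A : set R) (C E M : R) (f : R -> R) : measurable (A : set MR) -> A `<=` `[C, E] ->
  C <= E -> E - C <= 2 -> measurable_fun (A : set MR) f -> (forall t, A t -> `|f t| <= M) ->
  L2l A f /\ jq A f f <= 2 * M ^+ 2.
Proof.
move=> mA sA CE CE2 mf fM.
have fin : (leb A <= 2%:E)%E.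
  apply: (@le_trans _ _ (leb `[C, E])).
    by apply: le_measure => //; rewrite inE.
  rewrite lebesgue_measure_itv/=; case: ifP => _; last by rewrite lee_fin.
  by rewrite -EFinB lee_fin.
have fM2 t : A t -> f t * f t <= M ^+ 2.
  move=> /fM h; rewrite -expr2 -(real_normK (num_real (f t))) ler_pXn2r ?nnegrE//.
  exact: le_trans h.
have iM : leb.-integrable A (EFin \o (fun=> M ^+ 2)).
  apply: measurable_bounded_integrable => //; first exact: le_lt_trans fin (ltry _).
  exists (M ^+ 2); split; first exact: num_real.
  by move=> x Mx t _; apply: le_trans (ltW Mx); rewrite ger0_norm ?sqr_ge0.
have iff : leb.-integrable A (EFin \o (fun t => f t * f t)).
  apply: (le_integrable mA _ _ iM).
    by apply/measurable_EFinP; exact: measurable_funM.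
  move=> t At; rewrite lee_fin ger0_norm; last by rewrite -expr2 sqr_ge0.
  by rewrite ger0_norm ?sqr_ge0//; exact: fM2.
split; first by split.
rewrite jqE; apply: (@le_trans _ _ (\int[leb]_(t in A) M ^+ 2)).
  by apply: le_Rintegral => // t At; exact: fM2.
rewrite Rintegral_cst// mulrC ler_wpM2r ?sqr_ge0//.
by rewrite -lee_fin fineK// ge0_fin_numE// (le_lt_trans fin) ?ltry.
Qed.

(** For smooth [zn], the limit [z] is a pointwise defined continuous function up to the boundary;
    this is how the continuous representative of an H2 function is carried around. *)
Definition unif D (zn : nat -> R * R -> R) (z : R * R -> R) : Prop :=
  exists2 dl : nat -> R, dl n @[n --> \oo] --> (0 : R) &
    forall (n : nat) (p : R * R), closure D p -> `|zn n p - z p| <= dl n.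

Lemma unifS D D' zn z : D' `<=` D -> unif D zn z -> unif D' zn z.
Proof. by move=> DD [dl d0 h]; exists dl => // n p /(closure_subset DD); exact: h. Qed.

Lemma unif_pointwise D zn z p : unif D zn z -> closure D p -> zn n p @[n --> \oo] --> z p.
Proof. by move=> [dl d0 h] Dp; apply: cvg_dist_le d0 => n; exact: h. Qed.

Lemma unif_continuous D zn z : (forall n, continuous (zn n)) -> unif D zn z ->
  {within closure D, continuous z}.
Proof.
move=> cz [dl d0 h]; apply/continuous_within_itvP || idtac.
apply/subspace_continuousP => p Dp; apply/cvgrPdist_lt => eps e0.
have e3 : 0 < eps / 3 by rewrite divr_gt0.
move/cvgrPdist_lt : d0 => /(_ _ e3)[N _ /(_ N (leqnn N))] /=; rewrite sub0r normrN => dN.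
have {}dN : dl N < eps / 3 by exact: le_lt_trans (ler_norm _) dN.
have /cvgrPdist_lt/(_ _ e3) cN := cz N p.
change (\forall q \near p, closure D q -> `|z p - z q| < eps).
apply: filterS cN => q h3 Dq.
have h1 := h N p Dp; have h2 := h N q Dq.
move: h1 h2 h3 dN; rewrite !ltr_norml !ler_norml; clear.
move: (zn N p) (zn N q) (z p) (z q) (dl N) => x1 x2 x3 x4 x5.
by move=> /andP[? ?] /andP[? ?] /andP[? ?] ?; apply/andP; split; lra.
Qed.

Lemma cvg_H1_L2 D (zn : nat -> R * R -> R) z : isrect D -> (forall n, smooth (zn n)) -> H1 D z ->
  H1norm D (zn n - z) @[n --> \oo] --> (0 : R) -> cvn D zn z.
Proof. by move=> rD sz hz cz; have [] := cvn_cd_wd true rD sz hz cz. Qed.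

(** Fatou's lemma for [zn n - z], which tends pointwise to [z' - z], makes the norm of the latter
    smaller than every [eps]. *)
Lemma unif_aeq D zn z z' : isbox D -> (forall n, smooth (zn n)) -> L2 D z -> cvn D zn z ->
  unif D zn z' -> L2 D z' /\ aeq D z z'.
Proof.
move=> bD sz Lz cz uz; have rD := isbox_rect bD; have PI := L2_preip rD.
have Lzn n := L2_smooth rD (sz n).
have key eps : 0 < eps -> sqint mu2 (D : set (RR R)) (z' - z) /\ nrm mu2 (D : set (RR R)) (z' - z) <= eps.
  move=> e0; apply: (@fatou_sqint _ (RR R) R mu2 D (isrect_measurable rD)
    (fun n => zn n - z)).
  - by move=> n; exact: (preipB PI).
  - exact: ltW.
  - move=> p Dp; apply: cvgB; last exact: cvg_cst.
    by apply: (unif_pointwise uz); exact: subset_closure.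
  - move/cvgrPdist_lt : cz => /(_ _ e0); apply: filterS => n.
    rewrite sub0r normrN => h; apply: ltW; apply: le_lt_trans (ler_norm _) _.
    by move: h; rewrite /nm iq.unlock.
have Lzz : L2 D (z' - z) := (key 1 ltr01).1.
have Lz' : L2 D z' by have := preipD PI Lzz Lz; rewrite subrK.
split=> //.
have : aeq D (z' - z) (cst 0).
  apply: nm_eq0 => //; apply/eqP; rewrite eq_le bn_ge0 andbT /nm iq.unlock.
  by apply/ler_addgt0Pl => eps e0; rewrite addr0; exact: (key eps e0).2.
by apply: ae_onS => p _ h; apply/esym/eqP; rewrite -subr_eq0; apply/eqP.
Qed.

(** Uniform convergence on the closure gives convergence in L2 of every arc: each of the six lines
    contributes at most [2 * dl n ^+ 2], and 12 is at most the square of 4. *)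
Lemma unif_trace D S zn z z' : isbox D -> barc D S -> (forall n, smooth (zn n)) -> H1 D z ->
  H1norm D (zn n - z) @[n --> \oo] --> (0 : R) -> unif D zn z' -> trace_of D S z z'.
Proof.
move=> bD bS sz hz cz uz; have [dl d0 h] := uz; have PA := aq_preip bS.2.
have LS n := arc_L2_smooth bD bS (sz n).
have key n l : L2l (gridline l @^-1` S) ((zn n - z') \o gridline l) /\
   jq (gridline l @^-1` S) ((zn n - z') \o gridline l) ((zn n - z') \o gridline l) <= 2 * (dl n) ^+ 2.
  have [A [B [C [E [_ /andP[h1 h2] _ sub _]]]]] := barc_line bD l bS.
  have CE : C <= E by rewrite -subr_ge0 (le_trans ler01).
  apply: (@L2l_bounded _ C E) => //; first exact: (bS.2 l).
    apply: (@measurable_fun_cvg _ MR R (gridline l @^-1` S) (fun m => (zn n - zn m) \o gridline l)).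
      move=> m; have /arc_L2P/(_ l) := preipB PA (LS n) (LS m); by case.
    move=> t St; apply: cvgB; first exact: cvg_cst.
    by apply: (unif_pointwise uz); exact: (bS.1 _ St).
  by move=> t St; apply: h; exact: (bS.1 _ St).
have Ld n : arc_L2 S (zn n - z') by apply/arc_L2P => l; exact: (key n l).1.
have Lz' : arc_L2 S z'.
  have := preipB PA (LS 0%N) (Ld 0%N).
  by rewrite opprB addrCA subrr addr0.
apply/trace_ofP; split=> //; exists zn; split=> //.
apply: (@cvg_dist_le _ _ (fun n => 4 * dl n)); last exact: cvgK0.
move=> n; rewrite subr0 ger0_norm ?bn_ge0//.
have dl0 : 0 <= dl n.
  have [a [b [c [e [/andP[h1 _] /andP[h2 _] DE]]]]] := bD.
  apply: le_trans (normr_ge0 _) (h n ((a + b) / 2, (c + e) / 2) _).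
  apply: subset_closure; rewrite DE; split; rewrite /= in_itv/=; apply/andP; split; lra.
rewrite -(ler_pXn2r (n:=2)) ?nnegrE ?mulr_ge0 ?bn_ge0// (sqr_bn PA)// aqE.
apply: (@le_trans _ _ (\sum_(l : bool * 'I_3) 2 * dl n ^+ 2)).
  by apply: ler_sum => l _; exact: (key n l).2.
rewrite sumr_const card_prod card_bool card_ord -[(_ *+ _)]mulr_natl mulrA exprMn.
by apply: ler_wpM2r; rewrite ?sqr_ge0// -!natrM -natrX ler_nat.
Qed.

Lemma H2P D u : H2 D u <-> H1 D u /\ forall d, H1 D (wd d D u).
Proof.
split=> [[h1 h2 h3]|[h1 h]]; first by split=> // -[]; rewrite ?wd1 ?wd2.
by split=> //; [rewrite -wd1|rewrite -wd2]; exact: h.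
Qed.

(** [sup_bound] applied to differences makes the sequence of [mixed_approx] uniformly Cauchy. The
    convergence of the mixed derivatives is kept in the conclusion for the sake of the lift of the
    Dirichlet datum. *)
Lemma H2_approx D z : isbox D -> H2 D z -> exists (zn : nat -> R * R -> R) z', [/\ forall n, smooth (zn n),
  H1norm D (zn n - z) @[n --> \oo] --> (0 : R), unif D zn z'
  & cvn D (fun n => cd false (cd true (zn n))) (wd false D (wd true D z))].
Proof.
move=> bD /H2P[hz hz2]; have rD := isbox_rect bD; have PI := L2_preip rD.
have [zn [sz cz cm]] : exists zn : nat -> R * R -> R, [/\ forall n, smooth (zn n),
    H1norm D (zn n - z) @[n --> \oo] --> (0 : R)
    & cvn D (fun n => cd false (cd true (zn n))) (wd false D (wd true D z))].
  have [a [b [c [e [/andP[b1 b1'] /andP[b2 b2'] DE]]]]] := bD.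
  have ab : a < b by rewrite -subr_gt0 (lt_le_trans ltr01).
  have ce : c < e by rewrite -subr_gt0 (lt_le_trans ltr01).
  rewrite DE in hz hz2 *; apply: mixed_approx => //.
  exact: H1_wd.
have [c0 c1] := cvn_cd_wd true rD sz hz cz; have [_ c2] := cvn_cd_wd false rD sz hz cz.
pose dl n := 4 * (nm D (zn n - z) + nm D (cd true (zn n) - wd true D z)
   + nm D (cd false (zn n) - wd false D z) + nm D (cd false (cd true (zn n)) - wd false D (wd true D z))).
have d0 : dl n @[n --> \oo] --> (0 : R).
  by apply: cvgK0; apply: cvgD0 => //; apply: cvgD0 => //; exact: cvgD0.
have near n m p : closure D p -> `|zn n p - zn m p| <= dl n + dl m.
  move=> Dp; have := @sup_bound D (zn n - zn m) p bD (smoothB (sz n) (sz m)) Dp.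
  have s1 k := smooth_cd true (sz k); have s2 k := smooth_cd false (sz k); have s3 k := smooth_cd false (s1 k).
  rewrite !cdB// => h; apply: le_trans h _.
  have L f : smooth f -> L2 D f by exact: L2_smooth.
  have tri f g w : L2 D f -> L2 D g -> L2 D w -> nm D (f - g) <= nm D (f - w) + nm D (g - w).
    by move=> Lf Lg Lw; rewrite {3}/nm (bnBC PI Lg Lw); exact: (bnB_le PI).
  have t0 := tri _ _ _ (L _ (sz n)) (L _ (sz m)) (H1_L2 hz).
  have t1 := tri _ _ _ (L _ (s1 n)) (L _ (s1 m)) (H1_L2_wd true hz).
  have t2 := tri _ _ _ (L _ (s2 n)) (L _ (s2 m)) (H1_L2_wd false hz).
  have t3 := tri _ _ _ (L _ (s3 n)) (L _ (s3 m)) (H1_L2_wd false (hz2 true)).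
  rewrite /dl -mulrDr ler_pM2l//; move: t0 t1 t2 t3; clear.
  do 12! move: (nm D _) => ?; lra.
have cauchy p : closure D p -> cvg (zn n p @[n --> \oo]).
  move=> Dp; apply/cauchy_cvgP/cauchyP => eps e0 /=.
  have e4 : 0 < eps / 4 by rewrite divr_gt0.
  move/cvgrPdist_lt : d0 => /(_ _ e4)[N _ hN].
  exists (zn N p); rewrite /= nbhs_simpl /=; exists N => // n Nn.
  have := near N n p Dp; have /= := hN N (leqnn N); have /= := hN n Nn.
  rewrite !sub0r !normrN /ball/= => h1 h2 h3; apply: le_lt_trans h3 _.
  by have := ler_norm (dl n); have := ler_norm (dl N); move: h1 h2 e0; clear; move: (dl N) (dl n) => x y; lra.
exists zn, (fun p => lim (zn n p @[n --> \oo])); split=> //.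
exists dl => // n p Dp.
have l1 : `|zn n p - zn m p| @[m --> \oo] --> `|zn n p - lim (zn n p @[n --> \oo])|.
  by apply: cvg_norm; apply: cvgB; [exact: cvg_cst|exact: cauchy].
have l2 : dl n + dl m @[m --> \oo] --> dl n + 0 by apply: cvgD => //; exact: cvg_cst.
rewrite addr0 in l2; apply: (ler_cvg_to l1 l2); apply: nearW => m; exact: near.
Qed.

End SmoothLimits.

(** * Green's formula and fluxes *)

Section Green.
Context {R : realType}.
Notation MR := (measurableTypeR R).
Implicit Types (u v p r g : R * R -> R) (d : bool) (D S : set (R * R)) (l : bool * 'I_3).

Lemma nm_subset D D' u : isrect D -> isrect D' -> D' `<=` D -> L2 D u -> nm D' u <= nm D u.
Proof.
move=> rD rD' DD Lu; apply: bn_le; rewrite iq.unlock /Rintegral.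
have mD := isrect_measurable rD; have mD' := isrect_measurable rD'.
have Lu' := L2S rD rD' DD Lu.
apply: fine_le.
- by apply: integrable_fin_num => //; exact: (L2_integrableM rD' Lu' Lu').
- by apply: integrable_fin_num => //; exact: (L2_integrableM rD Lu Lu).
- apply: ge0_subset_integral => //.
  + by apply/measurable_EFinP; apply: measurable_funM; exact: Lu.1.
  + by move=> x _; rewrite lee_fin -expr2 sqr_ge0.
Qed.

Lemma cvnS D D' un u : isrect D -> isrect D' -> D' `<=` D -> (forall n, L2 D (un n)) -> L2 D u ->
  cvn D un u -> cvn D' un u.
Proof.
move=> rD rD' DD Lun Lu; apply: cvg0_le => n; rewrite bn_ge0 /=.
by apply: nm_subset => //; exact: (preipB (L2_preip rD)).
Qed.

Lemma green_smooth d A B C E p v : A <= B -> C <= E -> smooth p -> smooth v ->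
  iq (rectd d A B C E) p (cd d v) + iq (rectd d A B C E) (cd d p) v =
  jq `]C, E[ (fun t => p (line d B t)) (fun t => v (line d B t))
  - jq `]C, E[ (fun t => p (line d A t)) (fun t => v (line d A t)).
Proof.
move=> AB CE sp sv; have rD := rectd_isrect d AB CE.
rewrite -(sum_iq rD); try (by apply: L2_smooth => //; exact: smooth_cd).
rewrite -(cdM d sp sv) green_d//; last exact: smoothM.
have cp s := @continuous_line2 R d s _ (smooth_continuous sp).
have cv s := @continuous_line2 R d s _ (smooth_continuous sv).
rewrite !jqE RintegralB//.
  by apply: continuous_integrable_ivl => x; apply: cvgM; [exact: cp|exact: cv].
by apply: continuous_integrable_ivl => x; apply: cvgM; [exact: cp|exact: cv].
Qed.

Definition gl (k : 'I_3) : R := k%:R - 1.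

(** Hides which arc provides the trace, so that outer sides, interfaces and their unions enter
    Green's formula alike. *)
Definition side D C E l v g : Prop :=
  exists S, [/\ barc D S, trace_of D S v g & `]C, E[ `<=` gridline l @^-1` S].

Lemma side_L2l D C E l v g : isbox D -> side D C E l v g -> L2l `]C, E[ (g \o gridline l).
Proof.
move=> bD [S [bS tv sub]]; have /trace_ofP[_ /arc_L2P/(_ l) [m i] _] := tv.
have mI : measurable (`]C, E[%classic : set MR) := measurable_itv _.
split; first by apply: measurable_funS m; [exact: (bS.2 l)|exact: sub].
by apply: integrableS i => //; exact: (bS.2 l).
Qed.

Lemma side_cvg D C E l v g p (vn : nat -> R * R -> R) : isbox D -> side D C E l v g ->
  (forall n, smooth (vn n)) -> H1norm D (vn n - v) @[n --> \oo] --> (0 : R) -> continuous p ->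
  jq `]C, E[ (p \o gridline l) (vn n \o gridline l) @[n --> \oo] -->
  jq `]C, E[ (p \o gridline l) (g \o gridline l).
Proof.
move=> bD sv sn cv cp; have [S [bS tv sub]] := sv.
have mI : measurable (`]C, E[%classic : set MR) := measurable_itv _.
have PJ := jq_preip mI; have Lg := side_L2l bD sv.
have cl (f : R * R -> R) : continuous f -> continuous (f \o gridline l).
  move=> cf; rewrite (_ : _ \o _ = (fun t => f (line (~~ l.1) (l.2%:R - 1) t))); first exact: continuous_line2.
  by apply/funext => t; rewrite /= gridlineE.
have Lp := L2l_continuous C E (cl _ cp).
have Ln n := L2l_continuous C E (cl _ (smooth_continuous (sn n))).
have key : bn (jq `]C, E[) ((vn n \o gridline l) - (g \o gridline l)) @[n --> \oo] --> (0 : R).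
  apply: cvg0_le (trace_cvg bD bS tv sn cv) => n; rewrite bn_ge0 /=; apply: bn_le.
  rewrite aqE (bigD1 l)//=.
  have PA := aq_preip bS.2; have /trace_ofP[_ hg _] := tv.
  have /arc_L2P/(_ l) Ld := preipB PA (arc_L2_smooth bD bS (sn n)) hg.
  have L0 : L2l (set0 : set R) ((vn n - g) \o gridline l) by split; [exact: measurable_fun_set0|exact: integrable_set0].
  have := jq_cover mI (bS.2 l) measurable0 (preipB PJ (Ln n) Lg : L2l _ ((vn n - g) \o gridline l)) Ld L0.
  rewrite [jq set0 _ _]jqE Rintegral_set0 addr0 => h.
  apply: le_trans (h _) _; first by apply: nearW => t /sub; left.
  by rewrite lerDl; apply: sumr_ge0 => i _; exact: jq_ge0.
have := cvg_form PJ Ln Lg Lp key.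
rewrite (preipC PJ Lg Lp).
suff -> : (fun n => jq `]C, E[ (vn n \o gridline l) (p \o gridline l)) =
  (fun n => jq `]C, E[ (p \o gridline l) (vn n \o gridline l)) by [].
by apply/funext => n; exact: (preipC PJ).
Qed.

(** When [r] is the derivative of [p] along [d], this is the boundary integral of [p v] times the
    component of the outward normal along [d], expressed without any trace of [p]. *)
Definition flux_form d D p r v : R := iq D p (wd d D v) + iq D r v.

Lemma green_trace d D C E (kA kB : 'I_3) p v gA gB : isbox D -> gl kA <= gl kB -> C <= E ->
  D = rectd d (gl kA) (gl kB) C E -> smooth p ->
  side D C E (~~ d, kA) v gA -> side D C E (~~ d, kB) v gB ->
  flux_form d D p (cd d p) v =
  jq `]C, E[ (p \o gridline (~~ d, kB)) (gB \o gridline (~~ d, kB))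
  - jq `]C, E[ (p \o gridline (~~ d, kA)) (gA \o gridline (~~ d, kA)).
Proof.
move=> bD AB CE DE sp sA sB; have [S [bS /trace_ofP[hv _ [vn [sn cn _]]] _]] := sA.
have rD := isbox_rect bD; have PI := L2_preip rD.
have [c0 c1] := cvn_cd_wd d rD sn hv cn.
have Lp := L2_smooth rD sp; have Ldp := L2_smooth rD (smooth_cd d sp).
have Ln n := L2_smooth rD (sn n); have Ldn n := L2_smooth rD (smooth_cd d (sn n)).
have l1 := cvg_form PI Ldn (H1_L2_wd d hv) Lp c1.
have l2 := cvg_form PI Ln (H1_L2 hv) Ldp c0.
have r1 := side_cvg bD sB sn cn (smooth_continuous sp).
have r2 := side_cvg bD sA sn cn (smooth_continuous sp).
rewrite /flux_form (preipC PI Lp (H1_L2_wd d hv)) (preipC PI Ldp (H1_L2 hv)).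
apply: (cvg_unique _ (cvgD l1 l2)) => //.
suff -> : (fun n => iq D (cd d (vn n)) p) + (fun n => iq D (vn n) (cd d p)) =
  (fun n => jq `]C, E[ (p \o gridline (~~ d, kB)) (vn n \o gridline (~~ d, kB))
   - jq `]C, E[ (p \o gridline (~~ d, kA)) (vn n \o gridline (~~ d, kA))) by exact: cvgB.
apply/funext => n.
change (iq D (cd d (vn n)) p + iq D (vn n) (cd d p) = jq `]C, E[ (p \o gridline (~~ d, kB)) (vn n \o gridline (~~ d, kB))
   - jq `]C, E[ (p \o gridline (~~ d, kA)) (vn n \o gridline (~~ d, kA))).
rewrite (preipC PI (Ldn n) Lp) (preipC PI (Ln n) Ldp) DE green_smooth//.
have gE f k : f \o gridline (~~ d, k) = (fun t => f (line d (gl k) t)).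
  by apply/funext => t; rewrite /= gridlineE /= negbK.
by rewrite !gE.
Qed.

(** * Fluxes of a component with a weak derivative along its axis *)

Section Flux.
Variables (d : bool) (Q : set (R * R)) (p r : R * R -> R).
Hypotheses (bQ : isbox Q) (Lp : L2 Q p) (hp : is_wd d Q p r).
Let rQ := isbox_rect bQ.

Let Lr : L2 Q r := hp.1.

Let pn_ex : exists pn : nat -> R * R -> R, [/\ forall n, smooth (pn n), cvn Q pn p
  & cvn Q (fun n => cd d (pn n)) r].
Proof.
have [a [b [c [e [/andP[h1 h1'] /andP[h2 h2'] QE]]]]] := bQ.
have ab : a < b by rewrite -subr_gt0 (lt_le_trans ltr01).
have ce : c < e by rewrite -subr_gt0 (lt_le_trans ltr01).
move: Lp hp; rewrite QE; case: (d) => Lp' hp'.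
  exact: (@is_wd_approx _ true a b c e p r).
exact: (@is_wd_approx _ false c e a b p r).
Qed.

Lemma flux_form_cvg D v (pn : nat -> R * R -> R) : isbox D -> D `<=` Q -> H1 D v ->
  (forall n, smooth (pn n)) -> cvn Q pn p -> cvn Q (fun n => cd d (pn n)) r ->
  flux_form d D (pn n) (cd d (pn n)) v @[n --> \oo] --> flux_form d D p r v.
Proof.
move=> bD DQ hv sp c0 c1; have rD := isbox_rect bD; have PI := L2_preip rD.
have Ln n := L2_smooth rQ (sp n); have Ldn n := L2_smooth rQ (smooth_cd d (sp n)).
have l1 := cvg_form PI (fun n => L2S rQ rD DQ (Ln n)) (L2S rQ rD DQ Lp) (H1_L2_wd d hv)
  (cvnS rQ rD DQ Ln Lp c0).
have l2 := cvg_form PI (fun n => L2S rQ rD DQ (Ldn n)) (L2S rQ rD DQ Lr) (H1_L2 hv)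
  (cvnS rQ rD DQ Ldn Lr c1).
exact: (cvgD l1 l2).
Qed.

Lemma side_H1 D C E l v g : side D C E l v g -> H1 D v.
Proof. by move=> [S [_ [] ]]. Qed.

Lemma jq0r (A : set R) f : jq A f (cst 0) = 0.
Proof. by rewrite jqE Rintegral_eq0// => x _; exact: mulr0. Qed.

(** The boundary terms vanish for the smooth approximations of [p], and the flux is continuous in
    [p] and its derivative along [d]; no derivative of [p] along the other axis occurs. *)
Lemma flux_zero D C E (kA kB : 'I_3) v : isbox D -> D `<=` Q -> gl kA <= gl kB -> C <= E ->
  D = rectd d (gl kA) (gl kB) C E ->
  side D C E (~~ d, kA) v (cst 0) -> side D C E (~~ d, kB) v (cst 0) -> flux_form d D p r v = 0.
Proof.
move=> bD DQ AB CE DE sA sB; have [pn [sp c0 c1]] := pn_ex.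
have l := flux_form_cvg bD DQ (side_H1 sA) sp c0 c1.
apply: (cvg_unique _ l) => //.
suff -> : (fun n => flux_form d D (pn n) (cd d (pn n)) v) = cst 0 by exact: cvg_cst.
apply/funext => n; rewrite (green_trace bD AB CE DE (sp n) sA sB).
by rewrite -[cst 0 \o _]/(cst 0) -[(cst 0 \o gridline (~~ d, kA))]/(cst 0) !jq0r subrr.
Qed.

(** A smooth approximation of [p] on the whole of [Q] takes the same values on both sides of the
    middle line, where the normals are opposite and the traces of [v] and [w] agree. *)
Lemma flux_pair D D' C E (kA kM kB : 'I_3) v w g : isbox D -> isbox D' -> D `<=` Q -> D' `<=` Q ->
  gl kA <= gl kM -> gl kM <= gl kB -> C <= E ->
  D = rectd d (gl kA) (gl kM) C E -> D' = rectd d (gl kM) (gl kB) C E ->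
  side D C E (~~ d, kA) v (cst 0) -> side D C E (~~ d, kM) v g ->
  side D' C E (~~ d, kM) w g -> side D' C E (~~ d, kB) w (cst 0) ->
  flux_form d D p r v + flux_form d D' p r w = 0.
Proof.
move=> bD bD' DQ DQ' AM MB CE DE DE' sA sM sM' sB; have [pn [sp c0 c1]] := pn_ex.
have l := flux_form_cvg bD DQ (side_H1 sA) sp c0 c1.
have l' := flux_form_cvg bD' DQ' (side_H1 sB) sp c0 c1.
apply: (cvg_unique _ (cvgD l l')) => //.
suff -> : (fun n => flux_form d D (pn n) (cd d (pn n)) v) + (fun n => flux_form d D' (pn n) (cd d (pn n)) w) = cst 0.
  exact: cvg_cst.
apply/funext => n.
change (flux_form d D (pn n) (cd d (pn n)) v + flux_form d D' (pn n) (cd d (pn n)) w = 0).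
rewrite (green_trace bD AM CE DE (sp n) sA sM) (green_trace bD' MB CE DE' (sp n) sM' sB).
rewrite -[cst 0 \o _]/(cst 0) -[(cst 0 \o gridline (~~ d, kB))]/(cst 0) !jq0r.
by rewrite subr0 sub0r subrr.
Qed.

End Flux.

Lemma iqNl D u v : isrect D -> L2 D u -> L2 D v -> iq D (fun x => - u x) v = - iq D u v.
Proof.
move=> rD Lu Lv; have PI := L2_preip rD.
have -> : (fun x => - u x) = (-1) *: u by apply/funext => x; exact: (esym (mulN1r _)).
by rewrite (preip_formZl PI)// mulN1r.
Qed.

Lemma poissonE D u F : poisson D u F <-> forall phi, test_fun D phi -> dirichlet_form D u phi = iq D F phi.
Proof. by rewrite iq.unlock. Qed.

Lemma wlaplacianP D u :  isrect D -> (exists2 l : R * R -> R, L2 D l & poisson D u (fun x => - l x)) ->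
  L2 D (wlaplacian D u) /\ poisson D u (fun x => - wlaplacian D u x).
Proof.
move=> rD [l Ll hl].
exact: (@getPex _ [set l : R * R -> R | L2 D l /\ poisson D u (fun x => - l x)] (ex_intro _ l (conj Ll hl))).
Qed.

Lemma wlaplacian_unique D u (l : R * R -> R) : isrect D -> L2 D l -> poisson D u (fun x => - l x) ->
  aeq D (wlaplacian D u) l.
Proof.
move=> rD Ll hl; have PI := L2_preip rD.
have [Lw hw] := @wlaplacianP D u rD (ex_intro2 _ _ l Ll hl).
suff : aeq D (wlaplacian D u - l) (cst 0).
  by apply: ae_onS => p _ h; apply/eqP; rewrite -subr_eq0; apply/eqP.
apply: L2_orthogonal => //; first exact: (preipB PI).
move=> phi tp; have Lp := L2_test rD tp.
rewrite (preip_formBl PI)//; apply/eqP; rewrite subr_eq0; apply/eqP.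
apply: oppr_inj; rewrite -!iqNl//; move/poissonE : hl => /(_ phi tp) <-.
by move/poissonE : hw => /(_ phi tp) <-.
Qed.

Lemma normal_derivE D u (l : R * R -> R) v : isrect D -> L2 D l -> poisson D u (fun x => - l x) -> L2 D v ->
  normal_deriv D u v = dirichlet_form D u v + iq D l v.
Proof.
move=> rD Ll hl Lv; have [Lw _] := @wlaplacianP D u rD (ex_intro2 _ _ l Ll hl).
rewrite -(iq_ae rD Lw.1 Ll.1 Lv.1 (wlaplacian_unique rD Ll hl)).
by rewrite iq.unlock.
Qed.

Lemma dirichlet_test D u phi : isrect D -> H1 D u -> test_fun D phi ->
  dirichlet_form D u phi = iq D (wd true D u) (cd true phi) + iq D (wd false D u) (cd false phi).
Proof.
move=> rD hu tp; have sp := test_fun_smooth tp; have hp := H1_smooth rD sp; have PI := L2_preip rD.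
rewrite dirichlet_formE//.
have h d : iq D (wd d D u) (wd d D phi) = iq D (wd d D u) (cd d phi).
  have Lu := H1_L2_wd d hu; have Lp := H1_L2_wd d hp; have Lc := L2_smooth rD (smooth_cd d sp).
  rewrite (preipC PI Lu Lp) (preipC PI Lu Lc).
  by apply: iq_ae => //; [exact: Lp.1|exact: Lc.1|exact: Lu.1|exact: wd_smooth].
by rewrite !h.
Qed.

(** * Normal derivatives of H2 functions *)

Section H2Derivative.
Variables (Q : set (R * R)) (z : R * R -> R).
Hypotheses (rQ : isrect Q) (hz : H2 Q z).

Let h1 : H1 Q z. Proof. by case: hz. Qed.
Let h2 d : H1 Q (wd d Q z). Proof. by have /H2P[_] := hz; exact. Qed.

Definition lap : R * R -> R := wd true Q (wd true Q z) + wd false Q (wd false Q z).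

Lemma L2_lap D : isrect D -> D `<=` Q -> L2 D lap.
Proof.
move=> rD DQ; apply: (L2S rQ rD DQ); apply: (preipD (L2_preip rQ)); apply: H1_L2_wd; exact: h2.
Qed.

Lemma H2_poisson D : isrect D -> D `<=` Q -> poisson D z (fun x => - lap x).
Proof.
move=> rD DQ; apply/poissonE => phi tp; have PI := L2_preip rD; have Lp := L2_test rD tp.
have hD := H1S rQ rD DQ h1.
rewrite dirichlet_test// iqNl//; last exact: L2_lap.
rewrite (preip_formDl PI); [|by apply: (L2S rQ rD DQ); apply: H1_L2_wd; exact: h2|by apply: (L2S rQ rD DQ); apply: H1_L2_wd; exact: h2|exact: Lp].
rewrite opprD.
have h d : iq D (wd d D z) (cd d phi) = - iq D (wd d Q (wd d Q z)) phi.
  have w := is_wdS rQ rD DQ (H1_wd d (h2 d)).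
  rewrite -w.2//; apply: iq_ae => //.
  - exact: (H1_L2_wd d hD).1.
  - exact: (L2S rQ rD DQ (H1_L2_wd d h1)).1.
  - exact: (L2_test_derive d rD tp).1.
  - exact: wdS.
by rewrite !h.
Qed.

(** Grouping the gradient and Laplacian terms axis by axis leaves two fluxes, each involving one
    derivative of one component of the gradient. *)
Lemma normal_deriv_H2 D v : isrect D -> D `<=` Q -> H1 D v ->
  normal_deriv D z v = flux_form true D (wd true Q z) (wd true Q (wd true Q z)) v
                     + flux_form false D (wd false Q z) (wd false Q (wd false Q z)) v.
Proof.
move=> rD DQ hv; have PI := L2_preip rD; have hD := H1S rQ rD DQ h1.
rewrite (normal_derivE rD (L2_lap rD DQ) (H2_poisson rD DQ) (H1_L2 hv)) dirichlet_formE//.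
rewrite (preip_formDl PI); [|by apply: (L2S rQ rD DQ); apply: H1_L2_wd; exact: h2|by apply: (L2S rQ rD DQ); apply: H1_L2_wd; exact: h2|exact: (H1_L2 hv)].
have h d : iq D (wd d D z) (wd d D v) = iq D (wd d Q z) (wd d D v).
  apply: iq_ae => //.
  - exact: (H1_L2_wd d hD).1.
  - exact: (L2S rQ rD DQ (H1_L2_wd d h1)).1.
  - exact: (H1_L2_wd d hv).1.
  - exact: wdS.
by rewrite !h /flux_form addrACA.
Qed.

End H2Derivative.

End Green.

(** * Reflections *)

Section MeasurePreserving.
Context {R : realType} d (T : measurableType d) (mu : {measure set T -> \bar R}) (s : T -> T).
Hypotheses (ms : measurable_fun setT s)
  (mp : forall A, measurable A -> mu (s @^-1` A) = mu A) (ss : involutive s).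

Lemma mp_measurable (A : set T) : measurable A -> measurable (s @^-1` A).
Proof. by move=> mA; rewrite -[X in measurable X]setTI; exact: ms. Qed.

Lemma mp_measurable_fun (A : set T) (f : T -> R) : measurable A -> measurable_fun A f ->
  measurable_fun (s @^-1` A) (f \o s).
Proof.
move=> mA mf; apply: (measurable_comp mA) => //.
  by move=> _ [x Ax <-].
by apply: measurable_funTS.
Qed.

Lemma mp_integral_ge0 (A : set T) (f : T -> \bar R) : measurable A -> measurable_fun A f ->
  (forall x, 0 <= f x)%E -> (\int[mu]_(x in s @^-1` A) f (s x) = \int[mu]_(x in A) f x)%E.
Proof.
move=> mA mf f0; rewrite -[LHS]/(\int[mu]_(x in s @^-1` A) (f \o s) x)%E.
rewrite -(ge0_integral_pushforward ms)//.
by apply: eq_measure_integral => //= B mB _; exact: mp.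
Qed.

Lemma mp_integral (A : set T) (f : T -> \bar R) : measurable A -> measurable_fun A f ->
  (\int[mu]_(x in s @^-1` A) f (s x) = \int[mu]_(x in A) f x)%E.
Proof.
move=> mA mf; rewrite integralE [RHS]integralE; congr (_ - _)%E.
  rewrite -(@mp_integral_ge0 A (f^\+)%E)//; first by apply: eq_integral => x _; rewrite !funeposE.
  exact: measurable_funepos.
rewrite -(@mp_integral_ge0 A (f^\-)%E)//; first by apply: eq_integral => x _; rewrite !funenegE.
exact: measurable_funeneg.
Qed.

Lemma mp_sqint (A : set T) (f : T -> R) : measurable A -> sqint mu A f -> sqint mu (s @^-1` A) (f \o s).
Proof.
move=> mA [mf /integrableP[m2 i2]]; split; first exact: mp_measurable_fun.
apply/integrableP; split.
  by apply/measurable_EFinP; apply: measurable_funX; exact: mp_measurable_fun.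
rewrite (mp_integral_ge0 (f := fun x => `|(f x ^+ 2)%:E|%E))//.
exact: measurableT_comp.
Qed.

Lemma mp_ip (A : set T) (f g : T -> R) : measurable A -> measurable_fun A f -> measurable_fun A g ->
  ip mu (s @^-1` A) (f \o s) (g \o s) = ip mu A f g.
Proof.
move=> mA mf mg; congr fine; apply: (mp_integral (f := fun x => (f x * g x)%:E)) => //.
by apply/measurable_EFinP; exact: measurable_funM.
Qed.

Lemma mp_ae (P : T -> Prop) : {ae mu, forall x, P x} -> {ae mu, forall x, P (s x)}.
Proof.
move=> [N [mN N0 PN]]; exists (s @^-1` N); split; first exact: mp_measurable.
  by rewrite mp.
by move=> x nP; apply: PN => Px; apply: nP.
Qed.

End MeasurePreserving.

HB.lock Definition flip {R : realType} (b : bool) (p : R * R) : R * R :=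
  if b then (- p.1, p.2) else (p.1, - p.2).

Section Flip.
Context {R : realType}.
Notation leb := (@lebesgue_measure R).
Notation MR := (measurableTypeR R).
Implicit Types (b d : bool) (u v w phi : R * R -> R) (D S : set (R * R)) (l : bool * 'I_3).

Lemma flipE b (p : R * R) : flip b p = if b then (- p.1, p.2) else (p.1, - p.2).
Proof. by rewrite flip.unlock. Qed.

Lemma flipK b : involutive (flip b : R * R -> R * R).
Proof. by move=> p; rewrite !flipE; case: b => /=; rewrite opprK; case: p. Qed.

Lemma measurable_flip b : measurable_fun setT (flip b : RR R -> RR R).
Proof.
rewrite flip.unlock; case: b.
  by apply: measurable_fun_pair => //; apply: measurableT_comp => //.
by apply: measurable_fun_pair => //; apply: measurableT_comp => //.
Qed.

Lemma leb_opp (A : set R) : measurable (A : set MR) -> leb (-%R @^-1` A) = leb A.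
Proof. exact: lebesgue_measureN. Qed.

HB.instance Definition _ b := @isMeasurableFun.Build _ _ (RR R) (RR R) (flip b) (measurable_flip b).

(** The image measure agrees with [mu2] on products of measurable sets, which determine a product
    measure. *)
Lemma mu2_flip b (A : set (RR R)) : measurable A -> mu2 (flip b @^-1` A) = mu2 A.
Proof.
move=> mA; symmetry.
apply: (product_measure_unique (m' := pushforward mu2 (flip b : RR R -> RR R))) => //.
  exact: measurable_flip.
move=> mf B C mB mC; rewrite -[LHS]/(mu2 (flip b @^-1` (B `*` C))).
have mopp (E : set R) : measurable (E : set MR) -> measurable (-%R @^-1` E : set MR).
  by move=> mE; rewrite -[X in measurable X]setTI; exact: (@oppr_measurable R setT).
have -> : flip b @^-1` (B `*` C) = if b then (-%R @^-1` B) `*` C else B `*` (-%R @^-1` C).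
  by apply/seteqP; split=> p; rewrite /= flipE; case: (b) => -[].
case: (b); rewrite /mu2 product_measure1E//; try exact: mopp.
  by congr (_ * _)%E; exact: leb_opp.
by congr (_ * _)%E; exact: leb_opp.
Qed.

(** The sign that a derivative along the axis [d] acquires under the reflection [flip b]. *)
Definition fsg b d : R := if d == b then -1 else 1.

Lemma fsg_sqr b d : fsg b d * fsg b d = 1.
Proof. by rewrite /fsg; case: ifP => _; rewrite ?mulrNN mulr1. Qed.

Lemma continuous_flip b : continuous (flip b : R * R -> R * R).
Proof.
move=> [x y]; rewrite flip.unlock; case: b.
  apply: (@cvg_pair _ _ _ _ (nbhs (- x)) (nbhs y)); last exact: cvg_snd.
  by apply: cvgN; exact: cvg_fst.
apply: (@cvg_pair _ _ _ _ (nbhs x) (nbhs (- y))); first exact: cvg_fst.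
by apply: cvgN; exact: cvg_snd.
Qed.

Lemma is_derive_opp_comp (f : R -> R) (x df : R) : is_derive (- x) 1 f df ->
  is_derive x 1 (fun t => f (- t)) (- df).
Proof.
move=> h; have dN : is_derive x 1 (fun t : R => - t) (-1) by apply: is_deriveN.
have := @is_derive1_comp _ f (fun t => - t) x _ _ h dN.
by rewrite /comp mulrN1.
Qed.

Lemma partial1_flip b phi g : partial1 phi g -> partial1 (phi \o flip b) (fsg b true *: (g \o flip b)).
Proof.
move=> h [x y]; apply/is_derive_e1; rewrite flip.unlock /fsg; case: b => /=.
  have := h (- x, y) => /is_derive_e1 h'.
  apply: (is_derive_eq (is_derive_opp_comp h')).
  by rewrite -[RHS]/(-1 * g (- x, y)) mulN1r.
have := h (x, - y) => /is_derive_e1 h'.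
by apply: (is_derive_eq h'); rewrite -[RHS]/(1 * g (x, - y)) mul1r.
Qed.

Lemma partial2_flip b phi g : partial2 phi g -> partial2 (phi \o flip b) (fsg b false *: (g \o flip b)).
Proof.
move=> h [x y]; apply/is_derive_e2; rewrite flip.unlock /fsg; case: b => /=.
  have := h (- x, y) => /is_derive_e2 h'.
  by apply: (is_derive_eq h'); rewrite -[RHS]/(1 * g (- x, y)) mul1r.
have := h (x, - y) => /is_derive_e2 h'.
apply: (is_derive_eq (is_derive_opp_comp h')).
by rewrite -[RHS]/(-1 * g (x, - y)) mulN1r.
Qed.

Lemma continuous_flip_comp b phi : continuous phi -> continuous (phi \o flip b).
Proof. by move=> cp p; apply: continuous_comp; [exact: continuous_flip|exact: cp]. Qed.

Lemma Ck_flip b n phi : Ck n phi -> Ck n (phi \o flip b).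
Proof.
elim: n phi => [|n IH] phi h; first by split=> //; apply: continuous_flip_comp; exact: Ck_continuous h.
have [h1 h2] := CkS_derive h; have [d1 d2] := CkS_partial h.
have Z (k : R) (f : R * R -> R) : Ck n f -> Ck n (k *: f).
  move=> hf; rewrite -[_ *: _]addr0; apply: CkL => //; exact: smooth0.
exact: (Ck_intro (continuous_flip_comp (Ck_continuous h)) (partial1_flip b d1) (partial2_flip b d2)
  (Z _ _ (IH _ h1)) (Z _ _ (IH _ h2))).
Qed.

Lemma smooth_flip b phi : smooth phi -> smooth (phi \o flip b).
Proof. by move=> sp n; exact: Ck_flip. Qed.

Lemma cd_flip b d phi : smooth phi -> cd d (phi \o flip b) = fsg b d *: (cd d phi \o flip b).
Proof.
move=> sp; case: d; rewrite ?cd1 ?cd2.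
  exact: (partial1E_derive (partial1_flip b (smooth_partial1 sp))).
exact: (partial2E_derive (partial2_flip b (smooth_partial2 sp))).
Qed.

Lemma compflipK b phi : (phi \o flip b) \o flip b = phi.
Proof. by apply/funext => p; rewrite /= flipK. Qed.

Lemma preflipK b D : flip b @^-1` (flip b @^-1` D) = D.
Proof. by apply/seteqP; split=> p; rewrite /= flipK. Qed.

Lemma test_fun_flip b D phi : test_fun D phi -> test_fun (flip b @^-1` D) (phi \o flip b).
Proof.
move=> [sp [K [cK KD K0]]]; split; first exact: smooth_flip.
exists (flip b @^-1` K); split.
- have -> : flip b @^-1` K = flip b @` K.
    apply/seteqP; split=> p /=; last by move=> [q Kq <-]; rewrite flipK.
    by move=> Kp; exists (flip b p) => //; rewrite flipK.
  by apply: continuous_compact => //; apply: continuous_subspaceT; exact: continuous_flip.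
- by move=> p /KD.
- by move=> p; exact: K0.
Qed.

Lemma ae_on_flip b D (P : R * R -> Prop) : ae_on D P -> ae_on (flip b @^-1` D) (fun p => P (flip b p)).
Proof.
move=> h; exact: (@mp_ae R _ (RR R) mu2 (flip b) (measurable_flip b) (@mu2_flip b) (fun p => D p -> P p) h).
Qed.

Section Transport.
Variables (b : bool) (D : set (R * R)).
Let D' := flip b @^-1` D.
Hypotheses (rD : isrect D) (rD' : isrect D').
Let mD := isrect_measurable rD.

Lemma L2_flip u : L2 D u -> L2 D' (u \o flip b).
Proof. exact: (@mp_sqint R _ (RR R) mu2 (flip b) (measurable_flip b) (@mu2_flip b) D u mD). Qed.

Lemma iq_flip u v : L2 D u -> L2 D v -> iq D' (u \o flip b) (v \o flip b) = iq D u v.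
Proof.
move=> [mu _] [mv _]; rewrite iq.unlock.
have := @mp_ip R _ (RR R) mu2 (flip b) (measurable_flip b) (@mu2_flip b) D u v mD mu mv.
by rewrite /ip.
Qed.

Lemma is_wd_flip d u w : L2 D u -> is_wd d D u w -> is_wd d D' (u \o flip b) (fsg b d *: (w \o flip b)).
Proof.
move=> Lu [Lw hw]; have PI := L2_preip rD; have PI' := L2_preip rD'.
split; first by apply: (preipZ PI'); exact: L2_flip.
move=> phi tp; have sp := test_fun_smooth tp.
have tp' : test_fun D (phi \o flip b) by rewrite -[D](preflipK b); exact: test_fun_flip.
have Lp := L2_test rD tp'; have Lc := L2_test_derive d rD tp'.
rewrite -[phi](compflipK b) (cd_flip b d (smooth_flip b sp)).
rewrite (preip_formZr PI'); [|exact: L2_flip|exact: L2_flip].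
rewrite (preip_formZl PI'); [|exact: L2_flip|exact: L2_flip].
by rewrite !iq_flip// hw// mulrN.
Qed.

Lemma H1_flip u : H1 D u -> H1 D' (u \o flip b).
Proof.
move=> hu; apply: (@H1_intro _ D' _ (fun d => fsg b d *: (wd d D u \o flip b))).
  by apply: L2_flip; exact: H1_L2.
by move=> d; apply: is_wd_flip; [exact: H1_L2|exact: H1_wd].
Qed.

Lemma wd_flip d u : H1 D u -> aeq D' (wd d D' (u \o flip b)) (fsg b d *: (wd d D u \o flip b)).
Proof. by move=> hu; apply: aeq_wd => //; apply: is_wd_flip; [exact: H1_L2|exact: H1_wd]. Qed.

Lemma iq_wd_flip d u v : H1 D u -> H1 D v ->
  iq D' (wd d D' (u \o flip b)) (wd d D' (v \o flip b)) = iq D (wd d D u) (wd d D v).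
Proof.
move=> hu hv; have PI' := L2_preip rD'.
have L w : H1 D w -> L2 D' (fsg b d *: (wd d D w \o flip b)).
  by move=> hw; apply: (preipZ PI'); apply: L2_flip; exact: H1_L2_wd.
have L1 w : H1 D w -> L2 D' (wd d D' (w \o flip b)).
  by move=> hw; apply: H1_L2_wd; exact: H1_flip.
have Lc w : H1 D w -> L2 D' (wd d D w \o flip b) by move=> hw; apply: L2_flip; exact: H1_L2_wd.
rewrite (iq_ae rD' (L1 _ hu).1 (L _ hu).1 (L1 _ hv).1 (wd_flip d hu)).
rewrite (preipC PI' (L _ hu) (L1 _ hv)).
rewrite (iq_ae rD' (L1 _ hv).1 (L _ hv).1 (L _ hu).1 (wd_flip d hv)).
rewrite (preip_formZr PI' _ (Lc _ hu) (L _ hv)) (preip_formZl PI' _ (Lc _ hv) (Lc _ hu)).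
rewrite mulrA fsg_sqr mul1r iq_flip//; [|exact: H1_L2_wd|exact: H1_L2_wd].
exact: (preipC (L2_preip rD) (H1_L2_wd d hv) (H1_L2_wd d hu)).
Qed.

Lemma dirichlet_flip u v : H1 D u -> H1 D v ->
  dirichlet_form D' (u \o flip b) (v \o flip b) = dirichlet_form D u v.
Proof.
move=> hu hv; rewrite (dirichlet_formE rD hu hv) (dirichlet_formE rD' (H1_flip hu) (H1_flip hv)).
by rewrite !iq_wd_flip.
Qed.

Lemma H1norm_flip u : H1 D u -> H1norm D' (u \o flip b) = H1norm D u.
Proof.
move=> hu; rewrite !H1normE bn.unlock /h1form !iq_wd_flip// iq_flip//; exact: H1_L2.
Qed.

End Transport.

Lemma jq_opp (A : set R) f g : measurable (A : set MR) -> measurable_fun (A : set MR) f ->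
  measurable_fun (A : set MR) g ->
  jq (-%R @^-1` A) (fun t => f (- t)) (fun t => g (- t)) = jq A f g.
Proof.
move=> mA mf mg; rewrite !jqE.
exact: (@mp_ip R _ MR leb -%R (@oppr_measurable R setT) leb_opp A f g mA mf mg).
Qed.

(** A reflection maps a grid line onto itself, reversing its parameter, or onto the symmetric line,
    keeping the parameter. *)
Definition flipl b l : bool * 'I_3 := if l.1 == b then l else (l.1, rev_ord l.2).

Lemma gl_rev (k : 'I_3) : gl (rev_ord k) = - gl k :> R.
Proof.
have h : (k <= 2)%N by rewrite -ltnS.
by rewrite /gl /= subSS natrB//; lra.
Qed.

Lemma gridline_flip b l t : flip b (gridline l t) = gridline (flipl b l) (if l.1 == b then - t else t) :> R * R.
Proof.
case: l => a k; have := gl_rev k; rewrite /gl => h.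
by rewrite flip.unlock /flipl /gridline; case: a; case: b => /=; rewrite ?h.
Qed.

Lemma fliplK b : involutive (flipl b).
Proof. by move=> [a k]; rewrite /flipl /=; have [->|ab] := eqVneq a b; rewrite /= ?eqxx// (negbTE ab) rev_ordK. Qed.

Lemma preline_flip b S l : gridline l @^-1` (flip b @^-1` S) =
  if l.1 == b then -%R @^-1` (gridline (flipl b l) @^-1` S) else gridline (flipl b l) @^-1` S.
Proof. by apply/seteqP; split=> t; rewrite /= gridline_flip; case: ifP. Qed.

Lemma comp_gridline_flip b u l : (u \o flip b) \o gridline l =
  if l.1 == b then (u \o gridline (flipl b l)) \o -%R else u \o gridline (flipl b l).
Proof. by apply/funext => t; rewrite /= gridline_flip; case: ifP. Qed.

Lemma L2l_opp (A : set R) f : measurable (A : set MR) -> L2l A f -> L2l (-%R @^-1` A) (f \o -%R).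
Proof. by move=> mA; exact: (@mp_sqint R _ MR leb -%R (@oppr_measurable R setT) leb_opp A f mA). Qed.

Lemma arc_L2_flip b S u : arcset S -> arc_L2 S u -> arc_L2 (flip b @^-1` S) (u \o flip b).
Proof.
move=> mS /arc_L2P hu; apply/arc_L2P => l; rewrite preline_flip comp_gridline_flip.
by case: ifP => _; [apply: L2l_opp => //; exact: hu|exact: hu].
Qed.

Lemma aq_flip b S u v : arcset S -> arc_L2 S u -> arc_L2 S v ->
  aq (flip b @^-1` S) (u \o flip b) (v \o flip b) = aq S u v.
Proof.
move=> mS /arc_L2P hu /arc_L2P hv; rewrite !aqE (reindex_inj (inv_inj (fliplK b))).
apply: eq_bigr => l _; rewrite preline_flip !comp_gridline_flip fliplK.
by case: ifP => // _; apply: jq_opp => //; [exact: (hu l).1|exact: (hv l).1].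
Qed.

Lemma arc_ae_flip b S (P : R * R -> Prop) : arc_ae S P -> arc_ae (flip b @^-1` S) (fun p => P (flip b p)).
Proof.
move=> h l; have hl := h (flipl b l).
have [lb|lb] := eqVneq l.1 b; last first.
  by apply: ae_imp hl => t; rewrite /= gridline_flip (negbTE lb).
have := @mp_ae R _ MR leb -%R (@oppr_measurable R setT) leb_opp _ hl.
by apply: ae_imp => t; rewrite /= gridline_flip lb eqxx.
Qed.

Lemma trace_flip b D S u g : isbox D -> isbox (flip b @^-1` D) -> barc D S -> trace_of D S u g ->
  trace_of (flip b @^-1` D) (flip b @^-1` S) (u \o flip b) (g \o flip b).
Proof.
move=> bD bD' bS /trace_ofP[hu hg [phi [s1 c1 cg]]].
have rD := isbox_rect bD; have rD' := isbox_rect bD'.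
have PA := aq_preip bS.2.
apply/trace_ofP; split; [exact: H1_flip|exact: arc_L2_flip bS.2 hg|].
exists (fun n => phi n \o flip b); split.
- by move=> n; exact: smooth_flip.
- suff -> : (fun n => H1norm (flip b @^-1` D) (phi n \o flip b - (u \o flip b))) =
    (fun n => H1norm D (phi n - u)) by [].
  apply/funext => n; rewrite -(H1norm_flip rD rD')//.
  by apply: (H1B rD) => //; exact: H1_smooth.
- suff -> : (fun n => bn (aq (flip b @^-1` S)) ((phi n \o flip b) - (g \o flip b))) =
    (fun n => bn (aq S) (phi n - g)) by [].
  apply/funext => n; have L := preipB PA (arc_L2_smooth bD bS (s1 n)) hg.
  by rewrite bn.unlock -(aq_flip b bS.2 L L).
Qed.

Lemma H2_flip b Q u : isrect Q -> flip b @^-1` Q = Q -> H2 Q u -> H2 Q (u \o flip b).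
Proof.
move=> rQ QE /H2P[hu hu2]; have rQ' : isrect (flip b @^-1` Q) by rewrite QE.
have hf := H1_flip rQ rQ' hu; rewrite QE in hf.
apply/H2P; split=> // d.
have h2 := H1_flip rQ rQ' (hu2 d); rewrite QE in h2.
have h3 := preipZ (h1form_preip rQ) (fsg b d) h2.
have w := wd_flip rQ rQ' d hu; rewrite QE in w.
apply: (H1_ae rQ _ (aeq_sym w) h3); exact: (H1_L2_wd d hf).1.
Qed.

End Flip.

(** * The four subdomains *)

Definition k0 : 'I_3 := Ordinal (isT : (0 < 3)%N).
Definition k1 : 'I_3 := Ordinal (isT : (1 < 3)%N).
Definition k2 : 'I_3 := Ordinal (isT : (2 < 3)%N).

(* The subdomain across the interface normal to the axis [b]. *)
Definition nb (b : bool) (i : quad) : quad :=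
  match i with
  | Q1 => if b then Q2 else Q4
  | Q2 => if b then Q1 else Q3
  | Q3 => if b then Q4 else Q2
  | Q4 => if b then Q3 else Q1
  end.

Definition low (b : bool) (i : quad) : bool :=
  match i with Q1 => true | Q2 => ~~ b | Q3 => false | Q4 => b end.

(* The extent of [Om i] along the axis [b] is [](gl (lo b i)), (gl (hi b i))[];
   [out b i] is the index of its side on the boundary of [Omega]. *)
Definition lo b i := if low b i then k0 else k1.
Definition hi b i := if low b i then k1 else k2.
Definition out b i := if low b i then k0 else k2.

Section Geometry.
Context {R : realType}.
Implicit Types (i j : quad) (b d : bool) (D S : set (R * R)) (p : R * R).
Notation MR := (measurableTypeR R).
Notation RR := (RR R).

Lemma gl0 : gl k0 = -1 :> R. Proof. by rewrite /gl /= sub0r. Qed.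
Lemma gl1 : gl k1 = 0 :> R. Proof. by rewrite /gl /= subrr. Qed.
Lemma gl2 : gl k2 = 1 :> R. Proof. by rewrite /gl /=; lra. Qed.

Definition gls := (gl0, gl1, gl2).

Lemma nbK b : involutive (nb b). Proof. by case=> //; case: b. Qed.
Lemma nbC b d i : nb b (nb d i) = nb d (nb b i). Proof. by case: b; case: d; case: i. Qed.

Lemma OmE d i : Om i = rectd d (gl (lo d i)) (gl (hi d i)) (gl (lo (~~ d) i)) (gl (hi (~~ d) i)) :> set (R * R).
Proof. by case: d; case: i; rewrite /lo /hi /= !gls. Qed.

Lemma isbox_Om i : isbox (Om i : set (R * R)).
Proof.
exists (gl (lo true i)), (gl (hi true i)), (gl (lo false i)), (gl (hi false i)).
split; last exact: (OmE true).
  by rewrite /lo /hi; case: low; rewrite !gls; apply/andP; split; lra.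
by rewrite /lo /hi; case: low; rewrite !gls; apply/andP; split; lra.
Qed.

Lemma isbox_Omega : isbox (Omega : set (R * R)).
Proof. by exists (-1), 1, (-1), 1; split => //; apply/andP; split; lra. Qed.

Lemma Om_sub i : Om i `<=` (Omega : set (R * R)).
Proof.
move=> p; rewrite (OmE true) /lo /hi /=; case: low; case: low; rewrite !gls;
  case; rewrite /= !in_itv/= => h1 h2; split; rewrite /= in_itv/=; lra.
Qed.

Lemma closure_rect (a b c e : R) : a < b -> c < e ->
  closure (rect a b c e) = [set p | a <= p.1 <= b /\ c <= p.2 <= e].
Proof.
move=> ab ce; apply/seteqP; split; first exact: closure_rect_sub.
move=> [x y] /= [xab yce] U /nbhs_ballP[r /= r0 hr].
have near (s t z : R) : s < t -> s <= z <= t -> exists z', s < z' < t /\ `|z - z'| < r.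
  move=> st /andP[sz zt].
  pose m := Num.min r (t - s) / 4; have m0 : 0 < m by rewrite divr_gt0// lt_min r0 subr_gt0.
  have mr : m < r by rewrite /m; have := ge_min r r (t - s); rewrite lexx /=; lra.
  have mt : m < (t - s) / 2.
    by have : Num.min r (t - s) <= t - s; [rewrite ge_min lexx orbT|rewrite /m; lra].
  have [zm|zm] := leP z ((s + t) / 2).
    exists (z + m); split; first by apply/andP; split; lra.
    by rewrite opprD addrA subrr sub0r normrN gtr0_norm.
  exists (z - m); split; first by apply/andP; split; lra.
  by rewrite opprB addrCA subrr addr0 gtr0_norm.
have [x' [hx1 hx2]] := near a b x ab xab; have [y' [hy1 hy2]] := near c e y ce yce.
exists (x', y'); split; last by apply: hr; split.
by split; rewrite /= in_itv.
Qed.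

Lemma open_rect (a b c e : R) : open (rect a b c e).
Proof.
have -> : rect a b c e = (fst @^-1` `]a, b[) `&` (snd @^-1` `]c, e[) by [].
apply: openI.
  by apply: open_comp; [move=> p _; exact: cvg_fst|exact: itv_open].
by apply: open_comp; [move=> p _; exact: cvg_snd|exact: itv_open].
Qed.

Lemma rectP (a b c e : R) p : rect a b c e p <-> a < p.1 < b /\ c < p.2 < e.
Proof.
split=> -[h1 h2].
  by move: h1 h2; rewrite /= !in_itv/=.
by split; rewrite /= in_itv.
Qed.

Lemma boundary_rectP (a b c e : R) p : a < b -> c < e ->
  boundary (rect a b c e) p <->
  (a <= p.1 <= b /\ c <= p.2 <= e) /\ ~ (a < p.1 < b /\ c < p.2 < e).
Proof.
move=> ab ce; rewrite /boundary closure_rect//.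
have /interior_id -> := @open_rect a b c e.
by split=> -[h1 h2]; split=> // h; apply: h2; apply/rectP.
Qed.

Lemma boundary_OmegaP p : boundary (Omega : set (R * R)) p <->
  (-1 <= p.1 <= 1 /\ -1 <= p.2 <= 1) /\ ~ (-1 < p.1 < 1 /\ -1 < p.2 < 1).
Proof. by apply: boundary_rectP; lra. Qed.

Lemma boundary_OmP i p : boundary (Om i) p <->
  (gl (lo true i) <= p.1 <= gl (hi true i) /\ gl (lo false i) <= p.2 <= gl (hi false i)) /\
  ~ (gl (lo true i) < p.1 < gl (hi true i) /\ gl (lo false i) < p.2 < gl (hi false i)).
Proof.
by rewrite (OmE true); apply: boundary_rectP; rewrite /lo /hi; case: low; rewrite !gls; lra.
Qed.

Lemma GamP b i p : Gam i (nb b i) p <->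
  if b then p.1 = 0 /\ gl (lo false i) < p.2 < gl (hi false i)
  else gl (lo true i) < p.1 < gl (hi true i) /\ p.2 = 0.
Proof. by case: b; case: i; rewrite /lo /hi /= !gls; split=> -[]; rewrite /= !in_itv. Qed.

Lemma measurable_closed (A : set (R * R)) : closed A -> @measurable _ RR A.
Proof.
by move=> cA; rewrite -[A]setCK; apply: measurableC; apply: open_measurable2; exact: closed_openC.
Qed.

Lemma measurable_boundary D : @measurable _ RR (boundary D).
Proof.
apply: measurableD; first by apply: measurable_closed; exact: closed_closure.
by apply: open_measurable2; exact: open_interior.
Qed.

Lemma measurable_gridline (l : bool * 'I_3) : measurable_fun setT (gridline l : MR -> RR).
Proof.
case: l => b k; rewrite /gridline /=; case: b.
  by apply: measurable_fun_pair => //; exact: measurable_cst.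
by apply: measurable_fun_pair => //; exact: measurable_cst.
Qed.

Lemma arcset_measurable S : @measurable _ RR S -> arcset S.
Proof. by move=> mS l; rewrite -[X in measurable X]setTI; exact: measurable_gridline. Qed.

Lemma measurable_Gam i j : @measurable _ RR (Gam i j).
Proof.
by case: i; case: j => /=; try exact: measurable0; apply: measurableX => //;
  try exact: measurable_itv; exact: measurable_set1.
Qed.

Lemma boundary_closure D : boundary D `<=` closure D.
Proof. by move=> p []. Qed.

Lemma barc_boundary D : barc D (boundary D).
Proof.
split; first exact: boundary_closure.
by apply: arcset_measurable; exact: measurable_boundary.
Qed.

Lemma barc_outer i : barc (Om i) (outer i : set (R * R)).
Proof.
split; first by move=> p [/boundary_closure].
by apply: arcset_measurable; apply: measurableI; exact: measurable_boundary.
Qed.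

Lemma Gam_boundary b i : Gam i (nb b i) `<=` boundary (Om i : set (R * R)).
Proof.
move=> p /GamP h; apply/boundary_OmP; move: h; rewrite /lo /hi.
by case: b; case: i; rewrite /= !gls; lra.
Qed.

Lemma barc_Gam b i : barc (Om i) (Gam i (nb b i) : set (R * R)).
Proof.
split; first by move=> p /Gam_boundary/boundary_closure.
by apply: arcset_measurable; exact: measurable_Gam.
Qed.

Definition rest b i : set (R * R) := boundary (Om i) `\` Gam i (nb b i).

Lemma barc_rest b i : barc (Om i) (rest b i).
Proof.
split; first by move=> p [/boundary_closure].
apply: arcset_measurable; apply: measurableD; [exact: measurable_boundary|exact: measurable_Gam].
Qed.

Lemma outer_rest b i : outer i `<=` rest b i.
Proof.
move=> p [h1 h2]; split=> // /GamP h; move: h1 h2 h => /boundary_OmP + /boundary_OmegaP.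
by rewrite /lo /hi; case: b; case: i; rewrite /= !gls; lra.
Qed.

Lemma Gam_rest b i : Gam i (nb (~~ b) i) `<=` rest b i.
Proof.
move=> p h; split; first exact: Gam_boundary h.
move: h => /GamP h /GamP; move: h.
by rewrite /lo /hi; case: b; case: i; rewrite /= !gls; lra.
Qed.

Lemma countable_ae (A : set R) (P : R -> Prop) : countable A -> (forall t, ~ A t -> P t) ->
  {ae @lebesgue_measure R, forall t, P t}.
Proof.
move=> cA AP; exists A; split; first exact: countable_measurable.
  exact: countable_lebesgue_measure0.
by move=> t nP; apply: contrapT => nA; apply: nP; exact: AP.
Qed.

(** Interfaces are open segments, so the origin is missed; it has parameter 0 on the grid lines
    through it. *)
Lemma rest_cover b i : arc_ae (rest b i) (fun p => outer i p \/ Gam i (nb (~~ b) i) p).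
Proof.
move=> l; apply: (@countable_ae [set 0]); first exact: countable1.
move=> t /= t0; rewrite gridlineE; case: l => a k /= [/boundary_OmP h1 h2].
have [h|h] := pselect (boundary (Omega : set (R * R)) (line (~~ a) (k%:R - 1) t)).
  by left; split=> //; exact/boundary_OmP.
right; apply/GamP; move: h1 h2 h t0; rewrite line.unlock.
have kE : k%:R - 1 = -1 :> R \/ k%:R - 1 = 0 :> R \/ k%:R - 1 = 1 :> R.
  case: k => -[|[|[|//]]] /= _; [left|right; left|right; right]; lra.
move: (k%:R - 1) kE => s kE h1 h2 /boundary_OmegaP h3 /eqP t0.
have {}h2 : ~ (if b then (if ~~ a then (s, t) else (t, s)).1 = 0 /\ gl (lo false i) < (if ~~ a then (s, t) else (t, s)).2 < gl (hi false i)
  else gl (lo true i) < (if ~~ a then (s, t) else (t, s)).1 < gl (hi true i) /\ (if ~~ a then (s, t) else (t, s)).2 = 0).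
  by move=> /GamP.
move: h1 h2 h3 t0; rewrite /lo /hi.
by case: kE => [|[]] ->; case: a; case: b; case: i; rewrite /= !gls neq_lt => h1 h2 h3 /orP h4; lra.
Qed.

Lemma seg_outer d i : `]gl (lo (~~ d) i), gl (hi (~~ d) i)[ `<=` gridline (~~ d, out d i) @^-1` (outer i : set (R * R)).
Proof.
move=> t; rewrite /= in_itv/= gridlineE /= negbK line.unlock -/(gl _) => h.
split; [apply/boundary_OmP|apply/boundary_OmegaP]; move: h; rewrite /lo /hi /out;
by case: d; case: i; rewrite /= !gls; lra.
Qed.

Lemma seg_Gam d i : `]gl (lo (~~ d) i), gl (hi (~~ d) i)[ `<=` gridline (~~ d, k1) @^-1` (Gam i (nb d i) : set (R * R)).
Proof.
move=> t; rewrite /= in_itv/= gridlineE /= negbK line.unlock -/(gl _) => h.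
by apply/GamP; move: h; rewrite /lo /hi; case: d; case: i; rewrite /= !gls; lra.
Qed.

Lemma Gam_line b i (l : bool * 'I_3) : l != (~~ b, k1) -> gridline l @^-1` (Gam i (nb b i) : set (R * R)) = set0.
Proof.
case: l => a k lE; apply/seteqP; split=> // t; rewrite /= gridlineE => /GamP.
move: lE; rewrite line.unlock /lo /hi.
have [->|kE] : k = k1 \/ (k%:R - 1 = -1 :> R \/ k%:R - 1 = 1 :> R).
- case: k => -[|[|[|//]]] /= h; [right; left|left|right; right]; [lra|exact/val_inj|lra].
- rewrite -/(gl _) gl1; case: a; case: b; case: i => //=; rewrite /= !gls; lra.
- move=> _; case: kE => ->; case: a; case: b; case: i; rewrite /= !gls; lra.
Qed.

Lemma OmP i p : Om i p <-> gl (lo true i) < p.1 < gl (hi true i) /\ gl (lo false i) < p.2 < gl (hi false i).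
Proof. by rewrite (OmE true); exact: rectP. Qed.

Lemma flip_Om b i : flip b @^-1` Om i = Om (nb b i) :> set (R * R).
Proof.
apply/seteqP; split=> p; rewrite flip.unlock => /OmP h; apply/OmP; move: h;
  by case: b; case: i; rewrite /lo /hi /= !gls; lra.
Qed.

Lemma flip_Omega b : flip b @^-1` Omega = Omega :> set (R * R).
Proof.
have OP q : (Omega : set (R * R)) q <-> -1 < q.1 < 1 /\ -1 < q.2 < 1.
  exact: rectP.
by apply/seteqP; split=> p; rewrite flip.unlock => /OP h; apply/OP; move: h; case: b => /=; lra.
Qed.

Lemma flip_Gam b i : flip b @^-1` Gam i (nb b i) = Gam i (nb b i) :> set (R * R).
Proof.
apply/seteqP; split=> p; rewrite flip.unlock => /GamP h; apply/GamP; move: h;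
  by case: b; case: i; rewrite /lo /hi /= !gls; lra.
Qed.

Lemma flip_Gam_id b i p : Gam i (nb b i) p -> flip b p = p.
Proof.
move=> /GamP; rewrite flip.unlock; case: b => -[]; case: p => x y /=.
  by move=> ->; rewrite oppr0.
by move=> _ ->; rewrite oppr0.
Qed.

Lemma flip_Gam' b i : flip b @^-1` Gam i (nb (~~ b) i) = Gam (nb b i) (nb (~~ b) (nb b i)) :> set (R * R).
Proof.
apply/seteqP; split=> p; rewrite flip.unlock => /GamP h; apply/GamP; move: h;
  by case: b; case: i; rewrite /lo /hi /= !gls; lra.
Qed.

Lemma flip_boundary_Om b i : flip b @^-1` boundary (Om i) = boundary (Om (nb b i)) :> set (R * R).
Proof.
apply/seteqP; split=> p; rewrite flip.unlock => /boundary_OmP h; apply/boundary_OmP; move: h;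
  by case: b; case: i; rewrite /lo /hi /= !gls; lra.
Qed.

Lemma flip_boundary_Omega b : flip b @^-1` boundary Omega = boundary Omega :> set (R * R).
Proof.
apply/seteqP; split=> p; rewrite flip.unlock => /boundary_OmegaP h; apply/boundary_OmegaP; move: h;
  by case: b; rewrite /=; lra.
Qed.

Lemma flip_outer b i : flip b @^-1` outer i = outer (nb b i) :> set (R * R).
Proof. by rewrite /outer preimage_setI flip_boundary_Om flip_boundary_Omega. Qed.

Lemma Gam_sym i j : Gam i j = Gam j i :> set (R * R).
Proof. by case: i; case: j. Qed.

Lemma flip_rest b i : flip b @^-1` rest b i = rest b (nb b i).
Proof.
have E : Gam (nb b i) (nb b (nb b i)) = flip b @^-1` Gam i (nb b i) :> set (R * R).
  by rewrite nbK flip_Gam Gam_sym.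
by rewrite /rest E -flip_boundary_Om.
Qed.

(** [GamD1] is a set of sets, so membership is an equality of segments; the midpoints [A] and [B]
    exclude all other pairs of indices, including those with an empty interface. *)
Lemma GamD1P i j : @GamD1 R (Gam i j) <-> j = nb false i.
Proof.
have A : Gam Q2 Q3 (2^-1, 0 : R) by split => //=; rewrite in_itv/=; lra.
have B : Gam Q4 Q1 (- 2^-1, 0 : R) by split => //=; rewrite in_itv/=; lra.
split; last by move=> ->; case: i; [right|left|left|right].
case: i; case: j => //= -[] E; exfalso; have := A; have := B; rewrite -?E;
  by rewrite /= => -[] /=; rewrite ?in_itv/=; (try lra); move=> ? ? []; rewrite /= ?in_itv/=; lra.
Qed.

Lemma GamN1P i j : @GamN1 R (Gam i j) <-> j = nb true i.
Proof.
have A : Gam Q1 Q2 (0, - 2^-1 : R) by split => //=; rewrite in_itv/=; lra.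
have B : Gam Q3 Q4 (0, 2^-1 : R) by split => //=; rewrite in_itv/=; lra.
split; last by move=> ->; case: i; [left|left|right|right].
case: i; case: j => //= -[] E; exfalso; have := A; have := B; rewrite -?E;
  by rewrite /= => -[] /=; rewrite ?in_itv/=; (try lra); move=> ? ? []; rewrite /= ?in_itv/=; lra.
Qed.

Lemma Omega_Gamma p : (Omega `\` Gamma) p <-> exists i, Om i p.
Proof.
have cl : forall i j, closure (Gam i j) `<=` [set p | p.1 = 0 \/ p.2 = 0 :> R].
  move=> i j; have cA : closed [set p : R * R | p.1 = 0 \/ p.2 = 0].
    have -> : [set p : R * R | p.1 = 0 \/ p.2 = 0] = (fst @^-1` [set 0]) `|` (snd @^-1` [set 0]) by [].
    apply: closedU.
      by apply: preimage_closed; [move=> q _; exact: cvg_fst|exact: closed_eq].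
    by apply: preimage_closed; [move=> q _; exact: cvg_snd|exact: closed_eq].
  rewrite [X in _ `<=` X](closure_id _).1//; apply: closure_subset => q.
  by case: i; case: j => //= -[h1 h2]; first [by left|by right].
split.
  move=> [[]]; rewrite /= !in_itv/= => h1 h2 nG.
  have x0 : p.1 != 0.
    apply/eqP => x0; apply: nG; have [y0|y0|y0] := ltgtP p.2 0.
    - by exists Q1, Q2; apply: subset_closure; split=> //=; rewrite in_itv/=; lra.
    - by exists Q3, Q4; apply: subset_closure; split=> //=; rewrite in_itv/=; lra.
    (* The origin belongs to no interface but to the closure of this one, as points just below it
       show. *)
    exists Q1, Q2 => U /nbhs_ballP[r /= r0 hr].
    exists (0, - (Num.min r 1) / 2); split.
      split=> //=; rewrite in_itv/=; have : 0 < Num.min r 1 by rewrite lt_min r0 ltr01.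
      by have : Num.min r 1 <= 1; [rewrite ge_min lexx orbT|lra].
    apply: hr; split; rewrite /ball/= ?x0 ?y0 ?subrr ?normr0// sub0r normrN mulNr normrN.
    have m0 : 0 < Num.min r 1 by rewrite lt_min r0 ltr01.
    by rewrite gtr0_norm ?divr_gt0//; have : Num.min r 1 <= r; [rewrite ge_min lexx|lra].
  have y0 : p.2 != 0.
    apply/eqP => y0; apply: nG; move: x0; rewrite neq_lt => /orP[] x0.
    - by exists Q4, Q1; apply: subset_closure; split=> //=; rewrite in_itv/=; lra.
    - by exists Q2, Q3; apply: subset_closure; split=> //=; rewrite in_itv/=; lra.
  move: x0 y0; rewrite !neq_lt => /orP[] x0 /orP[] y0; [exists Q1|exists Q4|exists Q2|exists Q3];
    by split; rewrite /= in_itv/=; lra.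
move=> [i ip]; split; first exact: Om_sub ip.
by move=> [j [k /cl h]]; move: ip h; case: i => -[] /=; rewrite !in_itv/=; lra.
Qed.

End Geometry.

(** * The mixed problem on one subdomain *)

Section ZeroTraceSpace.
Context {R : realType}.
Implicit Types (i j : quad) (b d : bool) (D S : set (R * R)) (u v w : R * R -> R).

Lemma rOm i : isrect (Om i : set (R * R)). Proof. exact/isbox_rect/isbox_Om. Qed.
Lemma rOmega : isrect (Omega : set (R * R)). Proof. exact/isbox_rect/isbox_Omega. Qed.

Lemma lo_hi d i : [/\ gl (lo d i) <= (gl (hi d i) : R), gl (hi d i) - gl (lo d i) <= (2 : R),
  gl (lo d i) <= (gl (out d i) : R) <= gl (hi d i) & gl (lo d i) <= (gl k1 : R) <= gl (hi d i)].
Proof. by rewrite /lo /hi /out; case: low; rewrite !gls; split; lra. Qed.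

Lemma bn_wd_le_dirichlet D d u : isrect D -> H1 D u -> nm D (wd d D u) <= bn (dirichlet_form D) u.
Proof.
move=> rD hu; have PI := L2_preip rD; apply: bn_le; rewrite dirichlet_formE//.
have p1 := preip_ge0 PI (H1_L2_wd true hu); have p2 := preip_ge0 PI (H1_L2_wd false hu).
by case: d; [rewrite lerDl|rewrite lerDr].
Qed.

Lemma bn_dirichlet_le D u : isrect D -> H1 D u -> bn (dirichlet_form D) u <= H1norm D u.
Proof.
move=> rD hu; rewrite H1normE; apply: bn_le; rewrite dirichlet_formE// /h1form -addrA lerDr.
exact: (preip_ge0 (L2_preip rD) (H1_L2 hu)).
Qed.

Lemma trace_H1 D S u g : trace_of D S u g -> H1 D u. Proof. by case. Qed.

(** Poincare's inequality from the outer side gives 3 times the Dirichlet seminorm for the function,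
    and each of the two derivatives adds one: hence the 5. *)
Lemma zero_trace_poincare i S u : barc (Om i) S -> outer i `<=` S -> trace_of (Om i) S u (cst 0) ->
  H1norm (Om i) u <= 5 * bn (dirichlet_form (Om i)) u.
Proof.
move=> bS oS tu; have hu := trace_H1 tu; have rD := rOm i.
have [h1 h2 h3 _] := lo_hi true i.
have sub : `]gl (lo false i), gl (hi false i)[ `<=` gridline (false, out true i) @^-1` S.
  by move=> t /(@seg_outer R true i t)/oS.
have := @trace0_poincare R (Om i) (isbox_Om i) S u true _ _ _ _ (false, out true i) bS tu h1 h2 (OmE true i)
  erefl h3 sub.
have := bn_wd_le_dirichlet true rD hu; have := bn_wd_le_dirichlet false rD hu.
have := H1norm_le_nm rD hu; move: (nm _ u) (nm _ (wd true _ _)) (nm _ (wd false _ _)) (bn _ _) (H1norm _ _).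
by move=> x y z t s; lra.
Qed.

Lemma zero_trace_dirichlet i S u : barc (Om i) S -> outer i `<=` S -> trace_of (Om i) S u (cst 0) ->
  dirichlet_form (Om i) u u = 0 -> aeq (Om i) u (cst 0).
Proof.
move=> bS oS tu u0; have hu := trace_H1 tu; have rD := rOm i.
have := zero_trace_poincare bS oS tu; rewrite {1}bn.unlock u0 sqrtr0 mulr0 => h.
apply: nm_eq0 => //; first exact: H1_L2.
apply/eqP; rewrite eq_le bn_ge0 andbT.
exact: le_trans (nm_le_H1norm rD hu).1 h.
Qed.

(** The test space of the mixed problem whose Neumann side is the interface normal to the axis [b]:
    [true] in the first step, [false] in the second. *)
Definition Vrest b i : (R * R -> R) -> Prop := fun v => trace_of (Om i) (rest b i) v (cst 0).

Lemma trace_smooth D S u : isbox D -> barc D S -> smooth u -> trace_of D S u u.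
Proof.
move=> bD bS su; have rD := isbox_rect bD; have PA := aq_preip bS.2; have PH := h1form_preip rD.
apply/trace_ofP; split; first exact: H1_smooth.
  exact: (arc_L2_smooth bD bS su).
exists (fun=> u); split => //.
  rewrite subrr; under eq_fun do rewrite H1normE bn.unlock (preip_form0l PH (preip0 PH)) sqrtr0.
  exact: cvg_cst.
rewrite subrr; under eq_fun do rewrite bn.unlock (preip_form0l PA (preip0 PA)) sqrtr0.
exact: cvg_cst.
Qed.

Lemma Vrest_preip b i : preip (Vrest b i) (dirichlet_form (Om i)).
Proof.
have PD := dirichlet_preip (rOm i).
have VH v : Vrest b i v -> H1 (Om i) v by exact: trace_H1.
split.
- exact: (trace_smooth (isbox_Om i) (barc_rest b i) smooth0).
- move=> k u v hu hv; have := trace_lin (isbox_Om i) k (barc_rest b i) hu hv.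
  by rewrite -[cst 0]/(0 : R * R -> R) scaler0 addr0.
- by move=> u v /VH hu /VH hv; exact: (preipC PD).
- by move=> k u v w /VH hu /VH hv /VH hw; exact: (preipE PD).
- by move=> u /VH hu; exact: (preip_ge0 PD).
Qed.

Lemma Vrest_complete b i : bn_complete (Vrest b i) (dirichlet_form (Om i)).
Proof.
move=> u Vu cu; have rD := rOm i; have PV := Vrest_preip b i.
have hu n : H1 (Om i) (u n) by exact: trace_H1 (Vu n).
have K5 : 0 < 5 :> R by [].
have cH : bn_cauchy (h1form (Om i)) u.
  apply: (bn_cauchy_leK K5) cu => m n; rewrite -H1normE.
  apply: (@zero_trace_poincare i (rest b i)); [exact: barc_rest|exact: outer_rest|exact: (preipB PV)].
have [v hv cv] := H1_complete rD hu cH.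
have {}cv : H1norm (Om i) (u n - v) @[n --> \oo] --> (0 : R) by under eq_fun do rewrite H1normE.
exists v; first exact: (trace0_closed (isbox_Om i) (barc_rest b i) Vu hv cv).
apply: cvg0_le cv => n; rewrite bn_ge0 /=; apply: bn_dirichlet_le => //; exact: H1B.
Qed.

Lemma smooth1_line n d (s : R) u : Ck n u -> Ck1 n (fun t => u (line d t s)).
Proof.
elim: n u => [|n IH] u; first by move=> h; apply: continuous_line; exact: Ck_continuous h.
move=> h; have [h1 h2] := CkS_derive h; have [d1 d2] := CkS_partial h.
exists (fun t => (if d then 'D_e1 u else 'D_e2 u) (line d t s)); last by apply: IH; case: (d).
move=> x; case: (d); rewrite line.unlock.
  by have := d1 (x, s) => /is_derive_e1.
by have := d2 (s, x) => /is_derive_e2.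
Qed.

Lemma aq_eq S u v : (forall p, S p -> u p = v p) -> aq S u u = aq S v v.
Proof.
move=> uv; rewrite !aqE; apply: eq_bigr => l _; rewrite !jqE; apply: eq_Rintegral => t.
by rewrite inE => St; rewrite /= uv.
Qed.

Lemma sqr_small (e x y : R) : x < e / 4 -> y < e / 4 -> 0 <= x -> 0 <= y -> 0 < e ->
  2 * x ^+ 2 + 4 * y ^+ 2 < e ^+ 2.
Proof.
move=> xe ye x0 y0 e0.
have h1 : x ^+ 2 < (e / 4) ^+ 2 by rewrite ltr_pXn2r ?nnegrE// ltW// divr_gt0.
have h2 : y ^+ 2 < (e / 4) ^+ 2 by rewrite ltr_pXn2r ?nnegrE// ltW// divr_gt0.
have e2 : 0 < e ^+ 2 by rewrite exprn_gt0.
by move: h1 h2 e2; rewrite expr_div_n; move: (x ^+ 2) (y ^+ 2) (e ^+ 2) => X Y E; lra.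
Qed.

(** * The lift of the Dirichlet datum and the solution of the mixed problem *)

Section Lift.
Variables (w w' : R * R -> R) (zn : nat -> R * R -> R).
Hypotheses (hw : H2 Omega w) (sz : forall n, smooth (zn n))
  (cz : H1norm Omega (zn n - w) @[n --> \oo] --> (0 : R)) (uz : unif Omega zn w')
  (mz : cvn Omega (fun n => cd false (cd true (zn n))) (wd false Omega (wd true Omega w)))
  (w0 : w' (-1, 0) = 0).

Let D : set (R * R) := Om Q1.
Let rD : isrect D := rOm Q1.
Let bD : isbox D := isbox_Om Q1.
Let DO : D `<=` Omega := @Om_sub R Q1.
Let h1 : H1 Omega w. Proof. by case: hw. Qed.
Let h2 d : H1 Omega (wd d Omega w). Proof. by have /H2P[_] := hw; exact. Qed.

(** Subtracting the corner value makes the lift vanish exactly on the outer boundary; the correction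
    disappears in the limit because [w'] is 0 at the corner. *)
Let an n (x : R) : R := zn n (line true x 0) - zn n (-1, 0).
Let an' n (x : R) : R := cd true (zn n) (line true x 0).
Let y1 (y : R) : R := 1 + y.
Let Ln n := tensd true (an n) y1.

Let s_an n : smooth1 (an n).
Proof.
move=> k; apply: Ck1D; first exact: (@smooth1_line k true 0 _ (sz n k)).
exact: Ck1_cst.
Qed.

Let s_y1 : smooth1 y1. Proof. by apply: smooth1D; [exact: smooth1_cst|exact: smooth1_id]. Qed.

Let s_Ln n : smooth (Ln n). Proof. exact: smooth_tensd. Qed.

Let d_an n (x : R) : is_derive x 1 (an n) (an' n x).
Proof.
have h := @is_derive_line R true x 0 _ (sz n).
apply: (is_derive_eq (is_deriveB h (is_derive_cst _ _ _))); by rewrite subr0.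
Qed.

Let d_y1 (x : R) : is_derive x 1 y1 1.
Proof.
apply: (is_derive_eq (is_deriveD (is_derive_cst _ _ _) (is_derive_id _ _))); by rewrite add0r.
Qed.

Let c_an' n : continuous (an' n).
Proof. by apply: continuous_line; apply: smooth_continuous; exact: smooth_cd. Qed.

Let DE : D = rectd true (-1) 0 (-1) 0.
Proof. by []. Qed.

(** The trace inequality for the x-derivative of [zn] on the line y = 0 involves its y-derivative,
    that is, the mixed derivative: this is why its convergence is recorded in [H2_approx]. *)
Let an_cauchy : bn_cauchy (jq `]-1, 0[) an'.
Proof.
have s1 n := smooth_cd true (sz n); have s12 n := smooth_cd false (s1 n).
have L1 n : L2 D (cd true (zn n)) by exact: L2_smooth.
have L12 n : L2 D (cd false (cd true (zn n))) by exact: L2_smooth.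
have [_ c1] := cvn_cd_wd true rOmega sz h1 cz.
have LO (f : R * R -> R) : smooth f -> L2 Omega f by exact: L2_smooth rOmega.
have c1' := cvn_cauchy rD L1 (L2S rOmega rD DO (H1_L2_wd true h1))
  (cvnS rOmega rD DO (fun n => LO _ (s1 n)) (H1_L2_wd true h1) c1).
have c2' := cvn_cauchy rD L12 (L2S rOmega rD DO (H1_L2_wd false (h2 true)))
  (cvnS rOmega rD DO (fun n => LO _ (s12 n)) (H1_L2_wd false (h2 true)) mz).
move=> e e0; have e4 : 0 < e / 4 by rewrite divr_gt0.
have [N1 hN1] := c1' _ e4; have [N2 hN2] := c2' _ e4.
exists (maxn N1 N2) => m n; rewrite !geq_max => /andP[m1 m2] /andP[n1 n2].
have {hN1}t1 := hN1 m n m1 n1; have {hN2}t2 := hN2 m n m2 n2.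
have PJ := jq_preip (measurable_itv `]-1, (0:R)[).
have La k : L2l `]-1, 0[ (an' k) by exact: L2l_continuous.
have PI := L2_preip rD.
rewrite -(ltr_pXn2r (n:=2)) ?nnegrE ?bn_ge0 ?(ltW e0)// (sqr_bn PJ); last exact: (preipB PJ).
have b1 : 1 <= 0 - (-1 : R) <= 2 by apply/andP; split; lra.
have s0 : -1 <= (0 : R) <= 0 by apply/andP; split; lra.
have := @trace_rect R false (-1) 0 (-1) 0 (cd true (zn m) - cd true (zn n)) 0 b1 (smoothB (s1 m) (s1 n)) s0.
rewrite -[rectd false _ _ _ _]/D cdB//.
have -> : (fun t => (cd true (zn m) - cd true (zn n)) (line false 0 t)) = (an' m - an' n).
  by apply/funext => t; rewrite /an' [in RHS]line.unlock line.unlock.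
move=> h; apply: le_lt_trans h _.
rewrite -(sqr_bn PI); last exact: (preipB PI).
rewrite -(sqr_bn PI); last exact: (preipB PI).
move: t1 t2 (bn_ge0 (iq D) (cd true (zn m) - cd true (zn n))) (bn_ge0 (iq D) (cd false (cd true (zn m)) - cd false (cd true (zn n)))) e0.
by move=> *; apply: sqr_small.
Qed.

Let tens_cauchy (g : R -> R) : continuous g -> (forall y, -1 < y < 0 -> `|g y| <= 1) ->
  bn_cauchy (iq D) (fun n => tensd true (an' n) g).
Proof.
move=> cg g1; apply: bn_cauchy_leK (ltr01 : 0 < 1 :> R) _ an_cauchy => m n.
rewrite mul1r; apply: bn_le.
have -> : tensd true (an' m) g - tensd true (an' n) g = tensd true (an' m - an' n) g.
  apply/funext => p; change (an' m p.1 * g p.2 - an' n p.1 * g p.2 = (an' m p.1 - an' n p.1) * g p.2).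
  by rewrite mulrBl.
have ca : continuous (an' m - an' n) by move=> x; apply: cvgB; exact: c_an'.
rewrite DE iq_tensd//; apply: ler_piMr; first exact: jq_ge0.
have := @le_jq R (-1) 0 g (cst 1) cg (@cst_continuous _ _ _).
have N1 : -1 <= (0 : R) by lra.
rewrite (@jq_cst R (-1) 0 1 N1) expr1n mul1r sub0r opprK; apply => t /g1 h.
by rewrite -(real_normK (num_real (g t))) ?expr1n exprn_ile1.
Qed.

(** The lifts and their y-derivatives vanish on x = -1, so that [line_primitive_cauchy] reduces
    their convergence to that of their x-derivatives, which are tensor products with the factor
    [an']. *)
Let Ln_cauchy : bn_cauchy (h1form D) Ln.
Proof.
have N1 : (-1 : R) <= 0 by lra.
have N2 : 0 - (-1 : R) <= 2 by lra.
have an0 n : an n (-1) = 0 by rewrite /an line.unlock subrr.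
have d1 n : cd true (Ln n) = tensd true (an' n) y1 by exact: cd_tensd.
have d2 n : cd false (Ln n) = tensd true (an n) (cst 1) by exact: (@cd_tensdC _ true).
have d12 n : cd true (cd false (Ln n)) = tensd true (an' n) (cst 1) by rewrite d2; exact: cd_tensd.
have c1 : bn_cauchy (iq D) (fun n => cd true (Ln n)).
  under eq_fun do rewrite d1; apply: tens_cauchy; first exact: smooth1_continuous.
  by move=> y /andP[? ?]; rewrite ler_norml /y1; apply/andP; split; lra.
have c12 : bn_cauchy (iq D) (fun n => cd true (cd false (Ln n))).
  under eq_fun do rewrite d12; apply: tens_cauchy; first exact: cst_continuous.
  by move=> y _; rewrite normr1.
have [L LL cL] := @line_primitive_cauchy R true (-1) 0 (-1) 0 Ln N1 N2 N1 s_Ln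
  (fun n t => etrans (tensd_line _ _ _ _ _) (etrans (congr1 (fun z => z * y1 t) (an0 n)) (mul0r _))) c1.
have s2 n := smooth_cd false (s_Ln n).
have [L' LL' cL'] : exists2 u, L2 D u & cvn D (fun n => cd false (Ln n)) u.
  apply: (@line_primitive_cauchy R true (-1) 0 (-1) 0 _ N1 N2 N1 s2 _ c12) => n t.
  by rewrite d2 tensd_line an0 mul0r.
have [L1 LL1 cL1] := L2_cauchy_lim rD (fun n => L2_smooth rD (smooth_cd true (s_Ln n))) c1.
have [|||hL _ c] := @H1_cvg_smooth R D Ln L (fun d => if d then L1 else L') rD s_Ln LL.
- by case.
- exact: cL.
- by case.
apply: (bn_cvg_cauchy (h1form_preip rD) (fun n => H1_smooth rD (s_Ln n)) hL).
by under eq_fun do rewrite -H1normE.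
Qed.

Lemma lift_exists : exists L, [/\ H1 D L, trace_of D (outer Q1) L (cst 0) & trace_of D (Gam Q1 Q4) L w'].
Proof.
have bO : barc D (outer Q1) := barc_outer Q1; have bG : barc D (Gam Q1 Q4) := barc_Gam false Q1.
have [L hL cL] := H1_complete rD (fun n => H1_smooth rD (s_Ln n)) Ln_cauchy.
have {}cL : H1norm D (Ln n - L) @[n --> \oo] --> (0 : R) by under eq_fun do rewrite H1normE.
exists L; split=> //.
  apply: (trace0_closed bD bO _ hL cL) => n.
  have m0 : arc_measurable (outer Q1) (cst (0 : R)) by move=> l; exact: measurable_cst.
  apply: (trace_ae bD bO (trace_smooth bD bO (s_Ln n)) m0) => l.
  apply: nearW => t [/boundary_OmP B1 /boundary_OmegaP B2]; move: B1 B2; rewrite /lo /hi /= !gls.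
  move: (gridline l t) => p B1 B2.
  have [p1|p2] : p.1 = -1 \/ p.2 = -1 by lra.
    by rewrite /Ln /tensd /tens p1 /an line.unlock subrr mul0r.
  by rewrite /Ln /tensd /tens p2 /y1 subrr mulr0.
have bGD := trace_ofP D; have PA := aq_preip bG.2.
have unifD := unifS DO uz; have hwD := H1S rOmega rD DO h1.
have czD : H1norm D (zn n - w) @[n --> \oo] --> (0 : R).
  apply: cvg0_le cz => n; rewrite H1norm_ge0 /=.
  have hd := H1B rOmega (H1_smooth rOmega (sz n)) h1.
  rewrite !H1normE; apply: bn_le; rewrite /h1form.
  have le u v : L2 Omega u -> L2 D v -> aeq D v u -> iq D v v <= iq Omega u u.
    move=> Lu Lv vu; have := nm_subset rOmega rD DO Lu.
    rewrite -(nm_ae rD Lv.1 (L2S rOmega rD DO Lu).1 vu).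
    by rewrite -(ler_pXn2r (n:=2)) ?nnegrE ?bn_ge0// (sqr_bn (L2_preip rD))// (sqr_bn (L2_preip rOmega)).
  have Ld := H1_L2 hd; have hdD := H1S rOmega rD DO hd.
  apply: lerD; first apply: lerD.
  - by apply: le => //; [exact: H1_L2|exact: aeq_refl].
  - exact: (le _ _ (H1_L2_wd true hd) (H1_L2_wd true hdD) (@wdS R Omega D true _ rOmega rD DO hd)).
  - exact: (le _ _ (H1_L2_wd false hd) (H1_L2_wd false hdD) (@wdS R Omega D false _ rOmega rD DO hd)).
have tw := unif_trace bD bG sz hwD czD unifD.
have /trace_ofP[_ hw' _] := tw.
have cw := trace_cvg bD bG tw sz czD.
apply/trace_ofP; split; [exact: hL|exact: hw'|exists Ln; split; [exact: s_Ln|exact: cL|]].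
(* On the interface [Ln n] and [zn n] differ by this corner value alone. *)
have c0 : zn n (-1, 0) @[n --> \oo] --> (0 : R).
  have Dp : closure D (-1, 0) by rewrite DE closure_rect; [split=> /=; lra|lra|lra].
  by have := unif_pointwise unifD Dp; rewrite w0.
have cn : `|zn n (-1, 0)| * bn (aq (Gam Q1 Q4)) (cst (1 : R)) @[n --> \oo] --> (0 : R).
  have nz : `|zn n (-1, 0)| @[n --> \oo] --> (0 : R).
    apply/cvgrPdist_lt => e e0; move/cvgrPdist_lt : c0 => /(_ e e0); apply: filterS => n.
    by rewrite !sub0r !normrN normr_id.
  have := cvgM nz (cvg_cst (bn (aq (Gam Q1 Q4)) (cst (1 : R)))).
  by rewrite mul0r; apply.
have L1 : arc_L2 (Gam Q1 Q4) (cst (1 : R)) by apply: (arc_L2_continuous bD bG); exact: cst_continuous.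
apply: cvg0_le (cvgD0 cw cn) => n; rewrite bn_ge0 /=.
have Lz := arc_L2_smooth bD bG (sz n).
rewrite -(bnZ PA _ L1).
have -> : bn (aq (Gam Q1 Q4)) (Ln n - w') = bn (aq (Gam Q1 Q4)) ((zn n - w') - zn n (-1, 0) *: cst 1).
  rewrite bn.unlock; congr (Num.sqrt _); apply: aq_eq => p [_ p2].
  have {}p2 : p.2 = 0 by [].
  change (an n p.1 * y1 p.2 - w' p = zn n p - w' p - zn n (-1, 0) * 1).
  rewrite /an /y1 p2 line.unlock addr0 !mulr1 -p2 -surjective_pairing; ring.
have Lc := preipZ PA (zn n (-1, 0)) L1.
by rewrite -(bnN PA Lc); apply: (bnD PA (preipB PA Lz hw') (preipN PA Lc)).
Qed.

(** After subtraction of the lift [L], the unknown lies in [Vrest true Q1], which is complete for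
    the Dirichlet form by Poincare's inequality; the functional [l] is the Neumann datum of [w] less
    the contribution of [L]. *)
Lemma bvp : exists e, [/\ H1 D e, trace_of D (outer Q1) e (cst 0), trace_of D (Gam Q1 Q4) e w' &
  forall v, Vrest true Q1 v -> dirichlet_form D e v = normal_deriv D w v].
Proof.
have [L [hL oL gL]] := lift_exists; have PV := Vrest_preip true Q1; have PD := dirichlet_preip rD.
have PI := L2_preip rD.
have VH v : Vrest true Q1 v -> H1 D v by exact: trace_H1.
have hwD := H1S rOmega rD DO h1; have Ll := L2_lap rOmega hw rD DO.
pose l v := dirichlet_form D w v + iq D (lap Omega w) v - dirichlet_form D L v.
have lE a u v : Vrest true Q1 u -> Vrest true Q1 v -> l (a *: u + v) = a * l u + l v.
  move=> /VH hu /VH hv; have hau := preipZ PD a hu.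
  have Lu := H1_L2 hu; have Lv := H1_L2 hv; have Lau := preipZ PI a Lu.
  rewrite /l !(preip_formDr PD)// !(preip_formZr PD)// (preip_formDr PI)// (preip_formZr PI)//.
  move: (dirichlet_form D w u) (dirichlet_form D w v) (dirichlet_form D L u) (dirichlet_form D L v)
    (iq D (lap Omega w) u) (iq D (lap Omega w) v) => x1 x2 x3 x4 x5 x6; ring.
pose C := bn (dirichlet_form D) w + nm D (lap Omega w) * 5 + bn (dirichlet_form D) L.
have lB u : Vrest true Q1 u -> `|l u| <= C * bn (dirichlet_form D) u.
  move=> Vu; have hu := VH _ Vu; have Lu := H1_L2 hu.
  have b1 := bn_CS PD hwD hu; have b2 := bn_CS PI Ll Lu; have b3 := bn_CS PD hL hu.
  have p := zero_trace_poincare (barc_rest true Q1) (@outer_rest R true Q1) Vu.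
  have p' := (nm_le_H1norm rD hu).1.
  have b4 : nm D (lap Omega w) * nm D u <= nm D (lap Omega w) * (5 * bn (dirichlet_form D) u).
    by apply: ler_wpM2l; [exact: bn_ge0|exact: le_trans p' p].
  rewrite /l /C !mulrDl -mulrA.
  apply: le_trans (ler_normB _ _) _; apply: lerD => //.
  by apply: le_trans (ler_normD _ _) _; apply: lerD => //; exact: le_trans b2 b4.
have [v Vv vE] := riesz PV (@Vrest_complete true Q1) lE lB.
have hv := VH _ Vv.
exists (1 *: L + v); split.
- exact: (preipL PD).
- have bO : barc D (outer Q1) := barc_outer Q1.
  have tv := trace_restrict bD (@outer_rest R true Q1) (barc_rest true Q1) bO Vv.
  have := trace_lin bD 1 bO oL tv.
  by rewrite -[cst 0]/(0 : R * R -> R) scaler0 addr0.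
- have bG : barc D (Gam Q1 Q4) := barc_Gam false Q1.
  have tv : trace_of D (Gam Q1 Q4) v (cst 0) :=
    trace_restrict bD (@Gam_rest R true Q1) (barc_rest true Q1) bG Vv.
  have E : 1 *: w' + cst 0 = w' :> (R * R -> R).
    by apply/funext => p; change (1 * w' p + 0 = w' p); rewrite mul1r addr0.
  by rewrite -[X in trace_of _ _ _ X]E; exact: (trace_lin bD 1 bG gL tv).
- move=> u Vu; have hu := VH _ Vu.
  rewrite (preipE PD)// mul1r vE// /l.
  rewrite (normal_derivE rD Ll (H2_poisson rOmega hw rD DO) (H1_L2 hu)).
  move: (dirichlet_form D w u) (dirichlet_form D L u) (iq D (lap Omega w) u) => x1 x2 x3; ring.
Qed.

End Lift.

End ZeroTraceSpace.

(** * Fluxes across the interfaces *)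

Section Tools.
Context {R : realType}.
Implicit Types (i j : quad) (b d : bool) (D S : set (R * R)) (u v w z g h : R * R -> R).

Lemma H1norm_subset D D' u : isrect D -> isrect D' -> D' `<=` D -> H1 D u ->
  H1norm D' u <= H1norm D u.
Proof.
move=> rD rD' DD hu; have hu' := H1S rD rD' DD hu.
have le f g : L2 D f -> L2 D' g -> aeq D' g f -> iq D' g g <= iq D f f.
  move=> Lf Lg gf; have := nm_subset rD rD' DD Lf.
  rewrite -(nm_ae rD' Lg.1 (L2S rD rD' DD Lf).1 gf).
  by rewrite -(ler_pXn2r (n:=2)) ?nnegrE ?bn_ge0// (sqr_bn (L2_preip rD'))// (sqr_bn (L2_preip rD)).
rewrite !H1normE; apply: bn_le; rewrite /h1form.
apply: lerD; first apply: lerD.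
- by apply: le; [exact: H1_L2|exact: H1_L2|exact: aeq_refl].
- exact: (le _ _ (H1_L2_wd true hu) (H1_L2_wd true hu') (@wdS R D D' true _ rD rD' DD hu)).
- exact: (le _ _ (H1_L2_wd false hu) (H1_L2_wd false hu') (@wdS R D D' false _ rD rD' DD hu)).
Qed.

Lemma trace_subdomain D D' S u g : isbox D -> isbox D' -> D' `<=` D -> barc D S -> barc D' S ->
  trace_of D S u g -> trace_of D' S u g.
Proof.
move=> bD bD' DD bS bS' /trace_ofP[hu hg [phi [s1 c1 cg]]].
have rD := isbox_rect bD; have rD' := isbox_rect bD'.
apply/trace_ofP; split; [exact: (H1S rD rD' DD hu)|exact: hg|exists phi; split; [exact: s1| |exact: cg]].
apply: cvg0_le c1 => n; rewrite H1norm_ge0 /=; apply: H1norm_subset => //.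
by apply: H1B => //; exact: H1_smooth.
Qed.

Lemma trace_aeq D S u v g : isbox D -> H1 D v -> aeq D u v -> trace_of D S u g -> trace_of D S v g.
Proof.
move=> bD hv uv /trace_ofP[hu hg [phi [s1 c1 cg]]]; have rD := isbox_rect bD.
apply/trace_ofP; split; [exact: hv|exact: hg|exists phi; split; [exact: s1| |exact: cg]].
suff -> : (fun n => H1norm D (phi n - v)) = (fun n => H1norm D (phi n - u)) by [].
apply/funext => n; have hp := H1_smooth rD (s1 n); apply: H1norm_ae => //.
- exact: (H1_measurable (H1B rD hp hv)).
- exact: (H1_measurable (H1B rD hp hu)).
- by apply: aeqB; [exact: aeq_refl|exact: aeq_sym].
Qed.

Lemma H1_congr D u v : isrect D -> (forall p, D p -> u p = v p) -> H1 D u -> H1 D v /\ aeq D u v.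
Proof.
move=> rD uv hu; have a : aeq D u v by exact: nearW.
split=> //; apply: (H1_ae rD _ a hu).
apply: eq_measurable_fun (H1_measurable hu) => p; rewrite inE; exact: uv.
Qed.

Lemma H2_L D (k : R) u v : isrect D -> H2 D u -> H2 D v -> H2 D (k *: u + v).
Proof.
move=> rD /H2P[hu hu2] /H2P[hv hv2]; have h := H1L k rD hu hv.
apply/H2P; split=> // d; have h2 := H1L k rD (hu2 d) (hv2 d).
apply: (H1_ae rD _ (aeq_sym (wdL d k rD hu hv)) h2).
exact: (H1_L2_wd d h).1.
Qed.

Lemma H2_ae D u v : isrect D -> measurable_on D v -> aeq D u v -> H2 D u -> H2 D v.
Proof.
move=> rD mv uv /H2P[hu hu2]; have hv := H1_ae rD mv uv hu.
by apply/H2P; split=> // d; rewrite -(wd_ae d rD (H1_measurable hu) mv uv).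
Qed.

Lemma dirichlet_ae D u v w : isrect D -> measurable_on D u -> measurable_on D v -> aeq D u v ->
  dirichlet_form D u w = dirichlet_form D v w.
Proof. by move=> rD mu mv uv; rewrite /dirichlet_form -!wd1 -!wd2 !(wd_ae _ rD mu mv uv). Qed.

(** Almost everywhere equal functions satisfy the same Poisson equations, so that [wlaplacian]
    chooses the same function for both. *)
Lemma normal_deriv_ae D u v w : isrect D -> measurable_on D u -> measurable_on D v -> aeq D u v ->
  normal_deriv D u w = normal_deriv D v w.
Proof.
move=> rD mu mv uv; rewrite /normal_deriv (dirichlet_ae w rD mu mv uv).
suff -> : wlaplacian D u = wlaplacian D v by [].
have E : poisson D u = poisson D v.
  apply/funext => l; apply/propext; split=> h phi tp; have := h phi tp.
    by rewrite (dirichlet_ae phi rD mu mv uv).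
  by rewrite (dirichlet_ae phi rD mu mv uv).
by rewrite /wlaplacian E.
Qed.

Lemma normal_deriv_L D (k : R) u v l m w : isrect D -> H1 D u -> H1 D v -> H1 D w ->
  L2 D l -> L2 D m -> poisson D u (fun x => - l x) -> poisson D v (fun x => - m x) ->
  normal_deriv D (k *: u + v) w = k * normal_deriv D u w + normal_deriv D v w.
Proof.
move=> rD hu hv hw Ll Lm pu pv; have PI := L2_preip rD; have PD := dirichlet_preip rD.
have Lkm := preipL PI k Ll Lm.
have pl : poisson D (k *: u + v) (fun x => - (k *: l + m) x).
  apply/poissonE => phi tp; have hp := H1_smooth rD (test_fun_smooth tp); have Lp := L2_test rD tp.
  rewrite (preipE PD)// iqNl// (preipE PI)//.
  move/poissonE : pu => /(_ phi tp) ->; move/poissonE : pv => /(_ phi tp) ->.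
  by rewrite !iqNl// opprD mulrN.
have Lw := H1_L2 hw.
rewrite (normal_derivE rD Lkm pl Lw) (normal_derivE rD Ll pu Lw) (normal_derivE rD Lm pv Lw).
rewrite (preipE PD)// (preipE PI)//.
move: (dirichlet_form D u w) (dirichlet_form D v w) (iq D l w) (iq D m w) => x1 x2 x3 x4; ring.
Qed.

Lemma poisson_flip b D u F : isrect D -> isrect (flip b @^-1` D) -> H1 D u -> L2 D F ->
  poisson D u F -> poisson (flip b @^-1` D) (u \o flip b) (F \o flip b).
Proof.
move=> rD rD' hu LF /poissonE h; apply/poissonE => phi tp.
have tp' : test_fun D (phi \o flip b) by rewrite -[D](preflipK b); exact: test_fun_flip.
have hp := H1_smooth rD (test_fun_smooth tp').
by rewrite -[phi](compflipK b) dirichlet_flip// h// iq_flip//; exact: L2_test.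
Qed.

Lemma normal_deriv_flip b D u l v : isrect D -> isrect (flip b @^-1` D) -> H1 D u -> H1 D v ->
  L2 D l -> poisson D u (fun x => - l x) ->
  normal_deriv (flip b @^-1` D) (u \o flip b) (v \o flip b) = normal_deriv D u v.
Proof.
move=> rD rD' hu hv Ll pu; have PI := L2_preip rD; have Lv := H1_L2 hv.
have LN : L2 D (fun x => - l x).
  have -> : (fun x => - l x) = - l by [].
  exact: (preipN PI).
have pl : poisson (flip b @^-1` D) (u \o flip b) (fun x => - (l \o flip b) x).
  exact: (poisson_flip rD rD' hu LN pu).
rewrite (normal_derivE rD Ll pu Lv) (normal_derivE rD' (L2_flip b rD Ll) pl (L2_flip b rD Lv)).
by rewrite dirichlet_flip// iq_flip.
Qed.

(** Green's formula orders the two sides along the axis, whereas the data are attached to the outer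
    side and to the interface. *)
Lemma Om_sides d i v gO gG : side (Om i) (gl (lo (~~ d) i)) (gl (hi (~~ d) i)) (~~ d, out d i) v gO ->
  side (Om i) (gl (lo (~~ d) i)) (gl (hi (~~ d) i)) (~~ d, k1) v gG ->
  side (Om i) (gl (lo (~~ d) i)) (gl (hi (~~ d) i)) (~~ d, lo d i) v (if low d i then gO else gG) /\
  side (Om i) (gl (lo (~~ d) i)) (gl (hi (~~ d) i)) (~~ d, hi d i) v (if low d i then gG else gO).
Proof.
have L : lo d i = if low d i then k0 else k1 by [].
have H : hi d i = if low d i then k1 else k2 by [].
by rewrite L H /out; case: (low d i).
Qed.

Lemma side_of D S C E l v g : barc D S -> trace_of D S v g -> `]C, E[ `<=` gridline l @^-1` S ->
  side D C E l v g.
Proof. by move=> bS tv sub; exists S. Qed.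

Lemma rest_sides d b i v : Vrest b i v ->
  (d != b -> side (Om i) (gl (lo (~~ d) i)) (gl (hi (~~ d) i)) (~~ d, k1) v (cst 0)) /\
  side (Om i) (gl (lo (~~ d) i)) (gl (hi (~~ d) i)) (~~ d, out d i) v (cst 0).
Proof.
move=> Vv; split=> [db|].
  apply: (side_of (barc_rest b i) Vv); apply: subset_trans (@seg_Gam R d i) _.
  have -> : d = ~~ b by move: db; case: (d); case: (b).
  by move=> t; exact: Gam_rest.
apply: (side_of (barc_rest b i) Vv); apply: subset_trans (@seg_outer R d i) _.
by move=> t; exact: outer_rest.
Qed.

Lemma flux_zero_Om d i p r v : L2 Omega p -> is_wd d Omega p r ->
  side (Om i) (gl (lo (~~ d) i)) (gl (hi (~~ d) i)) (~~ d, k1) v (cst 0) ->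
  side (Om i) (gl (lo (~~ d) i)) (gl (hi (~~ d) i)) (~~ d, out d i) v (cst 0) ->
  flux_form d (Om i) p r v = 0.
Proof.
move=> Lp hp sG sO; have [h1 h2] := Om_sides sO sG; rewrite !if_same in h1 h2.
have [l1 _ _ _] := @lo_hi R d i; have [l2 _ _ _] := @lo_hi R (~~ d) i.
exact: (flux_zero (isbox_Omega (R := R)) Lp hp (isbox_Om i) (@Om_sub R i) l1 l2 (OmE d i) h1 h2).
Qed.

Section H2Flux.
Variable z : R * R -> R.
Hypothesis hz : H2 Omega z.
Let h1 : H1 Omega z. Proof. by case: hz. Qed.
Let h2 d : H1 Omega (wd d Omega z). Proof. by have /H2P[_] := hz; exact. Qed.

(** Extends Green's formula for [z] from smooth functions of compact support to all H1 functions of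
    zero trace: the flux along each axis vanishes by [flux_zero]. *)
Lemma nd_zero i v : trace_of (Om i) (boundary (Om i)) v (cst 0) -> normal_deriv (Om i) z v = 0.
Proof.
move=> tv; have hv := trace_H1 tv.
have V b : Vrest b i v.
  apply: (trace_restrict (isbox_Om i) _ (barc_boundary _) (barc_rest b i) tv).
  by move=> p [].
have sG d : side (Om i) (gl (lo (~~ d) i)) (gl (hi (~~ d) i)) (~~ d, k1) v (cst 0).
  by apply: (rest_sides d (V (~~ d))).1; case: (d).
rewrite (normal_deriv_H2 rOmega hz (rOm i) (@Om_sub R i) hv).
have key d := flux_zero_Om (H1_L2_wd d h1) (H1_wd d (h2 d)) (sG d) (rest_sides d (V d)).2.
by rewrite !key addr0.
Qed.

(** The normal derivative has no jump. The fluxes along the interface vanish since the test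
    functions are zero on the two sides they cross; the fluxes through it cancel by [flux_pair]. *)
Lemma nd_interface b i v w : interface_test i (nb b i) v w ->
  normal_deriv (Om i) z v + normal_deriv (Om (nb b i)) z w = 0.
Proof.
move=> [Vv Vw [t tv tw]]; have hv := trace_H1 tv; have hw := trace_H1 tw.
have {}Vw : Vrest b (nb b i) w by rewrite /Vrest /rest nbK [Gam (nb b i) i]Gam_sym.
have {}Vv : Vrest b i v by [].
rewrite (normal_deriv_H2 rOmega hz (rOm i) (@Om_sub R i) hv).
rewrite (normal_deriv_H2 rOmega hz (rOm _) (@Om_sub R (nb b i)) hw).
have tg j u : Vrest b j u -> flux_form (~~ b) (Om j) (wd (~~ b) Omega z) (wd (~~ b) Omega (wd (~~ b) Omega z)) u = 0.
  move=> Vu; apply: flux_zero_Om; [exact: H1_L2_wd|exact: H1_wd| |].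
    by apply: (rest_sides (~~ b) Vu).1; case: (b).
  exact: (rest_sides (~~ b) Vu).2.
suff nrm : flux_form b (Om i) (wd b Omega z) (wd b Omega (wd b Omega z)) v +
           flux_form b (Om (nb b i)) (wd b Omega z) (wd b Omega (wd b Omega z)) w = 0.
  move: nrm (tg i v Vv) (tg _ w Vw); case: (b) => /= n1 -> ->; rewrite ?addr0 ?add0r//.
have sv := (rest_sides b Vv).2; have sw := (rest_sides b Vw).2.
have sGv := side_of (barc_Gam b i) tv (@seg_Gam R b i).
have sGw : side (Om (nb b i)) (gl (lo (~~ b) (nb b i))) (gl (hi (~~ b) (nb b i))) (~~ b, k1) w t.
  apply: (side_of (barc_Gam b (nb b i)) _ (@seg_Gam R b (nb b i))).
  by rewrite nbK Gam_sym.
have [hv1 hv2] := Om_sides sv sGv; have [hw1 hw2] := Om_sides sw sGw.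
have loE : lo (~~ b) (nb b i) = lo (~~ b) i by case: (b); case: (i).
have hiE : hi (~~ b) (nb b i) = hi (~~ b) i by case: (b); case: (i).
have lowE : low b (nb b i) = ~~ low b i by case: (b); case: (i).
rewrite loE hiE lowE in hw1 hw2.
have [l1 _ _ _] := @lo_hi R b i; have [l2 _ _ _] := @lo_hi R b (nb b i).
have [l3 _ _ _] := @lo_hi R (~~ b) i.
have Lp := H1_L2_wd b h1; have hp := H1_wd b (h2 b).
have O2 : Om (nb b i) = rectd b (gl (lo b (nb b i))) (gl (hi b (nb b i))) (gl (lo (~~ b) i)) (gl (hi (~~ b) i)) :> set (R * R).
  by rewrite -loE -hiE -OmE.
case lb : (low b i) hv1 hv2 hw1 hw2 => /= hv1 hv2 hw1 hw2.
  have E : lo b (nb b i) = hi b i by rewrite /lo /hi lowE lb.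
  rewrite E in O2 hw1 l2.
  exact: (flux_pair (isbox_Omega (R := R)) Lp hp (isbox_Om i) (isbox_Om (nb b i)) (@Om_sub R i) (@Om_sub R (nb b i))
    l1 l2 l3 (OmE b i) O2 hv1 hv2 hw1 hw2).
have E : lo b i = hi b (nb b i) by rewrite /lo /hi lowE lb.
have O1 : Om i = rectd b (gl (lo b i)) (gl (hi b i)) (gl (lo (~~ b) i)) (gl (hi (~~ b) i)) :> set (R * R) := OmE b i.
rewrite E in O1 hv1 l1.
rewrite addrC.
exact: (flux_pair (isbox_Omega (R := R)) Lp hp (isbox_Om (nb b i)) (isbox_Om i) (@Om_sub R (nb b i)) (@Om_sub R i)
    l2 l1 l3 O2 O1 hw1 hw2 hv1 hv2).
Qed.

End H2Flux.

(** The fluxes of [z] against itself vanish because its trace is zero, so Green's formula makes its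
    Dirichlet energy zero, and Poincare's inequality concludes. *)
Lemma dirichlet_unique z : H2 Omega z -> poisson Omega z (cst 0) ->
  trace_of Omega (boundary Omega) z (cst 0) -> aeq Omega z (cst 0).
Proof.
move=> hz pz tz; have /H2P[h1 h2] := hz; have rO := rOmega (R := R); have bO := isbox_Omega (R := R).
have PI := L2_preip rO.
have OE d : Omega = rectd d (gl k0) (gl k2) (gl k0) (gl k2) :> set (R * R) by rewrite !gls; case: d.
have sub d k : (k == k0) || (k == k2) ->
    `]gl k0, gl k2[ `<=` gridline (~~ d, k) @^-1` (boundary Omega : set (R * R)).
  move=> hk t; rewrite /= in_itv/= gridlineE /= negbK line.unlock -/(gl _) => h.
  apply/boundary_OmegaP; move: h; rewrite !gls.
  by case/orP: hk => /eqP ->; rewrite !gls; case: (d) => /=; lra.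
have sd d k : (k == k0) || (k == k2) -> side Omega (gl k0) (gl k2) (~~ d, k) z (cst 0).
  by move=> hk; exact: (side_of (barc_boundary _) tz (sub d k hk)).
have l02 : gl k0 <= gl k2 :> R by rewrite !gls; lra.
have key d : flux_form d Omega (wd d Omega z) (wd d Omega (wd d Omega z)) z = 0.
  exact: (flux_zero bO (H1_L2_wd d h1) (H1_wd d (h2 d)) bO (@subset_refl _ _) l02 l02 (OE d)
    (sd d k0 isT) (sd d k2 isT)).
have nd0 : normal_deriv Omega z z = 0.
  by rewrite (normal_deriv_H2 rO hz rO (@subset_refl _ _) h1) !key addr0.
have L0 : L2 Omega (cst 0 : R * R -> R) := preip0 PI.
have pz' : poisson Omega z (fun x => - (cst 0 : R * R -> R) x).
  by have -> : (fun x => - (cst 0 : R * R -> R) x) = cst 0 by apply/funext => x; exact: oppr0.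
have d0 : dirichlet_form Omega z z = 0.
  rewrite -nd0 (normal_derivE rO L0 pz' (H1_L2 h1)).
  by rewrite -[cst 0]/(0 : R * R -> R) (preip_form0l PI) ?addr0//; exact: H1_L2.
have le2 : gl k2 - gl k0 <= 2 :> R by rewrite !gls; lra.
have k0k : gl k0 <= (gl k0 : R) <= gl k2 by rewrite lexx.
have := @trace0_poincare R Omega bO (boundary Omega) z true _ _ _ _ (false, k0) (barc_boundary _) tz
   l02 le2 (OE true) erefl k0k (sub true k0 isT).
have := bn_wd_le_dirichlet true rO h1; rewrite {1}bn.unlock d0 sqrtr0 => w0 n0.
apply: nm_eq0 => //; first exact: H1_L2.
by apply/eqP; rewrite eq_le bn_ge0 andbT; apply: le_trans n0 _; rewrite pmulr_rle0.
Qed.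

End Tools.

(** * Uniqueness of one step *)

Section Steps.
Context {R : realType}.
Implicit Types (i j : quad) (b d : bool) (D S : set (R * R)) (u v w z g h F G : R * R -> R).

Lemma wlaplacian_same D u v F : poisson D u F -> poisson D v F -> wlaplacian D u = wlaplacian D v.
Proof.
move=> pu pv; have E : poisson D u = poisson D v.
  apply/funext => l; apply/propext; split=> h phi tp; rewrite -(h phi tp).
    by rewrite (pu phi tp) (pv phi tp).
  by rewrite (pu phi tp) (pv phi tp).
by rewrite /wlaplacian E.
Qed.

(** Equal right-hand sides give the same candidates for the Laplacian, hence the same choice, and
    the zero-order terms cancel whatever that choice is. *)
Lemma normal_deriv_same D u v F x : poisson D u F -> poisson D v F ->
  normal_deriv D u x - normal_deriv D v x = dirichlet_form D u x - dirichlet_form D v x.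
Proof.
move=> pu pv; rewrite /normal_deriv (wlaplacian_same pu pv).
move: (dirichlet_form D u x) (dirichlet_form D v x) (Rintegral _ _ _) => x1 x2 x3; ring.
Qed.

Lemma Gam_trace_exists b i S u g : trace_of (Om i) S u g -> exists t, trace_of (Om i) (Gam i (nb b i)) u t.
Proof.
move=> tu; apply: (trace_exists (isbox_Om i) (barc_Gam b i) tu (l0 := (~~ b, k1))) => l; exact: Gam_line.
Qed.

Lemma trace_flip_Gam b i u t : trace_of (Om i) (Gam i (nb b i)) u t ->
  trace_of (Om (nb b i)) (Gam i (nb b i)) (u \o flip b) t.
Proof.
move=> tu; have bi := @isbox_Om R i; have bj : isbox (flip b @^-1` Om i : set (R * R)) by rewrite flip_Om; exact: isbox_Om.
have := trace_flip bi bj (barc_Gam b i) tu; rewrite flip_Om flip_Gam => h.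
have bG : barc (Om (nb b i)) (Gam i (nb b i) : set (R * R)).
  by have := @barc_Gam R b (nb b i); rewrite nbK Gam_sym.
have [_ [mt _] _] := tu.
apply: (trace_ae (isbox_Om _) bG h mt) => l; apply: nearW => s /flip_Gam_id /= E.
by rewrite E.
Qed.

Lemma Vrest_flip b i d v : Vrest d i v -> Vrest d (nb b i) (v \o flip b).
Proof.
have bi := @isbox_Om R i; have bj : isbox (flip b @^-1` Om i : set (R * R)) by rewrite flip_Om; exact: isbox_Om.
have GE : flip b @^-1` Gam i (nb d i) = Gam (nb b i) (nb d (nb b i)) :> set (R * R).
  have [->|db] := eqVneq d b; first by rewrite flip_Gam nbK Gam_sym.
  have -> : d = ~~ b by move: db; case: (d); case: (b).
  exact: flip_Gam'.
have E : flip b @^-1` rest d i = rest d (nb b i) :> set (R * R).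
  by rewrite /rest -flip_boundary_Om -GE.
by move=> /(trace_flip bi bj (barc_rest d i)); rewrite flip_Om E.
Qed.

(** Points of the interface are fixed by the reflection, so the mirror image has the same trace
    there. Every function of [Vrest b i] thus enters a Neumann condition. *)
Lemma interface_partner b i v : Vrest b i v -> interface_test i (nb b i) v (v \o flip b).
Proof.
move=> Vv; have [t tv] := Gam_trace_exists b Vv; split; first exact: Vv.
  have := Vrest_flip b Vv; rewrite /Vrest.
  by rewrite /rest nbK [Gam (nb b i) i]Gam_sym.
by exists t; [exact: tv|exact: trace_flip_Gam].
Qed.

Lemma trace_boundary b i v : trace_of (Om i) (rest b i) v (cst 0) ->
  trace_of (Om i) (Gam i (nb b i)) v (cst 0) -> trace_of (Om i) (boundary (Om i)) v (cst 0).
Proof.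
move=> h1 h2; apply: (trace0_union (isbox_Om i) (barc_boundary _) (barc_rest b i) (barc_Gam b i)) => //.
move=> l; apply: nearW => s hs.
by have [h|h] := pselect (Gam i (nb b i) (gridline l s)); [right|left].
Qed.

(** Allows an arbitrary partner to be replaced by the mirror image: the difference has zero trace on
    the whole boundary and is not seen by [dirichlet_error_zero]. *)
Lemma interface_diff b i v w : interface_test i (nb b i) v w ->
  trace_of (Om i) (boundary (Om i)) (v - (w \o flip b)) (cst 0).
Proof.
move=> [Vv Vw [t tv tw]].
have c0 : cst 0 - cst 0 = cst 0 :> (R * R -> R) by exact: subrr.
have tt0 : t - t = cst 0 :> (R * R -> R) by exact: subrr.
have bi := @isbox_Om R i; have bj := @isbox_Om R (nb b i).
have bF : isbox (flip b @^-1` Om (nb b i) : set (R * R)) by rewrite flip_Om; exact: isbox_Om.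
have {}Vw : Vrest b (nb b i) w by rewrite /Vrest /rest nbK [Gam (nb b i) i]Gam_sym.
have Vw' := trace_flip bj bF (barc_rest b (nb b i)) Vw.
rewrite flip_Om flip_rest nbK in Vw'.
have tw' : trace_of (Om i) (Gam i (nb b i)) (w \o flip b) t.
  have {}tw : trace_of (Om (nb b i)) (Gam (nb b i) (nb b (nb b i))) w t by rewrite nbK Gam_sym.
  by have := trace_flip_Gam tw; rewrite nbK [Gam (nb b i) i]Gam_sym.
apply: (@trace_boundary b).
  by rewrite -c0; exact: (trace_sub bi (barc_rest b i) Vv Vw').
by rewrite -tt0; exact: (trace_sub bi (barc_Gam b i) tv tw').
Qed.

Lemma Vrest_union b i v : trace_of (Om i) (outer i) v (cst 0) ->
  trace_of (Om i) (Gam i (nb (~~ b) i)) v (cst 0) -> Vrest b i v.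
Proof.
exact: (trace0_union (isbox_Om i) (barc_rest b i) (barc_outer i) (barc_Gam (~~ b) i) (@rest_cover R b i)).
Qed.

Lemma step_unique b i u v F G t : H1 (Om i) u -> H1 (Om i) v ->
  poisson (Om i) u F -> poisson (Om i) v F ->
  trace_of (Om i) (outer i) u G -> trace_of (Om i) (outer i) v G ->
  trace_of (Om i) (Gam i (nb (~~ b) i)) u t -> trace_of (Om i) (Gam i (nb (~~ b) i)) v t ->
  (forall x y, interface_test i (nb b i) x y -> normal_deriv (Om i) u x = normal_deriv (Om i) v x) ->
  aeq (Om i) u v.
Proof.
move=> hu hv pu pv ou ov gu gv nd; have rD := @rOm R i; have bD := @isbox_Om R i; have PD := dirichlet_preip rD.
have GG : G - G = cst 0 :> (R * R -> R) by exact: subrr.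
have tt0 : t - t = cst 0 :> (R * R -> R) by exact: subrr.
have Vd : Vrest b i (u - v).
  apply: Vrest_union.
    by rewrite -GG; exact: (trace_sub bD (barc_outer i) ou ov).
  by rewrite -tt0; exact: (trace_sub bD (barc_Gam (~~ b) i) gu gv).
have hd := trace_H1 Vd.
have d0 : dirichlet_form (Om i) (u - v) (u - v) = 0.
  have := nd _ _ (interface_partner Vd); have := normal_deriv_same (u - v) pu pv.
  rewrite [X in _ -> _ -> X = 0](preip_formBl PD hu hv hd).
  by move=> <- ->; rewrite subrr.
have := zero_trace_dirichlet (barc_rest b i) (@outer_rest R b i) Vd d0.
apply: ae_imp => p h /h /eqP; rewrite subr_eq0; exact: eqP.
Qed.

End Steps.

(** * The explicit iterates *)

Section Explicit.
Context {R : realType}.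
Implicit Types (i j : quad) (b d : bool) (D S : set (R * R)) (u v w z g h F G : R * R -> R).

Lemma barc_Om_Omega i S : barc (Om i) S -> barc (Omega : set (R * R)) S.
Proof.
move=> [h1 h2]; split=> // p /h1; apply: closure_subset; exact: Om_sub.
Qed.

(** The same [z'] serves on both sides of every interface: H2 functions have no jump across the
    interfaces. *)
Lemma H2_trace z : H2 Omega z -> exists z', forall i S, barc (Om i) S -> trace_of (Om i) S z z'.
Proof.
move=> hz; have bO := @isbox_Omega R; have /H2P[h1 _] := hz.
have [zn [z' [s1 c1 uz _]]] := H2_approx bO hz.
exists z' => i S bS; have bS' := barc_Om_Omega bS.
apply: (trace_subdomain bO (isbox_Om i) (@Om_sub R i) bS' bS).
exact: (unif_trace bO bS' s1 h1 c1 uz).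
Qed.

Lemma poisson_lin D (k : R) u v F : isrect D -> H1 D u -> H1 D v ->
  poisson D u (cst 0) -> poisson D v F -> poisson D (k *: u + v) F.
Proof.
move=> rD hu hv pu pv phi tp; have hp := H1_smooth rD (test_fun_smooth tp).
have I0 : iq D (cst 0) phi = 0.
  exact: (preip_form0l (L2_preip rD) (L2_test rD tp)).
rewrite (preipE (dirichlet_preip rD))// (pv phi tp).
by move/poissonE : pu => /(_ phi tp) ->; rewrite I0 mulr0 add0r.
Qed.

Lemma normal_deriv_harmonic D (k : R) u v : isrect D -> H1 D u -> H1 D v -> poisson D u (cst 0) ->
  normal_deriv D (k *: u) v = k * dirichlet_form D u v.
Proof.
move=> rD hu hv pu; have PI := L2_preip rD; have PD := dirichlet_preip rD.
have L0 : L2 D (0 : R * R -> R) := preip0 PI.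
have pz' : poisson D (k *: u) (fun x => - (0 : R * R -> R) x).
  have -> : (fun x => - (0 : R * R -> R) x) = cst 0 by apply/funext => x; exact: oppr0.
  have := poisson_lin k rD hu (preip0 PD) pu; rewrite addr0; apply.
  apply/poissonE => phi tp; have hp := H1_smooth rD (test_fun_smooth tp).
  have I0 : iq D (cst 0) phi = 0 by exact: (preip_form0l (L2_preip rD) (L2_test rD tp)).
  by rewrite I0 (preip_form0l PD).
rewrite (normal_derivE rD L0 pz' (H1_L2 hv)) (preip_form0l PI (H1_L2 hv)) addr0.
exact: (preip_formZl PD).
Qed.

(* [e] is the error after the first iteration. *)
Variables (theta : R) (uo fo go u0 psi0 w e : R * R -> R).
Hypothesis wE : w = - (2 * theta) *: psi0 + (u0 - uo).
Hypotheses (huo : H2 Omega uo) (hu0 : H2 Omega u0) (hpsi0 : H2 Omega psi0).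
Hypotheses (pu : forall i, poisson (Om i) uo fo) (ou : forall i, trace_of (Om i) (outer i) uo go).
Hypotheses (he : forall i, H1 (Om i) e) (pe : forall i, poisson (Om i) e (cst 0))
  (oe : forall i, trace_of (Om i) (outer i) e (cst 0)).
Hypothesis ge : forall i S g, S = Gam i (nb false i) -> trace_of (Om i) S w g -> trace_of (Om i) S e g.
Hypothesis de : forall i v, Vrest true i v -> dirichlet_form (Om i) e v = normal_deriv (Om i) w v.
Hypothesis se : forall b i p, Om i p -> e (flip b p) = (if b then -1 else 1) * e p.

Let U (c : R) : R * R -> R := c *: e + uo.
Let P (c : R) : R * R -> R := (2 * c) *: e.

Let hw : H2 Omega w.
Proof.
have E : u0 - uo = (- 1) *: uo + u0 by rewrite scaleN1r addrC.
by rewrite wE E; apply: (H2_L _ rOmega hpsi0); exact: (H2_L _ rOmega huo hu0).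
Qed.

Let huo' i : H1 (Om i) uo.
Proof. by apply: (H1S rOmega (rOm i) (@Om_sub R i)); have /H2P[] := huo. Qed.

(** Such a [v] lies in [Vrest true i], where [e] has the Neumann data of [w], and these do not see
    functions of zero trace. *)
Lemma dirichlet_error_zero i v : trace_of (Om i) (boundary (Om i)) v (cst 0) -> dirichlet_form (Om i) e v = 0.
Proof.
move=> tv; have sub : rest true i `<=` boundary (Om i : set (R * R)) by move=> p [].
have V : Vrest true i v := trace_restrict (isbox_Om i) sub (barc_boundary _) (barc_rest true i) tv.
by rewrite (de V) (nd_zero hw tv).
Qed.

Lemma aeq_error_flip b i : aeq (Om i) (e \o flip b) ((if b then -1 else 1) *: e).
Proof. apply: nearW => p ip; exact: (se b ip). Qed.

Lemma H1_error_flip b i : H1 (Om i) (e \o flip b).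
Proof. by have := H1_flip (b := b) (rOm (nb b i)) _ (he (nb b i)); rewrite flip_Om nbK; apply; exact: rOm. Qed.

(** The Dirichlet form is invariant under reflection, which multiplies [e] by a sign; the reflected
    [v'] may then be replaced by [v], by [interface_diff]. *)
Lemma dirichlet_error_flip b i v v' : interface_test i (nb b i) v v' ->
  dirichlet_form (Om (nb b i)) e v' = (if b then -1 else 1) * dirichlet_form (Om i) e v.
Proof.
move=> hvv; have z := dirichlet_error_zero (interface_diff hvv); case: hvv => Vv Vw _.
have rD := @rOm R i; have PD := dirichlet_preip rD.
have hv := trace_H1 Vv; have hv' := trace_H1 Vw.
have hf : H1 (Om i) (v' \o flip b).
  by have := H1_flip (b := b) (rOm (nb b i)) _ hv'; rewrite flip_Om nbK; apply; exact: rOm.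
have <- : dirichlet_form (Om i) e (v' \o flip b) = dirichlet_form (Om i) e v.
  move: z; rewrite (preip_formBr PD hv hf (he i)) => /eqP; rewrite subr_eq0 => /eqP E; exact: (esym E).
have E : dirichlet_form (Om (nb b i)) e v' = dirichlet_form (Om i) (e \o flip b) (v' \o flip b).
  have := dirichlet_flip (b := b) (rOm (nb b i)) _ (he (nb b i)) hv'.
  by rewrite flip_Om nbK => -> //; exact: rOm.
rewrite E -(preip_formZl PD _ (he i) hf); apply: (dirichlet_ae _ rD _ _ (@aeq_error_flip b i)).
  exact: (H1_measurable (H1_error_flip b i)).
exact: (H1_measurable (preipZ PD _ (he i))).
Qed.

Lemma trace_error_flip b i t : trace_of (Om i) (Gam i (nb b i)) e t ->
  trace_of (Om (nb b i)) (Gam i (nb b i)) e ((if b then -1 else 1) *: t).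
Proof.
move=> te; have := trace_flip_Gam te => h.
have bD := @isbox_Om R (nb b i); have PD := dirichlet_preip (@rOm R (nb b i)).
have bG : barc (Om (nb b i)) (Gam i (nb b i) : set (R * R)).
  by have := @barc_Gam R b (nb b i); rewrite nbK Gam_sym.
have h0 : trace_of (Om (nb b i)) (Gam i (nb b i)) (0 : R * R -> R) (0 : R * R -> R).
  exact: (trace_smooth bD bG smooth0).
have := trace_lin bD (if b then -1 else 1) bG h h0; rewrite !addr0.
apply: (trace_aeq bD (he _)).
apply: nearW => p ip; rewrite -[LHS]/((if b then -1 else 1) * e (flip b p)).
by rewrite (se b ip) mulrA; case: (b); rewrite ?mulrNN ?mul1r.
Qed.

Lemma iterate_harmonic i c : poisson (Om i) (U c) fo.
Proof. exact: (poisson_lin c (rOm i) (he i) (huo' i) (@pe i) (@pu i)). Qed.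

Lemma H1_iterate i c : H1 (Om i) (U c).
Proof. exact: (H1L c (rOm i) (he i) (huo' i)). Qed.

Lemma normal_deriv_iterate i c v : H1 (Om i) v ->
  normal_deriv (Om i) (U c) v = normal_deriv (Om i) uo v + c * dirichlet_form (Om i) e v.
Proof.
move=> hv; have := normal_deriv_same v (@iterate_harmonic i c) (@pu i).
rewrite (preipE (dirichlet_preip (rOm i)) _ (he i) (huo' i) hv) addrK => E.
by rewrite -E addrC subrK.
Qed.

Lemma normal_deriv_correction i c v : H1 (Om i) v ->
  normal_deriv (Om i) (P c) v = 2 * c * dirichlet_form (Om i) e v.
Proof. by move=> hv; exact: (normal_deriv_harmonic _ (rOm i)). Qed.

Lemma iterate_outer i c : trace_of (Om i) (outer i) (U c) go.
Proof.
have := trace_lin (isbox_Om i) c (barc_outer i) (oe i) (ou i).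
by rewrite -[cst 0]/(0 : R * R -> R) scaler0 add0r.
Qed.

Lemma second_step_iterate c : second_step (U c) (P c).
Proof.
move=> i; have bD := @isbox_Om R i; have rD := @rOm R i; have PD := dirichlet_preip rD.
have hP : H1 (Om i) (P c) := preipZ PD (2 * c) (he i).
have tP S t : barc (Om i) S -> trace_of (Om i) S e t -> trace_of (Om i) S (P c) ((2 * c) *: t).
  move=> bS te; have := trace_lin bD (2 * c) bS te (trace_smooth bD bS smooth0).
  by rewrite !addr0.
split.
- exact: hP.
- have p0 : poisson (Om i) (0 : R * R -> R) (cst 0).
    apply/poissonE => phi tp; have hp := H1_smooth rD (test_fun_smooth tp).
    have I0 : iq (Om i) (cst 0) phi = 0 by exact: (preip_form0l (L2_preip rD) (L2_test rD tp)).
    by rewrite I0 (preip_form0l PD).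
  by have := poisson_lin (2 * c) rD (he i) (preip0 PD) (@pe i) p0; rewrite addr0.
- have := tP _ _ (barc_outer i) (oe i).
  by rewrite -[cst 0]/(0 : R * R -> R) scaler0.
- move=> j /GamN1P ->; have [t te] := Gam_trace_exists true (oe i).
  have te' := trace_error_flip te; have [t0 ht0] := H2_trace huo.
  have bG := @barc_Gam R true i.
  have bG' : barc (Om (nb true i)) (Gam i (nb true i) : set (R * R)).
    by have := @barc_Gam R true (nb true i); rewrite nbK Gam_sym.
  (* Seen from the other side of x = 0, the trace of the odd function [e] is [-1 *: t], while that
     of [uo] is unchanged: the jump is [(2 * c) *: t]. *)
  exists ((2 * c) *: t), (c *: t + t0), (c *: (-1 *: t) + t0); split.
  + exact: tP.
  + exact: (trace_lin bD c bG te (ht0 _ _ bG)).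
  + exact: (trace_lin (isbox_Om _) c bG' te' (ht0 _ _ bG')).
  + move=> l; apply: nearW => s _; move: (gridline l s) => q.
    change (2 * c * t q = c * t q + t0 q - (c * (-1 * t q) + t0 q)); ring.
- move=> j /GamD1P -> v v' hvv; have [Vv Vw _] := hvv.
  have hv := trace_H1 Vv; have hv' := trace_H1 Vw.
  rewrite normal_deriv_correction// !normal_deriv_iterate// (dirichlet_error_flip hvv) mul1r.
  have := nd_interface huo hvv.
  move: (normal_deriv _ _ _) (normal_deriv _ _ _) (dirichlet_form _ _ _) => x1 x2 x3 h.
  have -> : x1 = - x2 by apply/eqP; rewrite -addr_eq0 addrC h.
  ring.
Qed.

Lemma first_step_iterate c : first_step theta fo go (U c) (P c) (U ((1 - 4 * theta) * c)).
Proof.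
move=> i; have bD := @isbox_Om R i; have rD := @rOm R i; have PD := dirichlet_preip rD.
split; [exact: H1_iterate|exact: iterate_harmonic|exact: iterate_outer| |].
- move=> j /GamD1P ->; have [t te] := Gam_trace_exists false (oe i).
  have te' := trace_error_flip te; have [t0 ht0] := H2_trace huo.
  have bG := @barc_Gam R false i.
  have bG' : barc (Om (nb false i)) (Gam i (nb false i) : set (R * R)).
    by have := @barc_Gam R false (nb false i); rewrite nbK Gam_sym.
  have tP k S g : barc (Om k) S -> trace_of (Om k) S e g -> trace_of (Om k) S (P c) ((2 * c) *: g).
    move=> bS tk; have := trace_lin (isbox_Om k) (2 * c) bS tk (trace_smooth (isbox_Om k) bS smooth0).
    by rewrite !addr0.
  exists (((1 - 4 * theta) * c) *: t + t0), (c *: t + t0), ((2 * c) *: t), ((2 * c) *: (1 *: t)); split.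
  + exact: (trace_lin bD _ bG te (ht0 _ _ bG)).
  + exact: (trace_lin bD _ bG te (ht0 _ _ bG)).
  + exact: tP.
  + exact: tP.
  + move=> l; apply: nearW => s _; move: (gridline l s) => q.
    change ((1 - 4 * theta) * c * t q + t0 q = c * t q + t0 q - theta * (2 * c * t q + 2 * c * (1 * t q))); ring.
- move=> j /GamN1P -> v v' hvv; have [Vv Vw _] := hvv.
  have hv := trace_H1 Vv; have hv' := trace_H1 Vw.
  rewrite !normal_deriv_correction// !normal_deriv_iterate// (dirichlet_error_flip hvv).
  move: (normal_deriv _ _ _) (dirichlet_form _ _ _) => x1 x3; ring.
Qed.

(** For [psi0] in H2, the sum of its two traces is twice the trace and the difference of its two
    outward normal derivatives is twice the normal derivative. The prescribed data are thus those of
    [w + uo], with [2 * theta] in [w]. *)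
Lemma first_step_initial : first_step theta fo go u0 psi0 (U 1).
Proof.
move=> i; have bD := @isbox_Om R i; have rD := @rOm R i; have PD := dirichlet_preip rD.
have rO := @rOmega R; have DO := @Om_sub R i.
split; [exact: H1_iterate|exact: iterate_harmonic|exact: iterate_outer| |].
- move=> j /GamD1P ->; have bG := @barc_Gam R false i.
  have bG' : barc (Om (nb false i)) (Gam i (nb false i) : set (R * R)).
    by have := @barc_Gam R false (nb false i); rewrite nbK Gam_sym.
  have [t ht] := H2_trace huo; have [s hs] := H2_trace hpsi0; have [z hz] := H2_trace hu0.
  have tw : trace_of (Om i) (Gam i (nb false i)) (- (2 * theta) *: psi0 + (u0 - uo)) (- (2 * theta) *: s + (z - t)).
    exact: (trace_lin bD _ bG (hs _ _ bG) (trace_sub bD bG (hz _ _ bG) (ht _ _ bG))).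
  rewrite -wE in tw; have te := ge erefl tw.
  exists (1 *: (- (2 * theta) *: s + (z - t)) + t), z, s, s; split.
  + exact: (trace_lin bD _ bG te (ht _ _ bG)).
  + exact: hz.
  + exact: hs.
  + exact: hs.
  + move=> l; apply: nearW => x _; move: (gridline l x) => q.
    change (1 * (- (2 * theta) * s q + (z q - t q)) + t q = z q - theta * (s q + s q)); ring.
- move=> j /GamN1P -> v v' hvv; have [Vv Vw _] := hvv.
  have hv := trace_H1 Vv; have hv' := trace_H1 Vw.
  have hD u : H2 Omega u -> H1 (Om i) u by move=> /H2P[h _]; exact: (H1S rO rD DO h).
  rewrite normal_deriv_iterate// mul1r (de Vv).
  have Lw u : H2 Omega u -> L2 (Om i) (lap Omega u) by move=> h; exact: (L2_lap rO h rD DO).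
  have pw u (h : H2 Omega u) := H2_poisson rO h rD DO.
  have E : u0 - uo = (- 1) *: uo + u0 by rewrite scaleN1r addrC.
  have hd : H2 Omega (u0 - uo) by rewrite E; exact: (H2_L _ rO).
  rewrite wE (normal_deriv_L _ rD (hD _ hpsi0) (hD _ hd) hv (Lw _ hpsi0) (Lw _ hd) (pw _ hpsi0) (pw _ hd)).
  rewrite E (normal_deriv_L _ rD (hD _ huo) (hD _ hu0) hv (Lw _ huo) (Lw _ hu0) (pw _ huo) (pw _ hu0)).
  have := nd_interface hpsi0 hvv.
  move: (normal_deriv _ uo _) (normal_deriv _ u0 _) (normal_deriv _ _ v) (normal_deriv _ _ v') => x1 x2 x3 x4 h.
  have -> : x4 = - x3 by apply/eqP; rewrite -addr_eq0 addrC h.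
  ring.
Qed.

End Explicit.

(** * Reflecting the error *)

Section ErrorConstruction.
Context {R : realType}.
Implicit Types (i j : quad) (b d : bool) (D S : set (R * R)) (u v z g h F G : R * R -> R).

Lemma trace_scale D S (k : R) u g : isbox D -> barc D S -> trace_of D S u g -> trace_of D S (k *: u) (k *: g).
Proof.
by move=> bD bS tu; have := trace_lin bD k bS tu (trace_smooth bD bS smooth0); rewrite !addr0.
Qed.

Lemma test_zero_trace D u : isbox D -> open D -> test_fun D u -> trace_of D (boundary D) u (cst 0).
Proof.
move=> bD oD [su [K [_ KD K0]]]; have bB := barc_boundary D.
have m0 : arc_measurable (boundary D) (cst (0 : R)) by move=> l; exact: measurable_cst.
apply: (trace_ae bD bB (trace_smooth bD bB su) m0) => l; apply: nearW => t [_ nD].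
by move: nD; have /interior_id -> := oD => nD; apply: K0 => /KD.
Qed.

Variables (w w' : R * R -> R) (wn : nat -> R * R -> R).
Hypotheses (hw : H2 Omega w) (swn : forall n, smooth (wn n))
  (cw : H1norm Omega (wn n - w) @[n --> \oo] --> (0 : R)) (uw : unif Omega wn w')
  (mw : cvn Omega (fun n => cd false (cd true (wn n))) (wd false Omega (wd true Omega w)))
  (w0 : w' (-1, 0) = 0).
Hypothesis w_odd : aeq Omega (w \o flip true \o flip false) (- w).

Let sg b : R := if b then -1 else 1.

Let error_prop e i := [/\ H1 (Om i) e, trace_of (Om i) (outer i) e (cst 0),
  trace_of (Om i) (Gam i (nb false i)) e w' &
  forall v, Vrest true i v -> dirichlet_form (Om i) e v = normal_deriv (Om i) w v].

Let h1 : H1 Omega w. Proof. by case: hw. Qed.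

Let trace_w i : trace_of (Om i) (Gam i (nb false i)) w w'.
Proof.
have bO := @isbox_Omega R; have bS := @barc_Gam R false i; have bS' := barc_Om_Omega bS.
apply: (trace_subdomain bO (isbox_Om i) (@Om_sub R i) bS' bS).
exact: (unif_trace bO bS' swn h1 cw uw).
Qed.

Let h1w i : H1 (Om i) w. Proof. exact: trace_H1 (trace_w i). Qed.

Let w_odd_Om i : aeq (Om i) (w \o flip true \o flip false) (- w).
Proof. by apply: ae_imp w_odd => p h ip; apply: h; exact: Om_sub ip. Qed.

Let bFl b i : isbox (flip b @^-1` Om i : set (R * R)).
Proof. by rewrite flip_Om; exact: isbox_Om. Qed.

(** On the line y = 0 the central symmetry coincides with the reflection in x. The trace of [w] from
    the opposite subdomain, reflected twice, is compared with the trace of [- w]. *)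
Lemma trace_odd i : arc_ae (Gam i (nb false i)) (fun p => w' (flip true p) = - w' p).
Proof.
have bD := @isbox_Om R i; have bG := @barc_Gam R false i; have PD := dirichlet_preip (@rOm R i).
pose k := nb true (nb false i).
have Ek : nb false (nb true k) = i by rewrite /k !nbK.
have G1 : flip true @^-1` Gam k (nb false k) = Gam (nb true k) (nb false (nb true k)) :> set (R * R).
  exact: (flip_Gam' true k).
have t1 := trace_flip (isbox_Om k) (bFl true k) (barc_Gam false k) (trace_w k).
rewrite flip_Om G1 in t1.
have := trace_flip_Gam t1; rewrite Ek [Gam (nb true k) i]Gam_sym.
have -> : nb true k = nb false i by rewrite /k nbK.
move=> t2.
have t3 : trace_of (Om i) (Gam i (nb false i)) (- w) (w' \o flip true).
  exact: (trace_aeq bD (preipN PD (h1w i)) (@w_odd_Om i) t2).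
have t4 := trace_scale (-1) bD bG (trace_w i); rewrite !scaleN1r in t4.
exact: (trace_unique bD bG t3 t4).
Qed.

Section Symmetric.
Variable e : R * R -> R.
Hypothesis se : forall b i p, Om i p -> e (flip b p) = sg b * e p.

Let e_flip b i p : Om i p -> (sg b *: (e \o flip b)) p = e p.
Proof.
move=> ip; rewrite -[LHS]/(sg b * e (flip b p)) (se b ip) mulrA.
by rewrite /sg; case: (b); rewrite ?mulrNN mul1r ?mul1r.
Qed.

(** The reflection carries the values and the traces. For the Neumann data, the reflection in x
    matches its sign with the opposite fluxes of [w] on the two sides of x = 0; the reflection in y
    also uses that [w] is odd. *)
Lemma error_prop_flip b i : error_prop e i -> error_prop e (nb b i).
Proof.
move=> [he oe ge de]; have rD := @rOm R (nb b i); have bD := @isbox_Om R (nb b i).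
have PD := dirichlet_preip rD; have rF : isrect (flip b @^-1` Om i : set (R * R)) by rewrite flip_Om.
have hf : H1 (Om (nb b i)) (sg b *: (e \o flip b)).
  by apply: (preipZ PD); rewrite -flip_Om; exact: (H1_flip (rOm i) rF he).
have [he' ae'] := H1_congr rD (@e_flip b (nb b i)) hf.
split.
- exact: he'.
- have := trace_flip (isbox_Om i) (bFl b i) (barc_outer i) oe; rewrite flip_Om flip_outer => t.
  have := trace_scale (sg b) bD (barc_outer (nb b i)) t.
  rewrite -[cst 0 \o flip b]/(0 : R * R -> R) scaler0; exact: (trace_aeq bD he' ae').
- have bG := @barc_Gam R false (nb b i).
  have GE : flip b @^-1` Gam i (nb false i) = Gam (nb b i) (nb false (nb b i)) :> set (R * R).
    by case: (b); [exact: (flip_Gam' true i)|rewrite flip_Gam nbK Gam_sym].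
  have := trace_flip (isbox_Om i) (bFl b i) (barc_Gam false i) ge; rewrite flip_Om GE => t.
  have := trace_scale (sg b) bD bG t => {}t.
  have := trace_aeq bD he' ae' t => {}t.
  have [_ [mw' _] _] := trace_w (nb b i).
  apply: (trace_ae bD bG t mw'); have := @trace_odd (nb b i); rewrite /sg; case: (b) => to.
    apply: arc_aeS to => p _ pE; rewrite -[LHS]/(-1 * w' (flip true p)) pE mulN1r opprK //.
  move=> l; apply: nearW => s /flip_Gam_id E.
  by rewrite -[LHS]/(1 * w' (flip false (gridline l s))) E mul1r.
move=> v Vv; have hv := trace_H1 Vv.
have hvf : H1 (Om i) (v \o flip b).
  by have := Vrest_flip b Vv; rewrite nbK => /trace_H1.
have Vf : Vrest true i (v \o flip b) by have := Vrest_flip b Vv; rewrite nbK.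
have E : dirichlet_form (Om (nb b i)) e v = sg b * normal_deriv (Om i) w (v \o flip b).
  rewrite -(de _ Vf).
  rewrite -(dirichlet_ae v rD (H1_measurable hf) (H1_measurable he') ae').
  have hf' : H1 (Om (nb b i)) (e \o flip b) by rewrite -flip_Om; exact: (H1_flip (rOm i) rF he).
  rewrite (preip_formZl PD _ hf' hv); congr (_ * _).
  have := dirichlet_flip (b := b) (rOm i) rF he hvf; rewrite compflipK flip_Om; exact.
rewrite E /sg; case: (b) Vv hvf Vf {E rD bD PD rF hf he' ae' hv} => Vv hvf Vf.
  have := nd_interface hw (interface_partner Vv); rewrite nbK.
  move: (normal_deriv _ _ _) (normal_deriv _ _ _) => x1 x2 h.
  by rewrite mulN1r; apply/eqP; rewrite eq_sym -addr_eq0 h.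
(* The central symmetry leads from [i] to the opposite subdomain [m], which faces [j] across x = 0.
   The sign due to oddness and the one due to the opposite fluxes cancel. *)
rewrite mul1r; set j := nb false i.
have Vm := Vrest_flip true Vv.
have := nd_interface hw (interface_partner Vv).
rewrite -/j; set m := nb true j; set v1 := v \o flip true => nd1.
have hv1 : H1 (Om m) v1 := trace_H1 Vm.
suff nd2 : normal_deriv (Om m) w v1 = - normal_deriv (Om i) w (v \o flip false).
  by move: nd1; rewrite nd2 => /eqP; rewrite subr_eq0 => /eqP.
have rO := @rOmega R; have DO k := @Om_sub R k.
have pw k := H2_poisson rO hw (@rOm R k) (DO k); have Lw k := L2_lap rO hw (@rOm R k) (DO k).
have rm := @rOm R m.
pose k := nb true i.
have mk : m = nb false k by rewrite /m /j /k nbC.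
have r1 : isrect (flip true @^-1` Om i : set (R * R)) by rewrite flip_Om; exact: rOm.
have r2 : isrect (flip false @^-1` Om k : set (R * R)) by rewrite flip_Om; exact: rOm.
have hk1 : H1 (Om k) (w \o flip true) by rewrite -flip_Om; exact: (H1_flip (rOm i) r1 (h1w i)).
have hk2 : H1 (Om k) ((v \o flip false) \o flip true) by rewrite -flip_Om; exact: (H1_flip (rOm i) r1 hvf).
have Lk : L2 (Om k) (lap Omega w \o flip true) by rewrite -flip_Om; exact: (L2_flip true (rOm i) (Lw i)).
have LN : L2 (Om i) (fun x => - lap Omega w x) := preipN (L2_preip (rOm i)) (Lw i).
have pk : poisson (Om k) (w \o flip true) (fun x => - (lap Omega w \o flip true) x).
  by rewrite -flip_Om; exact: (poisson_flip (rOm i) r1 (h1w i) LN (pw i)).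
have LNk : L2 (Om k) (fun x => - (lap Omega w \o flip true) x) := preipN (L2_preip (rOm k)) Lk.
have n1 := normal_deriv_flip (rOm i) r1 (h1w i) hvf (Lw i) (pw i).
have n2 := normal_deriv_flip (rOm k) r2 hk1 hk2 Lk pk.
rewrite flip_Om -/k in n1; rewrite flip_Om -mk in n2.
have vE : ((v \o flip false) \o flip true) \o flip false = v1.
  by apply/funext => p; rewrite /v1 /= !flip.unlock /= opprK.
rewrite vE in n2; rewrite -n1 -n2.
have hm : H1 (Om m) ((w \o flip true) \o flip false) by rewrite mk -flip_Om; exact: (H1_flip (rOm k) r2 hk1).
have hN : H1 (Om m) (- w) := preipN (dirichlet_preip rm) (h1w m).
rewrite (normal_deriv_ae v1 rm (H1_measurable hm) (H1_measurable hN) (@w_odd_Om m)).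
have PI := L2_preip rm; have PD := dirichlet_preip rm.
have LNm : L2 (Om m) (- lap Omega w) := preipN PI (Lw m).
have pN : poisson (Om m) (- w) (fun x => - (- lap Omega w) x).
  apply/poissonE => phi tp; have hp := H1_smooth rm (test_fun_smooth tp); have Lp := L2_test rm tp.
  rewrite -[- w]scaleN1r (preip_formZl PD _ (h1w m) hp).
  move/poissonE : (pw m) => /(_ phi tp) ->.
  by rewrite (iqNl rm LNm Lp) mulN1r; congr (- _); rewrite (iqNl rm (Lw m) Lp) -(iqNl rm (Lw m) Lp).
rewrite (normal_derivE rm LNm pN (H1_L2 hv1)) (normal_derivE rm (Lw m) (pw m) (H1_L2 hv1)).
rewrite -[- w]scaleN1r (preip_formZl PD _ (h1w m) hv1) (iqNl rm (Lw m) (H1_L2 hv1)).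
by rewrite mulN1r opprD !opprK.
Qed.

End Symmetric.

Lemma error_exists : exists e, [/\ forall i, H1 (Om i) e, forall i, trace_of (Om i) (outer i) e (cst 0),
  forall i S g, S = Gam i (nb false i) -> trace_of (Om i) S w g -> trace_of (Om i) S e g,
  forall i v, Vrest true i v -> dirichlet_form (Om i) e v = normal_deriv (Om i) w v &
  forall b i p, Om i p -> e (flip b p) = sg b * e p].
Proof.
have [e1 [he1 oe1 ge1 de1]] := bvp hw swn cw uw mw w0.
(* The absolute values fold the four subdomains onto the first one; the sign makes the extension odd
   in x and leaves it even in y. *)
pose e (p : R * R) : R := (if p.1 < 0 then 1 else -1) * e1 (- `|p.1|, - `|p.2|).
have e1E p : Om Q1 p -> e1 p = e p.
  move=> -[] /=; rewrite !in_itv/= => /andP[_ p1] /andP[_ p2].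
  by rewrite /e p1 mul1r !ltr0_norm// !opprK -surjective_pairing.
have se b i p : Om i p -> e (flip b p) = sg b * e p.
  move=> /OmP [p1 p2]; rewrite /e flip.unlock /sg; case: (b) => /=; rewrite normrN ?mul1r//.
  rewrite mulrA; congr (_ * _).
  have [x0|x0] := ltP p.1 0; first by rewrite ltNge ltW ?oppr_gt0//= mulr1.
  have {}x0 : 0 < p.1.
    by rewrite lt_neqAle x0 andbT eq_sym; apply/eqP => E; move: p1; rewrite E /lo /hi; case: low; rewrite !gls; lra.
  by rewrite oppr_lt0 x0 mulrNN mulr1.
have P1 : error_prop e Q1.
  have [he ae'] := H1_congr (rOm Q1) e1E he1; have bD := @isbox_Om R Q1.
  split; [exact: he|exact: (trace_aeq bD he ae')|exact: (trace_aeq bD he ae')|].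
  move=> v Vv; rewrite -(de1 _ Vv); symmetry.
  exact: (dirichlet_ae v (rOm Q1) (H1_measurable he1) (H1_measurable he) ae').
have P i : error_prop e i.
  have P2 := error_prop_flip se true P1; have P3 := error_prop_flip se false P2.
  have P4 := error_prop_flip se false P1.
  by case: i; [exact: P1|exact: P2|exact: P3|exact: P4].
exists e; split.
- by move=> i; case: (P i).
- by move=> i; case: (P i).
- move=> i S g -> tg; have [he _ ge _] := P i.
  have bD := @isbox_Om R i; have bG := @barc_Gam R false i; have [_ [mg _] _] := tg.
  exact: (trace_ae bD bG ge mg (trace_unique bD bG (trace_w i) tg)).
- by move=> i; case: (P i).
- exact: se.
Qed.

(** A smooth function of compact support has zero trace, so it is an admissible test function on
    which the Neumann data of [w] vanish. *)
Lemma error_harmonic e i : (forall v, Vrest true i v -> dirichlet_form (Om i) e v = normal_deriv (Om i) w v) ->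
  poisson (Om i) e (cst 0).
Proof.
move=> de; apply/poissonE => phi tp; have rD := @rOm R i.
have I0 : iq (Om i) (cst 0) phi = 0 by exact: (preip_form0l (L2_preip rD) (L2_test rD tp)).
have oD : open (Om i : set (R * R)) by rewrite (OmE true); exact: open_rect.
have tz := test_zero_trace (isbox_Om i) oD tp.
have sub : rest true i `<=` boundary (Om i : set (R * R)) by move=> p [].
have V : Vrest true i phi := trace_restrict (isbox_Om i) sub (barc_boundary _) (barc_rest true i) tz.
by rewrite I0 (de _ V) (nd_zero hw tz).
Qed.

End ErrorConstruction.

(** * Odd symmetric parts *)

Section Agreement.
Context {R : realType}.
Implicit Types (i j : quad) (b d : bool) (D S A : set (R * R)).
Notation leb := (@lebesgue_measure R).

(** Agreement at one point of each set of the filter is enough, which an equality almost everywhere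
    provides. *)
Lemma cvg_agree (T : Type) (F : set_system T) (f g : T -> R) (x y : R) : Filter F ->
  f @ F --> x -> g @ F --> y -> (forall X, F X -> exists2 q, X q & f q = g q) -> x = y.
Proof.
move=> FF fx gy FE; apply: contrapT => /eqP xy.
have e0 : 0 < `|x - y| / 2 by rewrite divr_gt0// normr_gt0 subr_eq0.
move/cvgrPdist_lt : fx => /(_ _ e0) h1; move/cvgrPdist_lt : gy => /(_ _ e0) h2.
have [q [q1 q2] fg] := FE _ (filterI h1 h2).
have : `|x - y| <= `|x - f q| + `|y - g q|.
  by rewrite fg [`|y - _|]distrC; have := ler_normD (x - g q) (g q - y); rewrite addrA subrK.
by move: q1 q2 => /=; lra.
Qed.

Lemma leb_itvoo (a b : R) : a < b -> leb `]a, b[ = (b - a)%:E.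
Proof. by move=> ab; rewrite lebesgue_measure_itv/= lte_fin ab EFinB. Qed.

Lemma ae_nbhs (P : R -> Prop) (t : R) (X : set R) : {ae leb, forall s, P s} -> nbhs t X ->
  exists2 s, X s & P s.
Proof.
move=> [N [mN N0 sN]] /nbhs_ballP[r /= r0 rX]; apply: contrapT => nP.
have sub : `]t - r, t + r[ `<=` N.
  move=> s; rewrite /= in_itv/= => /andP[s1 s2]; apply: sN => /= Ps; apply: nP; exists s => //.
  by apply: rX; rewrite /ball/= ltr_norml; apply/andP; split; lra.
move: sub; set a := t - r; set c := t + r => sub.
have : (leb `]a, c[ <= leb N)%E.
  by apply: le_measure; [rewrite inE; exact: measurable_itv|rewrite inE; exact: mN|exact: sub].
have ac : a < c by rewrite /a /c; lra.
by rewrite [X in (_ <= X)%E]N0 leb_itvoo// lee_fin; lra.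
Qed.

Lemma ae_on_open D (P : R * R -> Prop) (V : set (R * R)) p : ae_on D P -> open V -> V p -> V `<=` D ->
  exists2 q, V q & P q.
Proof.
move=> [N [mN N0 sN]] oV Vp VD; apply: contrapT => nP.
have /nbhs_ballP[r /= r0 rV] := open_nbhs_nbhs (conj oV Vp).
pose B := rect (p.1 - r) (p.1 + r) (p.2 - r) (p.2 + r).
have sub : B `<=` N.
  move=> q /rectP[q1 q2]; apply: sN => /= Pq; have Vq : V q.
    by apply: rV; split; rewrite /ball/= ltr_norml; apply/andP; split; lra.
  by apply: nP; exists q => //; apply: Pq; exact: VD.
have : (mu2 B <= mu2 N)%E.
  by apply: le_measure; [rewrite inE; exact: measurable_rect|rewrite inE; exact: mN|exact: sub].
rewrite [X in (_ <= X)%E]N0 /mu2 product_measure1E; [|exact: measurable_itv|exact: measurable_itv].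
set a := p.1 - r; set b := p.1 + r; set c := p.2 - r; set e := p.2 + r => h.
have ab : a < b by rewrite /a /b; lra.
have ce : c < e by rewrite /c /e; lra.
have : (leb `]a, b[ * leb `]c, e[ <= 0)%E := h.
rewrite !leb_itvoo// -EFinM lee_fin => {}h.
have : 0 < (b - a) * (e - c) by apply: mulr_gt0; lra.
lra.
Qed.

(** Every neighbourhood of a point of the closure meets [D] in a nonempty open set, which has
    positive measure and so contains points of agreement. *)
Lemma within_agree D (f g : R * R -> R) p : open D -> {within closure D, continuous f} ->
  {within closure D, continuous g} -> ae_on D (fun q => f q = g q) -> closure D p -> f p = g p.
Proof.
move=> oD /subspace_continuousP cf /subspace_continuousP cg fg Dp.
apply: (cvg_agree _ (cf _ Dp) (cg _ Dp)) => X hX.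
have : nbhs p [set q | closure D q -> X q] by [].
rewrite nbhsE => -[V [oV Vp] VX].
have [q0 [Dq0 Vq0]] := Dp _ (open_nbhs_nbhs (conj oV Vp)).
have [q [Vq Dq] E] := @ae_on_open D _ (V `&` D) q0 fg (openI oV oD) (conj Vq0 Dq0) (@subIsetr _ _ _).
by exists q => //; apply: VX => //; exact: subset_closure.
Qed.

Lemma within_path A (f : R * R -> R) (c : R -> R * R) (t : R) : {within A, continuous f} ->
  {for t, continuous c} -> A (c t) -> (\forall s \near t, A (c s)) -> f (c s) @[s --> t] --> f (c t).
Proof.
move=> /subspace_continuousP cf cc At As; have := cf _ At => {}cf.
apply: (@cvg_comp _ _ _ c f (nbhs t) (within A (nbhs (c t))) (nbhs (f (c t)))); last exact: cf.
move=> X hX; have := cc _ hX => h; apply: filterS2 h As => s /= h1 h2; exact: h1.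
Qed.

End Agreement.

Section OddParts.
Context {R : realType}.
Implicit Types (i j : quad) (b d : bool) (D S A : set (R * R)) (u v h ho g go : R * R -> R).

(** The central symmetry, written as two reflections so that the lemmas on [flip] apply to it. *)
Definition neg u : R * R -> R := (u \o flip true) \o flip false.

Lemma flip_flip (p : R * R) : flip true (flip false p) = - p.
Proof. by case: p => x y; rewrite flip.unlock. Qed.

Lemma negP u p : neg u p = u (- p). Proof. by rewrite /neg /= flip_flip. Qed.

Lemma ae_on_neg (P : R * R -> Prop) : ae_on Omega P -> ae_on Omega (fun p => P (- p)).
Proof.
move=> /(ae_on_flip true); rewrite flip_Omega => /(ae_on_flip false); rewrite flip_Omega.
by apply: ae_imp => p + hp => /(_ hp); rewrite flip_flip.
Qed.

Lemma arc_ae_neg (P : R * R -> Prop) : arc_ae (boundary Omega) P ->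
  arc_ae (boundary Omega) (fun p => P (- p)).
Proof.
move=> /(arc_ae_flip true); rewrite flip_boundary_Omega => /(arc_ae_flip false).
by rewrite flip_boundary_Omega; apply: arc_aeS => p _; rewrite flip_flip.
Qed.

Lemma odd_part_neg h ho : odd_part_in h ho -> aeq Omega (neg ho) (- ho).
Proof. by move=> [_ [he [_ _ o _]]]; apply: ae_imp o => p hp ip; rewrite negP hp. Qed.

Lemma half_diff (x y z t : R) : x = y + z -> t = y - z -> z = 2^-1 * (x - t).
Proof. by move=> -> ->; field. Qed.

Lemma odd_part_inE h ho : odd_part_in h ho -> aeq Omega ho (2^-1 *: (h - neg h)).
Proof.
move=> [_ [he [_ e o s]]]; have s' := ae_on_neg s.
have eo : ae_on Omega (fun p => he (- p) = he p /\ ho (- p) = - ho p).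
  by apply: ae_onS2 e o => p _; split.
have ss : ae_on Omega (fun p => h p = he p + ho p /\ h (- p) = he (- p) + ho (- p)).
  by apply: ae_onS2 s s' => p _; split.
apply: (ae_onS2 _ eo ss) => p _ [h1 h2] [h3 h4].
rewrite -[RHS]/(2^-1 * (h p - neg h p)) negP.
by apply: (half_diff h3); rewrite h4 h1 h2.
Qed.

Lemma odd_part_bdE g go : odd_part_bd g go ->
  arc_ae (boundary Omega) (fun p => go p = 2^-1 * (g p - g (- p))).
Proof.
move=> [_ [ge [_ e o s]]]; have s' := arc_ae_neg s.
have eo : arc_ae (boundary Omega) (fun p => ge (- p) = ge p /\ go (- p) = - go p).
  by apply: arc_aeS2 e o => p _; split.
have ss : arc_ae (boundary Omega) (fun p => g p = ge p + go p /\ g (- p) = ge (- p) + go (- p)).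
  by apply: arc_aeS2 s s' => p _; split.
apply: arc_aeS2 eo ss => p _ [h1 h2] [h3 h4].
by apply: (half_diff h3); rewrite h4 h1 h2.
Qed.

Lemma H2_neg u : H2 Omega u -> H2 Omega (neg u).
Proof.
move=> hu; apply: (H2_flip rOmega (flip_Omega false)).
exact: (H2_flip rOmega (flip_Omega true)).
Qed.

Lemma trace_neg u g : trace_of Omega (boundary Omega) u g -> trace_of Omega (boundary Omega) (neg u) (neg g).
Proof.
have bO := @isbox_Omega R.
have bF b : isbox (flip b @^-1` Omega : set (R * R)) by rewrite flip_Omega; exact: bO.
move=> /(trace_flip bO (bF true) (barc_boundary _)); rewrite flip_Omega flip_boundary_Omega.
by move=> /(trace_flip bO (bF false) (barc_boundary _)); rewrite flip_Omega flip_boundary_Omega.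
Qed.

Lemma H2_half u : H2 Omega u -> H2 Omega (2^-1 *: (u - neg u)).
Proof.
move=> hu; have rO := @rOmega R.
have -> : 2^-1 *: (u - neg u) = 2^-1 *: u + ((- 2^-1) *: neg u + 0).
  by rewrite addr0 scaleNr scalerBr.
have h0 : H2 Omega (0 : R * R -> R).
  by have := H2_L (-1) rO hu hu; rewrite scaleN1r addNr.
by apply: (H2_L _ rO hu); exact: (H2_L _ rO (H2_neg hu) h0).
Qed.

Lemma H2_odd_part u uo : odd_part_in u uo -> H2 Omega u -> H2 Omega uo.
Proof.
move=> o hu; apply: (H2_ae rOmega _ (aeq_sym (odd_part_inE o))); first by case: o.
exact: H2_half.
Qed.

Lemma trace_odd_part u uo g : odd_part_in u uo -> H2 Omega u ->
  trace_of Omega (boundary Omega) u g -> trace_of Omega (boundary Omega) uo (2^-1 *: (g - neg g)).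
Proof.
move=> o hu tu; have bO := @isbox_Omega R; have bB := barc_boundary (Omega : set (R * R)).
have [h1 _ _] := H2_odd_part o hu.
apply: (trace_aeq bO h1 (aeq_sym (odd_part_inE o))).
apply: (trace_scale _ bO bB); exact: (trace_sub bO bB tu (trace_neg tu)).
Qed.

Lemma H10_trace u : H10 Omega u -> trace_of Omega (boundary Omega) u (cst 0).
Proof.
move=> [hu [phi [tp cp]]]; have bO := @isbox_Omega R.
apply: (trace0_closed bO (barc_boundary _) _ hu cp) => n.
exact: (test_zero_trace bO (@open_rect R _ _ _ _) (tp n)).
Qed.

Lemma L2_odd_part h ho : odd_part_in h ho -> L2 Omega h -> L2 Omega ho.
Proof.
move=> o Lh; have PI := L2_preip (@rOmega R); have rO := @rOmega R.
have Lf b u : L2 Omega u -> L2 Omega (u \o flip b).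
  by move=> Lu; have := L2_flip b rO Lu; rewrite flip_Omega.
have Ln : L2 Omega (neg h) by apply: (Lf false); exact: (Lf true).
by apply: (L2_ae rO _ (aeq_sym (odd_part_inE o)) (preipZ PI _ (preipB PI Lh Ln))); case: o.
Qed.

(** The data being odd, [uo + neg uo] solves the homogeneous Dirichlet problem. *)
Lemma solution_odd uo f fo g go : L2 Omega f -> odd_part_in f fo -> odd_part_bd g go ->
  H2 Omega uo -> poisson Omega uo fo -> trace_of Omega (boundary Omega) uo go ->
  aeq Omega (neg uo) (- uo).
Proof.
move=> Lf ofo ogo huo po to; have rO := @rOmega R; have bO := @isbox_Omega R.
have PI := L2_preip rO; have PD := dirichlet_preip rO; have bB := barc_boundary (Omega : set (R * R)).
have [h1 _ _] := huo; have [h2 _ _] := H2_neg huo.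
have Lfo := L2_odd_part ofo Lf.
have pf b u F : H1 Omega u -> L2 Omega F -> poisson Omega u F ->
    [/\ H1 Omega (u \o flip b), L2 Omega (F \o flip b) & poisson Omega (u \o flip b) (F \o flip b)].
  move=> hu LF pu; have rF : isrect (flip b @^-1` Omega : set (R * R)) by rewrite flip_Omega.
  have := poisson_flip rO rF hu LF pu; have := L2_flip b rO LF; have := H1_flip rO rF hu.
  by rewrite flip_Omega; split.
have [h3 L3 p3] := pf true _ _ h1 Lfo po; have [_ L4 p4] := pf false _ _ h3 L3 p3.
have z2 : H2 Omega (1 *: uo + neg uo) by apply: (H2_L _ rO huo); exact: H2_neg.
have zp : poisson Omega (1 *: uo + neg uo) (cst 0).
  apply/poissonE => phi tp; have hp := H1_smooth rO (test_fun_smooth tp); have Lp := L2_test rO tp.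
  rewrite (preipE PD 1 h1 h2 hp) mul1r.
  move/poissonE : po => /(_ phi tp) ->; move/poissonE : p4 => /(_ phi tp) ->.
  rewrite -(preip_formDl PI Lfo L4 Lp).
  apply: (iq_ae rO (preipD PI Lfo L4).1 (preip0 PI).1 Lp.1).
  apply: ae_imp (odd_part_neg ofo) => p hp' ip; rewrite -[LHS]/(fo p + neg fo p) hp'// -[RHS]/(0 : R).
  exact: subrr.
have zt : trace_of Omega (boundary Omega) (1 *: uo + neg uo) (cst 0).
  have t := trace_lin bO 1 bB to (trace_neg to).
  have m0 : arc_measurable (boundary Omega) (cst (0 : R)) by move=> l; exact: measurable_cst.
  apply: (trace_ae bO bB t m0); have [_ [ge [_ _ o _]]] := ogo.
  apply: arc_aeS o => p _ hp'; rewrite -[LHS]/(1 * go p + neg go p) negP hp' mul1r; exact: subrr.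
apply: ae_imp (dirichlet_unique z2 zp zt) => p hp' ip; apply/eqP; rewrite -addr_eq0 addrC.
have := hp' ip; rewrite -[X in X = _ -> _]/(1 * uo p + neg uo p) mul1r => -> //.
Qed.

End OddParts.

(** * Vanishing at the cross points *)

Section Corner.
Context {R : realType}.
Implicit Types (g : R * R -> R).

Let left (t : R) : R * R := (-1, t).

Lemma left_continuous (t : R) : {for t, continuous left}.
Proof.
by apply: (@cvg_pair _ _ _ _ (nbhs (-1 : R)) (nbhs t)); [exact: cvg_cst|exact: cvg_id].
Qed.

Lemma boundary_left (t : R) : -1 < t < 1 -> boundary (Omega : set (R * R)) (left t) /\ boundary (Omega : set (R * R)) (- left t).
Proof. by move=> h; split; apply/boundary_OmegaP; split=> /=; lra. Qed.

Lemma near_left : \forall t \near (0 : R), -1 < t < 1.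
Proof.
have h : (0 : R) \in `]-1, 1[ by rewrite in_itv/=; lra.
by apply: filterS (near_in_itvoo h) => t; rewrite in_itv.
Qed.

Lemma cross_left : (boundary Omega `&` Gamma) (left 0) /\ (boundary Omega `&` Gamma) (- left 0).
Proof.
have [b1 b2] : boundary (Omega : set (R * R)) (left 0) /\ boundary (Omega : set (R * R)) (- left 0).
  by apply: boundary_left; lra.
split; (split; [by []|]).
  exists Q4, Q1 => U /nbhs_ballP[r /= r0 rU].
  have m0 : 0 < Num.min r 1 by rewrite lt_min r0 ltr01.
  have m1 : Num.min r 1 <= 1 by rewrite ge_min lexx orbT.
  have mr : Num.min r 1 <= r by rewrite ge_min lexx.
  exists (-1 + Num.min r 1 / 2, 0); split; first by split=> //=; rewrite in_itv/=; lra.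
  by apply: rU; split; rewrite /ball/= ltr_norml; lra.
exists Q2, Q3 => U /nbhs_ballP[r /= r0 rU].
have m0 : 0 < Num.min r 1 by rewrite lt_min r0 ltr01.
have m1 : Num.min r 1 <= 1 by rewrite ge_min lexx orbT.
have mr : Num.min r 1 <= r by rewrite ge_min lexx.
exists (1 - Num.min r 1 / 2, 0); split; first by split=> //=; rewrite in_itv/=; lra.
by apply: rU; split; rewrite /ball/= ltr_norml; lra.
Qed.

(** The trace of [uo] is known only almost everywhere, so the value at the corner is reached as a
    limit along the left side. There [w'] is the odd part of the continuous representatives of [u0]
    minus [g], which agree at the corner and at its opposite. *)
Lemma corner_zero (k : R) (g go uo u0 u0o psi0o w w' : R * R -> R) (wn : nat -> R * R -> R) :
  agree_at (boundary Omega `&` Gamma) u0 g -> H2 Omega u0 -> odd_part_in u0 u0o -> odd_part_bd g go ->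
  trace_of Omega (boundary Omega) uo go -> trace_of Omega (boundary Omega) psi0o (cst 0) ->
  w = k *: psi0o + (u0o - uo) -> H1 Omega w ->
  (forall n, smooth (wn n)) -> H1norm Omega (wn n - w) @[n --> \oo] --> (0 : R) -> unif Omega wn w' ->
  w' (-1, 0) = 0.
Proof.
move=> [uc [gc [[cuc auc] [cgc agc] hag]]] hu0 ou og tuo tpsi wE hw swn cw uw.
have bO := @isbox_Omega R; have rO := @rOmega R; have bB := barc_boundary (Omega : set (R * R)).
have [h0 _ _] := hu0.
have [zn [z [s1 c1 uz _]]] := H2_approx bO hu0.
have cz := unif_continuous (fun n => smooth_continuous (s1 n)) uz.
have cw' := unif_continuous (fun n => smooth_continuous (swn n)) uw.
have sub : boundary (Omega : set (R * R)) `<=` closure Omega by exact: boundary_closure.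
have zE p : closure Omega p -> z p = uc p.
  apply: (within_agree (@open_rect R _ _ _ _) cz cuc).
  have [_ a] := unif_aeq bO s1 (H1_L2 h0) (cvg_H1_L2 rO s1 h0 c1) uz.
  by apply: ae_onS2 a auc => q _ -> ->.
have tu0 : trace_of Omega (boundary Omega) u0 z := unif_trace bO bB s1 h0 c1 uz.
have tw : trace_of Omega (boundary Omega) w w' := unif_trace bO bB swn hw cw uw.
have tw2 := trace_lin bO k bB tpsi (trace_sub bO bB (trace_odd_part ou hu0 tu0) tuo).
rewrite -wE in tw2.
have e1 := trace_unique bO bB tw tw2; have e2 := odd_part_bdE og.
have e3 : arc_ae (boundary Omega) (fun p => gc p = g p /\ gc (- p) = g (- p)).
  by apply: arc_aeS2 agc (arc_ae_neg agc) => p _; split.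
have e4 : arc_ae (boundary Omega) (fun p => w' p = 2^-1 * (z p - z (- p)) - 2^-1 * (gc p - gc (- p))).
  apply: arc_aeS2 (arc_aeS2 (fun p _ a b => conj a b) e1 e2) e3 => p _ [p1 p2] [p3 p4].
  rewrite p1 -[LHS]/(k * 0 + (2^-1 * (z p - neg z p) - go p)) mulr0 add0r negP p2 p3 p4 //.
have [N1 N2] := cross_left; have [B1 B2] := boundary_left (ltac:(lra) : -1 < (0 : R) < 1).
have nB1 : \forall t \near (0 : R), boundary (Omega : set (R * R)) (left t).
  by apply: filterS near_left => t /boundary_left[].
have nB2 : \forall t \near (0 : R), boundary (Omega : set (R * R)) (- left t).
  by apply: filterS near_left => t /boundary_left[].
have cl := left_continuous (t := 0).
have cN : {for (0 : R), continuous (fun t => - left t)} by apply: cvgN; exact: cl.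
have czB := continuous_subspaceW sub cz; have cwB := continuous_subspaceW sub cw'.
have l1 := within_path cwB cl B1 nB1.
have l2 := within_path czB cl B1 nB1; have l3 := within_path czB cN B2 nB2.
have l4 := within_path cgc cl B1 nB1; have l5 := within_path cgc cN B2 nB2.
have l6 : 2^-1 * (z (left t) - z (- left t)) - 2^-1 * (gc (left t) - gc (- left t)) @[t --> (0 : R)] -->
    2^-1 * (z (left 0) - z (- left 0)) - 2^-1 * (gc (left 0) - gc (- left 0)).
  by apply: cvgB; apply: cvgMr; apply: cvgB.
rewrite -[(-1, 0)]/(left 0).
have -> : w' (left 0) = 2^-1 * (z (left 0) - z (- left 0)) - 2^-1 * (gc (left 0) - gc (- left 0)).
  apply: (cvg_agree _ l1 l6) => X hX.
  (* The grid line [(false, k0)] is x = -1; the boundary identity [e4] holds at points of it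
     arbitrarily close to the corner. *)
  have [t [Xt Bt] Et] := ae_nbhs (e4 (false, k0)) (filterI hX nB1).
  exists t => //; have gE : gridline (false, k0) t = left t by rewrite /gridline /= sub0r.
  by rewrite gE in Et; exact: Et.
rewrite (zE _ (sub _ B1)) (zE _ (sub _ B2)) (hag _ N1) (hag _ N2); exact: subrr.
Qed.

End Corner.

(** * Uniqueness of the iterates *)

Section Uniqueness.
Context {R : realType}.
Implicit Types (i j : quad) (b : bool) (D S : set (R * R)) (u v psi F G : R * R -> R) (theta : R).

(** Every subdomain has a Dirichlet interface in the first step, and possessing a trace there
    presupposes membership in H1. *)
Lemma step_traces theta F G u psi u1 : first_step theta F G u psi u1 ->
  forall i, H1 (Om i) u /\ H1 (Om i) psi.
Proof.
move=> fs i; have [_ _ _ h _] := fs i.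
have [ti' [ti [si [sj [_ t1 t2 _ _]]]]] := h _ ((GamD1P i (nb false i)).2 erefl).
by split; [exact: trace_H1 t1|exact: trace_H1 t2].
Qed.

Lemma first_step_H1 theta F G u psi u1 : first_step theta F G u psi u1 -> forall i, H1 (Om i) u1.
Proof. by move=> fs i; case: (fs i). Qed.

Lemma barc_Gam' b i : barc (Om (nb b i)) (Gam i (nb b i) : set (R * R)).
Proof. by have := @barc_Gam R b (nb b i); rewrite nbK Gam_sym. Qed.

Lemma first_step_unique theta F G u psi u1 v phi v1 :
  (forall i, aeq (Om i) u v) -> (forall i, aeq (Om i) psi phi) ->
  first_step theta F G u psi u1 -> first_step theta F G v phi v1 -> forall i, aeq (Om i) u1 v1.
Proof.
move=> uv pp fs fs' i; have [h1 p1 o1 d1 n1] := fs i; have [h2 p2 o2 d2 n2] := fs' i.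
have H := step_traces fs; have H' := step_traces fs'.
have [t1 [a1 [b1 [c1 [T1 A1 B1 C1 E1]]]]] := d1 _ ((GamD1P i (nb false i)).2 erefl).
have [t2 [a2 [b2 [c2 [T2 A2 B2 C2 E2]]]]] := d2 _ ((GamD1P i (nb false i)).2 erefl).
have bD k := @isbox_Om R k; have bG := @barc_Gam R false i; have bG' := barc_Gam' false i.
have rD k := @rOm R k.
have a12 := trace_unique (bD i) bG (trace_aeq (bD i) (H' i).1 (uv i) A1) A2.
have b12 := trace_unique (bD i) bG (trace_aeq (bD i) (H' i).2 (pp i) B1) B2.
have c12 := trace_unique (bD _) bG' (trace_aeq (bD _) (H' _).2 (pp _) C1) C2.
have t12 : arc_ae (Gam i (nb false i)) (fun p => t2 p = t1 p).
  apply: arc_aeS2 (arc_aeS2 (fun p _ x y => conj x y) E1 E2)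
    (arc_aeS2 (fun p _ x y => conj x y) a12 (arc_aeS2 (fun p _ x y => conj x y) b12 c12)) => p _ [-> ->].
  by move=> [-> [-> ->]].
have [_ [m1 _] _] := T1.
have T2' := trace_ae (bD i) bG T2 m1 t12.
apply: (@step_unique R true i u1 v1 F G t1 h1 h2 p1 p2 o1 o2 T1 T2') => x y xy.
have G1 := (@GamN1P R i (nb true i)).2 erefl.
rewrite (n1 _ G1 _ _ xy) (n2 _ G1 _ _ xy).
have M k := (H1_measurable (H k).1, H1_measurable (H k).2, H1_measurable (H' k).1, H1_measurable (H' k).2).
rewrite (normal_deriv_ae x (rD i) (M i).1.1.1 (M i).1.2 (uv i)).
rewrite (normal_deriv_ae x (rD i) (M i).1.1.2 (M i).2 (pp i)).
by rewrite (normal_deriv_ae y (rD _) (M (nb true i)).1.1.2 (M (nb true i)).2 (pp (nb true i))).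
Qed.

Lemma second_step_unique u psi v phi : (forall i, H1 (Om i) u) -> (forall i, H1 (Om i) v) ->
  (forall i, aeq (Om i) u v) -> second_step u psi -> second_step v phi ->
  forall i, aeq (Om i) psi phi.
Proof.
move=> hu hv uv ss ss' i; have [h1 p1 o1 d1 n1] := ss i; have [h2 p2 o2 d2 n2] := ss' i.
have [t1 [a1 [b1 [T1 A1 B1 E1]]]] := d1 _ ((GamN1P i (nb true i)).2 erefl).
have [t2 [a2 [b2 [T2 A2 B2 E2]]]] := d2 _ ((GamN1P i (nb true i)).2 erefl).
have bD k := @isbox_Om R k; have bG := @barc_Gam R true i; have bG' := barc_Gam' true i.
have rD k := @rOm R k.
have a12 := trace_unique (bD i) bG (trace_aeq (bD i) (hv i) (uv i) A1) A2.
have b12 := trace_unique (bD _) bG' (trace_aeq (bD _) (hv _) (uv _) B1) B2.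
have t12 : arc_ae (Gam i (nb true i)) (fun p => t2 p = t1 p).
  apply: arc_aeS2 (arc_aeS2 (fun p _ x y => conj x y) E1 E2)
    (arc_aeS2 (fun p _ x y => conj x y) a12 b12) => p _ [-> ->].
  by move=> [-> ->].
have [_ [m1 _] _] := T1.
have T2' := trace_ae (bD i) bG T2 m1 t12.
apply: (@step_unique R false i psi phi (cst 0) (cst 0) t1 h1 h2 p1 p2 o1 o2 T1 T2') => x y xy.
have G1 := (@GamD1P R i (nb false i)).2 erefl.
rewrite (n1 _ G1 _ _ xy) (n2 _ G1 _ _ xy).
rewrite (normal_deriv_ae x (rD i) (H1_measurable (hu i)) (H1_measurable (hv i)) (uv i)).
by rewrite (normal_deriv_ae y (rD _) (H1_measurable (hu _)) (H1_measurable (hv _)) (uv _)).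
Qed.

Lemma mixed_NN_unique theta F G u0 psi0 (u psi v phi : nat -> R * R -> R) :
  mixed_NN theta F G u0 psi0 u psi -> mixed_NN theta F G u0 psi0 v phi ->
  forall k, (forall i, aeq (Om i) (u k) (v k)) /\ (forall i, aeq (Om i) (psi k) (phi k)).
Proof.
move=> [u_0 psi_0 us] [v_0 phi_0 vs]; elim=> [|k [IHu IHp]].
  rewrite u_0 v_0 psi_0 phi_0; split=> i; exact: aeq_refl.
have [f1 s1] := us k; have [f2 s2] := vs k.
have uv := first_step_unique IHu IHp f1 f2; split; first exact: uv.
exact: (second_step_unique (first_step_H1 f1) (first_step_H1 f2) uv s1 s2).
Qed.

End Uniqueness.

Lemma ae_on_union {R : realType} d (T : measurableType d) (mu : {measure set T -> \bar R})
    (A B : set T) (P : T -> Prop) : {ae mu, forall p, A p -> P p} -> {ae mu, forall p, B p -> P p} ->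
  {ae mu, forall p, (A `|` B) p -> P p}.
Proof. by apply: filterS2 => p pA pB [|]; [exact: pA|exact: pB]. Qed.

(** * Norms over the union of the subdomains *)

Section Norms.
Context {R : realType}.
Implicit Types (i : quad) (f g : R * R -> R).
Notation RR := (RR R).

Lemma Omega_GammaE : Omega `\` Gamma = (Om Q1 `|` Om Q2) `|` (Om Q3 `|` Om Q4) :> set (R * R).
Proof.
apply/seteqP; split=> p.
  by move=> /Omega_Gamma[[]] h; [left; left|left; right|right; left|right; right].
by move=> h; apply/Omega_Gamma; case: h => -[] h; [exists Q1|exists Q2|exists Q3|exists Q4].
Qed.

Lemma ae_on_Omega_Gamma (P : R * R -> Prop) : (forall i, ae_on (Om i) P) -> ae_on (Omega `\` Gamma) P.
Proof.
move=> h; have U A B : ae_on A P -> ae_on B P -> ae_on (A `|` B) P.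
  exact: (@ae_on_union _ _ RR mu2).
by rewrite Omega_GammaE; apply: (U); apply: (U); exact: h.
Qed.

Lemma measurable_on_Omega_Gamma f : (forall i, measurable_on (Om i) f) -> measurable_on (Omega `\` Gamma) f.
Proof.
move=> h; have mD i := isrect_measurable (@rOm R i).
rewrite Omega_GammaE; apply/measurable_funU; [exact: measurableU|exact: measurableU|].
by split; [apply/(measurable_funU _ (mD Q1) (mD Q2))|apply/(measurable_funU _ (mD Q3) (mD Q4))]; split; exact: h.
Qed.

Lemma L2norm_scale (D : set RR) (k : R) f g : measurable D -> measurable_on D f -> measurable_on D g ->
  ae_on D (fun p => f p = k * g p) -> L2norm D f = `|k| * L2norm D g.
Proof.
move=> mD mf mg fg; rewrite /L2norm -sqrtr_sqr -sqrtrM ?sqr_ge0//; congr Num.sqrt.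
have mg2 : measurable_fun D (fun p : RR => g p ^+ 2) by exact: measurable_funX.
have mf2 : measurable_fun D (fun p : RR => f p ^+ 2) by exact: measurable_funX.
have E : (\int[mu2]_(p in D) (f p ^+ 2)%:E = (k ^+ 2)%:E * \int[mu2]_(p in D) (g p ^+ 2)%:E)%E.
  rewrite -ge0_integralZl//.
  - apply: ae_eq_integral => //.
    + exact/measurable_EFinP.
    + by apply: measurable_funeM; exact/measurable_EFinP.
    + by apply: ae_imp fg => p h Dp; rewrite h// exprMn EFinM.
  - exact/measurable_EFinP.
  - by move=> p _; rewrite lee_fin sqr_ge0.
  - by rewrite lee_fin sqr_ge0.
rewrite /Rintegral E.
have I0 : (0 <= \int[mu2]_(p in D) (g p ^+ 2)%:E)%E by apply: integral_ge0 => p _; rewrite lee_fin sqr_ge0.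
(* If the integral of [g ^+ 2] is infinite, [fine] makes both sides 0: the identity holds without
   square-integrability. *)
move: (\int[mu2]_(p in D) _)%E I0 => [r _ //|_|//].
have [->|k0] := eqVneq k 0; first by rewrite expr0n/= mul0e mul0r.
by rewrite gt0_muley ?lte_fin ?exprn_even_gt0//= mulr0.
Qed.

Lemma H1norm_scale i (k : R) f g : H1 (Om i) f -> H1 (Om i) g -> aeq (Om i) f (k *: g) ->
  H1norm (Om i) f = `|k| * H1norm (Om i) g.
Proof.
move=> hf hg fg; have rD := @rOm R i; have PH := h1form_preip rD.
rewrite (H1norm_ae rD (H1_measurable hf) (H1_measurable (preipZ PH k hg)) fg).
by rewrite !H1normE (bnZ PH k hg).
Qed.

End Norms.

(** * Convergence *)

Section Main.
Context {R : realType}.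
Implicit Types (i : quad) (u psi : nat -> R * R -> R).

(** By uniqueness of the weak Laplacian on the square, [fo] is [- lap Omega uo] almost everywhere;
    for H2 functions the latter equation restricts to every subdomain. *)
Lemma poisson_Om i (uo fo : R * R -> R) : H2 Omega uo -> L2 Omega fo -> poisson Omega uo fo ->
  poisson (Om i) uo fo.
Proof.
move=> huo Lfo po; have rO := @rOmega R; have rD := @rOm R i; have DO := @Om_sub R i.
have PI := L2_preip rO; have Ll := L2_lap rO huo rO (@subset_refl _ _).
have LN : L2 Omega (- fo) := preipN PI Lfo.
have po' : poisson Omega uo (fun x => - (- fo) x).
  by have -> : (fun x => - (- fo) x) = fo by apply/funext => x; exact: opprK.
have e1 := wlaplacian_unique rO LN po'.
have e2 := wlaplacian_unique rO Ll (H2_poisson rO huo rO (@subset_refl _ _)).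
have e : aeq (Om i) fo (- lap Omega uo).
  have : ae_on Omega (fun p => fo p = - lap Omega uo p).
    by apply: ae_onS2 e1 e2 => p _ h1 h2; rewrite -h2 h1; rewrite -[RHS]/(- - fo p) opprK.
  by apply: ae_imp => p h ip; apply: h; exact: DO.
have LfD := L2S rO rD DO Lfo; have LlD : L2 (Om i) (- lap Omega uo).
  exact: (preipN (L2_preip rD) (L2_lap rO huo rD DO)).
apply/poissonE => phi tp; have Lp := L2_test rD tp.
rewrite (iq_ae rD LfD.1 LlD.1 Lp.1 e).
by move/poissonE : (H2_poisson rO huo rD DO) => /(_ phi tp).
Qed.

Lemma error_sub (uo e : R * R -> R) (c : R) (v : R * R -> R) i : aeq (Om i) v (c *: e + uo) ->
  ae_on (Om i) (fun p => (uo \- v) p = - c * e p).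
Proof.
apply: ae_imp => p h ip; rewrite /= h// -[X in _ - X]/(c * e p + uo p); ring.
Qed.

End Main.

Theorem theorem4 (R : realType) (theta : R)
  (f g fo go uo u0 psi0 u0o psi0o : R * R -> R)
  (hf : L2 Omega f) (hg : H32_bd g)
  (hfo : odd_part_in f fo) (hgo : odd_part_bd g go)
  (huo : H2 Omega uo)
  (huo_eq : poisson Omega uo fo)
  (huo_bd : trace_of Omega (boundary Omega) uo go)
  (hu0 : H2 Omega u0)
  (hpsi0 : H2 Omega psi0) (hpsi0_bd : H10 Omega psi0)
  (hcross : agree_at (boundary Omega `&` Gamma) u0 g)
  (hu0o : odd_part_in u0 u0o) (hpsi0o : odd_part_in psi0 psi0o)
  (htheta : 0 < theta < 1 / 2) :
  (* the method is well defined *)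
  (exists u psi : nat -> R * R -> R, mixed_NN theta fo go u0o psi0o u psi) /\
  (forall u psi u' psi' : nat -> R * R -> R,
     mixed_NN theta fo go u0o psi0o u psi ->
     mixed_NN theta fo go u0o psi0o u' psi' ->
     forall k, ae_on (Omega `\` Gamma) (fun p => u k p = u' k p)) /\
  (* the sequence it produces converges geometrically *)
  (forall u psi : nat -> R * R -> R,
     mixed_NN theta fo go u0o psi0o u psi ->
     [/\ converges_geometrically (L2norm (Omega `\` Gamma)) `|1 - 4 * theta| u uo,
         converges_geometrically broken_H1norm `|1 - 4 * theta| u uo
       & theta = 1 / 4 -> reached_exactly u uo]).
Proof.
have rO := @rOmega R; have bO := @isbox_Omega R.
have bB := barc_boundary (Omega : set (R * R)).
have hu0o2 := H2_odd_part hu0o hu0; have hpsi0o2 := H2_odd_part hpsi0o hpsi0.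
have Lfo := L2_odd_part hfo hf.
have tpsi : trace_of Omega (boundary Omega) psi0o (cst 0).
  have := trace_odd_part hpsi0o hpsi0 (H10_trace hpsi0_bd).
  have -> : 2^-1 *: (cst 0 - neg (cst 0)) = cst 0 :> (R * R -> R).
    by apply/funext => p; rewrite -[LHS]/(2^-1 * (0 - 0)) subrr mulr0.
  exact.
have uo_odd := solution_odd hf hfo hgo huo huo_eq huo_bd.
(* The data of the first step exceed those of [uo] by the Dirichlet and Neumann data of this single
   H2 function. *)
pose w : R * R -> R := - (2 * theta) *: psi0o + (u0o - uo).
have wE : w = - (2 * theta) *: psi0o + (u0o - uo) by [].
have hw : H2 Omega w.
  have E : u0o - uo = (- 1) *: uo + u0o by rewrite scaleN1r addrC.
  by rewrite wE E; apply: (H2_L _ rO hpsi0o2); exact: (H2_L _ rO huo hu0o2).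
have w_odd : aeq Omega (w \o flip true \o flip false) (- w).
  apply: ae_onS2 (ae_onS2 (fun p _ a b => conj a b) (odd_part_neg hpsi0o) (odd_part_neg hu0o)) uo_odd.
  move=> p _ [h1 h2] h3.
  rewrite -[LHS]/(- (2 * theta) * neg psi0o p + (neg u0o p - neg uo p)) h1 h2 h3.
  rewrite -[LHS]/(- (2 * theta) * (- psi0o p) + (- u0o p - - uo p)).
  rewrite -[RHS]/(- (- (2 * theta) * psi0o p + (u0o p - uo p))); ring.
clearbody w.
have [h1w _ _] := hw.
have [wn [w' [swn cw uw mw]]] := H2_approx bO hw.
have w0 := corner_zero hcross hu0 hu0o hgo huo_bd tpsi wE h1w swn cw uw.
have [e [he oe ge de se]] := error_exists hw swn cw uw mw w0 w_odd.
have pe i : poisson (Om i) e (cst 0) := error_harmonic hw (@de i).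
have pu i := poisson_Om (i := i) huo Lfo huo_eq.
have ou i : trace_of (Om i) (outer i) uo go.
  have bS := barc_Om_Omega (@barc_outer R i).
  apply: (trace_subdomain bO (isbox_Om i) (@Om_sub R i) bS (barc_outer i)).
  by apply: (trace_restrict bO _ bB bS huo_bd) => p [].
pose r := 1 - 4 * theta.
(* The initial couple is not of the form [c *: e + uo], so the powers start at 0 with the first
   iterate; this is why the convergence factor is claimed from [k = 1] on. *)
pose U (k : nat) := if k is m.+1 then r ^+ m *: e + uo else u0o.
pose P (k : nat) := if k is m.+1 then (2 * r ^+ m) *: e else psi0o.
have UP : mixed_NN theta fo go u0o psi0o U P.
  split=> // -[|m].
    split; first exact: (first_step_initial wE huo hu0o2 hpsi0o2 pu ou he pe oe ge de).
    exact: (second_step_iterate wE huo hu0o2 hpsi0o2 pu he pe oe de se).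
  split; last exact: (second_step_iterate wE huo hu0o2 hpsi0o2 pu he pe oe de se).
  rewrite /U exprS; exact: (first_step_iterate wE huo hu0o2 hpsi0o2 pu ou he pe oe de se).
split; first by exists U, P.
split.
  move=> u psi u' psi' h h' k; apply: ae_on_Omega_Gamma => i.
  exact: (mixed_NN_unique h h' k).1.
move=> u psi h.
have ue k i : aeq (Om i) (u k.+1) (r ^+ k *: e + uo) := (mixed_NN_unique h UP k.+1).1 i.
have hu k i : H1 (Om i) (u k.+1).
  by case: h => _ _ /(_ k)[fs _]; exact: first_step_H1 fs i.
have huoi i : H1 (Om i) uo := trace_H1 (ou i).
have err k i : ae_on (Om i) (fun p => (uo \- u k.+1) p = - r ^+ k * e p) := error_sub (ue k i).
(* The two strict bounds on [theta] give the two strict inequalities [r < 1] and [-1 < r]. *)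
have r1 : 0 <= `|r| < 1.
  by rewrite normr_ge0 ltr_norml /r; apply/andP; split; lra.
have hd k i : H1 (Om i) (uo \- u k.+1) := H1B (rOm i) (huoi i) (hu k i).
have me : measurable_on (Omega `\` Gamma) e.
  by apply: measurable_on_Omega_Gamma => i; exact: H1_measurable (he i).
have md k : measurable_on (Omega `\` Gamma) (uo \- u k.+1).
  by apply: measurable_on_Omega_Gamma => i; exact: H1_measurable (hd k i).
have mD : @measurable _ (RR R) (Omega `\` Gamma).
  have mi i := isrect_measurable (@rOm R i).
  by rewrite Omega_GammaE; apply: measurableU; apply: measurableU.
split.
- split; first exact: r1.
  case=> // m _; have a k := ae_on_Omega_Gamma (err k).
  rewrite (L2norm_scale mD (md _) me (a m.+1)) (L2norm_scale mD (md _) me (a m)).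
  by rewrite !normrN exprS normrM mulrA.
- split; first exact: r1.
  case=> // m _; rewrite /broken_H1norm mulr_sumr; apply: eq_bigr => i _.
  rewrite (H1norm_scale (hd _ i) (he i) (err m.+1 i)) (H1norm_scale (hd _ i) (he i) (err m i)).
  by rewrite !normrN exprS normrM mulrA.
move=> t4; have r0 : r = 0 by rewrite /r t4; field.
(* The first iterate still has the error [e], since [r ^+ 0 = 1] even when [r = 0]; from the second
   one on a factor [r] is present. *)
exists 2; case=> [//|[//|k]] _; apply: ae_on_Omega_Gamma => i.
apply: ae_imp (ue k.+1 i) => p hp ip; rewrite hp// r0 exprS mul0r.
by rewrite -[LHS]/(0 * e p + uo p) mul0r add0r.
Qed.
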